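(* Let $X$ be a normal complex projective variety admitting a non-invertible polarized endomorphism. Then $X$ has valuative log canonical singularities. In particular, if $X$ has a log canonical model, then the log canonical model is small, i.e. an isomorphism in codimension one.
   Context: A polarized endomorphism of a projective variety $X$ is a (surjective) endomorphism $f:X\to X$ for which there exist an ample Cartier divisor $H$ and a positive integer $q$ with $f^*H\sim qH$; it is non-invertible if it is not an automorphism. A birational model of $X$ is a projective birational morphism $\pi : X_\pi \to X$ with $X_\pi$ normal. A prime divisor over $X$ is a prime divisor $E$ on some birational model of $X$. An $\mathbb{R}$-Weil $b$-divisor over $X$ is a family $B=(B_\pi)_\pi$ of $\mathbb{R}$-Weil divisors $B_\pi$ on $X_\pi$, one for each birational model, compatible under push-forward; $\operatorname{ord}_E(B)$ is the coefficient of $E$ in $B_\pi$ for any model on which $E$ is a divisor, and $B \ge 0$ means $\operatorname{ord}_E(B)\ge 0$ for all prime divisors $E$ over $X$. Fix a canonical divisor $K_X$ (the divisor of a nonzero rational top differential form); $K_{X_\pi}$ is the canonical divisor defined by the same form, and $K_{\mathfrak X}=(K_{X_\pi})_\pi$. Let $1_{\mathfrak X/X}$ be the $b$-divisor whose trace on $X_\pi$ is the sum of the $\pi$-exceptional prime divisors. For a nonzero coherent fractional ideal sheaf $\mathfrak a$ on $X$, $Z(\mathfrak a)$ is the $b$-divisor with $\operatorname{ord}_E Z(\mathfrak a) = -\min\{\operatorname{ord}_E(g)\}$, the minimum over local sections $g$ of $\mathfrak a$ at the generic point of the center of $E$. For an $\mathbb{R}$-Weil divisor $D$ on $X$, the nef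 envelope is $\mathrm{Env}_X(D)=\lim_{m\to\infty}\frac1m Z(\mathcal{O}_X(mD))$ (coefficientwise limit). Set $\mathrm{A}^+_{\mathfrak X/X} := K_{\mathfrak X}+1_{\mathfrak X/X}-\mathrm{Env}_X(K_X)$. $X$ has valuative log canonical singularities if $\mathrm{A}^+_{\mathfrak X/X}\ge 0$. A log canonical model of $X$ is a birational model $\mu: Y \to X$ such that $K_Y+E^\mu$ is $\mathbb{Q}$-Cartier and $\mu$-ample and $(Y,E^\mu)$ is log canonical, where $E^\mu$ is the sum of the $\mu$-exceptional prime divisors; it is small if there are no $\mu$-exceptional prime divisors. *)

(* Defs.v *)
From mathcomp Require Import all_boot all_order all_algebra complex.
From mathcomp Require Import all_classical all_reals topology normedtype sequences.
From mathcomp Require mpoly.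
Import Order.TTheory GRing.Theory Num.Theory numFieldNormedType.Exports.

Set Implicit Arguments.
Unset Strict Implicit.
Unset Printing Implicit Defensive.

Local Open Scope classical_set_scope.
Local Open Scope ring_scope.

(* Varieties are represented in the language of Zariski-Samuel (vol. II,
   ch. VI, section 17): a variety with function field K is the set of the local
   rings of all its scheme-theoretic points (the generic point included, with
   local ring K itself), each one being a subset of K.  So a point is a [set K]
   and a variety is a [set (set K)].  A birational morphism is used to identify
   the two function fields, so that all birational models of X live in the same
   field K; a birational morphism Y -> X then exists iff every local ring of Y
   dominates a local ring of X, and is then unique. *)

Section Subrings.
Context {K : fieldType}.
Implicit Types (A P Q p : set K) (s : seq K).

Definition is_subring A : Prop := GRing.subring_closed [in A].

Definition adjoin A (S : set K) : set K := smallest is_subring (A `|` S).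

Definition prime_ideal A p : Prop :=
  [/\ p `<=` A, p 0 /\ ~ p 1,
      forall x y, p x -> p y -> p (x + y),
      forall a x, A a -> p x -> p (a * x) &
      forall a b, A a -> A b -> p (a * b) -> p a \/ p b].

Definition localization A p : set K :=
  [set x | exists a b, [/\ A a, A b, ~ p b & x = a / b]].

(* The affine scheme Spec A, as a set of local rings. *)
Definition affine A : set (set K) :=
  [set P | exists2 p, prime_ideal A p & P = localization A p].

Definition unit_in P (x : K) : Prop := [/\ x != 0, P x & P x^-1].

Definition max_ideal P : set K := [set x | P x /\ ~ unit_in P x].

Definition dominates Q P : Prop :=
  P `<=` Q /\ (forall x, P x -> unit_in Q x -> unit_in P x).

Definition krull_dim1 P : Prop :=
  (exists2 x, max_ideal P x & x != 0) /\
  (forall p, prime_ideal P p -> p = [set 0] \/ p = max_ideal P).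

Definition integrally_closed P : Prop :=
  forall (x : K) (f : {poly K}),
    f \is monic -> (forall i, P f`_i) -> root f x -> P x.

(* The valuation of a discrete valuation ring E with fraction field K; the
   value at 0 is irrelevant. *)
Definition ord E (x : K) : int :=
  xget 0 [set k : int | exists t u : K,
    [/\ t != 0, max_ideal E = [set t * a | a in E], unit_in E u
      & x = u * t ^ k]].

Definition min_int (S : set int) : int :=
  xget 0 [set k | S k /\ forall j, S j -> k <= j].

(* For A a ring of functions on an affine base, the image in P^N_A of the
   generic point under (s_0 : ... : s_N) has as closure the integral scheme
   covered by the Spec A[s_j / s_i], s_i != 0. *)
Definition projective_over A s : set (set K) :=
  [set P | exists2 si, si \in s /\ si != 0 &
     affine (adjoin A [set sj / si | sj in [set` s]]) P].

End Subrings.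

Section Varieties.
Context {K : fieldType}.
Implicit Types (A P Q E F : set K) (X Y U : set (set K)).

(* The Zariski topology: the basic open subsets are the loci where finitely
   many given rational functions are regular. *)
Definition open_in X U : Prop :=
  U `<=` X /\
  forall P, U P -> exists s : seq K,
    [set` s] `<=` P /\ (forall Q, X Q -> [set` s] `<=` Q -> U Q).

Definition normal X : Prop := forall P, X P -> integrally_closed P.

(* Prime divisors are identified with their generic points. *)
Definition prime_divisor X E : Prop := X E /\ krull_dim1 E.

(* P is the image in X of the point Q of a model over X. *)
Definition center X Q P : Prop := X P /\ dominates Q P.

Definition birational_morphism Y X : Prop :=
  forall Q, Y Q -> exists P, center X Q P.

(* The center of E on X is not a divisor. *)
Definition exceptional X E : Prop :=
  ~ exists2 P, center X E P & krull_dim1 P.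

(* A Cartier divisor is given by the choice of a local equation h P at every
   point P of X. *)
Definition cartier X (h : set K -> K) : Prop :=
  forall P, X P -> h P != 0 /\
    exists U, [/\ open_in X U, U P & forall Q, U Q -> unit_in Q (h Q / h P)].

Definition cmul (m : nat) (h : set K -> K) : set K -> K := fun P => h P ^+ m.

Definition lin_equiv X (h h' : set K -> K) : Prop :=
  exists2 g : K, g != 0 & forall P, X P -> unit_in P (g * h P / h' P).

(* The s_i are global sections of O(h), whose stalk at P is (h P)^-1 P; they
   generate O(h) and define a closed embedding of Y into P^N_A. *)
Definition very_ample A Y (h : set K -> K) : Prop :=
  exists s : seq K, Y = projective_over A s /\
    forall P, Y P ->
      (forall x, x \in s -> P (h P * x)) /\
      (exists2 x, x \in s & unit_in P (h P * x)).

(* Over small enough affine open subsets Spec A of X, a positive multiple is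
   very ample relatively to A. *)
Definition rel_ample Y X (h : set K -> K) : Prop :=
  forall P, X P -> exists A,
    [/\ is_subring A, open_in X (affine A), affine A P &
      exists2 m, (0 < m)%N &
        very_ample A [set Q | Y Q /\ exists P', center (affine A) Q P']
          (cmul m h)].

(* f P = Q, for f the rational self-map of X with comorphism phi : K -> K. *)
Definition maps_to (phi : K -> K) P Q : Prop :=
  (forall x, Q x -> P (phi x)) /\
  (forall x, Q x -> unit_in P (phi x) -> unit_in Q x).

Definition pullback X (phi : K -> K) (h : set K -> K) : set K -> K :=
  fun P => phi (h (xget setT [set Q | X Q /\ maps_to phi P Q])).

End Varieties.

Section Projective.
Context {R : realType} {K : fieldType} (iota : {rmorphism R[i] -> K}).
Implicit Types (P Q E F : set K) (X Y U : set (set K)).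

(* The condition [X setT] says that K is the function field of X. *)
Definition projective_variety X : Prop :=
  X setT /\ exists s : seq K, X = projective_over (range iota) s.

Definition ample X (h : set K -> K) : Prop :=
  exists2 m, (0 < m)%N & very_ample (range iota) X (cmul m h).

Definition birational_model X Y : Prop :=
  [/\ projective_variety Y, normal Y & birational_morphism Y X].

Definition prime_divisor_over X E : Prop :=
  exists2 Y, birational_model X Y & prime_divisor Y E.

(* A surjective morphism X -> X over C, given by its comorphism. *)
Definition surjective_endomorphism X (phi : {rmorphism K -> K}) : Prop :=
  [/\ forall c, phi (iota c) = iota c,
      forall P, X P -> exists Q, X Q /\ maps_to phi P Q &
      forall Q, X Q -> exists P, X P /\ maps_to phi P Q].

Definition automorphism X (phi : {rmorphism K -> K}) : Prop :=
  surjective_endomorphism X phi /\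
  exists psi : {rmorphism K -> K},
    [/\ surjective_endomorphism X psi, cancel phi psi & cancel psi phi].

Definition polarized X (phi : {rmorphism K -> K}) : Prop :=
  exists (h : set K -> K) (q : nat),
    [/\ cartier X h, ample X h, (0 < q)%N &
        lin_equiv X (pullback X phi h) (cmul q h)].


Definition transcendence_basis n (t : 'I_n -> K) : Prop :=
  injective (mpoly.mmap iota t) /\
  forall x : K, exists f : {poly K},
    [/\ f != 0, forall i, adjoin (range iota) (range t) f`_i & root f x].

(* The rational top form  form_coef * dt_0 /\ ... /\ dt_(n-1),
   t = form_vars; every nonzero rational top form is of this shape. *)
Record top_form := TopForm {
  form_dim : nat;
  form_vars : 'I_form_dim -> K;
  form_coef : K }.

Definition nonzero_top_form (w : top_form) : Prop :=
  transcendence_basis (form_vars (t := w)) /\ form_coef w != 0.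

Definition derivation (D : K -> K) : Prop :=
  [/\ forall c, D (iota c) = 0,
      forall x y, D (x + y) = D x + D y &
      forall x y, D (x * y) = x * D y + D x * y].

Definition form_eval (w : top_form) (D : 'I_(form_dim w) -> K -> K) : K :=
  form_coef w * \det (\matrix_(i, j) D i (form_vars j)).

(* At the generic point E of a prime divisor of a normal variety, the module of
   differentials of E over C is free and its dual is the module of derivations
   preserving E; hence the order of w along E is the least order of the
   functions w(D_1, ..., D_n) for such derivations D_i. *)
Definition ord_form (w : top_form) E : int :=
  min_int [set k | exists D : 'I_(form_dim w) -> K -> K,
    [/\ forall i, derivation (D i) /\ (forall x, E x -> E (D i x)),
        form_eval D != 0 & k = ord E (form_eval D)]].


(* An R-Weil divisor on X is given by its coefficient along each prime divisor
   of X.  An R-Weil b-divisor over X is likewise given by its coefficient along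
   each prime divisor over X: compatibility under push-forward says precisely
   that this coefficient does not depend on the model.  Values at sets that are
   not prime divisors are irrelevant. *)
Definition divisor := set K -> R.

(* Both the Weil divisor K_Y on each model Y and the b-divisor. *)
Definition canonical (w : top_form) : divisor := fun E => (ord_form w E)%:~R.

Definition exc_divisor X : divisor :=
  fun E => if `[< exceptional X E >] then 1 else 0.

Definition sheafO X (D : divisor) U : set K :=
  [set g | g = 0 \/ forall E, prime_divisor X E -> U E ->
                      0 <= (ord E g)%:~R + D E].

Definition stalk X (a : set (set K) -> set K) P : set K :=
  [set g | exists U, [/\ open_in X U, U P & a U g]].

Definition Zdiv X (a : set (set K) -> set K) : divisor :=
  fun E => - (min_int [set k | exists P g,
                [/\ center X E P, stalk X a P g, g != 0 & k = ord E g]])%:~R.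

Definition Env X (D : divisor) : divisor :=
  fun E => lim ((fun m : nat =>
    m%:R^-1 * Zdiv X (sheafO X (fun F => m%:R * D F)) E) @ \oo).

Definition Aplus X (w : top_form) : divisor :=
  fun E => canonical w E + exc_divisor X E - Env X (canonical w) E.

Definition valuative_lc X (w : top_form) : Prop :=
  forall E, prime_divisor_over X E -> 0 <= Aplus X w E.


(* The Weil divisor m D is the one associated with the Cartier divisor h. *)
Definition cartier_multiple Y (D : divisor) (m : nat) (h : set K -> K) : Prop :=
  [/\ (0 < m)%N, cartier Y h &
      forall E, prime_divisor Y E -> (ord E (h E))%:~R = m%:R * D E].

Definition log_divisor (w : top_form) (B : divisor) : divisor :=
  fun E => canonical w E + B E.

(* K_Y + B is Q-Cartier and all discrepancies of (Y, B) are at least -1. *)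
Definition log_canonical Y (w : top_form) (B : divisor) : Prop :=
  exists (m : nat) (h : set K -> K),
    cartier_multiple Y (log_divisor w B) m h /\
    forall F Q, prime_divisor_over Y F -> center Y F Q ->
      -1 <= canonical w F - (ord F (h Q))%:~R / m%:R.

Definition log_canonical_model X (w : top_form) Y : Prop :=
  [/\ birational_model X Y,
      exists (m : nat) (h : set K -> K),
        cartier_multiple Y (log_divisor w (exc_divisor X)) m h /\
        rel_ample Y X h &
      log_canonical Y w (exc_divisor X)].

Definition small_model X Y : Prop :=
  forall E, prime_divisor Y E -> ~ exceptional X E.

(* Y -> X restricts to an isomorphism between open subsets (which, being
   subsets of the same field's local rings, are then equal) whose complements
   have codimension at least 2. *)
Definition iso_in_codim1 X Y : Prop :=
  exists U, [/\ open_in Y U, open_in X U,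
                forall E, prime_divisor Y E -> U E &
                forall E, prime_divisor X E -> U E].

End Projective.

(* Main.v *)
(* For a prime divisor [E] over [X] put [B(E) = ord_E(K) + 1 - ord_E Env(K_X)], and let [f] be the
   given endomorphism. If a divisorial valuation [V] restricts to [E] along [f] with ramification
   index [e], then [B(V) <= e B(E)]: the order of [f^*w] is computed by the Hurwitz formula, and
   sections of multiples of [K_X] pull back. On the other hand [B] is bounded below by minus the
   order of a fixed section [s] of a multiple of the polarization, by comparison with the
   coordinates in which [w] is written. If [B(E) < 0], then [s] vanishes along the valuations
   over [E] for [f^k] to an order proportional to their ramification index, so the norm of [s]
   along [f^k] vanishes along [E] to an order proportional to [deg f^k]; since [f^*H ~ qH], the
   [q^k]-th power of this norm is a section of degree proportional to [deg f^k] only. As [q > 1],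
   this contradicts the linear bound for the order along [E] of a section in terms of its degree.
   When [q = 1], pulling back is an injective linear map of a finite-dimensional space of
   sections, so that [f] is an automorphism.

   For an exceptional prime divisor [E] of a log canonical model, relative ampleness gives a
   section of [O_X(n K_X)] whose pole along [E] has order greater than [n (ord_E(K) + 1)], so that
   [B(E) < 0]. *)
From HB Require Import structures.
Require Import Defs.
From mathcomp Require Import all_boot all_order all_algebra complex.
From mathcomp Require Import all_classical all_reals topology normedtype sequences.
From mathcomp Require Import ring lra zify.
From mathcomp Require mpoly.
Import (canonicals) mpoly.
Import Order.TTheory GRing.Theory Num.Theory numFieldNormedType.Exports.
Set Implicit Arguments.
Unset Strict Implicit.
Unset Printing Implicit Defensive.
Local Open Scope classical_set_scope.
Local Open Scope ring_scope.

(** A variety being a set of local rings in [K], properness, integrality and the finiteness of the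
    endomorphism are all tested on valuation rings of [K]. The valuations [V] over [E] are not known
    to come from a model of [X]: discreteness, a uniformizer, coordinates and bounds on derivations
    are transported to them from [E], and the lower bound for [B] is proved for every discrete
    valuation ring over the constants that has such coordinates. Norms are determinants of
    multiplication matrices; they are integral because the base ring is completely integrally
    closed, so no conjugates appear. The degree of the iterate cancels in the final comparison and
    is never computed. The envelope enters only through inequalities on single sections: by
    superadditivity, the limit that defines it is the supremum of [- ord g / m]. *)

(** * Subrings, adjunction, fraction fields, and Zorn's lemma for families of sets *)

Section Basics.
Context {K : fieldType}.
Implicit Types (A B L V : set K) (x y z : K) (p q : {poly K}).

Lemma subringP A : is_subring A <->
  [/\ A 1, forall x y, A x -> A y -> A (x - y)
    & forall x y, A x -> A y -> A (x * y)].
Proof.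
split=> [[h1 h2 h3]|[h1 h2 h3]].
  split; first by move: h1; rewrite inE.
    by move=> x y hx hy; have := h2 x y; rewrite !inE; apply.
  by move=> x y hx hy; have := h3 x y; rewrite !inE; apply.
split; first by rewrite inE.
  by move=> x y; rewrite !inE; apply: h2.
by move=> x y; rewrite !inE; apply: h3.
Qed.

Section SubringTheory.
Variables (A : set K) (hA : is_subring A).

Lemma sr1 : A 1. Proof. by case/subringP: hA. Qed.
Lemma srB x y : A x -> A y -> A (x - y). Proof. by case/subringP: hA => _ + _; apply. Qed.
Lemma srM x y : A x -> A y -> A (x * y). Proof. by case/subringP: hA => _ _; apply. Qed.
Lemma sr0 : A 0. Proof. by rewrite -(subrr 1); apply: srB; apply: sr1. Qed.
Lemma srN x : A x -> A (- x).
Proof. by move=> hx; rewrite -sub0r; apply: srB => //; apply: sr0. Qed.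
Lemma srD x y : A x -> A y -> A (x + y).
Proof. by move=> hx hy; rewrite -(opprK y); apply: srB => //; apply: srN. Qed.
Lemma srX x n : A x -> A (x ^+ n).
Proof.
by move=> hx; elim: n => [|n ih]; rewrite ?expr0 ?exprS; [apply: sr1|apply: srM].
Qed.
Lemma sr_sum I (r : seq I) (P : pred I) (F : I -> K) :
  (forall i, P i -> A (F i)) -> A (\sum_(i <- r | P i) F i).
Proof. by move=> h; elim/big_ind: _ => //; [apply: sr0|apply: srD]. Qed.
Lemma sr_prod I (r : seq I) (P : pred I) (F : I -> K) :
  (forall i, P i -> A (F i)) -> A (\prod_(i <- r | P i) F i).
Proof. by move=> h; elim/big_ind: _ => //; [apply: sr1|apply: srM]. Qed.
Lemma srMn x n : A x -> A (x *+ n).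
Proof. by move=> hx; elim: n => [|n ih]; rewrite ?mulr0n ?mulrS; [apply: sr0|apply: srD]. Qed.
Lemma sr_nat n : A n%:R. Proof. by apply: srMn; apply: sr1. Qed.
Lemma sr_sign n : A ((-1) ^+ n). Proof. by apply/srX/srN/sr1. Qed.

Lemma sr_horner p x : (forall i, A p`_i) -> A x -> A p.[x].
Proof.
by move=> hp hx; rewrite horner_coef; apply: sr_sum => i _; apply: srM => //; apply: srX.
Qed.

Lemma unit_inM x y : unit_in A x -> unit_in A y -> unit_in A (x * y).
Proof.
move=> [x0 hx hx'] [y0 hy hy']; split; first by rewrite mulf_neq0.
  exact: srM.
by rewrite invfM; apply: srM.
Qed.

Lemma unit_inV x : unit_in A x -> unit_in A x^-1.
Proof. by move=> [x0 hx hx']; split; rewrite ?invr_eq0 ?invrK. Qed.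

Lemma unit_in1 : unit_in A 1.
Proof. by split; rewrite ?oner_eq0 ?invr1 //; apply: sr1. Qed.

Lemma unit_inX x n : unit_in A x -> unit_in A (x ^+ n).
Proof.
by move=> hx; elim: n => [|n ih]; [exact: unit_in1|rewrite exprS; exact: unit_inM].
Qed.

Lemma unit_inMl x y : A x -> A y -> unit_in A (x * y) -> unit_in A x.
Proof.
move=> hx hy [xy0 _ hxy]; have [x0 y0] : x != 0 /\ y != 0.
  by move: xy0; rewrite mulf_eq0 negb_or => /andP.
split=> //; rewrite (_ : x^-1 = y * (x * y)^-1); first exact: srM.
by rewrite invfM mulrCA divff // mulr1.
Qed.

Lemma unit_inMr x y : A x -> A y -> unit_in A (x * y) -> unit_in A y.
Proof. by rewrite mulrC => hx hy; apply: unit_inMl. Qed.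
End SubringTheory.

Definition pover A p := forall i, A p`_i.

Section PolyOver.
Variables (A : set K) (hA : is_subring A).

Lemma pover0 : pover A 0. Proof. by move=> i; rewrite coef0; apply: sr0. Qed.
Lemma poverC x : A x -> pover A x%:P.
Proof. by move=> hx i; rewrite coefC; case: ifP => // _; apply: sr0. Qed.
Lemma pover1 : pover A 1. Proof. by apply: poverC; apply: sr1. Qed.
Lemma poverX : pover A 'X.
Proof. by move=> i; rewrite coefX; case: (i == 1)%N; [apply: sr1|apply: sr0]. Qed.
Lemma poverXn n : pover A 'X^n.
Proof. by move=> i; rewrite coefXn; case: (i == n)%N; [apply: sr1|apply: sr0]. Qed.
Lemma poverD p q : pover A p -> pover A q -> pover A (p + q).
Proof. by move=> hp hq i; rewrite coefD; apply: srD. Qed.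
Lemma poverN p : pover A p -> pover A (- p).
Proof. by move=> hp i; rewrite coefN; apply: srN. Qed.
Lemma poverB p q : pover A p -> pover A q -> pover A (p - q).
Proof. by move=> hp hq; apply: poverD => //; apply: poverN. Qed.
Lemma poverM p q : pover A p -> pover A q -> pover A (p * q).
Proof. by move=> hp hq i; rewrite coefM; apply: sr_sum => // j _; apply: srM. Qed.
Lemma poverZ a p : A a -> pover A p -> pover A (a *: p).
Proof. by move=> ha hp i; rewrite coefZ; apply: srM. Qed.
Lemma pover_sum I (r : seq I) (P : pred I) (F : I -> {poly K}) :
  (forall i, P i -> pover A (F i)) -> pover A (\sum_(i <- r | P i) F i).
Proof. by move=> h; elim/big_ind: _ => //; [apply: pover0|apply: poverD]. Qed.
Lemma poverE p n : pover A p -> pover A (p ^+ n).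
Proof.
by move=> hp; elim: n => [|n ih]; rewrite ?expr0 ?exprS; [apply: pover1|apply: poverM].
Qed.
Lemma pover_poly n (E : nat -> K) :
  (forall i, (i < n)%N -> A (E i)) -> pover A (\poly_(i < n) E i).
Proof. by move=> h i; rewrite coef_poly; case: ifP => [/h//|_]; apply: sr0. Qed.
Lemma pover_deriv p : pover A p -> pover A p^`().
Proof. by move=> hp i; rewrite coef_deriv; apply: srMn. Qed.
End PolyOver.

Lemma pover_sub A B p : A `<=` B -> pover A p -> pover B p.
Proof. by move=> AB hp i; apply: AB. Qed.

Lemma adjoin_subring A (S : set K) : is_subring (adjoin A S).
Proof.
apply/subringP; split.
- by move=> B [hB _]; apply: sr1.
- by move=> x y hx hy B hB; apply: srB; [case: hB|apply: hx|apply: hy].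
- by move=> x y hx hy B hB; apply: srM; [case: hB|apply: hx|apply: hy].
Qed.

Lemma mem_adjoinl A (S : set K) x : A x -> adjoin A S x.
Proof. by move=> hx B [_ hB]; apply: hB; left. Qed.
Lemma mem_adjoinr A (S : set K) x : S x -> adjoin A S x.
Proof. by move=> hx B [_ hB]; apply: hB; right. Qed.
Lemma adjoin_min A (S : set K) B :
  is_subring B -> A `<=` B -> S `<=` B -> adjoin A S `<=` B.
Proof. by move=> hB h1 h2 x; apply; split=> // y []; [apply: h1|apply: h2]. Qed.
Opaque adjoin.

Lemma adjoinS A (S S' : set K) : S `<=` S' -> adjoin A S `<=` adjoin A S'.
Proof.
move=> h; apply: adjoin_min; [exact: adjoin_subring|by move=> x; exact: mem_adjoinl|].
by move=> x /h; exact: mem_adjoinr.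
Qed.

Lemma adjoin1P A x y : is_subring A ->
  adjoin A [set x] y <-> exists2 p, pover A p & y = p.[x].
Proof.
move=> hA; split; last first.
  move=> [p hp ->]; have hB := adjoin_subring A [set x].
  by apply: (sr_horner hB) => [i|]; [exact: (mem_adjoinl (hp i))|exact: mem_adjoinr].
apply: (@adjoin_min A [set x] [set y | exists2 p, pover A p & y = p.[x]]).
- apply/subringP; split.
  + by exists 1; [exact: pover1|rewrite hornerC].
  + move=> _ _ [p hp ->] [q hq ->]; exists (p - q); first exact: poverB.
    by rewrite hornerD hornerN.
  + move=> _ _ [p hp ->] [q hq ->]; exists (p * q); first exact: poverM.
    by rewrite hornerM.
- by move=> a ha; exists a%:P; [exact: poverC|rewrite hornerC].
- by move=> _ ->; exists 'X; [exact: poverX|rewrite hornerX].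
Qed.

Lemma adjoinU A (S T : set K) : adjoin A (S `|` T) = adjoin (adjoin A S) T.
Proof.
apply/seteqP; split.
  apply: adjoin_min; first exact: adjoin_subring.
    by move=> x hx; exact: (mem_adjoinl (mem_adjoinl hx)).
  by move=> x [hx|hx]; [exact: (mem_adjoinl (mem_adjoinr hx))|exact: mem_adjoinr].
apply: adjoin_min; first exact: adjoin_subring.
  apply: adjoin_min; first exact: adjoin_subring.
    by move=> x; exact: mem_adjoinl.
  by move=> x hx; apply: mem_adjoinr; left.
by move=> x hx; apply: mem_adjoinr; right.
Qed.

Lemma adjoin_cons A x (s : seq K) :
  adjoin A [set` x :: s] = adjoin (adjoin A [set` s]) [set x].
Proof.
rewrite -adjoinU; congr adjoin; apply/seteqP; split => y /=.
  by rewrite inE => /orP[/eqP->|]; [right|left].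
by move=> [h|->]; rewrite inE ?eqxx ?h ?orbT.
Qed.

Lemma adjoin_nil A : is_subring A -> adjoin A [set` ([::] : seq K)] = A.
Proof.
move=> hA; apply/seteqP; split; last by move=> x; exact: mem_adjoinl.
by apply: adjoin_min => // x /=; rewrite in_nil.
Qed.

Definition is_subfield L := is_subring L /\ forall x, L x -> L x^-1.

Definition frac A : set K := [set x | exists a b, [/\ A a, A b, b != 0 & x = a / b]].

Lemma sub_frac A : is_subring A -> A `<=` frac A.
Proof.
by move=> hA a ha; exists a, 1; rewrite divr1 oner_eq0; split=> //; apply: sr1.
Qed.

Lemma frac_subfield A : is_subring A -> is_subfield (frac A).
Proof.
move=> hA; split; last first.
  move=> _ [a [b [ha hb b0 ->]]]; have [->|a0] := eqVneq a 0.
    by rewrite mul0r invr0; apply: sub_frac => //; apply: sr0.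
  by exists b, a; rewrite invf_div.
apply/subringP; split; first by apply: sub_frac => //; apply: sr1.
- move=> _ _ [a [b [ha hb b0 ->]]] [c [d [hc hd d0 ->]]].
  exists (a * d - c * b), (b * d); split; last by field; rewrite ?b0 ?d0.
  + by apply: srB => //; apply: srM.
  + exact: srM.
  + by rewrite mulf_neq0.
- move=> _ _ [a [b [ha hb b0 ->]]] [c [d [hc hd d0 ->]]].
  exists (a * c), (b * d); split; last by field; rewrite ?b0 ?d0.
  + exact: srM.
  + exact: srM.
  + by rewrite mulf_neq0.
Qed.

Lemma frac_min A L : is_subfield L -> A `<=` L -> frac A `<=` L.
Proof.
move=> [hL hLV] AL _ [a [b [ha hb b0 ->]]]; apply: srM => //; first exact: AL.
by apply/hLV/AL.
Qed.

Lemma frac_id L : is_subfield L -> frac L = L.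
Proof.
move=> hL; apply/seteqP; split; first exact: frac_min.
by apply: sub_frac; case: hL.
Qed.

Lemma fracS A B : A `<=` B -> frac A `<=` frac B.
Proof. by move=> h _ [a [b [ha hb b0 ->]]]; exists a, b; split=> //; apply: h. Qed.

Lemma common_denom A (s : seq K) : is_subring A ->
  (forall x, x \in s -> frac A x) ->
  exists d, [/\ A d, d != 0 & forall x, x \in s -> A (d * x)].
Proof.
move=> hA; elim: s => [|x s ih] h.
  by exists 1; split; rewrite ?oner_eq0 //; apply: sr1.
have [|d [hd d0 hs]] := ih; first by move=> y ys; apply: h; rewrite inE ys orbT.
have [a [b [ha hb b0 ex]]] := h x (mem_head _ _).
exists (d * b); split; rewrite ?mulf_neq0 //; first exact: srM.
move=> y; rewrite inE => /orP[/eqP->|/hs h']; last first.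
  by rewrite mulrAC; apply: srM.
by rewrite ex (_ : d * b * (a / b) = d * a); [apply: srM|field].
Qed.

Definition integral_over A x := exists p, [/\ p \is monic, pover A p & root p x].

Definition valring V := is_subring V /\ forall x, V x \/ V x^-1.

(** [Zorn_bigcup] also asks for the union of the empty chain, and the empty set need not be good. It
    is added to the family; if it turns out maximal, then [B0] is empty too. *)
Lemma Zorn_sets (T : Type) (good : set (set T)) (B0 : set T) : good B0 ->
  (forall F : set (set T), F `<=` good -> total_on F subset -> F !=set0 ->
     good (\bigcup_(X in F) X)) ->
  exists A : set T, good A /\ forall B : set T, A `<=` B -> good B -> A = B.
Proof.
move=> g0 hch.
have [|A [hA hmax]] := @Zorn_bigcup T [set B | B = set0 \/ good B].
  move=> F hF tF; have [[X [FX X0]]|h] := pselect (exists X, F X /\ X !=set0).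
    right; rewrite (_ : \bigcup_(X in F) X = \bigcup_(X in F `&` [set X | X !=set0]) X).
      apply: hch.
      - by move=> Y [/hF [->|//] []].
      - by move=> Y Z [FY _] [FZ _]; apply: tF.
      - by exists X.
    apply/seteqP; split=> x [Y]; last by move=> [FY _] ?; exists Y.
    by move=> FY Yx; exists Y => //; split=> //; exists x.
  left; apply/seteqP; split=> // x [Y FY Yx]; apply: h.
  by exists Y; split=> //; exists x.
have gA : good A.
  case: hA => // A0; case: (pselect (B0 = set0)) => [e|ne]; first by rewrite A0 -e.
  case: (hmax B0); last by right.
  by rewrite A0; split=> // h; apply: ne; apply/seteqP; split.
exists A; split=> // B AB gB; apply: contrapT => ne; apply: (hmax B); last by right.
by split=> // BA; apply: ne; apply/seteqP; split.
Qed.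

End Basics.

(** * Integral closure as an intersection of valuation rings *)

Section Valrings.
Context {K : fieldType}.
Implicit Types (A B L V : set K) (x y z : K) (p q : {poly K}).

Lemma exprVB x m n : x != 0 -> (m <= n)%N -> x ^- m * x ^+ n = x ^+ (n - m).
Proof.
by move=> x0 mn; rewrite -{1}(subnKC mn) exprD mulKf // expf_neq0.
Qed.

Lemma monic_rootE p x : p \is monic -> root p x ->
  exists2 n, size p = n.+1 & x ^+ n = - \sum_(i < n) p`_i * x ^+ i.
Proof.
move=> pm /rootP pr.
have sp : (0 < size p)%N by rewrite size_poly_gt0 monic_neq0.
exists (size p).-1; first by rewrite prednK.
move: pr; rewrite horner_coef -(prednK sp) big_ord_recr /= => /eqP.
rewrite -lead_coefE (monicP pm) mul1r addrC addr_eq0 => /eqP ->.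
by [].
Qed.

Lemma integral_of_pow A x n (c : nat -> K) : is_subring A ->
  (forall i, (i < n)%N -> A (c i)) -> x ^+ n = \sum_(i < n) c i * x ^+ i ->
  integral_over A x.
Proof.
move=> hA hc e; exists ('X^n - \poly_(i < n) c i); split.
- rewrite monicE lead_coefDl ?lead_coefXn // size_polyN size_polyXn ltnS.
  exact: size_poly.
- by apply: poverB => //; [exact: poverXn|exact: pover_poly].
- by rewrite rootE !hornerE horner_poly e subrr.
Qed.

(** The integral closure of a subring [A] in [K], by [integral_cl] and [cl_integral]. In this form
    integrality is checked one valuation ring at a time. For a subfield it is the algebraic closure
    in [K], so [~ cl (frac A) x] says that [x] is transcendental. *)
Definition cl A : set K := [set x | forall V, valring V -> A `<=` V -> V x].

Lemma cl_subring A : is_subring (cl A).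
Proof.
apply/subringP; split=> [V [hV _] _|x y hx hy V hV AV|x y hx hy V hV AV].
- exact: sr1.
- by apply: srB; [case: hV|apply: hx|apply: hy].
- by apply: srM; [case: hV|apply: hx|apply: hy].
Qed.
Lemma sub_cl A : A `<=` cl A.
Proof. by move=> x Ax V _; apply. Qed.
Lemma cl_min A B : A `<=` cl B -> cl A `<=` cl B.
Proof. by move=> h x hx V hV BV; apply: hx => // y /h; apply. Qed.
Lemma clS A B : A `<=` B -> cl A `<=` cl B.
Proof. by move=> h; apply: cl_min => x /h; apply: sub_cl. Qed.
Lemma cl_adjoin A B (S : set K) : A `<=` cl B -> S `<=` cl B -> adjoin A S `<=` cl B.
Proof. by move=> h1 h2; apply: adjoin_min => //; apply: cl_subring. Qed.

(** Dividing a monic relation of degree [n + 1] by [x ^+ n] writes [x] as a polynomial in [x^-1]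
    over [A]. *)
Lemma integral_inv A B x : is_subring B -> A `<=` B -> integral_over A x ->
  B x^-1 -> B x.
Proof.
move=> hB AB [p [pm pA pr]] hxB.
have [x0|x0] := eqVneq x 0; first by rewrite x0; apply: sr0.
have [n sp e] := monic_rootE pm pr; case: n sp e => [|n] sp.
  by rewrite big_ord0 expr0 oppr0 => /eqP; rewrite oner_eq0.
move=> e; have -> : x = - \sum_(i < n.+1) p`_i * x^-1 ^+ (n - i).
  apply: (mulfI (expf_neq0 n x0)); rewrite -exprSr e mulrN mulr_sumr; congr (- _).
  apply: eq_bigr => i _; rewrite mulrCA; congr (_ * _).
  rewrite exprVn -{2}(subnKC (ltn_ord i : (i <= n)%N)) exprD -mulrA divff ?mulr1 //.
  exact: expf_neq0.
apply: srN => //; apply: sr_sum => // i _; apply: srM => //; first exact: (AB _ (pA _)).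
exact: srX.
Qed.

Lemma integral_cl A x : integral_over A x -> cl A x.
Proof.
move=> hx V [hV VR] AV; case: (VR x) => // hxV.
exact: (integral_inv hV AV hx).
Qed.

Section Maximal.
Variables (B : set K) (x : K).
Hypotheses (hB : is_subring B) (Bx : ~ B x) (Bxi : B x^-1).
Hypothesis Bmax : forall B', is_subring B' -> B `<=` B' -> ~ B' x -> B = B'.

Let y := x^-1.

Let x0 : x != 0.
Proof. by apply/eqP => e; apply: Bx; rewrite e; apply: sr0. Qed.

Let adj_x z : ~ B z -> exists2 p, pover B p & x = p.[z].
Proof.
move=> Bz; apply/adjoin1P => //; apply: contrapT => h; apply: Bz.
rewrite (Bmax (adjoin_subring B [set z]) _ h); first exact: mem_adjoinr.
by move=> t; exact: mem_adjoinl.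
Qed.

(** [y] lies in the Jacobson radical: if the inverse of [u = 1 - y * c] were not in [B], maximality
    would give [x = p(u^-1)]. Multiply by a power of [u], which has the form [1 - y * b]: then
    [x - b], hence [x], is in [B]. *)
Let unit1B c : B c -> B (1 - y * c)^-1 /\ 1 - y * c != 0.
Proof.
move=> Bc; have u0 : 1 - y * c != 0.
  apply/eqP => /eqP; rewrite subr_eq0 => /eqP e; apply: Bx.
  by rewrite -(mulr1 x) e mulrA divff // mul1r.
split=> //; set u := 1 - y * c; apply: contrapT => /adj_x [p hp e].
have hu : forall n, exists2 b, B b & u ^+ n = 1 - y * b.
  elim=> [|n [b hb eb]]; first by exists 0; [exact: sr0|rewrite mulr0 subr0].
  exists (c + b - y * c * b); last by rewrite exprS eb /u; ring.
  apply: srB; [exact: hB|exact: srD|apply: srM => //; exact: srM].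
have [b hb eb] := hu (size p); apply: Bx.
have : B (x * u ^+ size p).
  rewrite {1}e horner_coef mulr_suml; apply: sr_sum => // i _.
  rewrite -mulrA; apply: srM => //.
  rewrite exprVn -{2}(subnKC (ltnW (ltn_ord i))) exprD mulrA mulVf ?mul1r; last exact: expf_neq0.
  by apply: srX => //; apply: srB; [|exact: sr1|apply: srM].
rewrite eb mulrBr mulr1 mulrA divff // mul1r => h.
by rewrite -(subrK b x); apply: srD.
Qed.

Let Rz z n := exists2 p, pover B p & (size p <= n.+1)%N /\ x = p.[z].

(** Chevalley's degree reduction. In the relation in [z^-1] the constant term is absorbed by the
    unit [1 - y * q_0], which expresses 1 by negative powers of [z]; this lowers the top term of the
    relation in [z]. *)
Let reduce z n m : z != 0 -> (0 < m)%N -> (m <= n)%N -> Rz z n -> Rz z^-1 m -> Rz z n.-1.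
Proof.
move=> z0 m0 mn [p hp [sp ep]] [q hq [sq eq]].
have [hu u0] := unit1B (hq 0%N); set u := 1 - y * q`_0 in hu u0.
case: n mn sp => [|n] mn sp; first by case: (m) m0 mn.
have e1 : 1 = u^-1 * y * \sum_(i < m) q`_i.+1 * z^-1 ^+ i.+1.
  apply: (mulfI u0); rewrite mulr1 -mulrA mulVKf //.
  have -> : \sum_(i < m) q`_i.+1 * z^-1 ^+ i.+1 = x - q`_0.
    rewrite {1}eq (horner_coef_wide _ sq) big_ord_recl expr0 mulr1 [q`_0 + _]addrC addrK.
    by apply: eq_bigr.
  by rewrite mulrBr mulVf.
pose p' := \poly_(i < n.+1) p`_i
   + (p`_n.+1 * (u^-1 * y)) *: \sum_(i < m) q`_i.+1 *: 'X^(n - i).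
exists p'.
  apply: poverD => //; first by apply: pover_poly => // i _; apply: (hp _).
  apply: poverZ => //; first by apply: srM => //; exact: srM.
  by apply: pover_sum => // i _; apply: poverZ => //; exact: poverXn.
split.
  rewrite /= (leq_trans (size_polyD _ _)) // geq_max size_poly /=.
  rewrite (leq_trans (size_scale_leq _ _)) // (leq_trans (size_sum _ _ _)) //.
  apply/bigmax_leqP => i _; rewrite (leq_trans (size_scale_leq _ _)) //.
  by rewrite size_polyXn ltnS leq_subr.
rewrite /p' hornerD hornerZ horner_poly {1}ep (horner_coef_wide _ sp) big_ord_recr /=.
congr (_ + _); rewrite -mulrA; congr (_ * _).
rewrite -{1}[z ^+ n.+1]mulr1 e1 mulrCA; congr (_ * _).
rewrite horner_sum mulr_sumr; apply: eq_bigr => i _.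
rewrite hornerZ hornerXn mulrCA; congr (_ * _).
rewrite exprVn -{1}(subnK (leq_trans (ltn_ord i) mn : (i.+1 <= n.+1)%N)) subSS exprD.
by rewrite mulfK // expf_neq0.
Qed.

(** If neither [z] nor [z^-1] were in [B], maximality would give relations for [x] in both. The one
    of larger degree can always be lowered, until [x] is in [B]. *)
Lemma maximal_valring : valring B.
Proof.
split=> // z; apply: contrapT => /not_orP [Bz Bzi].
have z0 : z != 0 by apply/eqP => e; apply: Bz; rewrite e; apply: sr0.
have noR0 : forall z, ~ Rz z 0.
  move=> t [p hp [/size1_polyC -> e]]; apply: Bx; rewrite e hornerC; exact: (hp _).
have H : forall N n m, (n + m <= N)%N -> Rz z n -> Rz z^-1 m -> False.
  elim=> [|N ih] n m; first by rewrite leqn0 addn_eq0 => /andP[/eqP -> _] /noR0.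
  case: n => [|n]; first by move=> _ /noR0.
  case: m => [|m]; first by move=> _ _ /noR0.
  move=> hN hn hm; case: (leqP m n) => mn.
    by apply: (ih n m.+1) => //; apply: (@reduce _ n.+1 m.+1).
  apply: (ih n.+1 m) => //; first by move: hN; rewrite addSn addnS.
  apply: (@reduce _ m.+1 n.+1); rewrite ?invr_eq0 ?invrK //; lia.
have [p hp ep] := adj_x Bz; have [q hq eq] := adj_x Bzi.
apply: (H _ (size p) (size q) (leqnn _)); first by exists p.
by exists q.
Qed.
End Maximal.

(* Chevalley: a subring maximal among those that contain [x^-1] but not [x] is
   a valuation ring. *)
Lemma cl_integral A x : is_subring A -> cl A x -> integral_over A x.
Proof.
move=> hA; apply: contraPP => nint hx.
have x0 : x != 0.
  apply/eqP => e; apply: nint; exists 'X; rewrite monicX e rootX; split=> //.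
  exact: poverX.
pose good B := [/\ is_subring B, A `<=` B, B x^-1 & ~ B x].
have g0 : good (adjoin A [set x^-1]).
  split; first exact: adjoin_subring.
  - by move=> t; exact: mem_adjoinl.
  - exact: mem_adjoinr.
  (* If [x] is in [A[x^-1]], multiplying [x = p(x^-1)] by [x ^+ size p] gives a monic relation, with
     constant coefficient 0. *)
  - move/(adjoin1P _ _ hA) => [p hp e]; apply: nint.
    apply: (@integral_of_pow _ _ (size p).+1 (fun i => if i is 0 then 0 else p`_(size p - i))) => //.
      by case=> [|i] _; [exact: sr0|exact: (hp _)].
    rewrite big_ord_recl mul0r add0r exprS {1}e horner_coef mulr_suml.
    rewrite (reindex_inj rev_ord_inj) /=; apply: eq_bigr => i _.
    by rewrite -mulrA; congr (_ * _); rewrite exprVn exprVB ?leq_subr // subKn.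
have [B [[hB AB Bxi Bx] Bmax]] : exists B : set K, good B /\
    forall B' : set K, B `<=` B' -> good B' -> B = B'.
  apply: (Zorn_sets g0) => F hF tF [X0 FX0]; split.
  - apply/subringP; split.
    + by exists X0 => //; have [h _ _ _] := hF _ FX0; apply: sr1.
    + move=> a b [X FX Xa] [Y FY Yb]; have [XY|YX] := tF _ _ FX FY.
        by exists Y => //; have [h _ _ _] := hF _ FY; apply: srB => //; apply: XY.
      by exists X => //; have [h _ _ _] := hF _ FX; apply: srB => //; apply: YX.
    + move=> a b [X FX Xa] [Y FY Yb]; have [XY|YX] := tF _ _ FX FY.
        by exists Y => //; have [h _ _ _] := hF _ FY; apply: srM => //; apply: XY.
      by exists X => //; have [h _ _ _] := hF _ FX; apply: srM => //; apply: YX.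
  - by move=> a Aa; exists X0 => //; have [_ h _ _] := hF _ FX0; apply: h.
  - by exists X0 => //; have [_ _ h _] := hF _ FX0.
  - by move=> [X FX Xx]; have [_ _ _] := hF _ FX.
apply: (Bx); apply: hx => //; apply: (maximal_valring hB Bx Bxi) => B' h1 h2 h3.
by apply: Bmax => //; split=> //; [move=> t /AB /h2|exact: h2].
Qed.

Lemma cl_of_pow A x n (c : nat -> K) : is_subring A ->
  (forall i, (i < n)%N -> A (c i)) -> x ^+ n = \sum_(i < n) c i * x ^+ i -> cl A x.
Proof. by move=> hA hc e; exact: (integral_cl (integral_of_pow hA hc e)). Qed.

Lemma cl_normal A : is_subring A -> integrally_closed A -> cl A `<=` A.
Proof. by move=> hA nA x /cl_integral -/(_ hA) [p [pm pA pr]]; apply: nA pr. Qed.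

Lemma valring_cl V : valring V -> cl V `<=` V.
Proof. by move=> hV x hx; apply: hx. Qed.

(** The inverse of a nonzero algebraic element is algebraic, hence also in every valuation ring over
    [L]. *)
Lemma subfield_valring L V : is_subfield L -> valring V -> L `<=` V ->
  forall x, cl L x -> x != 0 -> unit_in V x.
Proof.
move=> [hL hLV] hV LV x hx x0; split=> //; first exact: hx.
have := cl_integral hL hx => -[p [pm hp pr]].
have [n sp e] := monic_rootE pm pr.
suff : cl L x^-1 by apply.
(* Removing the root 0 leaves a relation with nonzero constant term, which can be solved for
   [x^-1]. *)
have [m [q q0 ep]] := multiplicity_XsubC p 0.
move: q0; rewrite (monic_neq0 pm) /= subr0 in ep * => q0.
have hq : pover L q by move=> i; have := hp (i + m)%N; rewrite ep coefMXn ltnNge leq_addl addnK.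
have qx : root q x.
  move: pr; rewrite ep rootM => /orP[//|].
  by rewrite /root hornerXn expf_eq0 (negbTE x0) andbF.
have sq : (0 < size q)%N.
  by rewrite size_poly_gt0; apply: contraNneq q0 => ->; apply: root0.
have q00 : q`_0 != 0 by rewrite -horner_coef0.
have : x^-1 = - \sum_(i < (size q).-1) q`_i.+1 / q`_0 * x ^+ i.
  move: (rootP qx); rewrite horner_coef -(prednK sq) big_ord_recl mulr1.
  move=> /eqP; rewrite addr_eq0 => /eqP e3; apply: (mulfI q00); apply: (mulIf x0).
  rewrite mulfVK // [LHS]e3 mulrN mulNr; congr (- _); rewrite mulr_sumr mulr_suml.
  by apply: eq_bigr => i _; rewrite lift0 exprS; field.
have hS := cl_subring L; move=> ->; apply: (srN hS); apply: (sr_sum hS) => i _.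
apply: (srM hS); last exact: (srX hS).
by apply: (@sub_cl L); apply: srM => //; exact: (hLV _ (hq _)).
Qed.

Lemma cl_subfield L : is_subfield L -> is_subfield (cl L).
Proof.
move=> hL; split; first exact: cl_subring.
move=> x hx; have [->|x0] := eqVneq x 0; first by rewrite invr0; exact: (sr0 (cl_subring L)).
by move=> V hV LV; have [] := subfield_valring hL hV LV hx x0.
Qed.

(** If [d] clears the coefficients of a monic relation for [x], then [d * x] satisfies a monic
    relation over [A]. *)
Lemma cl_frac_denom A x : is_subring A -> cl (frac A) x ->
  exists a, [/\ A a, a != 0 & cl A (a * x)].
Proof.
move=> hA /cl_integral []; first by case: (frac_subfield hA).
move=> p [pm hp pr]; have [n sp e] := monic_rootE pm pr.
have [|d [hd d0 hs]] := @common_denom _ A p hA.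
  by move=> y /(nthP 0) [i _ <-]; apply: (hp _).
have hdp i : A (d * p`_i).
  have [h|h] := ltnP i (size p); first by apply: hs; apply: mem_nth.
  by rewrite nth_default // mulr0; apply: sr0.
exists d; split=> //.
apply: (@cl_of_pow _ _ n (fun i => - (d * p`_i * d ^+ (n - i).-1))) => //.
  by move=> i _; apply: srN => //; apply: srM => //; apply: srX.
rewrite exprMn e mulrN mulr_sumr -sumrN; apply: eq_bigr => i _.
rewrite mulNr; congr (- _); rewrite exprMn -{1}(subnK (ltnW (ltn_ord i))).
rewrite exprD -{1}(prednK (_ : 0 < n - i)%N) ?subn_gt0 // exprS; ring.
Qed.

Lemma cl_root L p x : is_subfield L -> pover L p -> p != 0 -> root p x -> cl L x.
Proof.
move=> [hL hLV] hp p0 pr; apply: integral_cl; exists ((lead_coef p)^-1 *: p); split.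
- by rewrite monicE lead_coefZ mulVf // lead_coef_eq0.
- by apply: poverZ => //; apply/hLV; rewrite lead_coefE; apply: (hp _).
- by rewrite rootE hornerZ (rootP pr) mulr0.
Qed.

End Valrings.

(** * Noetherian rings, localizations and discrete valuation rings *)

Section Noetherian.
Context {K : fieldType}.
Implicit Types (A B L V P I J : set K) (x y z : K) (p q : {poly K}).

Definition ideal B I := [/\ I `<=` B, I 0, forall x y, I x -> I y -> I (x + y)
  & forall a x, B a -> I x -> I (a * x)].

Definition noeth B := forall I : nat -> set K, (forall n, ideal B (I n)) ->
  (forall n, I n `<=` I n.+1) -> exists n, forall m, I m `<=` I n.

Fixpoint ispan B (s : seq K) : set K :=
  if s is x :: s' then [set z | exists a y, [/\ B a, ispan B s' y & z = a * x + y]]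
  else [set 0].

Lemma chain_le (I : nat -> set K) : (forall n, I n `<=` I n.+1) ->
  forall m n, (m <= n)%N -> I m `<=` I n.
Proof.
move=> h m n /subnK <-; elim: (n - m)%N => [|k ih]; first by rewrite add0n.
by move=> x /ih hx; rewrite addSn; apply: h.
Qed.

Lemma ispan_ideal B s : is_subring B -> [set` s] `<=` B -> ideal B (ispan B s).
Proof.
move=> hB; elim: s => [|x s ih] hs /=.
  split=> [y ->||y z -> ->|a y _ ->] //; rewrite ?addr0 ?mulr0 //; exact: sr0.
have [|h1 h2 h3 h4] := ih; first by move=> y ys; apply: hs; rewrite /= inE ys orbT.
have Bx : B x by apply: hs; rewrite /= mem_head.
split.
- by move=> _ [a [y [Ba hy ->]]]; apply: srD => //; [apply: srM|apply: h1].
- by exists 0, 0; rewrite mul0r addr0; split=> //; apply: sr0.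
- move=> _ _ [a [y [Ba hy ->]]] [b [z [Bb hz ->]]].
  by exists (a + b), (y + z); split; [exact: srD|exact: h3|ring].
- move=> c _ Bc [a [y [Ba hy ->]]].
  by exists (c * a), (c * y); split; [exact: srM|exact: h4|ring].
Qed.

Lemma mem_ispan B s x : is_subring B -> x \in s -> ispan B s x.
Proof.
move=> hB; elim: s => [//|y s ih] /=; rewrite inE => /orP[/eqP ->|/ih h].
  exists 1, 0; rewrite mul1r addr0; split=> //; first exact: sr1.
  by elim: {ih} s => //= z s ih; exists 0, 0; rewrite mul0r addr0; split=> //; apply: sr0.
by exists 0, x; rewrite mul0r add0r; split=> //; apply: sr0.
Qed.

Lemma ispan_min B s J : ideal B J -> [set` s] `<=` J -> ispan B s `<=` J.
Proof.
move=> [_ h2 h3 h4]; elim: s => [|x s ih] hs /=; first by move=> _ ->.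
move=> _ [a [y [Ba hy ->]]]; apply: h3.
  by apply: h4 => //; apply: hs; rewrite /= mem_head.
by apply: ih hy => z zs; apply: hs; rewrite /= inE zs orbT.
Qed.

Lemma noeth_max B (F : set (set K)) I0 : noeth B ->
  (forall I, F I -> ideal B I) -> F I0 ->
  exists I, F I /\ forall J, F J -> I `<=` J -> J `<=` I.
Proof.
move=> nB hF F0; apply: contrapT => hno.
have /choice [f hf] : forall I, exists J, F I -> [/\ F J, I `<=` J & ~ J `<=` I].
  move=> I; have [FI|nFI] := pselect (F I); last by exists I0.
  apply: contrapT => hJ; apply: hno; exists I; split=> // J FJ IJ.
  by apply: contrapT => JI; apply: hJ; exists J.
have Fn : forall n, F (iter n f I0) by elim=> //= n /hf [].
have [n hn] := nB (fun n => iter n f I0) (fun n => hF _ (Fn n))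
  (fun n => let: And3 _ h _ := hf _ (Fn n) in h).
by have [_ _] := hf _ (Fn n); apply; apply: (hn n.+1).
Qed.

Lemma noeth_fg B I : is_subring B -> noeth B -> ideal B I ->
  exists s, [set` s] `<=` I /\ I `<=` ispan B s.
Proof.
move=> hB nB hI; have [IB I0 _ _] := hI.
pose F := [set J | exists s, [set` s] `<=` I /\ J = ispan B s].
have [||_ [[s [sI ->]] hmax]] := @noeth_max B F [set 0] nB.
- by move=> _ [s [sI ->]]; apply: ispan_ideal => // x /sI /IB.
- by exists [::]; split=> // x /=; rewrite in_nil.
exists s; split=> // x Ix.
have hxs : [set` x :: s] `<=` I.
  by move=> y /=; rewrite inE => /orP[/eqP -> //|]; apply: sI.
apply: (hmax (ispan B (x :: s))); first by exists (x :: s).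
  by move=> y hy /=; exists 0, y; rewrite mul0r add0r; split=> //; apply: sr0.
by apply: mem_ispan => //; rewrite mem_head.
Qed.

(** Almost integral elements are integral: the ideals spanned by the [w * y ^+ i], [i < n], become
    stationary, and division by [w] leaves a monic relation for [y]. *)
Lemma noeth_cic B w y : is_subring B -> noeth B -> w != 0 ->
  (forall k, B (w * y ^+ k)) -> cl B y.
Proof.
move=> hB nB w0 hw.
pose I n := [set x | exists c : nat -> K,
  (forall i, B (c i)) /\ x = \sum_(i < n) c i * (w * y ^+ i)].
have [||n /(_ n.+1) hn] := nB I.
- move=> n; split.
  + by move=> _ [c [hc ->]]; apply: sr_sum => // i _; apply: srM.
  + exists (fun=> 0); split=> [_|]; first exact: sr0.
    by rewrite big1 // => i _; rewrite mul0r.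
  + move=> _ _ [c [hc ->]] [d [hd ->]]; exists (fun i => c i + d i); split=> [i|].
      exact: srD.
    by rewrite -big_split /=; apply: eq_bigr => i _; rewrite mulrDl.
  + move=> a _ Ba [c [hc ->]]; exists (fun i => a * c i); split=> [i|].
      exact: srM.
    by rewrite mulr_sumr; apply: eq_bigr => i _; rewrite mulrA.
- move=> n _ [c [hc ->]]; exists (fun i => if (i < n)%N then c i else 0); split.
    by move=> i; case: ifP => _ //; apply: sr0.
  rewrite big_ord_recr /= ltnn mul0r addr0; apply: eq_bigr => i _.
  by rewrite ltn_ord.
have [|c [hc e]] := hn (w * y ^+ n).
  exists (fun i => if i == n then 1 else 0); split.
    by move=> i; case: ifP => _; [exact: sr1|exact: sr0].
  rewrite big_ord_recr /= eqxx mul1r big1 ?add0r // => i _.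
  by rewrite ltn_eqF ?mul0r.
apply: (@cl_of_pow _ _ _ n c) => //; apply: (mulfI w0); rewrite e mulr_sumr.
by apply: eq_bigr => i _; rewrite mulrCA.
Qed.

Lemma noeth_subfield L : is_subfield L -> noeth L.
Proof.
move=> [hL hLV] I hI hch.
have [[n [x [Ix x0]]]|h] := pselect (exists n x, I n x /\ x != 0).
  exists n => m y Iy; have [IL _ _ hm] := hI n; have [IL' _ _ _] := hI m.
  rewrite -[y](@mulfVK _ x) //; apply: hm => //; apply: srM => //; first exact: IL'.
  exact/hLV/IL.
exists 0%N => m y Iy; have [->|y0] := eqVneq y 0; first by case: (hI 0%N).
by case: h; exists m, y.
Qed.

(** Hilbert's basis theorem, for values at [x] of polynomials, where [x] may be algebraic over
    [A]. *)
Lemma noeth_adjoin1 A x : is_subring A -> noeth A -> noeth (adjoin A [set x]).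
Proof.
move=> hA nA; have hB := adjoin_subring A [set x]; move: hB.
set B := adjoin A [set x] => hB I hI hch.
have Bp p : pover A p -> B p.[x] by move=> hp; apply/adjoin1P => //; exists p.
have ADD n y z : I n y -> I n z -> I n (y + z) by case: (hI n) => _ _ + _; apply.
have MUL n a z : B a -> I n z -> I n (a * z) by case: (hI n) => _ _ _; apply.
have ABl a : A a -> B a by move=> Aa; exact: mem_adjoinl.
pose Lc d n := [set a | exists p, [/\ pover A p, (size p <= d.+1)%N, I n p.[x] & a = p`_d]].
have Lid d n : ideal A (Lc d n).
  split.
  - by move=> _ [p [hp _ _ ->]].
  - exists 0; split; rewrite ?size_poly0 ?horner0 ?coef0 //; first exact: pover0.
    by case: (hI n).
  - move=> _ _ [p [hp sp Ip ->]] [q [hq sq Iq ->]]; exists (p + q).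
    split; rewrite ?coefD ?hornerD //; [exact: poverD| |exact: ADD].
    by rewrite (leq_trans (size_polyD _ _)) // geq_max sp.
  - move=> a _ Aa [p [hp sp Ip ->]]; exists (a *: p).
    split; rewrite ?coefZ ?hornerZ //; [exact: poverZ| |].
      by rewrite (leq_trans (size_scale_leq _ _)).
    by apply: MUL => //; apply: ABl.
have Ln d n : Lc d n `<=` Lc d n.+1.
  by move=> _ [p [hp sp Ip ->]]; exists p; split=> //; apply: hch.
have Ld d n : Lc d n `<=` Lc d.+1 n.
  move=> _ [p [hp sp Ip ->]]; exists (p * 'X); split.
  - by apply: poverM => //; apply: poverX.
  - have [->|p0] := eqVneq p 0; first by rewrite mul0r size_poly0.
    by rewrite size_mulX.
  - rewrite hornerMX mulrC; apply: MUL => //; exact: mem_adjoinr.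
  - by rewrite coefMX.
have Lnn d m n : (m <= n)%N -> Lc d m `<=` Lc d n by apply: chain_le.
have Ldd n d e : (d <= e)%N -> Lc d n `<=` Lc e n by apply: (@chain_le (fun d => Lc d n)).
have [N hN] := nA (fun n => Lc n n) (fun n => Lid n n)
  (fun n a h => Ld _ _ _ (Ln _ _ _ h)).
have /choice [g hg] : forall d, exists n, forall m, Lc d m `<=` Lc d n.
  by move=> d; apply: nA.
(* The diagonal chain is stationary from [N] on and serves all degrees above [N]; each of the
   finitely many smaller degrees has its own bound. *)
pose M := maxn N (\max_(d < N) g d).
exists M => m y hy; have : B y by case: (hI m) => + _ _ _; apply.
case/adjoin1P => // p hp ey; rewrite {y}ey in hy *.
move: (leqnn (size p)); move: {2}(size p) => k.
elim: k m p hp hy => [|k ih] m p hp hy sp.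
  move: sp; rewrite leqn0 size_poly_eq0 => /eqP ->; rewrite horner0; by case: (hI M).
have : Lc k m p`_k by exists p.
have : Lc k m `<=` Lc k M.
  have [kN|Nk] := ltnP k N.
    move=> a /hg; apply: Lnn; rewrite leq_max; apply/orP; right.
    exact: (leq_bigmax (Ordinal kN)).
  move=> a ha; have : Lc N N a.
    apply: (hN (maxn k m)); apply: (Ldd _ k); first exact: leq_maxl.
    by apply: (Lnn _ m) ha; exact: leq_maxr.
  by move=> /(Ldd _ _ _ Nk); apply: Lnn; rewrite leq_max leqnn.
move=> sub /sub [q [hq sq Iq eq]].
rewrite -(subrK q p) hornerD; apply: (ADD) => //.
apply: (ih (maxn m M)).
- exact: poverB.
- rewrite hornerD hornerN -mulN1r; apply: (ADD).
    by apply: (chain_le hch _ hy); exact: leq_maxl.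
  apply: MUL; first by apply: (srN hB); apply: (sr1 hB).
  by apply: (chain_le hch _ Iq); exact: leq_maxr.
- apply/leq_sizeP => j; rewrite leq_eqVlt => /orP[/eqP <-|kj].
    by rewrite coefB eq subrr.
  by rewrite coefB !nth_default ?subrr // (leq_trans _ kj).
Qed.

Lemma noeth_adjoin A (s : seq K) : is_subring A -> noeth A -> noeth (adjoin A [set` s]).
Proof.
move=> hA nA; elim: s => [|x s ih]; first by rewrite adjoin_nil.
by rewrite adjoin_cons; apply: noeth_adjoin1 => //; apply: adjoin_subring.
Qed.

Section Localization.
Variables (A pr : set K).
Hypotheses (hA : is_subring A) (hp : prime_ideal A pr).

Lemma prime_nz b : ~ pr b -> b != 0.
Proof. by case: hp => _ [p0 _] _ _ _ h; apply: contra_notN h => /eqP ->. Qed.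

Lemma prime_ideal_ideal : ideal A pr.
Proof. by case: hp => h1 [h2 _] h3 h4 _; split. Qed.

Lemma primeNM a b : A a -> A b -> ~ pr a -> ~ pr b -> ~ pr (a * b).
Proof. by case: hp => _ _ _ _ h Aa Ab na nb /(h _ _ Aa Ab) []. Qed.

Lemma prime_N1 : ~ pr 1. Proof. by case: hp => _ []. Qed.

Lemma loc_subring : is_subring (localization A pr).
Proof.
apply/subringP; split.
- exists 1, 1; rewrite divr1; split=> //; [exact: sr1|exact: sr1|exact: prime_N1].
- move=> _ _ [a [b [Aa Ab nb ->]]] [c [d [Ac Ad nd ->]]].
  exists (a * d - c * b), (b * d); split.
  + by apply: srB => //; apply: srM.
  + exact: srM.
  + exact: primeNM.
  + by field; rewrite (prime_nz nb) (prime_nz nd).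
- move=> _ _ [a [b [Aa Ab nb ->]]] [c [d [Ac Ad nd ->]]].
  exists (a * c), (b * d); split; [exact: srM|exact: srM|exact: primeNM|].
  by field; rewrite (prime_nz nb) (prime_nz nd).
Qed.

Lemma sub_loc : A `<=` localization A pr.
Proof.
move=> a Aa; exists a, 1; rewrite divr1.
by split=> //; [exact: sr1|exact: prime_N1].
Qed.

Lemma loc_inv b : A b -> ~ pr b -> localization A pr b^-1.
Proof. by move=> Ab nb; exists 1, b; rewrite div1r; split=> //; exact: sr1. Qed.

Lemma loc_unit a : A a -> unit_in (localization A pr) a <-> ~ pr a.
Proof.
move=> Aa; split.
  move=> [a0 _ [c [d [Ac Ad nd e]]]] pa; apply: (nd).
  have -> : d = c * a by apply: (mulIf (invr_neq0 a0)); rewrite mulfK // e mulrCA divff ?mulr1 // prime_nz.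
  by case: hp => _ _ _ + _; apply.
by move=> na; split; [exact: prime_nz|exact: sub_loc|exact: loc_inv].
Qed.

Lemma loc_frac : localization A pr `<=` frac A.
Proof. by move=> _ [a [b [Aa Ab nb ->]]]; exists a, b; split=> //; exact: prime_nz. Qed.

Lemma noeth_loc : noeth A -> noeth (localization A pr).
Proof.
move=> nA I hI hch; have [||n hn] := nA (fun n => I n `&` A).
- move=> n; have [h1 h2 h3 h4] := hI n; split.
  + by move=> x [].
  + by split=> //; apply: sr0.
  + by move=> x y [? ?] [? ?]; split; [exact: h3|exact: srD].
  + by move=> a x Aa [? ?]; split; [apply: h4 => //; exact: sub_loc|exact: srM].
- by move=> n x [? ?]; split=> //; apply: hch.
exists n => m x Ix; have [h1 _ _ h4] := hI m; have [_ _ _ h4'] := hI n.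
have [a [b [Aa Ab nb e]]] := h1 _ Ix; rewrite e mulrC; apply: h4'; first exact: loc_inv.
have [|//] := hn m a; split=> //; rewrite (_ : a = b * x); first by apply: h4 => //; exact: sub_loc.
by rewrite e mulrC mulfVK // prime_nz.
Qed.

Lemma loc_maxE x : max_ideal (localization A pr) x <->
  exists a b, [/\ pr a, A b, ~ pr b & x = a / b].
Proof.
have hP := loc_subring; split.
  move=> [[a [b [Aa Ab nb e]]] nu]; exists a, b; split=> //.
  apply: contrapT => na; apply: nu; rewrite e; apply: (unit_inM hP); first by apply/loc_unit.
  by apply: unit_inV; apply/loc_unit.
move=> [a [b [pa Ab nb e]]]; have Aa : A a by case: hp => + _ _ _ _; apply.
split; first by exists a, b.
move=> hu; have : unit_in (localization A pr) (x * b).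
  by apply: (unit_inM hP) => //; apply/loc_unit.
by rewrite e mulfVK ?prime_nz // => /loc_unit; apply.
Qed.

Lemma loc_max_prime : prime_ideal (localization A pr) (max_ideal (localization A pr)).
Proof.
have hP := loc_subring; have [h1 [h20 h21] h3 h4 h5] := hp.
split.
- by move=> x [].
- split; first by apply/loc_maxE; exists 0, 1; rewrite mul0r; split=> //; exact: sr1.
  by move=> [_]; apply; exact: unit_in1.
- move=> _ _ /loc_maxE [a [b [pa Ab nb ->]]] /loc_maxE [c [d [pc Ad nd ->]]].
  apply/loc_maxE; exists (d * a + b * c), (b * d); split.
  + by apply: h3; apply: h4.
  + exact: srM.
  + exact: primeNM.
  + by field; rewrite (prime_nz nb) (prime_nz nd).
- move=> _ _ [c [d [Ac Ad nd ->]]] /loc_maxE [a [b [pa Ab nb ->]]].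
  apply/loc_maxE; exists (c * a), (d * b); split; [exact: h4|exact: srM|exact: primeNM|].
  by field; rewrite (prime_nz nb) (prime_nz nd).
- move=> x y Px Py [_ hxy]; apply: contrapT => /not_orP [hx hy]; apply: hxy.
  by apply: (unit_inM hP); apply: contrapT => h; [apply: hx|apply: hy].
Qed.

Lemma loc_loc qr : prime_ideal (localization A pr) qr ->
  prime_ideal A (qr `&` A) /\ localization (localization A pr) qr = localization A (qr `&` A).
Proof.
move=> hq; have [h1 [h20 h21] h3 h4 h5] := hq.
have hqA : prime_ideal A (qr `&` A).
  split.
  - by move=> x [].
  - by split=> [|[]//]; split=> //; apply: sr0.
  - by move=> x y [? ?] [? ?]; split; [exact: h3|exact: srD].
  - by move=> a x Aa [? ?]; split; [apply: h4 => //; exact: sub_loc|exact: srM].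
  - move=> a b Aa Ab [hab _]; have [||h|h] := h5 a b _ _ hab; try exact: sub_loc.
      by left.
    by right.
split=> //; apply/seteqP; split=> x; last first.
  move=> [a [b [Aa Ab nb ->]]]; exists a, b; split=> //; try exact: sub_loc.
  by move=> qb; apply: nb.
move=> [_ [_ [[a [b [Aa Ab nb ->]]] [c [d [Ac Ad nd ->]]] ncd ->]]].
have nc : ~ qr c.
  by move=> qc; apply: ncd; rewrite mulrC; apply: h4 => //; exact: loc_inv.
have nbq : ~ qr b.
  move=> qb; apply: h21; rewrite -(@mulVf _ b) ?prime_nz //; apply: h4 => //.
  exact: loc_inv.
have c0 : c != 0 by apply: contra_notN nc => /eqP ->.
exists (a * d), (b * c); split; [exact: srM|exact: srM| |].
- move=> [hbc _]; have [||//|//] := h5 b c _ _ hbc; exact: sub_loc.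
- by field; rewrite c0 (prime_nz nb) (prime_nz nd).
Qed.
End Localization.

(* An associated prime of [(A + xA)/A]. *)
Lemma colon_prime A x : is_subring A -> noeth A -> ~ A x ->
  exists c, [/\ A c, ~ A (x * c) & prime_ideal A [set d | A d /\ A (d * (x * c))]].
Proof.
move=> hA nA nx.
pose colon y := [set d | A d /\ A (d * y)].
pose F := [set I | exists c, [/\ A c, ~ A (x * c) & I = colon (x * c)]].
have cid y : ideal A (colon y).
  split.
  - by move=> d [].
  - by rewrite /colon /= mul0r; split; exact: sr0.
  - by move=> a b [? ?] [? ?]; split; rewrite ?mulrDl; exact: srD.
  - by move=> a b ? [? ?]; split; rewrite -?mulrA; exact: srM.
have [||_ [[c [Ac nc ->]] hmax]] := @noeth_max A F (colon (x * 1)) nA.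
- by move=> _ [c [_ _ ->]].
- by exists 1; rewrite mulr1; split=> //; exact: sr1.
exists c; split=> //; have [h1 h2 h3 h4] := cid (x * c); split=> //.
  by split=> //; rewrite /= mul1r => -[_].
move=> a b Aa Ab [_ hab]; have [hb|nb] := pselect (A (b * (x * c))).
  by right.
left; apply: (hmax (colon (x * (c * b)))).
- exists (c * b); split=> //; first exact: srM.
  by rewrite mulrA mulrC.
- move=> d [Ad hd]; split=> //; rewrite (_ : _ * _ = b * (d * (x * c))); last by ring.
  exact: srM.
- by split=> //; rewrite (_ : _ * _ = a * b * (x * c)) //; ring.
Qed.

(** If [x] were not in [A], a fraction [x = a / b] with [b] outside the prime of [colon_prime] would
    put [b] into that prime. *)
Lemma loc_all A x : is_subring A -> noeth A ->
  (forall pr, prime_ideal A pr -> localization A pr x) -> A x.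
Proof.
move=> hA nA h; apply: contrapT => nx.
have [c [Ac nc hp]] := colon_prime hA nA nx.
have [a [b [Aa Ab nb e]]] := h _ hp; apply: nb; split=> //.
rewrite mulrA e mulrCA divff ?mulr1; first exact: srM.
by apply: contra_notN nc => /eqP b0; rewrite e b0 invr0 mulr0 mul0r; exact: sr0.
Qed.

Definition is_dvr E := is_subring E /\ exists t : K,
  [/\ t != 0, E t, ~ E t^-1 & forall x, x != 0 -> exists (k : int) u, unit_in E u /\ x = u * t ^ k].

(** If [y] multiplied the maximal ideal into itself it would be almost integral, hence in [E]. So
    some [a * y] is a unit and [y^-1] is in [E]; it is the uniformizer. For the same reason,
    multiplying an element of [E] repeatedly by [y] must reach a unit. *)
Lemma dvr_crit E y : is_subring E -> noeth E -> integrally_closed E ->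
  frac E = setT -> ~ E y -> (forall a, max_ideal E a -> E (a * y)) ->
  (exists2 a, max_ideal E a & a != 0) -> is_dvr E.
Proof.
move=> hE nE cE fE nEy hy [a0 ma0 a00].
have nomax : ~ forall a, max_ideal E a -> max_ideal E (a * y).
  move=> h; apply: nEy; apply: (cl_normal hE cE); apply: (noeth_cic hE nE a00) => k.
  suff : max_ideal E (a0 * y ^+ k) by case.
  by elim: k => [|k ih]; rewrite ?expr0 ?mulr1 // exprSr mulrA; apply: h.
have [a [[Ea nua] uay]] : exists a, max_ideal E a /\ unit_in E (a * y).
  apply: contrapT => h; apply: nomax => a ma; split; first exact: hy.
  by move=> u; apply: h; exists a.
have y0 : y != 0 by apply: contra_notN nEy => /eqP ->; exact: sr0.
have Et : E y^-1.
  have [ay0 _ hh] := uay.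
  have -> : y^-1 = a * (a * y)^-1.
    by move: ay0; rewrite mulf_eq0 negb_or => /andP[a1 _]; field; rewrite ?a1 ?y0.
  exact: srM.
split=> //; exists y^-1; split; rewrite ?invr_eq0 ?invrK //.
have main x : E x -> x != 0 -> exists n, unit_in E (x * y ^+ n).
  move=> Ex x0; apply: contrapT => h; apply: nEy; apply: (cl_normal hE cE).
  apply: (noeth_cic hE nE x0) => k; elim: k => [|k ih]; first by rewrite mulr1.
  rewrite exprSr mulrA; apply: hy; split=> // u; by apply: h; exists k.
have main' x : E x -> x != 0 -> exists (n : nat) u, unit_in E u /\ x = u * y^-1 ^+ n.
  move=> Ex x0; have [n hn] := main x Ex x0; exists n, (x * y ^+ n); split=> //.
  by rewrite exprVn mulfK // expf_neq0.
move=> x x0; have : frac E x by rewrite fE.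
move=> [c [d [Ec Ed d0 e]]].
have c0 : c != 0 by apply: contraNneq x0 => c0; rewrite e c0 mul0r.
have [n [u [hu eu]]] := main' c Ec c0; have [m [v [hv ev]]] := main' d Ed d0.
exists (n%:Z - m%:Z), (u / v); split; first by apply: unit_inM => //; exact: unit_inV.
rewrite expfzDr ?invr_eq0 // -invr_expz -!exprnP e eu ev.
have [v0 _ _] := hv; by field; rewrite ?v0 ?expf_neq0 ?invr_eq0 ?y0.
Qed.

(** The associated prime of [x^-1] modulo [E] contains [x]; in dimension one it is therefore the
    maximal ideal. *)
Lemma dim1_dvr E : is_subring E -> noeth E -> integrally_closed E ->
  frac E = setT -> krull_dim1 E -> is_dvr E.
Proof.
move=> hE nE cE fE [[x mx x0] hdim].
have nx : ~ E x^-1 by case: mx => Ex nu h; apply: nu.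
have [c [Ec nc hp]] := colon_prime hE nE nx.
apply: (@dvr_crit _ (x^-1 * c)) => //; last by exists x.
have [e|e] := hdim _ hp.
  have : [set d | E d /\ E (d * (x^-1 * c))] x.
    by split; [case: mx|rewrite mulrA divff // mul1r].
  by rewrite e /= => xe; rewrite xe eqxx in x0.
by move=> a; rewrite -e => -[].
Qed.

Section DVR.
Variables (E : set K).
Hypothesis dE : is_dvr E.

Let hE : is_subring E. Proof. by case: dE. Qed.

(** [ord] chooses a uniformizer by [xget]; two uniformizers differ by a unit, so the exponent does
    not depend on the choice. *)
Lemma dvr_ord_aux : exists t, [/\ t != 0, max_ideal E = [set t * a | a in E]
  & forall x, x != 0 -> unit_in E (x / t ^ ord E x)] /\
  (forall u k, unit_in E u -> ord E (u * t ^ k) = k).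
Proof.
have [_ [t [t0 Et nEt dec]]] := dE.
have ge0 u (k : int) : unit_in E u -> E (u * t ^ k) -> 0 <= k.
  move=> [u0 Eu Eui]; case: k => // n; rewrite NegzE -invr_expz -exprnP => h; case: nEt.
  have : E (u^-1 * (u * t ^- n.+1) * t ^+ n) by do 2?apply: (srM hE) => //; exact: srX.
  by rewrite mulKf // exprS invfM -mulrA mulVf ?mulr1 // expf_neq0.
have mE : max_ideal E = [set t * a | a in E].
  apply/seteqP; split=> x.
    move=> [Ex nu]; have [->|x0] := eqVneq x 0.
      by exists 0; [exact: sr0|rewrite mulr0].
    have [k [u [hu e]]] := dec x x0; have := ge0 u k hu; rewrite -e => /(_ Ex).
    case: k e => // -[|n] e _; first by case: nu; rewrite e expr0z mulr1.
    exists (u * t ^+ n); last by rewrite e -exprnP exprS mulrCA.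
    by apply: srM => //; [case: hu|exact: srX].
  move=> [a Ea <-]; split; first exact: srM.
  by move=> [ta0 _ h]; case: nEt; have := unit_inMl hE Et Ea (And3 ta0 (srM hE Et Ea) h); case.
have uniq t' u u' (k k' : int) : t' != 0 -> max_ideal E = [set t' * a | a in E] ->
   unit_in E u -> unit_in E u' -> u * t ^ k = u' * t' ^ k' -> k = k'.
  move=> t'0 mE' hu hu' e.
  have [c Ec tc] : [set t' * a | a in E] t by rewrite -mE' mE; exists 1; [exact: sr1|rewrite mulr1].
  have [d Ed td] : [set t * a | a in E] t' by rewrite -mE mE'; exists 1; [exact: sr1|rewrite mulr1].
  have cd : c * d = 1 by apply: (mulfI t'0); rewrite mulr1 mulrA tc td.
  have ud : unit_in E d.
    apply: (unit_inMr hE Ec Ed); rewrite cd; exact: unit_in1.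
  have udz (z : int) : unit_in E (d ^ z).
    by case: z => n; [exact: unit_inX|exact/unit_inV/unit_inX].
  have : u / (u' * d ^ k') * t ^ (k - k') = 1.
    have [[u'0 _ _] [d0 _ _]] := (hu', ud).
    rewrite -td expfzMl mulrA in e.
    rewrite expfzDr // -invr_expz mulrACA e invfM.
    have := expfz_neq0 k' t0; have := expfz_neq0 k' d0.
    by move=> h1 h2; field; rewrite u'0 h1 h2.
  move=> e1; have hu2 : unit_in E (u / (u' * d ^ k')).
    by apply: unit_inM => //; apply: unit_inV; apply: unit_inM.
  apply/eqP; rewrite -subr_eq0 eq_le; apply/andP; split; last first.
    by apply: (ge0 _ _ hu2); rewrite e1; exact: sr1.
  rewrite -oppr_ge0; apply: (ge0 _ _ (unit_inV hu2)).
  by rewrite -invr_expz -invfM e1 invr1; exact: sr1.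
have ordE u k : unit_in E u -> ord E (u * t ^ k) = k.
  move=> hu; rewrite /ord; case: xgetP => [k' -> [t' [u' [t'0 mE' hu' e]]]|/(_ k)].
    exact/esym/(uniq _ _ _ _ _ t'0 mE' hu hu' e).
  by case; exists t, u.
exists t; split=> //; split=> // x x0; have [k [u [hu e]]] := dec x x0.
by rewrite {2}e ordE // e mulfK ?expfz_neq0.
Qed.

Lemma ord_ge0 x : x != 0 -> E x <-> 0 <= ord E x.
Proof.
move=> x0; have [t [[t0 mE h] ho]] := dvr_ord_aux; have hx := h x x0.
have Et : max_ideal E t by rewrite mE; exists 1; [exact: sr1|rewrite mulr1].
have e : x = x / t ^ ord E x * t ^ ord E x by rewrite mulfVK // expfz_neq0.
split=> h1; last first.
  rewrite e; case: (ord E x) h1 hx => // n _ [_ hx _].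
  by apply: srM => //; apply: srX => //; case: Et.
case k : (ord E x) => [//|n]; case: Et => Et []; split=> //.
move: (hx); rewrite k NegzE -invr_expz invrK => -[_ _ hu].
have : E (x * (x * t ^ n.+1%:Z)^-1 * t ^+ n).
  by do 2?apply: srM => //; exact: srX.
suff -> : t^-1 = x * (x * t ^ n.+1%:Z)^-1 * t ^+ n by [].
by rewrite -exprnP exprS; field; rewrite ?x0 ?t0 ?expf_neq0.
Qed.

Lemma ordM x y : x != 0 -> y != 0 -> ord E (x * y) = ord E x + ord E y.
Proof.
move=> x0 y0; have [t [[t0 mE h] ho]] := dvr_ord_aux.
have -> : x * y = (x / t ^ ord E x) * (y / t ^ ord E y) * t ^ (ord E x + ord E y).
  rewrite expfzDr //; have := expfz_neq0 (ord E x) t0; have := expfz_neq0 (ord E y) t0.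
  by move=> h1 h2; field; rewrite h1 h2.
by rewrite ho //; apply: unit_inM => //; apply: h.
Qed.

Lemma ord_unitP x : unit_in E x <-> x != 0 /\ ord E x = 0.
Proof.
have [t [[t0 mE h] ho]] := dvr_ord_aux; split.
  by move=> hx; split; [case: hx|rewrite -[x]mulr1 -(expr0z t) ho].
by move=> [x0 e]; have := h x x0; rewrite e expr0z divr1.
Qed.

Lemma ord1 : ord E 1 = 0.
Proof. by have /ord_unitP [] := unit_in1 hE. Qed.

Lemma ordV x : x != 0 -> ord E x^-1 = - ord E x.
Proof.
move=> x0; apply/eqP; by rewrite -addr_eq0 -(ordM (invr_neq0 x0) x0) mulVf // ord1.
Qed.

Lemma ordX x n : x != 0 -> ord E (x ^+ n) = ord E x *+ n.
Proof.
move=> x0; elim: n => [|n ih]; first by rewrite mulr0n ord1.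
by rewrite exprS ordM ?expf_neq0 // ih mulrS.
Qed.

Lemma ord_unif : exists t, [/\ t != 0, E t & ord E t = 1].
Proof.
have [t [[t0 mE h] ho]] := dvr_ord_aux; exists t.
have : max_ideal E t by rewrite mE; exists 1; [exact: sr1|rewrite mulr1].
move=> [Et _]; split=> //; by rewrite -[t in LHS]mul1r -[t in LHS]expr1z ho //; exact: unit_in1.
Qed.

Lemma dvr_valring : valring E.
Proof.
split=> // x; have [->|x0] := eqVneq x 0; first by left; exact: sr0.
have [h|h] := lerP 0 (ord E x); [left|right]; apply/ord_ge0; rewrite ?invr_eq0 //.
by rewrite ordV // oppr_ge0 ltW.
Qed.

Lemma ordXz x (k : int) : x != 0 -> ord E (x ^ k) = ord E x * k.
Proof.
move=> x0; case: k => n; first by rewrite -exprnP ordX // -mulr_natr natz.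
by rewrite NegzE -invr_expz ordV ?expf_neq0 // -exprnP ordX // -mulr_natr natz mulrN.
Qed.

Lemma max_idealP x : x != 0 -> max_ideal E x <-> 0 < ord E x.
Proof.
move=> x0; split.
  move=> [/(ord_ge0 x0) h nu]; rewrite lt_neqAle h andbT; apply/eqP => e.
  by apply: nu; apply/ord_unitP.
move=> h; split; first by apply/ord_ge0 => //; exact: ltW.
by move=> /ord_unitP [_ e]; rewrite e ltxx in h.
Qed.

Lemma dvr_neqT : E <> setT.
Proof.
by case: dE => _ [t [_ _ h _]] e; apply: h; rewrite e.
Qed.

(** A larger subring contains an element of negative order, and its powers have poles of arbitrarily
    high order. *)
Lemma dvr_over B : is_subring B -> E `<=` B -> B <> E -> B = setT.
Proof.
move=> hB EB ne; have [x [Bx nEx]] : exists x, B x /\ ~ E x.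
  apply: contrapT => h; apply: ne; apply/seteqP; split=> // x Bx.
  by apply: contrapT => nx; apply: h; exists x.
have x0 : x != 0 by apply: contra_notN nEx => /eqP ->; exact: sr0.
have ox : ord E x < 0 by rewrite ltNge; apply/negP => /(ord_ge0 x0).
apply/seteqP; split=> // y _; have [->|y0] := eqVneq y 0; first exact: sr0.
have : E (y / x ^+ `|ord E y|%N).
  apply/ord_ge0; rewrite ?mulf_neq0 ?invr_eq0 ?expf_neq0 //.
  rewrite ordM ?invr_eq0 ?expf_neq0 // ordV ?expf_neq0 // ordX //.
  have : ord E x *+ `|ord E y| <= - (`|ord E y|%N)%:Z.
    rewrite -mulr_natr natz -mulN1r; apply: ler_wpM2r => //; lia.
  lia.
move/EB => h; rewrite -(@mulfVK _ (x ^+ `|ord E y|%N) _ y) ?expf_neq0 //.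
by apply: srM => //; exact: srX.
Qed.

Lemma dvr_krull : krull_dim1 E.
Proof.
have [t [t0 Et et]] := ord_unif; split.
  by exists t => //; apply/max_idealP => //; rewrite et.
move=> qr hq; have [h1 [h20 h21] h3 h4 h5] := hq.
have [[x [qx x0]]|h] := pselect (exists x, qr x /\ x != 0); last first.
  left; apply/seteqP; split=> [x qx|_ -> //]; apply/eqP.
  by apply: contrapT => /negP x0; apply: h; exists x.
right; apply/seteqP; split=> y.
  move=> qy; split; first exact: h1.
  by move=> [y0 _ Eyi]; apply: h21; rewrite -(mulVf y0); exact: h4.
have [-> //|y0] := eqVneq y 0; move=> /(max_idealP y0) oy.
have : qr (y ^+ `|ord E x|%N).
  rewrite -(mulfVK x0 (y ^+ _)); apply: h4 => //; apply/ord_ge0.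
    by rewrite mulf_neq0 ?invr_eq0 // expf_neq0.
  rewrite ordM ?invr_eq0 ?expf_neq0 // ordV // ordX //.
  have : (`|ord E x|%N)%:Z <= ord E y *+ `|ord E x|.
    rewrite -mulr_natr natz -{1}[(`|ord E x|%N)%:Z]mul1r; apply: ler_wpM2r => //.
  lia.
have Ey : E y by apply/ord_ge0 => //; exact: ltW.
elim: (`|ord E x|%N) => [|n ih]; first by rewrite expr0.
by rewrite exprS => /h5 [//||//|/ih //]; exact: srX.
Qed.

Lemma dvr_frac : frac E = setT.
Proof.
apply/seteqP; split=> // x _; have [->|x0] := eqVneq x 0.
  exists 0, 1; rewrite mul0r oner_eq0; split=> //; [exact: sr0|exact: sr1].
have [[_ h] _] := (dvr_valring, 0%N); have [Ex|Ex] := h x.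
  by exists x, 1; rewrite divr1 oner_eq0; split=> //; exact: sr1.
by exists 1, x^-1; rewrite invrK mul1r invr_eq0; split=> //; exact: sr1.
Qed.
End DVR.

End Noetherian.

(** * Finite extensions: bases, multiplication matrices, norms and traces *)

Section FiniteExtension.
Context {K : fieldType}.
Implicit Types (A B L V : set K) (x y z : K) (p q : {poly K}).

Lemma ispan_closed B s : is_subring B ->
  [/\ ispan B s 0, forall x y, ispan B s x -> ispan B s y -> ispan B s (x + y)
    & forall a x, B a -> ispan B s x -> ispan B s (a * x)].
Proof.
move=> hB; elim: s => [|x s [h2 h3 h4]] /=.
  by split=> [//|y z -> ->|a y _ ->]; rewrite ?addr0 ?mulr0.
split.
- by exists 0, 0; rewrite mul0r addr0; split=> //; apply: sr0.
- move=> _ _ [a [y [Ba hy ->]]] [b [z [Bb hz ->]]].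
  by exists (a + b), (y + z); split; [exact: srD|exact: h3|ring].
- move=> c _ Bc [a [y [Ba hy ->]]].
  by exists (c * a), (c * y); split; [exact: srM|exact: h4|ring].
Qed.

Lemma ispan_sum B s I (r : seq I) (P : pred I) (F : I -> K) : is_subring B ->
  (forall i, P i -> ispan B s (F i)) -> ispan B s (\sum_(i <- r | P i) F i).
Proof.
move=> hB; have [h0 hD _] := ispan_closed s hB.
by move=> h; elim/big_ind: _ => //; exact: hD.
Qed.

Lemma ispan_sub B s s' : is_subring B ->
  (forall x, x \in s -> ispan B s' x) -> ispan B s `<=` ispan B s'.
Proof.
move=> hB; have [h0 hD hM] := ispan_closed s' hB.
elim: s => [|x s ih] h /= y; first by move=> ->.
move=> [a [z [Ba hz ->]]]; apply: hD; first by apply: hM => //; apply: h; rewrite mem_head.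
by apply: ih hz => t ts; apply: h; rewrite inE ts orbT.
Qed.

Lemma ispanP B s z : is_subring B -> ispan B s z ->
  exists a : 'rV[K]_(size s), (forall i, B (a 0 i)) /\ z = \sum_i a 0 i * s`_i.
Proof.
move=> hB; elim: s z => [|x s ih] z /=.
  by move=> ->; exists 0; split=> [[]//|]; rewrite big_ord0.
move=> [a [y [Ba /ih [c [hc ->]] ->]]].
exists (\row_i (if unlift ord0 i is Some j then c 0 j else a)); split=> [i|].
  by rewrite mxE; case: unliftP.
rewrite big_ord_recl mxE unlift_none; congr (_ + _).
by apply: eq_bigr => i _; rewrite mxE liftK.
Qed.

Lemma monic_reduce A p q : is_subring A -> q \is monic -> pover A q -> pover A p ->
  exists r, [/\ pover A r, (size r < size q)%N & forall x, root q x -> p.[x] = r.[x]].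
Proof.
move=> hA qm hq; have sq : (0 < size q)%N by rewrite size_poly_gt0 monic_neq0.
move: (leqnn (size p)); move: {2}(size p) => n.
elim: n p => [|n ih] p sp hp.
  move: sp; rewrite leqn0 size_poly_eq0 => /eqP ->; exists 0.
  by rewrite size_poly0; split=> //; exact: pover0.
have [h|h] := ltnP (size p) (size q); first by exists p.
pose p' := p - p`_n *: ('X^(n.+1 - size q) * q).
have [||r [hr sr er]] := ih p'.
- apply/leq_sizeP => j; rewrite leq_eqVlt => /orP[/eqP <-|nj].
    rewrite coefB coefZ coefXnM ltnNge.
    have -> : (n.+1 - size q <= n)%N by lia.
    rewrite /= (_ : (n - (n.+1 - size q) = (size q).-1)%N); last by lia.
    by rewrite -lead_coefE (monicP qm) mulr1 subrr.
  rewrite coefB coefZ coefXnM; case: ifP => jn; first by lia.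
  have -> : p`_j = 0 by rewrite nth_default // (leq_trans sp nj).
  have -> : q`_(j - (n.+1 - size q)) = 0.
    rewrite nth_default //; move: (leq_trans h sp) nj; move: (size _) => m; lia.
  by rewrite mulr0 subr0.
- apply: poverB => //; apply: poverZ => //; apply: poverM => //; exact: poverXn.
exists r; split=> // x qx; rewrite -er // /p' hornerD hornerN hornerZ hornerM.
by rewrite (rootP qx) !mulr0 subr0.
Qed.

(** Polynomials in the generators reduce modulo their monic relations, so [L[s]] is spanned by
    finitely many monomials; being algebraic over [L], it is already a field. *)
Lemma fin_span L (s : seq K) : is_subfield L -> (forall x, x \in s -> cl L x) ->
  frac (adjoin L [set` s]) = setT -> exists b, ispan L b = setT.
Proof.
move=> hLf; have [hL hLV] := hLf => hs hfr.
have [b hb] : exists b, adjoin L [set` s] `<=` ispan L b.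
  elim: s hs {hfr} => [|x s ih] hs.
    exists [:: 1] => y; rewrite adjoin_nil // => Ly; exists y, 0.
    by rewrite mulr1 addr0.
  have [|b hb] := ih; first by move=> y ys; apply: hs; rewrite inE ys orbT.
  have /cl_integral -/(_ hL) [q [qm hq qx]] := hs x (mem_head _ _).
  exists [seq u * x ^+ j | u <- b, j <- iota 0 (size q)] => y.
  rewrite adjoin_cons => /adjoin1P -/(_ (adjoin_subring _ _)) [p hp ->].
  have [|r [hr sr ->]] := monic_reduce (adjoin_subring L [set` s]) qm _ hp => //.
    by apply: pover_sub hq => z; exact: mem_adjoinl.
  rewrite (horner_coef_wide _ (ltnW sr)); apply: (@ispan_sum L _ _ _ _ _ hL) => j _.
  have [a [ha ->]] := ispanP hL (hb _ (hr j)).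
  rewrite mulr_suml; apply: (@ispan_sum L _ _ _ _ _ hL) => i _; rewrite -mulrA.
  have [_ _ hM] := ispan_closed [seq u * x ^+ j | u <- b, j <- iota 0 (size q)] hL.
  apply: hM => //; apply: mem_ispan => //; apply: allpairs_f; first exact: mem_nth.
  by rewrite mem_iota /= ltn_ord.
exists b; apply/seteqP; split=> // y _.
have : frac (adjoin L [set` s]) y by rewrite hfr.
have hS := adjoin_subring L [set` s].
move=> [c [d [hc hd d0 ->]]]; apply: hb; apply: (srM hS) => //.
have [_ hV] := cl_subfield hLf.
apply: (@integral_inv _ L _ d^-1 hS); last by rewrite invrK.
  by move=> z; exact: mem_adjoinl.
apply: cl_integral => //; apply: hV; apply: (cl_adjoin _ _ hd); last by move=> z; exact: hs.
exact: sub_cl.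
Qed.

(** Subfields being sets, all matrices have entries in [K]; membership of the coordinates in [L] is
    carried as a side condition. *)
Definition basis L r (e : 'cV[K]_r) :=
  (forall x, exists a : 'rV[K]_r, (forall i, L (a 0 i)) /\ x = (a *m e) 0 0) /\
  (forall a : 'rV[K]_r, (forall i, L (a 0 i)) -> (a *m e) 0 0 = 0 -> a = 0).

Lemma basis_exists L b0 : is_subfield L -> ispan L b0 = setT ->
  exists r (e : 'cV[K]_r), basis L e.
Proof.
move=> [hL hLV] hb0.
have ex : exists n, `[< exists b, size b = n /\ ispan L b = setT >].
  by exists (size b0); apply/asboolP; exists b0.
case: (ex_minnP ex) => n /asboolP [b [sb hb]] hmin.
exists (size b), (\col_i b`_i).
have mE a : (a *m \col_i b`_i) (0 : 'I_1) 0 = \sum_i a 0 i * b`_i.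
  by rewrite mxE; apply: eq_bigr => i _; rewrite mxE.
split=> [x|a ha].
  have : ispan L b x by rewrite hb.
  by move/(ispanP hL) => [a [ha ->]]; exists a; rewrite mE.
rewrite mE => e0; apply/rowP => k; rewrite mxE; apply/eqP; apply: contrapT => /negP ak0.
have : (n <= n.-1)%N.
  apply: hmin; apply/asboolP; exists [seq b`_(val j) | j <- enum (predC1 k)].
  have [h0 hD hM] := ispan_closed [seq b`_(val j) | j <- enum (predC1 k)] hL.
  split; first by rewrite size_map -cardE cardC1 card_ord sb.
  apply/seteqP; split=> // x _; have : ispan L b x by rewrite hb.
  have mem j : j != k -> ispan L [seq b`_(val j) | j <- enum (predC1 k)] b`_(val j).
    by move=> jk; apply: mem_ispan => //; apply: map_f; rewrite mem_enum.
  apply: (ispan_sub hL) => y /(nthP 0) [l lb <-].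
  have [ek|] := eqVneq (Ordinal lb) k; last exact: mem.
  rewrite (_ : b`_l = \sum_(j | j != k) (- a 0 j / a 0 k) * b`_j).
    apply: (@ispan_sum L _ _ _ _ _ hL) => j /mem; apply: hM; apply: srM => //; [exact: srN|exact: hLV].
  rewrite -[l]/(val (Ordinal lb)) ek; move: e0; rewrite (bigD1 k) //= => /eqP.
  rewrite addr_eq0 => /eqP e0; apply: (mulfI ak0); rewrite e0 -sumrN mulr_sumr.
  by apply: eq_bigr => j _; field.
by case: (n) sb => [|m] ; [move=> e; case: (k) => i; rewrite e|rewrite ltnn].
Qed.

Definition mover A m n (M : 'M[K]_(m, n)) := forall i j, A (M i j).

Lemma mover_mul A m n k (M : 'M[K]_(m, n)) (N : 'M[K]_(n, k)) : is_subring A ->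
  mover A M -> mover A N -> mover A (M *m N).
Proof.
by move=> hA hM hN i j; rewrite mxE; apply: sr_sum => // l _; apply: srM.
Qed.

Lemma det_over A n (M : 'M[K]_n) : is_subring A -> mover A M -> A (\det M).
Proof.
move=> hA hM; apply: sr_sum => // s _; apply: srM => //; first exact: sr_sign.
by apply: sr_prod => // i _.
Qed.

Lemma horner_char_poly n (M : 'M[K]_n) a : (char_poly M).[a] = \det (a%:M - M).
Proof.
rewrite -[LHS]/(horner_eval a _) /char_poly -det_map_mx; congr (\det _).
apply/matrixP => i j; by rewrite !mxE /= /horner_eval hornerD hornerN hornerC hornerMn hornerX.
Qed.

(* Complete integral closedness relative to [L]. *)
Definition cicin L A := forall w y, A w -> w != 0 -> L y ->
  (forall k, A (w * y ^+ k)) -> A y.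

Definition Qsub A := forall n, (n.+1%:R != 0 :> K) /\ A (n.+1%:R)^-1.

(** Divided differences: [(p(n) - p(N)) / (n - N)] stays in [A] since positive integers are
    invertible there. This recovers the coefficients of a characteristic polynomial from the norms
    of the [n - x]. *)
Lemma interpolation A p N : is_subring A -> Qsub A ->
  (forall n, (N <= n)%N -> A p.[n%:R]) -> pover A p.
Proof.
move=> hA hQ; move: (leqnn (size p)); move: {2}(size p) => m.
elim: m p N => [|m ih] p N sp h.
  by move: sp; rewrite leqn0 size_poly_eq0 => /eqP ->; exact: pover0.
have [q eq] : exists q, p - (p.[N%:R])%:P = q * ('X - N%:R%:P).
  by apply/factor_theorem; rewrite rootE hornerD hornerN hornerC subrr.
have ep : p = q * ('X - N%:R%:P) + (p.[N%:R])%:P by rewrite -eq subrK.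
have hq : pover A q.
  apply: (ih _ N.+1).
    have [->|q0] := eqVneq q 0; first by rewrite size_poly0.
    have : (size (q * ('X - N%:R%:P))%R <= m.+1)%N.
      rewrite -eq (leq_trans (size_polyD _ _)) // geq_max sp size_polyN.
      by rewrite (leq_trans (size_polyC_leq1 _)).
    by rewrite size_Mmonic ?monicXsubC // size_XsubC addn2.
  move=> n Nn; have [n0 hn] := hQ (n - N.+1)%N.
  have e1 : n%:R - N%:R = (n - N.+1).+1%:R :> K.
    by rewrite -natrB ?(ltnW Nn) //; congr (_%:R); lia.
  have -> : q.[n%:R] = (p.[n%:R] - p.[N%:R]) * ((n - N.+1).+1%:R)^-1.
    by rewrite {1}ep !hornerE -e1 addrK mulfK // e1.
  by apply: srM => //; apply: srB => //; apply: h => //; exact: ltnW.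
rewrite ep; apply: poverD => //; last by apply: poverC => //; exact: h.
by apply: poverM => //; apply: poverB => //; [exact: poverX|apply: poverC => //; exact: sr_nat].
Qed.

Section Norm.
Variables (L : set K) (r : nat) (e : 'cV[K]_r).
Hypotheses (hLf : is_subfield L) (he : basis L e).

Let hL : is_subring L. Proof. by case: hLf. Qed.

Definition coord x : 'rV[K]_r :=
  xget 0 [set a : 'rV[K]_r | (forall i, L (a 0 i)) /\ x = (a *m e) 0 0].

Lemma coordP x : (forall i, L (coord x 0 i)) /\ x = (coord x *m e) 0 0.
Proof.
by rewrite /coord; case: xgetP => [y -> //|h]; have [a ha] := he.1 x; case: (h a).
Qed.

Definition Mx x : 'M[K]_r := \matrix_i coord (x * e i 0).

Lemma Mx_over x : mover L (Mx x).
Proof. by move=> i j; rewrite mxE; case: (coordP (x * e i 0)). Qed.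

Lemma Mx_mul x : Mx x *m e = x *: e.
Proof.
apply/colP => i; rewrite [RHS]mxE [in RHS](coordP (x * e i 0)).2 !mxE.
by apply: eq_bigr => j _; rewrite mxE.
Qed.

Lemma Mx_uniq (M N : 'M[K]_r) : mover L M -> mover L N -> M *m e = N *m e -> M = N.
Proof.
move=> hM hN h; apply/row_matrixP => i; apply/eqP; rewrite -subr_eq0; apply/eqP.
apply: he.2 => [j|]; first by rewrite !mxE; exact: srB.
by rewrite mulmxBl -!row_mul h subrr mxE.
Qed.

Lemma MxM x y : Mx (x * y) = Mx x *m Mx y.
Proof.
apply: Mx_uniq; [exact: Mx_over|by apply: mover_mul => //; exact: Mx_over|].
by rewrite Mx_mul -mulmxA Mx_mul -scalemxAr Mx_mul scalerA mulrC.
Qed.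

Lemma Mx_lin I (s : seq I) (a y : I -> K) : (forall i, L (a i)) ->
  Mx (\sum_(i <- s) a i * y i) = \sum_(i <- s) a i *: Mx (y i).
Proof.
move=> ha; apply: Mx_uniq; first exact: Mx_over.
  move=> i j; rewrite summxE; apply: sr_sum => // l _; rewrite mxE.
  by apply: srM => //; exact: Mx_over.
rewrite Mx_mul mulmx_suml scaler_suml; apply: eq_bigr => i _.
by rewrite -scalemxAl Mx_mul scalerA.
Qed.

Lemma MxL a : L a -> Mx a = a%:M.
Proof.
move=> La; apply: Mx_uniq; [exact: Mx_over| |by rewrite Mx_mul mul_scalar_mx].
by move=> i j; rewrite mxE; case: (_ == _); rewrite ?mulr1n ?mulr0n //; exact: sr0.
Qed.

Lemma MxB x y : Mx (x - y) = Mx x - Mx y.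
Proof.
apply: Mx_uniq; [exact: Mx_over| |by rewrite mulmxBl !Mx_mul scalerBl].
by move=> i j; rewrite !mxE; apply: srB => //; exact: (coordP _).1.
Qed.

Definition normL x := \det (Mx x).

Lemma normLM x y : normL (x * y) = normL x * normL y.
Proof. by rewrite /normL MxM det_mulmx. Qed.
Lemma normLa a : L a -> normL a = a ^+ r.
Proof. by move=> /MxL; rewrite /normL => ->; rewrite det_scalar. Qed.
Lemma normLX x n : normL (x ^+ n) = normL x ^+ n.
Proof.
elim: n => [|n ih]; last by rewrite !exprS normLM ih.
by rewrite !expr0 normLa ?expr1n //; exact: sr1.
Qed.
Lemma normL_in x : L (normL x).
Proof. by apply: det_over => //; exact: Mx_over. Qed.

Lemma basis_gt0 : (0 < r)%N.
Proof.
have [_ e1] := coordP 1; rewrite lt0n; apply: contra_eqN e1 => /eqP r0.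
rewrite mxE big1 ?oner_eq0 // => i _; by have := ltn_ord i; rewrite [in X in (_ < X)%N]r0.
Qed.

Lemma normL_neq0 x : x != 0 -> normL x != 0.
Proof.
move=> x0; have : normL (x * x^-1) = 1 by rewrite divff // normLa ?expr1n //; exact: sr1.
by rewrite normLM => h; apply: contra_eq_neq h => ->; rewrite mul0r eq_sym oner_eq0.
Qed.

Lemma char_poly_Mx_root x : root (char_poly (Mx x)) x.
Proof.
rewrite rootE horner_char_poly; apply: contrapT => /negP d0.
have hu : x%:M - Mx x \in unitmx by rewrite unitmxE unitfE.
have e0 : e = 0.
  by rewrite -[e](mulKmx hu) mulmxBl mul_scalar_mx Mx_mul subrr mulmx0.
by have [_ e1] := coordP 1; move/eqP: e1; rewrite e0 mulmx0 mxE oner_eq0.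
Qed.

(** The powers of an integral element are [A]-combinations of finitely many of them, so one
    denominator clears all their matrices. *)
Lemma Mx_denom A x : is_subring A -> L `<=` frac A -> A `<=` L -> cl A x ->
  exists w, [/\ A w, w != 0 & forall k i j, A (w * Mx (x ^+ k) i j)].
Proof.
move=> hA LA AL /cl_integral -/(_ hA) [q [qm hq qx]].
pose s := [seq Mx (x ^+ (t.1.1)) t.1.2 t.2 | t : 'I_(size q) * 'I_r * 'I_r].
have [|w [Aw w0 hw]] := @common_denom _ A s hA.
  by move=> y /mapP [t _ ->]; apply: LA; exact: Mx_over.
exists w; split=> // k i j.
have [|t [ht st et]] := @monic_reduce A 'X^k q hA qm hq; first exact: poverXn.
have -> : x ^+ k = \sum_(l < size q) t`_l * x ^+ l.
  by rewrite -(horner_coef_wide _ (ltnW st)) -et // hornerXn.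
rewrite (Mx_lin _ (fun l : 'I_(size q) => x ^+ l)) => [|l]; last by exact: (AL _ (ht _)).
rewrite summxE mulr_sumr; apply: sr_sum => // l _; rewrite mxE mulrCA.
apply: srM => //; apply: hw; apply/mapP; exists (l, i, j) => //; exact: mem_enum.
Qed.

Lemma normL_weak A x : is_subring A -> L `<=` frac A -> A `<=` L -> cl A x ->
  exists w, [/\ A w, w != 0 & forall k, A (w * normL x ^+ k)].
Proof.
move=> hA LA AL hx; have [w [Aw w0 hw]] := Mx_denom hA LA AL hx.
exists (w ^+ r); split; [exact: srX|exact: expf_neq0|move=> k].
rewrite -normLX /normL -detZ; apply: det_over => // i j; rewrite mxE; exact: hw.
Qed.

Section Integral.
Variable A : set K.
Hypotheses (hA : is_subring A) (LA : L `<=` frac A) (AL : A `<=` L) (cA : cicin L A).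

(** By [normL_weak] all powers of the norm have a common denominator, and [A] is completely
    integrally closed in [L]. *)
Lemma normL_integral x : cl A x -> A (normL x).
Proof.
move=> /(normL_weak hA LA AL) [w [Aw w0 hw]]; apply: (cA Aw w0) => //; exact: normL_in.
Qed.

Lemma char_poly_integral x : Qsub A -> cl A x -> pover A (char_poly (Mx x)).
Proof.
move=> hQ hx; apply: (@interpolation _ _ 0) => // n _; rewrite horner_char_poly.
have An : A n%:R by exact: sr_nat.
rewrite -(MxL (AL An)) -MxB; apply: normL_integral.
by apply: (srB (cl_subring A)) => //; exact: sub_cl.
Qed.

Lemma trace_integral x : Qsub A -> cl A x -> A (\tr (Mx x)).
Proof.
move=> hQ /(char_poly_integral hQ) h; rewrite -[\tr _]opprK.
by rewrite -char_poly_trace ?basis_gt0 //; apply: srN.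
Qed.
End Integral.

(** Pairing [x] with [x^-1] gives the trace of 1, which is [r] and does not vanish. *)
Lemma trace_nondeg x : (forall n, n.+1%:R != 0 :> K) ->
  (forall i, \tr (Mx (x * e i 0)) = 0) -> x = 0.
Proof.
move=> ch0 h; apply/eqP; apply: contrapT => /negP x0.
have : \tr (Mx (x * x^-1)) = 0.
  have [hc ec] := coordP x^-1; rewrite {1}ec mxE mulr_sumr.
  under eq_bigr do rewrite mulrCA.
  rewrite (Mx_lin _ (fun i => x * e i 0)) // linear_sum big1 // => i _.
  by rewrite /= mxtraceZ h mulr0.
rewrite divff // MxL; last exact: sr1.
rewrite mxtrace_scalar => /eqP; rewrite -[r]prednK ?basis_gt0 //.
by rewrite (negbTE (ch0 _)).
Qed.

End Norm.
End FiniteExtension.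

(** * Local rings of normal projective varieties *)

Section Projective.
Context {R : realType} {K : fieldType} (iota : {rmorphism R[i] -> K}).
Implicit Types (A B L V P Q E F : set K) (X Y U : set (set K)) (x y z : K) (s : seq K).

Local Notation C := (range iota).
Local Notation center := Defs.center.

Lemma C_subfield : is_subfield C.
Proof.
split; last by move=> _ [c _ <-]; exists c^-1 => //; rewrite fmorphV.
apply/subringP; split; first by exists 1 => //; rewrite rmorph1.
- by move=> _ _ [c _ <-] [d _ <-]; exists (c - d) => //; rewrite rmorphB.
- by move=> _ _ [c _ <-] [d _ <-]; exists (c * d) => //; rewrite rmorphM.
Qed.

Lemma C_subring : is_subring C. Proof. by case: C_subfield. Qed.

Lemma natK_neq0 n : n.+1%:R != 0 :> K.
Proof. by rewrite -(rmorph_nat iota) fmorph_eq0 pnatr_eq0. Qed.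

Lemma C_Qsub A : C `<=` A -> Qsub A.
Proof.
move=> CA n; split; first exact: natK_neq0.
by apply: CA; exists (n.+1%:R^-1) => //; rewrite fmorphV rmorph_nat.
Qed.

Definition chart s si : set K := adjoin C [set sj / si | sj in [set` s]].

Lemma chartE s si : chart s si = adjoin C [set` [seq sj / si | sj <- s]].
Proof.
congr adjoin; apply/seteqP; split=> y /=.
  by move=> [sj hj <-]; apply/mapP; exists sj.
by move=> /mapP [sj hj ->]; exists sj.
Qed.

Lemma chart_subring s si : is_subring (chart s si).
Proof. exact: adjoin_subring. Qed.
Lemma C_chart s si : C `<=` chart s si.
Proof. by move=> x; exact: mem_adjoinl. Qed.
Lemma mem_chart s si sj : sj \in s -> chart s si (sj / si).
Proof. by move=> h; apply: mem_adjoinr; exists sj. Qed.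
Lemma chart_min s si B : is_subring B -> C `<=` B ->
  (forall sj, sj \in s -> B (sj / si)) -> chart s si `<=` B.
Proof. by move=> hB CB h; apply: adjoin_min => // _ [sj hj <-]; exact: h. Qed.

Lemma chart_noeth s si : noeth (chart s si).
Proof.
rewrite chartE; apply: noeth_adjoin; [exact: C_subring|exact/noeth_subfield/C_subfield].
Qed.

(* [si] has minimal order among the homogeneous coordinates at [P]. *)
Definition idx s P si := [/\ si \in s, si != 0 & forall sj, sj \in s -> P (sj / si)].

Lemma idxS s P Q si : P `<=` Q -> idx s P si -> idx s Q si.
Proof. by move=> PQ [h1 h2 h3]; split=> // sj /h3 /PQ. Qed.

Lemma idx_unit s P si sj : is_subring P -> idx s P si -> idx s P sj -> unit_in P (si / sj).
Proof.
move=> hP [h1 h2 h3] [h4 h5 h6]; split; first by rewrite mulf_neq0 ?invr_eq0.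
  exact: h6.
by rewrite invf_div; exact: h3.
Qed.

(** Values in a valuation ring are totally ordered. The twist by [psi] serves to find both centers
    on [X] and images under an endomorphism. *)
Lemma valring_max V (psi : {rmorphism K -> K}) s : valring V -> has (fun x => x != 0) s ->
  exists si, [/\ si \in s, si != 0 & forall sj, sj \in s -> V (psi (sj / si))].
Proof.
move=> [hV VR]; elim: s => //= x s ih; have [hs _|hs] := boolP (has (fun x => x != 0) s).
  have [si [h1 h2 h3]] := ih hs; have [->|x0] := eqVneq x 0.
    exists si; split=> //; first by rewrite inE h1 orbT.
    by move=> sj; rewrite inE => /orP[/eqP ->|/h3 //]; rewrite mul0r rmorph0; exact: sr0.
  have [h|h] := VR (psi (x / si)).
    exists si; split=> //; first by rewrite inE h1 orbT.
    by move=> sj; rewrite inE => /orP[/eqP ->|/h3 //].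
  exists x; split=> //; first by rewrite mem_head.
  move=> sj; rewrite inE => /orP[/eqP ->|/h3 h']; first by rewrite divff // rmorph1; exact: sr1.
  move: h; rewrite -fmorphV invf_div => h.
  rewrite (_ : sj / x = (sj / si) * (si / x)); last by rewrite mulrA mulfVK.
  by rewrite rmorphM; exact: srM.
rewrite orbF => x0; exists x; split=> //; first by rewrite mem_head.
move=> sj; rewrite inE => /orP[/eqP ->|hj]; first by rewrite divff // rmorph1; exact: sr1.
move/hasPn: hs => /(_ _ hj); rewrite negbK => /eqP ->.
by rewrite mul0r rmorph0; exact: sr0.
Qed.

Section Variety.
Variables (s : seq K) (X : set (set K)).
Hypotheses (Xs : X = projective_over C s) (XT : X setT).

Lemma ptP P : X P -> exists si p, [/\ si \in s, si != 0, prime_ideal (chart s si) p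
  & P = localization (chart s si) p].
Proof. by rewrite Xs => -[si [[h1 h2] [p hp e]]]; exists si, p. Qed.

Lemma pt_mk si p : si \in s -> si != 0 -> prime_ideal (chart s si) p ->
  X (localization (chart s si) p).
Proof. by move=> h1 h2 hp; rewrite Xs; exists si => //; exists p. Qed.

Lemma pt_facts P : X P -> [/\ is_subring P, C `<=` P, noeth P,
   prime_ideal P (max_ideal P) & exists si, idx s P si].
Proof.
move=> /ptP [si [p [h1 h2 hp ->]]]; have hA := chart_subring s si.
split; [exact: loc_subring|by move=> x Cx; apply: (sub_loc hA hp); exact: mem_adjoinl| |exact: loc_max_prime|].
  by apply: noeth_loc => //; exact: chart_noeth.
by exists si; split=> // sj /mem_chart h; apply: sub_loc => //; exact: h.
Qed.

Lemma pt_subring P : X P -> is_subring P. Proof. by case/pt_facts. Qed.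

Lemma has_nz : has (fun x => x != 0) s.
Proof. by have [si [p [h1 h2 _ _]]] := ptP XT; apply/hasP; exists si. Qed.

(** Valuative criterion of properness: the coordinate of smallest value selects a chart that [psi]
    maps into [V], and the elements with non-unit image form the prime of the point. *)
Lemma center_exists V (psi : {rmorphism K -> K}) : valring V ->
  (forall c, C c -> V (psi c)) -> exists2 P, X P & maps_to psi V P.
Proof.
move=> VV hC; have [hV VR] := VV; have [si [h1 h2 h3]] := valring_max psi VV has_nz.
have hA := chart_subring s si.
have AV a : chart s si a -> V (psi a).
  apply: (@chart_min s si [set a | V (psi a)]) => //.
  apply/subringP; split=> /=; first by rewrite rmorph1; exact: sr1.
    by move=> x y hx hy; rewrite rmorphB; exact: srB.
  by move=> x y hx hy; rewrite rmorphM; exact: srM.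
pose p := [set a | chart s si a /\ ~ unit_in V (psi a)].
have nu0 : ~ unit_in V (psi 0) by move=> [+ _ _]; rewrite rmorph0 eqxx.
have hp : prime_ideal (chart s si) p.
  split.
  - by move=> a [].
  - by split; [split=> //; exact: sr0|move=> [_]; apply; rewrite rmorph1; exact: unit_in1].
  - move=> a b [Aa na] [Ab nb]; split; first exact: (srD hA).
    wlog h : a b Aa na Ab nb / V (psi (b / a)) /\ a != 0.
      move=> W; have [a0|a0] := eqVneq a 0; first by rewrite a0 add0r.
      have [h|] := VR (psi (b / a)); first by apply: W.
      have [b0|b0] := eqVneq b 0; first by rewrite b0 addr0.
      by rewrite -fmorphV invf_div addrC => h; apply: W.
    case: h => h a0; have -> : a + b = a * (1 + b / a) by field.
    rewrite rmorphM => hu; apply: na; apply: (unit_inMl hV _ _ hu); first exact: AV.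
    by rewrite rmorphD rmorph1; apply: srD => //; exact: sr1.
  - move=> a b Aa [Ab nb]; split; first exact: (srM hA).
    by rewrite rmorphM => hu; apply: nb; apply: (unit_inMr hV _ _ hu); exact: AV.
  - move=> a b Aa Ab [_ nab]; apply: contrapT => /not_orP [h4 h5]; apply: nab.
    rewrite rmorphM; apply: unit_inM => //; apply: contrapT => h.
      by apply: h4.
    by apply: h5.
exists (localization (chart s si) p); first exact: pt_mk.
have ub b : chart s si b -> ~ p b -> unit_in V (psi b).
  by move=> Ab nb; apply: contrapT => h; apply: nb.
split=> _ [a [b [Aa Ab nb ->]]]; have [b0 Vb Vb'] := ub b Ab nb.
  by rewrite rmorphM fmorphV; apply: srM => //; exact: AV.
move=> hu; apply: (unit_inM (loc_subring hA hp)); last first.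
  by apply: unit_inV; apply/loc_unit.
apply/loc_unit => //; move=> [_]; apply.
have : unit_in V (psi (a / b) * psi b) by apply: unit_inM.
by rewrite rmorphM fmorphV mulfVK.
Qed.

Lemma maps_to_unit (psi : {rmorphism K -> K}) P Q x :
  maps_to psi P Q -> unit_in Q x -> unit_in P (psi x).
Proof.
by move=> [h _] [x0 Qx Qx']; split; [rewrite fmorph_eq0|exact: h|rewrite -fmorphV; exact: h].
Qed.

(** Separatedness: [si / sj] has unit image in [P], hence is a unit in [Q2], so that the chart of
    [Q1] lies in [Q2]. *)
Lemma pt_sub (psi : {rmorphism K -> K}) P Q1 Q2 : is_subring P ->
  X Q1 -> X Q2 -> maps_to psi P Q1 -> maps_to psi P Q2 -> Q1 `<=` Q2.
Proof.
move=> hP X1 X2 m1 m2; have [si [p [i1 i2 hp e1]]] := ptP X1.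
have [hQ2 CQ2 _ _ [sj [j1 j2 hj]]] := pt_facts X2.
have hA := chart_subring s si.
have hu : unit_in Q2 (si / sj).
  have Q2i : Q2 (si / sj) by exact: hj.
  apply: m2.2 => //; split; first by rewrite fmorph_eq0 mulf_neq0 ?invr_eq0.
    exact: m2.1.
  rewrite -fmorphV invf_div; apply: m1.1; rewrite e1; apply: sub_loc => //.
  exact: mem_chart.
have AQ : chart s si `<=` Q2.
  apply: chart_min => // sl hl; rewrite (_ : sl / si = (sl / sj) * (si / sj)^-1).
    by apply: srM => //; [exact: hj|case: hu].
  by rewrite invf_div mulrA mulfVK.
move=> x; rewrite e1 => -[a [b [Aa Ab nb ->]]]; apply: srM => //; first exact: AQ.
have [//|_ _ //] := m2.2 b (AQ _ Ab); apply: (maps_to_unit m1); rewrite e1.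
exact/loc_unit.
Qed.

Lemma pt_uniq (psi : {rmorphism K -> K}) P Q1 Q2 : is_subring P ->
  X Q1 -> X Q2 -> maps_to psi P Q1 -> maps_to psi P Q2 -> Q1 = Q2.
Proof.
by move=> hP X1 X2 m1 m2; apply/seteqP; split; [apply: pt_sub m1 m2|apply: pt_sub m2 m1].
Qed.

Lemma center_uniq P Q1 Q2 : is_subring P -> center X P Q1 -> center X P Q2 -> Q1 = Q2.
Proof. by move=> hP [X1 m1] [X2 m2]; apply: (@pt_uniq idfun P). Qed.

Lemma center_self P : X P -> center X P P.
Proof. by move=> XP; split=> //; split. Qed.

Lemma loc_pt P q : X P -> prime_ideal P q -> X (localization P q).
Proof.
move=> /ptP [si [p [h1 h2 hp e]]]; rewrite e => hq.
by have [h ->] := loc_loc (chart_subring s si) hp hq; exact: pt_mk.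
Qed.

Lemma frac_pt P : X P -> frac P = setT.
Proof.
move=> XP; have [hP CP _ _ [si [i1 i2 hi]]] := pt_facts XP.
have [s0 [p0 [h1 h2 hp0 eT]]] := ptP XT.
apply/seteqP; split=> // x _; have : localization (chart s s0) p0 x by rewrite -eT.
move/(loc_frac hp0); have [hF hV] := frac_subfield hP.
apply: (@frac_min _ (chart s s0) (frac P)); first by split.
apply: chart_min => //; first by move=> c /CP; exact: sub_frac.
move=> sj hj; rewrite (_ : sj / s0 = (sj / si) / (s0 / si)); last by field; rewrite ?h2 ?i2.
by apply: srM => //; [|apply: hV]; apply: sub_frac => //; exact: hi.
Qed.

Lemma frac_chart si : si \in s -> si != 0 -> frac (chart s si) = setT.
Proof.
move=> h1 h2; have hA := chart_subring s si.
have [s0 [p0 [h3 h4 hp0 eT]]] := ptP XT.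
apply/seteqP; split=> // x _; have : localization (chart s s0) p0 x by rewrite -eT.
move/(loc_frac hp0); have [hF hV] := frac_subfield hA.
apply: (@frac_min _ (chart s s0) (frac (chart s si))); first by split.
apply: chart_min => //; first by move=> c /C_chart h; apply: sub_frac => //; exact: h.
move=> sj hj; rewrite (_ : sj / s0 = (sj / si) / (s0 / si)); last by field; rewrite ?h2 ?i2.
by apply: (srM hF); [|apply: hV]; apply: sub_frac => //; exact: mem_chart.
Qed.

Lemma homogenize si sj a : si \in s -> sj \in s -> si != 0 -> sj != 0 -> chart s si a ->
  exists m0, forall m, (m0 <= m)%N -> chart s sj ((si / sj) ^+ m * a).
Proof.
move=> i1 j1 i2 j2; have hA := chart_subring s sj.
have hij : chart s sj (si / sj) by exact: mem_chart.
pose B := [set a | exists m0, forall m, (m0 <= m)%N -> chart s sj ((si / sj) ^+ m * a)].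
apply: (@chart_min s si B).
- apply/subringP; split.
  + by exists 0%N => m _; rewrite mulr1; exact: (srX hA).
  + move=> x y [m hm] [n hn]; exists (maxn m n) => k; rewrite geq_max => /andP[k1 k2].
    by rewrite mulrBr; apply: (srB hA) => //; [exact: hm|exact: hn].
  + move=> x y [m hm] [n hn]; exists (m + n)%N => k hk.
    rewrite (_ : k = (m + (k - m))%N); last by lia.
    by rewrite exprD mulrACA; apply: (srM hA) => //; [exact: hm|apply: hn; lia].
- move=> c /(@C_chart s sj) hc; exists 0%N => m _; apply: (srM hA) => //; exact: (srX hA).
- move=> sl hl; exists 1%N => -[//|m] _; rewrite exprSr -mulrA.
  rewrite (_ : si / sj * (sl / si) = sl / sj); last by field; rewrite ?i2 ?j2.
  by apply: (srM hA) => //; [exact: (srX hA)|exact: mem_chart].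
Qed.

Lemma idx_center V P i : is_subring V -> center X V P -> idx s V i -> idx s P i.
Proof.
move=> hV [XP [PV PV']] hi; have [i1 i2 iV] := hi.
have [hP CP _ _ [sj hj]] := pt_facts XP; have [j1 j2 jP] := hj.
split=> // sk ks; have iPu : unit_in P (i / sj).
  apply: PV'; first exact: jP.
  by apply: (idx_unit hV hi); exact: idxS hj.
rewrite (_ : sk / i = sk / sj * (i / sj)^-1); last by rewrite invf_div mulrA mulfVK.
by apply: (srM hP); [exact: jP|case: iPu].
Qed.

Section Normal.
Hypothesis Xn : normal X.

Lemma pt_cl P : X P -> cl P `<=` P.
Proof. by move=> XP; apply: cl_normal; [exact: pt_subring|exact: Xn]. Qed.

Lemma chart_cl si : si \in s -> si != 0 -> cl (chart s si) `<=` chart s si.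
Proof.
move=> h1 h2 x hx; apply: loc_all; [exact: chart_subring|exact: chart_noeth|].
move=> p hp; apply: (pt_cl (pt_mk h1 h2 hp)); apply: clS hx.
by apply: sub_loc => //; exact: chart_subring.
Qed.

Lemma prime_divisor_dvr E : prime_divisor X E -> is_dvr E.
Proof.
move=> [XE kE]; have [hE _ nE _ _] := pt_facts XE.
by apply: dim1_dvr => //; [exact: Xn|exact: frac_pt].
Qed.

(** By [dvr_crit], localizing at an associated prime of [x] modulo [P] gives a discrete valuation
    ring. It is a prime divisor through [P] along which [x] is not regular. *)
Lemma hartogs P x : X P -> (forall F, prime_divisor X F -> P `<=` F -> F x) -> P x.
Proof.
move=> XP h; apply: contrapT => nx; have [hP CP nP _ _] := pt_facts XP.
have [c [Pc nxc hp]] := colon_prime hP nP nx.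
set p := [set d | _] in hp; have XF := loc_pt XP hp; have hF := pt_subring XF.
have PF := sub_loc hP hp.
have nF : ~ localization P p (x * c).
  move=> [a [b [Pa Pb nb e]]]; apply: nb; split=> //.
  have b0 : b != 0 by apply: contra_notN nxc => /eqP b0; rewrite e b0 invr0 mulr0; exact: sr0.
  by rewrite e mulrC mulfVK.
have dF : is_dvr (localization P p).
  apply: (dvr_crit hF _ (Xn XF) (frac_pt XF) nF); first exact: noeth_loc.
    move=> a /(loc_maxE hP hp) [a' [b [[Pa' ha'] Pb nb ->]]].
    by exists (a' * (x * c)), b; split=> //; ring.
  have : frac P x by rewrite frac_pt.
  move=> [a [b [Pa Pb b0 e]]]; exists b => //; apply/(loc_maxE hP hp).
  exists b, 1; rewrite divr1; split=> //; [|exact: sr1|exact: (prime_N1 hp)].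
  split=> //; rewrite (_ : b * (x * c) = a * c); first exact: srM.
  by rewrite e; field.
apply: nF; apply: srM => //; last exact: PF.
by apply: h => //; split=> //; exact: dvr_krull.
Qed.

(* A discrete valuation ring is maximal for domination. *)
Lemma dvr_center_eq E P : is_dvr E -> center X E P -> krull_dim1 P -> P = E.
Proof.
move=> dE [XP [PE _]] kP; have dP := prime_divisor_dvr (conj XP kP).
apply: contrapT => ne; have hE : is_subring E by case: dE.
apply: (dvr_neqT dE); apply: (dvr_over dP hE PE) => e; exact: ne.
Qed.
End Normal.
End Variety.

Lemma maps_to_comp (phi psi : {rmorphism K -> K}) P Q S :
  maps_to phi P Q -> maps_to psi Q S -> maps_to (phi \o psi) P S.
Proof.
move=> [h1 h2] [h3 h4]; split=> x Sx; first exact/h1/h3.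
by move=> hu; apply: h4 => //; apply: h2 => //; exact: h3.
Qed.

Lemma C_unit A c : is_subring A -> C `<=` A -> C c -> c != 0 -> unit_in A c.
Proof. by move=> hA CA Cc c0; split=> //; apply: CA => //; apply: C_subfield.2. Qed.

End Projective.

(** * Noether normalization and algebraic independence *)

Section Noether.
Context {R : realType} {K : fieldType} (iota : {rmorphism R[i] -> K}).
Implicit Types (A B L V P Q E F : set K) (x y z u : K) (s l : seq K).

Local Notation C := (range iota).
Local Notation pol s := (adjoin C [set` s]).

Lemma pol_subring s : is_subring (pol s). Proof. exact: adjoin_subring. Qed.
Lemma C_pol s : C `<=` pol s. Proof. by move=> x; exact: mem_adjoinl. Qed.
Lemma mem_pol s x : x \in s -> pol s x. Proof. by move=> h; exact: mem_adjoinr. Qed.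
Lemma polS s l : {subset s <= l} -> pol s `<=` pol l.
Proof. by move=> h; apply: adjoinS => x; exact: h. Qed.
Lemma pol_min s B : is_subring B -> C `<=` B -> (forall x, x \in s -> B x) -> pol s `<=` B.
Proof. by move=> hB CB h; apply: adjoin_min. Qed.
Lemma pol_nil : pol [::] = C.
Proof. by apply: adjoin_nil; exact: C_subring. Qed.
Lemma pol_cons x s : pol (x :: s) = adjoin (pol s) [set x].
Proof. exact: adjoin_cons. Qed.
Lemma pol_perm s l : perm_eq s l -> pol s = pol l.
Proof.
by move=> h; apply/seteqP; split; apply: polS => x; rewrite (perm_mem h).
Qed.

(** As [z] has a pole at [V], the term [c / z] is in the maximal ideal. *)
Lemma valring_unitD V z x c : valring V -> ~ V z -> unit_in V x -> V c -> unit_in V (x + c / z).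
Proof.
move=> [hV VR] nz [x0 Vx Vx'] Vc.
have z0 : z != 0 by apply: contra_notN nz => /eqP ->; exact: sr0.
have Vzi : V z^-1 by case: (VR z).
set y := x + c / z; have Vy : V y by apply: srD => //; exact: srM.
have eyz : y * z = x * z + c by rewrite /y; field.
have nyz : ~ V (y * z).
  move=> h; apply: nz; rewrite (_ : z = x^-1 * (y * z - c)); last by rewrite eyz; field.
  by apply: srM => //; exact: srB.
have yz0 : y * z != 0 by apply: contra_notN nyz => /eqP ->; exact: sr0.
have [y0 _] : y != 0 /\ z != 0 by move: yz0; rewrite mulf_eq0 negb_or => /andP.
split=> //; set g := (y * z)^-1.
have Vg : V g by case: (VR (y * z)).
rewrite (_ : y^-1 = x^-1 * (1 - g * c)).
  by apply: srM => //; apply: srB => //; [exact: sr1|exact: srM].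
have -> : c = y * z - x * z by rewrite eyz; ring.
by rewrite /g; field; rewrite ?x0 ?y0 ?z0.
Qed.

(** The term of degree [k] grows like [z] to the power [w k + k * r], and [w k < r] makes these
    exponents strictly increasing, so the top term dominates. *)
Lemma horner_top V z (p : {poly K}) u (w : nat -> nat) r : valring V -> ~ V z -> p != 0 ->
  unit_in V (u / z ^+ r) ->
  (forall k, p`_k != 0 -> unit_in V (p`_k / z ^+ w k) /\ (w k < r)%N) ->
  unit_in V (p.[u] / z ^+ (w (size p).-1 + (size p).-1 * r)).
Proof.
move=> VV nz p0 hu hp; have [hV VR] := VV.
have z0 : z != 0 by apply: contra_notN nz => /eqP ->; exact: sr0.
have Vzi : V z^-1 by case: (VR z).
set d := (size p).-1; set W := (_ + _)%N.
have sp : size p = d.+1 by rewrite /d prednK // size_poly_gt0.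
have pd0 : p`_d != 0 by rewrite /d -lead_coefE lead_coef_eq0.
have term k n : p`_k != 0 -> p`_k * u ^+ k / z ^+ (w k + k * r + n) =
    (p`_k / z ^+ w k) * (u / z ^+ r) ^+ k * (z^-1) ^+ n.
  move=> _; rewrite expr_div_n -exprM !exprD [(r * k)%N]mulnC exprVn.
  by field; rewrite !expf_neq0.
rewrite horner_coef sp big_ord_recr /= mulrDl addrC mulr_suml.
have -> : \sum_(i < d) p`_i * u ^+ i / z ^+ W
   = (\sum_(i < d) p`_i * u ^+ i / z ^+ W.-1) / z.
  have [_ hwr] := hp d pd0; case: (posnP d) => [->|d0].
    by rewrite !big_ord0 mul0r.
  have -> : W = W.-1.+1 by rewrite prednK // /W; nia.
  rewrite /= mulr_suml; apply: eq_bigr => i _; rewrite exprS.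
  by field; rewrite z0 expf_neq0.
apply: valring_unitD => //.
  have := term d 0%N pd0; rewrite addn0 expr0 mulr1 => ->.
  by apply: unit_inM => //; [case: (hp d pd0)|exact: unit_inX].
apply: sr_sum => // i _; have [->|pi0] := eqVneq p`_i 0; first by rewrite !mul0r; exact: sr0.
have [hpi hwi] := hp i pi0.
have -> : W.-1 = (w i + i * r + (W.-1 - (w i + i * r)))%N.
  by rewrite subnKC // /W; have := ltn_ord i; nia.
rewrite term //; apply: srM => //; last exact: srX.
apply: srM => //; first by case: hpi.
by apply: srX => //; case: hu.
Qed.

(** Nagata's substitution seen from [V]: at a pole of [z], the element [l_i] grows exactly like [z]
    to the power [r_i]. *)
Definition shifted V z l (rs : seq nat) :=
  forall i, (i < size l)%N -> V (nth 0 l i - z ^+ nth 0%N rs i).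

Lemma shifted_unit V z u r : valring V -> ~ V z -> (0 < r)%N -> V (u - z ^+ r) ->
  unit_in V (u / z ^+ r).
Proof.
move=> VV nz r0 h; have [hV VR] := VV.
have z0 : z != 0 by apply: contra_notN nz => /eqP ->; exact: sr0.
have Vzi : V z^-1 by case: (VR z).
have -> : u / z ^+ r = 1 + ((u - z ^+ r) * z^-1 ^+ r.-1) / z.
  by case: (r) r0 => // m _; rewrite /= exprS exprVn; field; rewrite z0 expf_neq0.
apply: valring_unitD => //; first exact: unit_in1.
by apply: srM => //; exact: srX.
Qed.

(** The exponents are chosen from the end of [l] to its head, each above the growth of all
    coefficients with respect to its variable. They depend on [Q] only, and so serve every [V] at
    once. *)
Lemma growth z l (Q : seq K) : (forall q, q \in Q -> q != 0 /\ pol (rcons l z) q) ->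
  exists (rs : seq nat) (w : K -> nat), size rs = size l /\
    forall V, valring V -> C `<=` V -> ~ V z -> shifted V z l rs ->
      forall q, q \in Q -> unit_in V (q / z ^+ w q).
Proof.
elim: l Q => [|u l ih] Q hQ.
  have /choice [f hf] : forall q, exists p : {poly K}, q \in Q -> pover C p /\ q = p.[z].
    move=> q; have [qQ|nq] := boolP (q \in Q); last by exists 0.
    have [_] := hQ q qQ; rewrite /= pol_cons pol_nil => /(adjoin1P _ _ (C_subring iota)) [p hp e].
    by exists p.
  exists [::], (fun q => (size (f q)).-1); split=> // V VV CV nz _ q qQ.
  have [hV _] := VV; have [q0 _] := hQ q qQ; have [hp e] := hf q qQ.
  have z0 : z != 0 by apply: contra_notN nz => /eqP ->; exact: sr0.
  have p0 : f q != 0 by apply: contraNneq q0 => p0; rewrite e p0 horner0.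
  have := @horner_top V z (f q) z (fun=> 0%N) 1 VV nz p0; rewrite -e add0n muln1.
  apply; first by rewrite expr1 divff //; exact: unit_in1.
  move=> k hk; split=> //; rewrite expr0 divr1; by apply: (@C_unit _ _ iota) => //; exact: (hp k).
have /choice [f hf] : forall q, exists p : {poly K}, q \in Q ->
    pover (pol (rcons l z)) p /\ q = p.[u].
  move=> q; have [qQ|nq] := boolP (q \in Q); last by exists 0.
  have [_] := hQ q qQ; rewrite /= pol_cons => /(adjoin1P _ _ (pol_subring _)) [p hp e].
  by exists p.
pose Q' := [seq c <- flatten [seq (f q : seq K) | q <- Q] | c != 0].
have memQ' q k : q \in Q -> (f q)`_k != 0 -> (f q)`_k \in Q'.
  move=> qQ h; rewrite mem_filter h; apply/flattenP; exists (f q : seq K).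
    exact: map_f.
  by apply: mem_nth; rewrite ltnNge; apply: contraNN h => h; rewrite nth_default.
have [|rs [w [srs hw]]] := ih Q'.
  move=> c; rewrite mem_filter => /andP[c0 /flattenP [_ /mapP [q qQ ->]]].
  move=> /(nthP 0) [k _ ec]; split=> //; rewrite -ec; have [h _] := hf q qQ; exact: (h k).
pose r := (\max_(c <- Q') w c).+1.
exists (r :: rs), (fun q => (w (lead_coef (f q)) + (size (f q)).-1 * r)%N).
split=> [|V VV CV nz sh q qQ]; first by rewrite /= srs.
have sh' : shifted V z l rs by move=> i hi; exact: (sh i.+1).
have [q0 _] := hQ q qQ; have [hp e] := hf q qQ.
have p0 : f q != 0 by apply: contraNneq q0 => p0; rewrite e p0 horner0.
have := @horner_top V z (f q) u (fun k => w (f q)`_k) r VV nz p0; rewrite -e -lead_coefE.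
apply; first by apply: shifted_unit => //; exact: (sh 0%N).
move=> k hk; have hk' := memQ' q k qQ hk; split; first exact: hw.
by rewrite ltnS; exact: leq_bigmax_seq.
Qed.

Lemma cl_frac_poly A x : is_subring A -> cl (frac A) x ->
  exists p, [/\ p != 0, pover A p & root p x].
Proof.
move=> hA /cl_integral []; first by case: (frac_subfield hA).
move=> p [pm hp pr]; have [|d [hd d0 hs]] := @common_denom _ A p hA.
  by move=> y /(nthP 0) [i _ <-]; exact: (hp i).
exists (d *: p); split.
- by rewrite scaler_eq0 negb_or d0 monic_neq0.
- move=> i; rewrite coefZ; have [h|h] := ltnP i (size p); first by apply: hs; exact: mem_nth.
  by rewrite nth_default // mulr0; exact: sr0.
- by rewrite rootE hornerZ (rootP pr) mulr0.
Qed.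

(* Nagata's substitution: if [x] is algebraic over [C(l, z)], then [z] is integral over the
   ring generated by [x - z ^ r_0] and the [l_i - z ^ r_i], for rapidly growing [r_i]. *)
Lemma eliminate x l z : cl (frac (pol (rcons l z))) x ->
  exists y : seq K, [/\ size y = size (x :: l), {subset y <= pol (x :: rcons l z)} &
    pol (x :: rcons l z) `<=` cl (pol y)].
Proof.
move=> /(cl_frac_poly (pol_subring _)) [p [p0 hp pr]].
pose Q := [seq c <- (p : seq K) | c != 0].
have [|rs [w [srs hw]]] := @growth z l Q.
  move=> c; rewrite mem_filter => /andP[c0] /(nthP 0) [i _ e].
  by split=> //; rewrite -e; exact: (hp i).
pose r := (\max_(c <- Q) w c).+1.
pose y := (x - z ^+ r) :: [seq nth 0 l i - z ^+ nth 0%N rs i | i <- seq.iota 0 (size l)].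
have hz : cl (pol y) z.
  move=> V VV yV; have [hV _] := VV; apply: contrapT => nz.
  have CV : C `<=` V by move=> c /(@C_pol y) /yV.
  have sh : shifted V z l rs.
    move=> i hi; apply: yV; apply: mem_pol; rewrite inE; apply/orP; right.
    by apply/mapP; exists i => //; rewrite mem_iota.
  have := @horner_top V z p x (fun k => w p`_k) r VV nz p0; rewrite (rootP pr) mul0r.
  case; first by apply: shifted_unit => //; apply: yV; apply: mem_pol; rewrite mem_head.
    move=> k hk; have pQ : p`_k \in Q.
      rewrite mem_filter hk; apply: mem_nth; rewrite ltnNge.
      by apply: contraNN hk => h; rewrite nth_default.
    by split; [exact: hw|rewrite ltnS; exact: leq_bigmax_seq].
  by rewrite eqxx.
have hS := cl_subring (pol y).
exists y; split; first by rewrite /= size_map size_iota.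
  have hP := pol_subring (x :: rcons l z).
  have Pz : pol (x :: rcons l z) z by apply: mem_pol; rewrite inE mem_rcons mem_head orbT.
  move=> c; rewrite in_cons => /orP[/eqP ->|/mapP [j]].
    by rewrite inE; apply: (srB hP); [apply: mem_pol; rewrite mem_head|exact: (srX hP)].
  rewrite mem_iota => /andP[_ hi] ->; rewrite inE; apply: (srB hP); last exact: (srX hP).
  by apply: mem_pol; rewrite inE mem_rcons inE mem_nth ?orbT.
apply: pol_min => //; first by move=> c /(@C_pol y); exact: sub_cl.
move=> c; rewrite inE mem_rcons inE => /orP[/eqP ->|/orP[/eqP -> //|/(nthP 0) [i hi <-]]].
  rewrite -[x](subrK (z ^+ r)); apply: (srD hS); last exact: (srX hS).
  by apply: sub_cl; apply: mem_pol; rewrite mem_head.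
rewrite -[nth 0 l i](subrK (z ^+ nth 0%N rs i)); apply: (srD hS); last exact: (srX hS).
apply: sub_cl; apply: mem_pol; rewrite inE; apply/orP; right.
by apply/mapP; exists i => //; rewrite mem_iota.
Qed.

(** [cl] of a subfield is its algebraic closure in [K], so this is algebraic independence over the
    constants. *)
Definition indep s := forall x, x \in s -> ~ cl (frac (pol (rem x s))) x.

(** A family [z] of minimal length is independent: an element algebraic over the others could be
    removed by [eliminate], or simply dropped when it is the only one. *)
Lemma noether_normalization s : exists z : seq K,
  [/\ {subset z <= pol s}, {subset s <= cl (pol z)} & indep z].
Proof.
pose good (z : seq K) := {subset z <= pol s} /\ {subset s <= cl (pol z)}.
have ex : exists n, `[< exists z : seq K, size z = n /\ good z >].
  exists (size s); apply/asboolP; exists s; split=> //; split=> x xs; rewrite inE.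
    exact: mem_pol.
  by apply: sub_cl; exact: mem_pol.
case: (ex_minnP ex) => n /asboolP [z [sz [z1 z2]]] hmin; exists z; split=> // x xz hx.
have pz := perm_to_rem xz.
suff [z' [h1 h2 h3]] : exists z' : seq K, [/\ (size z' < size z)%N, {subset z' <= pol z} &
    pol z `<=` cl (pol z')].
  have : (n <= size z')%N.
    apply: hmin; apply/asboolP; exists z'; split=> //; split.
      move=> c /h2; rewrite !inE; apply: pol_min; [exact: pol_subring|exact: C_pol|].
      by move=> t /z1; rewrite inE.
    by move=> c /z2; rewrite !inE; apply: cl_min.
  by rewrite -sz leqNgt h1.
move: pz hx; case: (lastP (rem x z)) => [|l z0] pz.
  rewrite pol_nil frac_id; last exact: C_subfield.
  move=> hx; exists [::]; split=> //; first by rewrite (perm_size pz).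
  rewrite (pol_perm pz) pol_cons pol_nil; apply: cl_adjoin; first exact: sub_cl.
  by move=> _ ->.
move=> /eliminate [y [sy y1 y2]]; exists y; rewrite (pol_perm pz); split=> //.
by rewrite sy (perm_size pz) /= size_rcons.
Qed.

Lemma indep_uniq s : indep s -> uniq s.
Proof.
elim: s => // x s ih hi /=; apply/andP; split.
  apply/negP => xs; apply: (hi x (mem_head _ _)); rewrite /= eqxx.
  by apply: sub_cl; apply: sub_frac; [exact: pol_subring|exact: mem_pol].
apply: ih => y ys; have := hi y; rewrite inE ys orbT => /(_ isT) h hy; apply: h.
rewrite /=; have [e|ne] := eqVneq x y.
  by apply: sub_cl; apply: sub_frac; [exact: pol_subring|exact: mem_pol].
by apply: clS hy; apply: fracS; apply: polS => t ht; rewrite inE ht orbT.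
Qed.

Lemma indep_rem s x : indep s -> indep (rem x s).
Proof.
move=> hi y ys; have us := indep_uniq hi.
have yz : y \in s by exact: (mem_subseq (rem_subseq x s)).
move=> h; apply: (hi y yz); apply: clS h; apply: fracS; apply: polS => t.
have hu : uniq (rem x s) by exact: rem_uniq.
rewrite mem_rem_uniq // inE mem_rem_uniq // inE => /andP[h1 /andP[_ h2]].
by rewrite mem_rem_uniq // inE h1.
Qed.

Lemma indep_cons x s : indep (x :: s) -> ~ cl (frac (pol s)) x /\ indep s.
Proof.
move=> hi; have := hi x (mem_head _ _); have := @indep_rem _ x hi.
by rewrite /= eqxx.
Qed.

Lemma trans_poly0 L p x : is_subfield L -> ~ cl L x -> pover L p -> root p x -> p = 0.
Proof.
move=> hL nx hp pr; apply/eqP; apply: contrapT => /negP p0; apply: nx.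
exact: cl_root pr.
Qed.

(** The relation of [b] over [L[a]], reordered by powers of [a], is the polynomial [S] over [L[b]];
    it is nonzero because [b] is transcendental over [L]. *)
Lemma exchange L a b : is_subfield L -> cl (frac (adjoin L [set a])) b -> ~ cl L b ->
  cl (frac (adjoin L [set b])) a.
Proof.
move=> hLf; have [hL _] := hLf; have hLa := adjoin_subring L [set a].
have hLb := adjoin_subring L [set b].
move=> /(cl_frac_poly hLa) [p [p0 hp pr]] nb.
have /choice [q hq] : forall j, exists q : {poly K}, pover L q /\ p`_j = q.[a].
  by move=> j; have /(adjoin1P _ _ hL) [q h1 h2] := hp j; exists q.
pose S := \sum_(j < size p) b ^+ j *: q j.
have hS : pover (adjoin L [set b]) S.
  apply: (pover_sum hLb) => j _; apply: (poverZ hLb).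
    by apply: (srX hLb); exact: mem_adjoinr.
  by move=> i; apply: mem_adjoinl; case: (hq j).
apply: (@cl_root _ _ S).
- exact: frac_subfield.
- by apply: pover_sub hS => z; exact: sub_frac.
- have : lead_coef p != 0 by rewrite lead_coef_eq0.
  rewrite lead_coefE; have [hqd ->] := hq (size p).-1 => ne.
  have qd0 : q (size p).-1 != 0 by apply: contraNneq ne => ->; rewrite horner0.
  have : lead_coef (q (size p).-1) != 0 by rewrite lead_coef_eq0.
  rewrite lead_coefE; set i := (size (q _)).-1 => qi0.
  apply/eqP => S0; have : S`_i = 0 by rewrite S0 coef0.
  rewrite /S coef_sum => e; move: qi0.
  have : \poly_(j < size p) (q j)`_i = 0.
    apply: (trans_poly0 hLf nb); first by apply: pover_poly => // j _; case: (hq j).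
    rewrite rootE horner_poly; apply/eqP; rewrite -[RHS]e; apply: eq_bigr => j _.
    by rewrite coefZ mulrC.
  move/polyP => /(_ (size p).-1); rewrite coef_poly coef0 prednK ?size_poly_gt0 // leqnn.
  by move=> ->; rewrite eqxx.
- apply/eqP; rewrite /S horner_sum -[RHS](rootP pr) horner_coef.
  by apply: eq_bigr => j _; rewrite hornerZ; have [_ ->] := hq j; rewrite mulrC.
Qed.

End Noether.

(** * Complete integral closedness of polynomial rings and of the degree valuation ring *)

Section PolynomialClosedness.
Context {K : fieldType}.
Implicit Types (A B L V k : set K) (x y z u : K) (P Q U W G H : {poly K}).

Lemma subfield_subring L : is_subfield L -> is_subring L. Proof. by case. Qed.

Lemma size_exp_pred P n : (size (P ^+ n)).-1 = ((size P).-1 * n)%N.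
Proof. exact: size_exp. Qed.

Lemma size_drop_lead n P Q : (size P <= n.+1)%N -> (size Q <= n.+1)%N -> P`_n = Q`_n ->
  (size (P - Q)%R <= n)%N.
Proof.
move=> sP sQ e; apply/leq_sizeP => j; rewrite leq_eqVlt => /orP[/eqP <-|nj].
  by rewrite coefB e subrr.
by rewrite coefB !nth_default ?subrr // (leq_trans _ nj).
Qed.

Lemma pover_quot L P Q U : is_subfield L -> pover L P -> pover L Q -> Q != 0 ->
  P = U * Q -> pover L U.
Proof.
move=> [hL hLV] hP hQ Q0; move: (leqnn (size U)); move: {2}(size U) => n.
elim: n P U hP => [|n ih] P U hP sU e.
  by move: sU; rewrite leqn0 size_poly_eq0 => /eqP ->; exact: pover0.
have [U0|U0] := eqVneq U 0; first by rewrite U0; exact: pover0.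
have lU : L (lead_coef U).
  have -> : lead_coef U = lead_coef P / lead_coef Q.
    by rewrite e lead_coefM mulfK // lead_coef_eq0.
  by apply: srM => //; [exact: hP|apply: hLV; exact: hQ].
pose m := (size U).-1.
have sU' : size U = m.+1 by rewrite prednK // size_poly_gt0.
have hm : pover L (lead_coef U *: 'X^m) by apply: poverZ => //; exact: poverXn.
rewrite -(subrK (lead_coef U *: 'X^m) U); apply: poverD => //.
apply: (ih (P - lead_coef U *: 'X^m * Q)).
- by apply: poverB => //; exact: poverM.
- rewrite sU' in sU; rewrite (leq_trans (size_drop_lead (n := m) _ _ _)) ?sU' //.
    by rewrite (leq_trans (size_scale_leq _ _)) // size_polyXn.
  by rewrite coefZ coefXn eqxx mulr1 lead_coefE sU'.
- by rewrite e mulrBl.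
Qed.

(** The leading coefficient of [U] is almost integral over [A], hence in [A]; the leading term is
    subtracted and the argument repeated. *)
Lemma cic_descend A W U : is_subring A -> cicin (frac A) A -> pover A W -> W != 0 ->
  pover (frac A) U -> (forall j, pover A (W * U ^+ j)) -> pover A U.
Proof.
move=> hA cA hW W0; move: (leqnn (size U)); move: {2}(size U) => n.
elim: n U => [|n ih] U sU hU hWU.
  by move: sU; rewrite leqn0 size_poly_eq0 => /eqP ->; exact: pover0.
have [U0|U0] := eqVneq U 0; first by rewrite U0; exact: pover0.
have lU : A (lead_coef U).
  apply: (cA (lead_coef W)); rewrite ?lead_coef_eq0 //; try exact: hU; try exact: hW.
  move=> j; rewrite -lead_coef_exp -lead_coefM lead_coefE; exact: hWU.
pose m := (size U).-1.
have sU' : size U = m.+1 by rewrite prednK // size_poly_gt0.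
have hm : pover A (lead_coef U *: 'X^m) by apply: poverZ => //; exact: poverXn.
rewrite -(subrK (lead_coef U *: 'X^m) U); apply: poverD => //; apply: ih.
- rewrite sU' in sU; rewrite (leq_trans (size_drop_lead (n := m) _ _ _)) ?sU' //.
    by rewrite (leq_trans (size_scale_leq _ _)) // size_polyXn.
  by rewrite coefZ coefXn eqxx mulr1 lead_coefE sU'.
- have hF := subfield_subring (frac_subfield hA); apply: (poverB hF) => //.
  by apply: pover_sub hm; exact: sub_frac.
- move=> j; rewrite exprDn mulr_sumr; apply: pover_sum => // i _.
  rewrite mulrnAr => l; rewrite coefMn; apply: srMn => //; move: l.
  rewrite mulrA; apply: poverM => //; apply: poverE => //; exact: poverN.
Qed.

Lemma trans_horner_neq0 L P x : is_subfield L -> ~ cl L x -> pover L P -> P != 0 -> P.[x] != 0.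
Proof.
by move=> hL nx hP P0; apply: contraNneq P0 => e; apply/eqP/(trans_poly0 hL nx hP)/eqP.
Qed.

Lemma trans_eq L P Q x : is_subfield L -> ~ cl L x -> pover L P -> pover L Q ->
  P.[x] = Q.[x] -> P = Q.
Proof.
move=> hL nx hP hQ e; apply/eqP; rewrite -subr_eq0; apply/eqP.
apply: (trans_poly0 hL nx); first by apply: poverB => //; case: hL.
by rewrite rootE hornerD hornerN e subrr.
Qed.

(** In lowest terms every power of the denominator divides the fixed polynomial [W], so the
    denominator is constant. *)
Lemma fraction_lowest L P Q W (G : nat -> {poly K}) : is_subfield L -> pover L P ->
  pover L Q -> Q != 0 -> W != 0 -> (forall j, W * P ^+ j = Q ^+ j * G j) ->
  exists2 U, pover L U & P = U * Q.
Proof.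
move=> hL hP hQ Q0 W0 e; pose d := gcdp P Q.
have d0 : d != 0 by rewrite gcdp_eq0 negb_and Q0 orbT.
have /dvdpP [P' eP] : d %| P by exact: dvdp_gcdl.
have /dvdpP [Q' eQ] : d %| Q by exact: dvdp_gcdr.
have cop : coprimep P' Q'.
  have : d %= gcdp (P' * d) (Q' * d) by rewrite -eP -eQ eqpxx.
  rewrite /coprimep => h; have := eqp_ltrans h; move: h.
  have := gcdp_mul2r P' d Q' => h1 h2.
  have /(eqp_trans h2) h3 : gcdp (P' * d) (Q' * d) %= gcdp P' Q' * d.
    exact: gcdp_mul2r.
  move=> _; have := eqp_size h3; rewrite size_mul //; last first.
    rewrite gcdp_eq0 negb_and; apply/orP; right; apply: contraNneq Q0 => Q'0.
    by rewrite eQ Q'0 mul0r.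
  have : (0 < size d)%N by rewrite size_poly_gt0.
  move: (size (gcdp P' Q')) (size d) => a b; move=> h4 h5; apply/eqP; lia.
have Q'0 : Q' != 0 by apply: contraNneq Q0 => h; rewrite eQ h mul0r.
have dv j : Q' ^+ j %| W.
  have : Q' ^+ j %| W * P' ^+ j.
    apply/dvdpP; exists (G j); have := e j; rewrite eP eQ !exprMn.
    move=> h; apply: (mulIf (expf_neq0 j d0)); rewrite -mulrA h; ring.
  by rewrite Gauss_dvdpl // coprimep_expl // coprimep_expr // coprimep_sym.
have sQ' : size Q' = 1%N.
  have := dvdp_leq W0 (dv (size W)).
  have := size_exp_pred Q' (size W).
  have : (0 < size Q')%N by rewrite size_poly_gt0.
  have : (0 < size W)%N by rewrite size_poly_gt0.
  move: (size (polyseq (Q' ^+ size W)%R)) => a.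
  by move: (size (polyseq Q')) (size (polyseq W)) => b c; nia.
have [c c0 eQ'] : exists2 c, c != 0 & Q' = c%:P.
  by move/eqP: sQ' => /size_poly1P [c c0 ->]; exists c.
have eU : P = (c^-1 *: P') * Q.
  by rewrite {1}eP eQ eQ' -scalerAl mulrCA mul_polyC scalerA mulVf // scale1r.
by exists (c^-1 *: P') => //; exact: (pover_quot hL hP hQ Q0 eU).
Qed.

Lemma frac_horner A z y : is_subring A -> frac (adjoin A [set z]) y ->
  exists P Q, [/\ pover A P, pover A Q, Q.[z] != 0 & y = P.[z] / Q.[z]].
Proof.
move=> hA [a [b [/(adjoin1P _ _ hA) [P hP ->] /(adjoin1P _ _ hA) [Q hQ ->] h ->]]].
by exists P, Q.
Qed.

Lemma horner_adjoin A z P : is_subring A -> pover A P -> adjoin A [set z] P.[z].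
Proof. by move=> hA hP; apply/adjoin1P => //; exists P. Qed.

(** An almost integral fraction is a polynomial over the fraction field by [fraction_lowest], and
    then a polynomial over [A] by [cic_descend]. *)
Lemma cic_poly A z : is_subring A -> cicin (frac A) A -> ~ cl (frac A) z ->
  cicin (frac (adjoin A [set z])) (adjoin A [set z]).
Proof.
move=> hA cA nz w y /(adjoin1P _ _ hA) [W hW ->] w0 /(frac_horner hA).
move=> [P [Q [hP hQ q0 ->]]] h; have hF := frac_subfield hA.
have sub P1 : pover A P1 -> pover (frac A) P1 by apply: pover_sub; exact: sub_frac.
have W0 : W != 0 by apply: contraNneq w0 => ->; rewrite horner0.
have Q0 : Q != 0 by apply: contraNneq q0 => ->; rewrite horner0.
have /choice [G hG] : forall j, exists G, pover A G /\ W * P ^+ j = Q ^+ j * G.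
  move=> j; have /(adjoin1P _ _ hA) [G hG e] := h j; exists G; split=> //.
  apply: (trans_eq hF nz).
  - by apply: sub; apply: poverM => //; exact: poverE.
  - by apply: sub; apply: poverM => //; exact: poverE.
  - by rewrite !hornerM !horner_exp -e expr_div_n; field; rewrite expf_neq0.
have [U hU eU] := fraction_lowest hF (sub _ hP) (sub _ hQ) Q0 W0 (fun j => (hG j).2).
have : pover A U.
  apply: (cic_descend hA cA hW W0 hU) => j; have [h1 h2] := hG j.
  rewrite (_ : W * U ^+ j = G j) //; apply: (mulfI (expf_neq0 j Q0)).
  by rewrite -h2 eU exprMn; ring.
by move=> hU'; rewrite eU hornerM mulfK //; exact: horner_adjoin.
Qed.

Section Degree.
Variables (k : set K) (z : K).
Hypotheses (hk : is_subfield k) (nz : ~ cl k z).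

Let hkr : is_subring k. Proof. by case: hk. Qed.

(* The valuation ring of [-deg] on the rational functions [k(z)]. *)
Definition degring : set K := [set x | exists P Q,
  [/\ pover k P, pover k Q, Q != 0, (size P <= size Q)%N & x = P.[z] / Q.[z]]].

Lemma degring_subring : is_subring degring.
Proof.
have mulsz P Q P' Q' : Q != 0 -> Q' != 0 -> (size P <= size Q)%N ->
    (size P' <= size Q')%N -> (size (P * P')%R <= size (Q * Q')%R)%N.
  move=> q0 q0' h h'; have [->|p0] := eqVneq P 0; first by rewrite mul0r size_poly0.
  have [->|p0'] := eqVneq P' 0; first by rewrite mulr0 size_poly0.
  by rewrite !size_mul // -!subn1 leq_sub2r // leq_add.
apply/subringP; split.
- exists 1, 1; rewrite oner_eq0 !hornerC divr1; split=> //; exact: pover1.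
- move=> _ _ [P [Q [hP hQ q0 s1 ->]]] [P' [Q' [hP' hQ' q0' s2 ->]]].
  exists (P * Q' - P' * Q), (Q * Q'); split; rewrite ?mulf_neq0 //.
  + by apply: poverB => //; exact: poverM.
  + exact: poverM.
  + rewrite (leq_trans (size_polyD _ _)) // geq_max size_polyN; apply/andP; split.
      exact: mulsz.
    by rewrite [Q * Q']mulrC; exact: mulsz.
  + rewrite !hornerE; field.
    by rewrite (trans_horner_neq0 hk nz hQ q0) (trans_horner_neq0 hk nz hQ' q0').
- move=> _ _ [P [Q [hP hQ q0 s1 ->]]] [P' [Q' [hP' hQ' q0' s2 ->]]].
  exists (P * P'), (Q * Q'); split; rewrite ?mulf_neq0 //.
  + exact: poverM.
  + exact: poverM.
  + exact: mulsz.
  + rewrite !hornerM; field.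
    by rewrite (trans_horner_neq0 hk nz hQ q0) (trans_horner_neq0 hk nz hQ' q0').
Qed.

Lemma degring_poly P n : pover k P -> (size P <= n.+1)%N -> degring (P.[z] / z ^+ n).
Proof.
move=> hP sP; exists P, 'X^n; rewrite hornerXn -size_poly_eq0 size_polyXn.
by split=> //; exact: poverXn.
Qed.

Lemma k_degring : k `<=` degring.
Proof.
move=> c kc; have := @degring_poly c%:P 0; rewrite hornerC expr0 divr1; apply.
  exact: poverC.
exact: size_polyC_leq1.
Qed.

Lemma trans_neq0 : z != 0.
Proof. by apply/eqP => e; apply: nz; rewrite e; apply: sub_cl; exact: sr0. Qed.

Lemma degring_inv : degring z^-1.
Proof.
have := @degring_poly 1 1 (pover1 hkr); rewrite size_poly1 hornerC div1r expr1.
exact.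
Qed.

Lemma degring_sub : degring `<=` frac (adjoin k [set z]).
Proof.
move=> _ [P [Q [hP hQ q0 _ ->]]]; exists P.[z], Q.[z]; split=> //.
- exact: horner_adjoin.
- exact: horner_adjoin.
- exact: (trans_horner_neq0 hk nz).
Qed.

Lemma degring_frac : frac (adjoin k [set z]) `<=` frac degring.
Proof.
have hW := degring_subring; have [hF hFV] := frac_subfield hW.
apply: frac_min; first by split.
apply: adjoin_min => //; first by move=> c /k_degring; exact: sub_frac.
move=> _ ->; rewrite -[z]invrK; apply: hFV; apply: sub_frac => //; exact: degring_inv.
Qed.

(** If [y] had positive degree, [w * y ^+ n] would have positive degree for [n] above the degree of
    the denominator [Q0] of [w]; hence the exponent [(size Q0).+1]. *)
Lemma degring_cic : cicin (frac (adjoin k [set z])) degring.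
Proof.
move=> w y [P0 [Q0 [hP0 hQ0 q00 _ ->]]] w0 /(frac_horner hkr) [P [Q [hP hQ qz ->]]] h.
have Q1 : Q != 0 by apply: contraNneq qz => ->; rewrite horner0.
have [P00|P1] := eqVneq P 0; first by rewrite P00 horner0 mul0r; exact: (sr0 degring_subring).
have p00 : P0 != 0 by apply: contraNneq w0 => ->; rewrite horner0 mul0r.
exists P, Q; split=> //.
have [P2 [Q2 [hP2 hQ2 q20 s2 e]]] := h (size Q0).+1.
have {}e : P0 * P ^+ (size Q0).+1 * Q2 = P2 * Q0 * Q ^+ (size Q0).+1.
  apply: (trans_eq hk nz).
  - by apply: poverM => //; apply: poverM => //; exact: poverE.
  - by apply: poverM => //; [exact: poverM|exact: poverE].
  - rewrite !hornerM !horner_exp; have n1 := trans_horner_neq0 hk nz hQ2 q20.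
    have n2 := trans_horner_neq0 hk nz hQ0 q00.
    have e' : P2.[z] = P0.[z] / Q0.[z] * (P.[z] / Q.[z]) ^+ (size Q0).+1 * Q2.[z].
      by rewrite e mulfVK.
    by rewrite e' expr_div_n; field; rewrite expf_neq0 // n2.
have P20 : P2 != 0.
  apply: contra_eq_neq e => ->; rewrite !mul0r.
  by rewrite !mulf_neq0 // expf_neq0.
have := congr1 (fun p : {poly K} => size p) e.
rewrite /= !size_mul ?mulf_neq0 ?expf_neq0 //.
have := size_exp_pred P (size Q0).+1; have := size_exp_pred Q (size Q0).+1.
have : (0 < size (P ^+ (size Q0).+1)%R)%N by rewrite size_poly_gt0 expf_neq0.
have : (0 < size (Q ^+ (size Q0).+1)%R)%N by rewrite size_poly_gt0 expf_neq0.
have : (0 < size P)%N by rewrite size_poly_gt0.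
have : (0 < size Q)%N by rewrite size_poly_gt0.
have : (0 < size P0)%N by rewrite size_poly_gt0.
have : (0 < size Q0)%N by rewrite size_poly_gt0.
have : (0 < size P2)%N by rewrite size_poly_gt0.
have : (0 < size Q2)%N by rewrite size_poly_gt0.
move: s2; move: (size (polyseq (P ^+ (size Q0).+1)%R)) (size (polyseq (Q ^+ (size Q0).+1)%R)) => a b.
move: (size (polyseq P)) (size (polyseq Q)) (size (polyseq P0)) (size (polyseq Q0))
  (size (polyseq P2)) (size (polyseq Q2)) => c d e1 f g i; nia.
Qed.

End Degree.

Lemma frac_adjoin_frac A z : is_subring A ->
  frac (adjoin (frac A) [set z]) = frac (adjoin A [set z]).
Proof.
move=> hA; have hS := adjoin_subring A [set z]; have [hF hFV] := frac_subfield hS.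
apply/seteqP; split; last first.
  apply: fracS; apply: adjoin_min; first exact: adjoin_subring.
    by move=> a /(sub_frac hA); exact: mem_adjoinl.
  by move=> _ ->; exact: mem_adjoinr.
apply: frac_min; first by split.
apply: adjoin_min => //.
  by apply: fracS => a; exact: mem_adjoinl.
by move=> _ ->; apply: sub_frac => //; exact: mem_adjoinr.
Qed.

End PolynomialClosedness.

(** * Coordinates along a divisor, and the linear bound for orders of sections *)

Section DivisorCoordinates.
Context {R : realType} {K : fieldType} (iota : {rmorphism R[i] -> K}).
Implicit Types (A B L V P Q E F : set K) (x y z u : K) (s l : seq K).

Local Notation C := (range iota).
Local Notation pol s := (adjoin C [set` s]).

(** Degree bookkeeping, in terms of sizes, for the polynomial identity that ends [linear_bound]. *)
Lemma degree_count (a1 b1 c1 d1 e1 f1 j : nat) : (e1 <= d1 -> 1 < b1 -> 0 < d1 -> 0 < c1 ->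
  0 < a1 -> a1.-1 = b1.-1 * j -> ((a1 + c1).-1 + d1).-1 = f1 + e1 -> j <= f1)%N.
Proof. nia. Qed.

Lemma pol_cic s : indep iota s -> cicin (frac (pol s)) (pol s).
Proof.
elim: s => [|x s ih] hi.
  rewrite pol_nil frac_id; last exact: C_subfield.
  by move=> w y _ _ Cy _.
have [nx /ih h] := indep_cons hi.
by rewrite pol_cons; apply: cic_poly => //; exact: pol_subring.
Qed.

(** If [h] were free of each variable separately, independence would allow discarding them one after
    another, down to the constants. *)
Lemma involves s h : indep iota s -> pol s h -> ~ C h ->
  exists2 x, x \in s & ~ pol (rem x s) h.
Proof.
move=> hi sh nC; apply: contrapT => hno; apply: nC; rewrite -(pol_nil iota).
have hr x : x \in s -> pol (rem x s) h.
  by move=> xs; apply: contrapT => n; apply: hno; exists x.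
suff H : forall a b, perm_eq s (a ++ b) -> pol b h by apply: (H s); rewrite cats0.
elim=> [|x a ih] b hp; first by rewrite -(pol_perm iota hp).
have : pol (x :: b) h by apply: ih; rewrite (perm_trans hp) // -cat_rcons -cats1 -catA perm_sym perm_catCA.
rewrite pol_cons => /(adjoin1P _ _ (pol_subring iota b)) [p hp' e].
have xs : x \in s by rewrite (perm_mem hp) mem_head.
have hx := hr x xs; have nx := hi x xs.
have pb : pol b `<=` pol (rem x s).
  apply: polS => c cb; have hpr : perm_eq (rem x s) (a ++ b).
    by rewrite -(perm_cons x) (perm_trans _ hp) // perm_sym perm_to_rem.
  by rewrite (perm_mem hpr) mem_cat cb orbT.
have hF := frac_subfield (pol_subring iota (rem x s)).
have ep : p = h%:P.
  apply: (trans_eq hF nx); last by rewrite hornerC.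
    by apply: pover_sub hp' => c /pb; apply: sub_frac; exact: pol_subring.
  by apply: poverC; [case: hF|apply: sub_frac => //; exact: pol_subring].
by have := hp' 0%N; rewrite ep coefC eqxx.
Qed.

Lemma pol_rem s x : x \in s -> pol s = adjoin (pol (rem x s)) [set x].
Proof. by move=> xs; rewrite (pol_perm iota (perm_to_rem xs)) pol_cons. Qed.

Section DegreeBound.
Variables (s : seq K) (x : K).
Hypotheses (hi : indep iota s) (xs : x \in s).

Let k := frac (pol (rem x s)).
(** The valuation at infinity of one Noether coordinate, against which the growth of sections is
    measured. *)
Definition polW := degring k x.

Let hk : is_subfield k. Proof. exact/frac_subfield/pol_subring. Qed.
Let nx : ~ cl k x. Proof. exact: hi. Qed.

Lemma polW_facts : [/\ is_subring polW, C `<=` polW, frac (pol s) `<=` frac polW,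
  polW `<=` frac (pol s) & cicin (frac (pol s)) polW].
Proof.
have eL : frac (pol s) = frac (adjoin k [set x]).
  by rewrite (pol_rem xs) frac_adjoin_frac //; exact: pol_subring.
rewrite eL; split; [exact: degring_subring| |exact: degring_frac|exact: degring_sub|exact: degring_cic].
move=> c Cc; rewrite /polW; apply: (k_degring x hk); apply: sub_frac; first exact: pol_subring.
exact: C_pol.
Qed.

Lemma x_neq0 : x != 0. Proof. exact: (trans_neq0 hk nx). Qed.

(** Dividing by [x ^+ c'] divides the coefficient of degree [j] of a monic relation by
    [x ^+ (c' * (n - j))], which offsets its degree in [x] once [c'] is large. *)
Lemma cl_polW_bound a : cl (pol s) a ->
  exists c, forall c', (c <= c')%N -> cl polW (a / x ^+ c').
Proof.
have [hW _ _ _ _] := polW_facts; have x0 := x_neq0.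
move=> /cl_integral -/(_ (pol_subring iota s)) [p [pm hp pr]].
have [n sp e] := monic_rootE pm pr.
have hR := pol_subring iota (rem x s).
have /choice [q hq] : forall j, exists q : {poly K}, pover (pol (rem x s)) q /\ p`_j = q.[x].
  move=> j; have := hp j; rewrite (pol_rem xs) => /(adjoin1P _ _ hR) [q h1 h2].
  by exists q.
pose c := (\max_(j < n) size (q j)).+1.
exists c => c' cc'.
apply: (@cl_of_pow _ _ _ n (fun j => - (p`_j / x ^+ (c' * (n - j))))) => //.
  move=> j jn; apply: srN => //; have [h1 ->] := hq j.
  rewrite /polW; apply: (degring_poly x hk) => //; first by apply: pover_sub h1; exact: sub_frac.
  have : (size (q j) <= \max_(j < n) size (q j))%N by exact: (leq_bigmax (Ordinal jn)).
  move: cc'; rewrite /c; have : (0 < n - j)%N by rewrite subn_gt0.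
  move: (size (polyseq (q j))) (\max_(j < n) _)%N (n - j)%N => a1 b1 d1; nia.
rewrite expr_div_n e mulNr mulr_suml -sumrN; apply: eq_bigr => j _.
rewrite mulNr; congr (- _); rewrite expr_div_n -!exprM.
have -> : (c' * n = c' * (n - j) + c' * j)%N by rewrite -mulnDr subnK // ltnW.
by rewrite exprD; field; rewrite !expf_neq0.
Qed.

Lemma cl_polW_bounds (l : seq K) : (forall a, a \in l -> cl (pol s) a) ->
  exists c, forall a, a \in l -> cl polW (a / x ^+ c).
Proof.
move=> hl; suff [c hc] : exists c, forall a, a \in l -> forall c', (c <= c')%N -> cl polW (a / x ^+ c').
  by exists c => a al; exact: hc.
elim: l hl => [|a l ih] hl; first by exists 0%N.
have [|c hc] := ih; first by move=> b bl; apply: hl; rewrite inE bl orbT.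
have [d hd] := cl_polW_bound (hl a (mem_head _ _)).
exists (maxn c d) => b; rewrite inE => /orP[/eqP ->|bl] c'; rewrite geq_max => /andP[h1 h2].
  exact: hd.
exact: hc.
Qed.
End DegreeBound.

(* Sections of the [M]-th power of the line bundle generated by [sg]. *)
Definition sect sg M : set K := [set x | forall V, valring V -> C `<=` V ->
  forall i, idx sg V i -> V (x / i ^+ M)].

(** [l] lifts independent elements of the residue field, so [E] is trivial on the polynomials in
    [l]; together with the uniformizer [t] it forms a transcendence basis of [K]. *)
Definition dcoord E l t := [/\ forall x, x \in l -> E x, indep iota l,
  forall g, pol l g -> g != 0 -> unit_in E g, E t /\ ord E t = 1
  & forall x, cl (frac (pol (t :: l))) x].

Section DivisorRing.
Variables (s : seq K) (E : set K) (t : K).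
Hypotheses (dE : is_dvr E) (clA : cl (pol s) `<=` pol s) (fA : frac (pol s) = setT)
  (AE : pol s `<=` E) (At : pol s t) (ot : ord E t = 1)
  (divt : forall a, pol s a -> a != 0 -> 0 < ord E a -> pol s (a / t)).

Let hE : is_subring E. Proof. by case: dE. Qed.
Let hA1 : is_subring (pol s). Proof. exact: pol_subring. Qed.
Let t0 : t != 0.
Proof.
apply/eqP => e; have := ot; rewrite e /ord; case: xgetP => // k _ [t' [u [t'0 _ [u0 _ _]]]].
by move/esym/eqP; rewrite mulf_eq0 (negbTE u0) expfz_eq0 (negbTE t'0) andbF.
Qed.

Lemma divt_pow j a : pol s a -> a != 0 -> (j%:Z <= ord E a) -> exists2 b, pol s b & a = t ^+ j * b.
Proof.
move=> Aa a0; elim: j => [|j ih] hj; first by exists a => //; rewrite mul1r.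
have [|b Ab e] := ih; first by apply: le_trans hj; rewrite lez_nat.
have b0 : b != 0 by apply: contraNneq a0 => h; rewrite e h mulr0.
exists (b / t); last by rewrite e exprSr -mulrA [t * _]mulrC mulfVK.
apply: divt => //; move: hj; rewrite e ordM ?expf_neq0 // ordX // ot natz.
by rewrite -addn1 PoszD lerD2l => h; exact: lt_le_trans h.
Qed.

Lemma cl_setT (z : seq K) : pol s `<=` cl (pol z) -> forall x, cl (frac (pol z)) x.
Proof.
move=> h x; have hz := frac_subfield (pol_subring iota z).
have : frac (pol s) x by rewrite fA.
apply: frac_min; first exact: cl_subfield.
by move=> a /h; apply: clS; apply: sub_frac; exact: pol_subring.
Qed.

Lemma pol_frac_basis (z : seq K) : pol s `<=` cl (pol z) ->
  exists r (e : 'cV[K]_r), basis (frac (pol z)) e.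
Proof.
move=> h; have hz := frac_subfield (pol_subring iota z).
have [||b hb] := @fin_span _ (frac (pol z)) s hz.
- by move=> x _; exact: cl_setT.
- apply/seteqP; split=> // x _; have : frac (pol s) x by rewrite fA.
  apply: fracS; apply: pol_min; first exact: adjoin_subring.
    by move=> c /(@C_pol _ _ iota z) hc; apply: mem_adjoinl; apply: sub_frac => //; exact: pol_subring.
  by move=> y ys; exact: mem_adjoinr.
exact: basis_exists hb.
Qed.

(** If the norm of [t] were a constant, the constant term of the characteristic polynomial of [t], a
    multiple of [t], would be a unit, and so would [t] at [E]. Hence the norm involves some
    coordinate [x]. *)
Lemma noether_divisor : exists (z : seq K) (r : nat) (e : 'cV[K]_r) (x : K) (H : {poly K}),
  [/\ {subset z <= pol s}, pol s `<=` cl (pol z), indep iota z, basis (frac (pol z)) e &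
   [/\ x \in z, pover (pol (rem x z)) H, normL (frac (pol z)) e t = H.[x] & (1 < size H)%N]].
Proof.
have [z [z1 z2 hz]] := noether_normalization iota s.
have sz : pol s `<=` cl (pol z).
  apply: pol_min; first exact: cl_subring.
    by move=> c /(@C_pol _ _ iota z); exact: sub_cl.
  by move=> x /z2; rewrite inE.
have zs : pol z `<=` pol s.
  by apply: pol_min => //; [exact: C_pol|move=> x /z1; rewrite inE].
have [r [e he]] := pol_frac_basis sz.
have hL := frac_subfield (pol_subring iota z); set L := frac (pol z) in hL he.
have hZ := pol_subring iota z.
have subL : pol z `<=` L by exact: sub_frac.
have cA := pol_cic hz.
pose h := normL L e t.
have Ah : pol z h by apply: (normL_integral hL he hZ _ subL cA (sz _ At)).
have h0 : h != 0 by exact: normL_neq0.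
have nC : ~ C h.
  move=> Ch; have := char_poly_integral hL he hZ (fun _ h => h) subL cA (C_Qsub (@C_pol _ _ iota z)) (sz _ At).
  have := char_poly_Mx_root he t.
  set p := char_poly _ => pr hp.
  have p0 : p`_0 = (-1) ^+ r * h.
    by rewrite -horner_coef0 horner_char_poly rmorph0 sub0r -scaleN1r detZ.
  have [p' ep] : exists p', p - (p`_0)%:P = p' * ('X - 0%:P).
    by apply/factor_theorem; rewrite rootE hornerD hornerN hornerC -horner_coef0 subrr.
  rewrite subr0 in ep; have hp' : pover (pol z) p'.
    move=> i; have := congr1 (fun q : {poly K} => q`_i.+1) ep.
    by rewrite /= coefMX coefB coefC /= subr0 => <-; exact: hp.
  have e1 : p`_0 = - p'.[t] * t.
    have : p.[t] = p'.[t] * t + p`_0.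
      by rewrite -{1}(subrK (p`_0)%:P p) ep !hornerE.
    by rewrite (rootP pr) mulNr => /esym/eqP; rewrite addrC addr_eq0 => /eqP.
  have : unit_in E p`_0.
    rewrite p0; apply: C_unit; [exact: hE| |apply: (srM (C_subring iota)) => //|].
    - by move=> c Cc; apply: AE; exact: C_pol.
    - exact: (sr_sign (C_subring iota)).
    - by rewrite mulf_neq0 // expf_neq0 // oppr_eq0 oner_eq0.
  rewrite e1 => hu.
  have /(ord_unitP dE) [_] : unit_in E t.
    apply: (unit_inMr hE _ _ hu); last exact: (AE At).
    apply: (srN hE); apply: AE; apply: (sr_horner hA1) => //.
    by move=> i; apply: zs; exact: hp'.
  by rewrite ot.
have [x xz nx] := involves hz Ah nC.
have := Ah; rewrite (pol_rem xz) => /(adjoin1P _ _ (pol_subring iota _)) [H hH eH].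
exists z, r, e, x, H; split=> //; split=> //; rewrite ltnNge; apply/negP => /size1_polyC eH'.
by apply: nx; rewrite eH eH' hornerC; exact: (hH 0%N).
Qed.

Lemma norm_poly (z : seq K) r (e : 'cV[K]_r) x a : {subset z <= pol s} -> pol s `<=` cl (pol z) ->
  indep iota z -> basis (frac (pol z)) e -> x \in z -> pol s a -> a != 0 ->
  exists B : {poly K}, [/\ pover (pol (rem x z)) B, B != 0 & normL (frac (pol z)) e a = B.[x]].
Proof.
move=> z1 sz hz he xz Aa a0; have hZ := pol_subring iota z.
have hL := frac_subfield hZ.
have := normL_integral hL he hZ (fun _ h => h) (sub_frac hZ) (pol_cic hz) (sz _ Aa).
rewrite {1}(pol_rem xz) => /(adjoin1P _ _ (pol_subring iota _)) [B hB eB].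
exists B; split=> //; apply: contraNneq (normL_neq0 hL he a0) => B0.
by rewrite eB B0 horner0.
Qed.

(** A polynomial [g] free of [x] and vanishing along [E] would be divisible by [t]; then the norm
    [g ^+ r] of [g] would be a multiple of the norm of [t], which has positive degree in [x]. So the
    remaining coordinates are independent on [E], and [x] is exchanged for [t]. *)
Lemma divisor_dcoord : exists l, dcoord E l t.
Proof.
have [z [r [e [x [H [z1 sz hz he [xz hH eH sH]]]]]]] := noether_divisor.
have hZ := pol_subring iota z; have hL := frac_subfield hZ.
have zs : pol z `<=` pol s.
  by apply: pol_min => //; [exact: C_pol|move=> y /z1; rewrite inE].
have rz : pol (rem x z) `<=` pol z by apply: polS => y; exact: mem_rem.
have hR := pol_subring iota (rem x z); have hk := frac_subfield hR.
have nx := hz x xz.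
have ER g : pol (rem x z) g -> g != 0 -> unit_in E g.
  move=> Rg g0; have Ag : pol s g by exact: (zs _ (rz _ Rg)).
  apply: contrapT => nu; have og : 0 < ord E g by apply/max_idealP => //; split=> //; exact: AE.
  have Aa := divt Ag g0 og; have a0 : g / t != 0 by rewrite mulf_neq0 ?invr_eq0.
  have [B [hB B0 eB]] := norm_poly z1 sz hz he xz Aa a0.
  have : H * B = (g ^+ r)%:P.
    apply: (trans_eq hk nx).
    - by apply: poverM; [by case: hk|apply: pover_sub hH|apply: pover_sub hB]; exact: sub_frac.
    - by apply: poverC; [by case: hk|apply: sub_frac => //; exact: (srX hR)].
    rewrite hornerM hornerC -eB -eH -(normLM hL he) mulrC mulfVK //.
    by rewrite (normLa hL he) //; apply: sub_frac => //; exact: rz.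
  move/(congr1 (fun p : {poly K} => size p)); rewrite /= size_mul //; last first.
    by rewrite -size_poly_gt0 (ltn_trans _ sH).
  rewrite size_polyC expf_neq0 //=; have : (0 < size B)%N by rewrite size_poly_gt0.
  by move: sH; move: (size (polyseq H)) (size (polyseq B)) => a b; lia.
have kE : frac (pol (rem x z)) `<=` E.
  move=> _ [a [b [Ra Rb b0 ->]]]; apply: srM => //; first exact: (AE (zs _ (rz _ Ra))).
  by case: (ER b Rb b0).
exists (rem x z); split=> //.
- by move=> y yr; apply: AE; apply: zs; apply: rz; exact: mem_pol.
- exact: indep_rem.
- by split=> //; exact: AE.
have nt : ~ cl (frac (pol (rem x z))) t.
  move=> ct; have /(ord_unitP dE) [_] := subfield_valring hk (dvr_valring dE) kE ct t0.
  by rewrite ot.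
have hx : cl (frac (pol (t :: rem x z))) x.
  rewrite pol_cons -frac_adjoin_frac //; apply: exchange => //.
  rewrite frac_adjoin_frac // -(pol_rem xz); exact: cl_setT.
move=> y; have := cl_setT sz y.
have hF := cl_subfield (frac_subfield (pol_subring iota (t :: rem x z))).
have subF := sub_frac (pol_subring iota (t :: rem x z)).
apply: cl_min; apply: frac_min => //.
rewrite (pol_rem xz); apply: cl_adjoin; last by move=> _ ->.
by move=> c hc; apply: sub_cl; apply: subF; apply: polS hc => w; rewrite inE orbC => ->.
Qed.

(* Write [d^M x = t^j a]; the degree of the norm of [d^M x] in one of the variables is at
   least [j] because the norm of [t] has positive degree, and at most linear in [M]. *)
Lemma linear_bound sg : has (fun i => i != 0) sg ->
  exists c : nat, forall M x, sect sg M x -> x != 0 -> ord E x <= (c * M)%:Z.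
Proof.
move=> nsg; have [z [r [e [x [H [z1 sz hz he [xz hH eH sH]]]]]]] := noether_divisor.
have hZ := pol_subring iota z; have hL := frac_subfield hZ.
have hR := pol_subring iota (rem x z); have hk := frac_subfield hR.
have nx := hz x xz; have x0 := x_neq0 hz xz.
have [hW CW LW WL cW] := polW_facts hz xz.
have [|d [Ad d0 hd]] := @common_denom _ (pol s) sg hA1; first by move=> i _; rewrite fA.
have [|c0 hc0] := @cl_polW_bounds _ _ hz xz [seq d * i | i <- sg].
  by move=> _ /mapP [i isg ->]; apply: sz; exact: hd.
(* A section of the [M]-th power times [d ^+ M] has degree at most [c0 * M] in [x], and its norm at
   most [c0 * M * r]. *)
exists (c0 * r)%N => M y hy y0.
have hV V : valring V -> C `<=` V -> exists i, idx sg V i.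
  by move=> VV CV; have [i [? ? ?]] := valring_max (idfun : {rmorphism K -> K}) VV nsg; exists i.
have Ady : pol s (d ^+ M * y).
  apply: clA => V VV AV; have CV : C `<=` V by move=> c /(@C_pol _ _ iota s) /AV.
  have [i hi] := hV V VV CV; have [isg i0 _] := hi.
  have -> : d ^+ M * y = (d * i) ^+ M * (y / i ^+ M) by rewrite exprMn; field; rewrite expf_neq0.
  have [hVr _] := VV; apply: srM => //; last exact: (hy V VV CV).
  by apply: srX => //; apply: AV; exact: hd.
have dy0 : d ^+ M * y != 0 by rewrite mulf_neq0 ?expf_neq0.
have ody : 0 <= ord E (d ^+ M * y) by apply/(ord_ge0 dE dy0); exact: (AE Ady).
pose j := `|ord E (d ^+ M * y)|%N.
have ej : j%:Z = ord E (d ^+ M * y) by rewrite gez0_abs.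
have [|a Aa ea] := @divt_pow j _ Ady dy0; first by rewrite ej.
have a0 : a != 0 by apply: contraNneq dy0 => h; rewrite ea h mulr0.
have [B [hB B0 eB]] := norm_poly z1 sz hz he xz Aa a0.
have : cl (polW z x) ((d ^+ M * y) / x ^+ (c0 * M)).
  move=> V VV WV; have CV : C `<=` V by move=> c /CW /WV.
  have [i hi] := hV V VV CV; have [isg i0 _] := hi.
  have -> : d ^+ M * y / x ^+ (c0 * M) = (d * i / x ^+ c0) ^+ M * (y / i ^+ M).
    by rewrite exprM expr_div_n exprMn; field; rewrite !expf_neq0.
  have [hVr _] := VV; apply: srM => //; last exact: (hy V VV CV).
  by apply: srX => //; apply: (hc0 _ _ V VV WV); exact: map_f.
move/(normL_integral hL he hW LW WL cW).
have Lx : frac (pol z) x by apply: sub_frac => //; exact: mem_pol.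
have Lxi : frac (pol z) (x ^+ (c0 * M))^-1 by apply: hL.2; apply: srX => //; case: hL.
rewrite (normLM hL he) (normLa hL he Lxi) {1}ea (normLM hL he) (normLX hL he) eB eH.
move=> [P [Q [hP hQ Q0 sPQ ePQ]]].
have eq : H ^+ j * B * Q = P * 'X^(c0 * M * r).
  apply: (trans_eq hk nx).
  - apply: poverM; [by case: hk| |by []]; apply: poverM; [by case: hk| |].
      by apply: poverE; [by case: hk|apply: pover_sub hH; exact: sub_frac].
    by apply: pover_sub hB; exact: sub_frac.
  - by apply: poverM; [by case: hk| |apply: poverXn; case: hk].
  rewrite !hornerM !horner_exp hornerX.
  have q0 := trans_horner_neq0 hk nx hQ Q0.
  have -> : P.[x] = H.[x] ^+ j * B.[x] / x ^+ (c0 * M) ^+ r * Q.[x].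
    by rewrite exprVn in ePQ; rewrite ePQ mulfVK.
  by rewrite -exprM; field; rewrite expf_neq0.
have H0 : H != 0 by rewrite -size_poly_gt0 (ltn_trans _ sH).
have jle : (j <= c0 * M * r)%N.
  have P0 : P != 0.
    apply: contra_eq_neq eq => ->; rewrite mul0r !mulf_neq0 //.
    by rewrite expf_neq0.
  have := congr1 (fun p : {poly K} => size p) eq.
  rewrite /= size_mulXn // !size_mul ?mulf_neq0 ?expf_neq0 //.
  have := size_exp_pred H j; have : (0 < size (H ^+ j)%R)%N by rewrite size_poly_gt0 expf_neq0.
  have : (0 < size B)%N by rewrite size_poly_gt0.
  have : (0 < size Q)%N by rewrite size_poly_gt0.
  move: sPQ sH; move: (size (polyseq (H ^+ j)%R)) => a1.
  move: (size (polyseq H)) (size (polyseq B)) (size (polyseq Q)) (size (polyseq P)) => b1 c1 d1 e1.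
  exact: degree_count.
have : ord E (d ^+ M * y) = ord E d *+ M + ord E y by rewrite ordM ?expf_neq0 // ordX.
have od : 0 <= ord E d by apply/(ord_ge0 dE d0); exact: (AE Ad).
have : 0 <= ord E d *+ M by rewrite mulrn_wge0.
rewrite -ej => h1 h2; have -> : ord E y = j%:Z - ord E d *+ M by rewrite h2 addrC addKr.
by apply: (@le_trans _ _ j%:Z); [rewrite gerBl|rewrite lez_nat mulnAC].
Qed.

End DivisorRing.

End DivisorCoordinates.

(** * Affine rings on which a prime divisor is principal *)

Section PrimeDivisors.
Context {R : realType} {K : fieldType} (iota : {rmorphism R[i] -> K}).
Implicit Types (A B L V P Q E F : set K) (X Y : set (set K)) (x y z u : K) (s l : seq K).

Local Notation C := (range iota).
Local Notation pol s := (adjoin C [set` s]).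

Lemma loc_denom A pr l : is_subring A -> prime_ideal A pr ->
  (forall x, x \in l -> localization A pr x) ->
  exists b, [/\ A b, ~ pr b & forall x, x \in l -> A (b * x)].
Proof.
move=> hA hp; elim: l => [|x l ih] h.
  by exists 1; split=> //; [exact: sr1|exact: (prime_N1 hp)].
have [|d [hd d0 hs]] := ih; first by move=> y ys; apply: h; rewrite inE ys orbT.
have [a [b [ha hb b0 ex]]] := h x (mem_head _ _).
exists (d * b); split; [exact: srM|exact: (primeNM hp)|].
move=> y; rewrite inE => /orP[/eqP->|/hs h']; last by rewrite mulrAC; apply: srM.
rewrite ex (_ : d * b * (a / b) = d * a); first exact: srM.
by field; exact: (prime_nz hp).
Qed.

Lemma loc_ideal A pr x : is_subring A -> prime_ideal A pr -> A x ->
  max_ideal (localization A pr) x <-> pr x.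
Proof.
move=> hA hp Ax; split.
  by move=> [_ nu]; apply: contrapT => nx; apply: nu; apply/(loc_unit hA hp).
move=> px; split; first exact: (sub_loc hA hp).
by move=> /(loc_unit hA hp Ax).
Qed.

(** [pr] is finitely generated and each generator is a multiple of the uniformizer in the
    localization; one [b] clears all these denominators. *)
Lemma local_uniformizer A pr E : is_subring A -> noeth A -> prime_ideal A pr ->
  E = localization A pr -> is_dvr E ->
  exists t b, [/\ A t, t != 0 & ord E t = 1] /\
    [/\ A b, ~ pr b & forall x, pr x -> A (b * (x / t))].
Proof.
move=> hA nA hp eE dE; have [t0 [t00 Et0 ot0]] := ord_unif dE; have hE : is_subring E by case: dE.
have [a [b0 [Aa Ab0 nb0 et]]] : localization A pr t0 by rewrite -eE.
have b00 := prime_nz hp nb0.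
have ea : a = t0 * b0 by rewrite et mulfVK.
have a0 : a != 0 by rewrite ea mulf_neq0.
have oa : ord E a = 1.
  rewrite ea ordM // ot0; have /(ord_unitP dE) [_ ->] : unit_in E b0 by rewrite eE; apply/(loc_unit hA hp).
  by rewrite addr0.
have [l [lp pl]] := noeth_fg hA nA (prime_ideal_ideal hp).
have prA x : pr x -> A x by case: hp => + _ _ _ _; apply.
have [|b [Ab nb hb]] := @loc_denom A pr [seq x / a | x <- l] hA hp.
  move=> _ /mapP [x xl ->]; rewrite -eE; have px := lp x xl.
  have [->|x0] := eqVneq x 0; first by rewrite mul0r; exact: sr0.
  have : max_ideal E x by rewrite eE; apply/(loc_ideal hA hp) => //; exact: prA.
  move/(max_idealP dE x0) => ox; apply/(ord_ge0 dE); first by rewrite mulf_neq0 ?invr_eq0.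
  by rewrite (ordM dE) ?invr_eq0 // (ordV dE) // oa subr_ge0.
exists a, b; do 2!split=> //; move=> x /pl.
suff sub : ispan A l `<=` [set x | A x /\ A (b * (x / a))] by move=> /sub [].
apply: ispan_min.
  split=> /=.
  - by move=> y [].
  - by rewrite mul0r mulr0; split; exact: sr0.
  - by move=> y z [? ?] [? ?]; rewrite mulrDl mulrDr; split; exact: srD.
  - by move=> c y Ac [? ?]; rewrite -mulrA mulrCA; split; exact: srM.
by move=> y yl /=; split; [exact/prA/lp|apply: hb; exact: map_f].
Qed.

Lemma chart_pol s si : chart iota s si = pol [seq sj / si | sj <- s].
Proof. exact: chartE. Qed.

(** Adjoining the inverse of the [b] of [local_uniformizer] to a chart makes the ideal of [E]
    principal, and the ring stays integrally closed. *)
Lemma divisor_ring s X E : X = projective_over C s -> X setT -> normal X -> prime_divisor X E ->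
  exists l t, [/\ cl (pol l) `<=` pol l, frac (pol l) = setT, pol l `<=` E & pol l t] /\
    (ord E t = 1 /\ forall a, pol l a -> a != 0 -> 0 < ord E a -> pol l (a / t)).
Proof.
move=> Xs XT Xn pE; have dE := prime_divisor_dvr Xs XT Xn pE; have [XE kE] := pE.
have [si [p [i1 i2 hp eE]]] := ptP Xs XE.
set A := chart iota s si in hp eE; have hA : is_subring A := chart_subring iota s si.
have nA : noeth A by exact: chart_noeth.
have fA : frac A = setT := frac_chart Xs XT i1 i2.
have hE : is_subring E by case: dE.
have [t [b [[At t0 ot] [Ab nb hb]]]] := local_uniformizer hA nA hp eE dE.
have b0 := prime_nz hp nb.
pose l := b^-1 :: [seq sj / si | sj <- s].
have el : pol l = adjoin A [set b^-1] by rewrite pol_cons /A chart_pol.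
have hl := pol_subring iota l.
have Al : A `<=` pol l by rewrite el => x; exact: mem_adjoinl.
have lbi : pol l b^-1 by apply: mem_pol; rewrite mem_head.
have AE : A `<=` E by rewrite eE; exact: sub_loc.
have ub : unit_in E b by rewrite eE; apply/(loc_unit hA hp).
have clear x : pol l x -> exists n, forall m, (n <= m)%N -> A (b ^+ m * x).
  rewrite el => /(adjoin1P _ _ hA) [q hq ->]; exists (size q) => m qm.
  rewrite horner_coef mulr_sumr; apply: (sr_sum hA) => i _; rewrite mulrCA exprVn.
  apply: (srM hA) => //; rewrite mulrC exprVB //; first exact: (srX hA).
  by apply: ltnW; apply: leq_trans qm.
exists l, t; split; split=> //.
- move=> x /cl_integral -/(_ hl) [q [qm hq qx]]; have [n sp e] := monic_rootE qm qx.
  have /choice [f hf] : forall i, exists n, forall m, (n <= m)%N -> A (b ^+ m * q`_i).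
    by move=> i; exact: clear.
  pose N := (\max_(i < n) f i).+1.
  have : cl A (b ^+ N * x).
    apply: (@cl_of_pow _ _ _ n (fun i => - (b ^+ (N * (n - i)) * q`_i))) => //.
      move=> i hi; apply: (srN hA); apply: hf.
      have : (f i <= \max_(i < n) f i)%N by exact: (leq_bigmax (Ordinal hi)).
      have : (0 < n - i)%N by rewrite subn_gt0.
      by rewrite /N; move: (f i) (\max_(i < n) _)%N (n - i)%N => a1 b1 d1; nia.
    rewrite exprMn e mulrN mulr_sumr -sumrN; apply: eq_bigr => i _.
    rewrite mulNr exprMn -!exprM; congr (- _).
    have -> : (N * n = N * (n - i) + N * i)%N by rewrite -mulnDr subnK // ltnW.
    by rewrite exprD; ring.
  move=> /(chart_cl Xs Xn i1 i2) h; rewrite -[x](mulKf (expf_neq0 N b0)).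
  apply: (srM hl); last exact: Al.
  by rewrite -exprVn; exact: (srX hl).
- apply/seteqP; split=> // x _; have : frac A x by rewrite fA.
  by apply: fracS.
- rewrite el; apply: adjoin_min => //.
  by move=> _ ->; case: ub.
- exact: Al.
- move=> a la a0 oa; have [n hn] := clear a la.
  have Aa := hn n (leqnn n).
  have pa : p (b ^+ n * a).
    apply/(loc_ideal hA hp Aa); rewrite -eE; apply/max_idealP => //.
      by rewrite mulf_neq0 // expf_neq0.
    rewrite (ordM dE) ?expf_neq0 //; have /(ord_unitP dE) [_ ->] := unit_inX hE n ub.
    by rewrite add0r.
  have := Al _ (hb _ pa); rewrite (_ : a / t = b^-1 ^+ n.+1 * (b * (b ^+ n * a / t))).
    by move=> h; apply: (srM hl) => //; exact: (srX hl).
  by rewrite exprVn exprS; field; rewrite b0 t0 expf_neq0.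
Qed.

Lemma prime_dcoord s X E : X = projective_over C s -> X setT -> normal X -> prime_divisor X E ->
  exists l t, dcoord iota E l t.
Proof.
move=> Xs XT Xn pE; have dE := prime_divisor_dvr Xs XT Xn pE.
have [l [t [[h1 h2 h3 h4] [h5 h6]]]] := divisor_ring Xs XT Xn pE.
by have [l' h] := divisor_dcoord dE h2 h3 h4 h5 h6; exists l', t.
Qed.

Lemma prime_linear_bound s X E sg : X = projective_over C s -> X setT -> normal X ->
  prime_divisor X E -> has (fun i => i != 0) sg ->
  exists c : nat, forall M x, sect iota sg M x -> x != 0 -> ord E x <= (c * M)%:Z.
Proof.
move=> Xs XT Xn pE; have dE := prime_divisor_dvr Xs XT Xn pE.
have [l [t [[h1 h2 h3 h4] [h5 h6]]]] := divisor_ring Xs XT Xn pE.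
exact: (linear_bound dE h1 h2 h3 h4 h5 h6).
Qed.

End PrimeDivisors.

(** * Derivations along a field endomorphism and their extension *)

Section Derivations.
Context {R : realType} {K : fieldType} (iota : {rmorphism R[i] -> K}).
Implicit Types (A B L V P Q E F : set K) (x y z u : K) (s l : seq K) (p q : {poly K}).

Local Notation C := (range iota).
Local Notation pol s := (adjoin C [set` s]).

(* The target is a module over the source through [phi]. *)
Definition pderiv (phi : {rmorphism K -> K}) (d : K -> K) :=
  [/\ forall c, d (iota c) = 0, forall x y, d (x + y) = d x + d y
    & forall x y, d (x * y) = phi x * d y + d x * phi y].

Lemma derivation_pderiv d : derivation iota d <-> pderiv idfun d.
Proof. by split=> -[]. Qed.

Section PDeriv.
Variables (phi : {rmorphism K -> K}) (d : K -> K).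
Hypothesis hd : pderiv phi d.

Lemma pd0 : d 0 = 0. Proof. by case: hd => h _ _; have := h 0; rewrite rmorph0. Qed.
Lemma pd1 : d 1 = 0. Proof. by case: hd => h _ _; have := h 1; rewrite rmorph1. Qed.
Lemma pdD x y : d (x + y) = d x + d y. Proof. by case: hd. Qed.
Lemma pdM x y : d (x * y) = phi x * d y + d x * phi y. Proof. by case: hd. Qed.
Lemma pd_sum I (r : seq I) (F : I -> K) : d (\sum_(i <- r) F i) = \sum_(i <- r) d (F i).
Proof. by elim: r => [|i r ih]; rewrite ?big_nil ?pd0 // !big_cons pdD ih. Qed.
Lemma pdN x : d (- x) = - d x.
Proof. by apply/eqP; rewrite -addr_eq0 -pdD addNr pd0. Qed.
Lemma pdX x n : d (x ^+ n) = phi x ^+ n.-1 *+ n * d x.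
Proof.
elim: n => [|n ih]; first by rewrite pd1 mulr0n mul0r.
rewrite exprS pdM ih rmorphXn; case: n {ih} => [|n]; first by rewrite mulr0n mul0r mulr0 add0r mulr1 mul1r.
rewrite /= [in RHS]mulrSr mulrDl; congr (_ + _); last by rewrite mulrC.
by rewrite mulrA mulrnAr -exprS.
Qed.
Lemma pdV x : x != 0 -> d x^-1 = - d x / phi x ^+ 2.
Proof.
move=> x0; have px0 : phi x != 0 by rewrite fmorph_eq0.
have : d (x * x^-1) = 0 by rewrite divff // pd1.
rewrite pdM fmorphV => /eqP; rewrite addr_eq0 => /eqP e.
by apply: (mulfI px0); rewrite e; field.
Qed.
End PDeriv.

Definition Dp (d : K -> K) p := \poly_(i < size p) d p`_i.

Lemma coef_Dp d p i : d 0 = 0 -> (Dp d p)`_i = d p`_i.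
Proof. by move=> d0; rewrite coef_poly; case: ltnP => // h; rewrite nth_default. Qed.

Lemma pd_horner phi d p x : pderiv phi d ->
  d p.[x] = (Dp d p).[phi x] + (map_poly phi p^`()).[phi x] * d x.
Proof.
move=> hd; rewrite horner_coef (pd_sum hd) horner_poly.
under eq_bigr do rewrite (pdM hd) (pdX hd) rmorphXn addrC.
rewrite big_split /=; congr (_ + _).
have -> : (map_poly phi p^`()).[phi x] = \sum_(i < size p) phi p`_i * (phi x ^+ i.-1 *+ i).
  rewrite -deriv_map; case: (posnP (size p)) => [/eqP|sp].
    by rewrite size_poly_eq0 => /eqP ->; rewrite size_poly0 big_ord0 rmorph0 deriv0 horner0.
  have sd : (size (map_poly phi p)^`() <= (size p).-1)%N.
    have [->|p0] := eqVneq p 0; first by rewrite rmorph0 deriv0 size_poly0.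
    rewrite -ltnS prednK //; have := lt_size_deriv (p := map_poly phi p).
    by rewrite size_map_poly map_poly_eq0; apply.
  rewrite (horner_coef_wide _ sd); case: (size p) sp => // m _.
  rewrite [RHS]big_ord_recl mulr0n mulr0 add0r.
  by apply: eq_bigr => i _; rewrite coef_deriv coef_map mulrnAr mulrnAl.
by rewrite mulr_suml; apply: eq_bigr => i _; rewrite mulrA.
Qed.

Lemma natn0 n : n.+1%:R != 0 :> K. Proof. exact: (natK_neq0 iota). Qed.

Lemma deriv_neq0 p : (1 < size p)%N -> p^`() != 0.
Proof.
move=> sp; apply/eqP => /polyP /(_ (size p).-2); rewrite coef_deriv coef0.
have -> : (size p).-2.+1 = (size p).-1 by case: (size p) sp => [|[]].
move/eqP; rewrite -mulr_natr mulf_eq0 -lead_coefE lead_coef_eq0 => /orP[/eqP p0|].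
  by rewrite p0 size_poly0 in sp.
by case: (size p) sp => [|[|m]] //= _; rewrite (negbTE (natn0 _)).
Qed.

(** In characteristic zero, minimality of the degree makes the derivative nonzero at [x]. The
    relation is not made monic, in order to keep its coefficients in [A]. *)
Lemma min_root A x : is_subring A -> cl (frac A) x -> exists p,
  [/\ pover A p, p != 0, root p x, p^`().[x] != 0 &
    forall q, pover A q -> root q x -> (size q < size p)%N -> q = 0].
Proof.
move=> hA /(cl_frac_poly hA) [p0 [p00 hp0 pr0]].
have ex : exists n, `[< exists p, [/\ size p = n, pover A p, p != 0 & root p x] >].
  by exists (size p0); apply/asboolP; exists p0.
case: (ex_minnP ex) => n /asboolP [p [sp hp pn0 pr]] hmin.
have minp q : pover A q -> root q x -> (size q < size p)%N -> q = 0.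
  move=> hq qr sq; apply/eqP; apply: contraLR sq => q0; rewrite -leqNgt sp.
  by apply: hmin; apply/asboolP; exists q.
have sp1 : (1 < size p)%N.
  rewrite ltnNge; apply/negP => /size1_polyC e; move: pr; rewrite e rootC => /eqP c0.
  by move: pn0; rewrite e c0 eqxx.
exists p; split=> //; apply/negP => d0.
have := minp p^`() (pover_deriv hA hp); rewrite rootE d0 => /(_ isT).
rewrite lt_size_deriv // => /(_ isT) /eqP; apply/negP; exact: deriv_neq0.
Qed.

Lemma pderiv_uniq phi d A x : pderiv phi d -> is_subring A -> (forall a, A a -> d a = 0) ->
  cl (frac A) x -> d x = 0.
Proof.
move=> hd hA dA /(min_root hA) [p [hp p0 pr pd _]].
have := pd_horner p x hd; rewrite (rootP pr) (pd0 hd).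
have -> : Dp d p = 0 by apply/polyP => i; rewrite coef_Dp ?(pd0 hd) // coef0 dA.
rewrite horner0 add0r horner_map => /esym/eqP; rewrite mulf_eq0 fmorph_eq0 (negbTE pd).
by move=> /= /eqP.
Qed.

(** A derivation of [A] into [K], encoded as a total function whose values outside [A] are
    arbitrary. *)
Definition pd A (d : K -> K) := [/\ forall c, d (iota c) = 0,
  forall x y, A x -> A y -> d (x + y) = d x + d y
  & forall x y, A x -> A y -> d (x * y) = x * d y + d x * y].

Section Extend.
Variables (A : set K) (d : K -> K).
Hypotheses (hA : is_subring A) (CA : C `<=` A) (hd : pd A d).

Let d0 : d 0 = 0. Proof. by case: hd => h _ _; have := h 0; rewrite rmorph0. Qed.
Let d1 : d 1 = 0. Proof. by case: hd => h _ _; have := h 1; rewrite rmorph1. Qed.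
Let dD x y : A x -> A y -> d (x + y) = d x + d y. Proof. by case: hd => _ + _; apply. Qed.
Let dM x y : A x -> A y -> d (x * y) = x * d y + d x * y.
Proof. by case: hd => _ _; apply. Qed.
Let dsum n (F : nat -> K) : (forall i, A (F i)) -> d (\sum_(i < n) F i) = \sum_(i < n) d (F i).
Proof.
move=> hF; elim: n => [|n ih]; first by rewrite !big_ord0.
by rewrite !big_ord_recr /= dD ?ih //; apply: sr_sum.
Qed.
Let dN x : A x -> d (- x) = - d x.
Proof.
by move=> Ax; apply/eqP; rewrite -addr_eq0 -dD ?addNr ?d0 //; exact: srN.
Qed.

Let DpD p q : pover A p -> pover A q -> Dp d (p + q) = Dp d p + Dp d q.
Proof. by move=> hp hq; apply/polyP => i; rewrite coef_Dp // coefD dD // [RHS]coefD !coef_Dp. Qed.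
Let DpN p : pover A p -> Dp d (- p) = - Dp d p.
Proof. by move=> hp; apply/polyP => i; rewrite coef_Dp // coefN dN // [RHS]coefN !coef_Dp. Qed.
Let DpM p q : pover A p -> pover A q -> Dp d (p * q) = p * Dp d q + Dp d p * q.
Proof.
move=> hp hq; apply/polyP => i; rewrite coef_Dp // [RHS]coefD !coefM.
rewrite (@dsum _ (fun j => p`_j * q`_(i - j))); last by move=> j; apply: srM.
by rewrite -big_split /=; apply: eq_bigr => j _; rewrite dM // !coef_Dp.
Qed.

Section Step.
Variables (x u : K).
(** The value forced on [p.[x]] by prescribing [u] at [x]; [compat] makes it depend on [p.[x]]
    only. *)
Definition dev p := (Dp d p).[x] + p^`().[x] * u.
Hypothesis compat : forall p, pover A p -> root p x -> dev p = 0.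

Lemma devD p q : pover A p -> pover A q -> dev (p + q) = dev p + dev q.
Proof. by move=> hp hq; rewrite /dev DpD // derivD !hornerD; ring. Qed.
Lemma devN p : pover A p -> dev (- p) = - dev p.
Proof. by move=> hp; rewrite /dev DpN // derivN !hornerN; ring. Qed.
Lemma devM p q : pover A p -> pover A q -> dev (p * q) = p.[x] * dev q + dev p * q.[x].
Proof. by move=> hp hq; rewrite /dev DpM // derivM !hornerE; ring. Qed.

Lemma extend_step : exists d', [/\ pd (adjoin A [set x]) d', forall a, A a -> d' a = d a & d' x = u].
Proof.
have /choice [f hf] : forall y, exists p, adjoin A [set x] y -> pover A p /\ y = p.[x].
  move=> y; have [h|h] := pselect (adjoin A [set x] y); last by exists 0.
  by have /(adjoin1P _ _ hA) [p h1 h2] := h; exists p.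
pose d' y := dev (f y).
have hd' p : pover A p -> d' p.[x] = dev p.
  move=> hp; have [hq e] := hf p.[x] ((adjoin1P _ _ hA).2 (ex_intro2 _ _ p hp erefl)).
  have h : pover A (f p.[x] - p) by exact: poverB.
  have := compat h; rewrite rootE hornerD hornerN -e subrr => /(_ (eqxx _)).
  rewrite devD ?devN //; last exact: poverN.
  by move/eqP; rewrite subr_eq0 => /eqP.
have dA a : A a -> d' a = d a.
  move=> Aa; have := hd' a%:P; rewrite hornerC => ->; last exact: poverC.
  rewrite /dev derivC horner0 mul0r addr0; have -> : Dp d a%:P = (d a)%:P.
    by apply/polyP => i; rewrite coef_Dp // !coefC; case: ifP.
  by rewrite hornerC.
exists d'; split=> //.
- split.
  + by move=> c; rewrite dA; [case: hd|apply: CA; exists c].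
  + move=> _ _ /(adjoin1P _ _ hA) [p hp ->] /(adjoin1P _ _ hA) [q hq ->].
    by rewrite -hornerD !hd' ?devD //; exact: poverD.
  + move=> _ _ /(adjoin1P _ _ hA) [p hp ->] /(adjoin1P _ _ hA) [q hq ->].
    by rewrite -hornerM !hd' ?devM //; exact: poverM.
- rewrite -{1}[x]hornerX hd'; last exact: poverX.
  rewrite /dev derivX hornerC mul1r; have -> : Dp d 'X = 0.
    by apply/polyP => i; rewrite coef_Dp // coefX coef0; case: (i == 1)%N.
  by rewrite horner0 add0r.
Qed.
End Step.

Lemma extend_trans x u : ~ cl (frac A) x ->
  exists d', [/\ pd (adjoin A [set x]) d', forall a, A a -> d' a = d a & d' x = u].
Proof.
move=> nx; apply: extend_step => p hp pr.
have -> : p = 0.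
  apply: (trans_poly0 (frac_subfield hA) nx) => //.
  by apply: pover_sub hp; exact: sub_frac.
rewrite /dev deriv0 horner0 mul0r addr0; have -> : Dp d 0 = 0.
  by apply/polyP => i; rewrite coef_Dp // !coef0.
by rewrite horner0.
Qed.

(** The minimal relation forces [u]. Other relations reduce to it by pseudo-division: as [A] is not
    a field, they are multiplied by the leading coefficient instead of dividing by it. *)
Lemma extend_alg x : cl (frac A) x ->
  exists d', pd (adjoin A [set x]) d' /\ forall a, A a -> d' a = d a.
Proof.
move=> /(min_root hA) [p [hp p0 pr px minp]].
pose u := - (Dp d p).[x] / p^`().[x].
have evp : dev x u p = 0 by rewrite /dev /u; field.
have [q hq qr|d' [h1 h2 _]] := @extend_step x u; last by exists d'.
move: (leqnn (size q)); move: {2}(size q) => n; elim: n q hq qr => [|n ih] q hq qr sq.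
  move: sq; rewrite leqn0 size_poly_eq0 => /eqP ->.
  rewrite /dev deriv0 horner0 mul0r addr0; have -> : Dp d 0 = 0.
    by apply/polyP => i; rewrite coef_Dp // !coef0.
  by rewrite horner0.
have [h|h] := ltnP (size q) (size p).
  rewrite (minp q hq qr h) /dev deriv0 horner0 mul0r addr0; have -> : Dp d 0 = 0.
    by apply/polyP => i; rewrite coef_Dp // !coef0.
  by rewrite horner0.
have lp : A (lead_coef p) by exact: hp.
have lp0 : lead_coef p != 0 by rewrite lead_coef_eq0.
pose r := q`_n *: 'X^(n.+1 - size p).
have hr : pover A r by apply: poverZ => //; exact: poverXn.
pose q1 := (lead_coef p)%:P * q - r * p.
have hlq : pover A ((lead_coef p)%:P * q) by apply: poverM => //; exact: poverC.
have hq1 : pover A q1 by apply: poverB => //; exact: poverM.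
have : dev x u q1 = 0.
  apply: ih => //; first by rewrite rootE /q1 hornerD hornerN !hornerM (rootP pr) (rootP qr) !mulr0 subrr.
  apply: size_drop_lead.
  - by rewrite mul_polyC (leq_trans (size_scale_leq _ _)).
  - rewrite /r -scalerAl (leq_trans (size_scale_leq _ _)) //.
    rewrite mulrC size_mulXn // subnK // (leq_trans h) //.
  - rewrite mul_polyC coefZ /r -scalerAl coefZ coefXnM.
    have -> : (n < n.+1 - size p)%N = false.
      by move: (size_poly_gt0 p); rewrite p0 => /=; move: (size (polyseq p)) => m; lia.
    have -> : (n - (n.+1 - size p) = (size p).-1)%N.
      have := leq_trans h sq; move: (size_poly_gt0 p); rewrite p0 => /=.
      by move: (size (polyseq p)) => m; lia.
    by rewrite -lead_coefE mulrC.
have hrp : pover A (r * p) by exact: poverM.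
rewrite /q1 devD ?devN //; last exact: poverN.
rewrite devM // ?devM //; last exact: poverC.
rewrite evp (rootP pr) (rootP qr) !mulr0 !addr0 subr0 hornerC => /eqP.
by rewrite mulf_eq0 (negbTE lp0) => /eqP.
Qed.

Lemma extend_frac : frac A = setT -> exists d', derivation iota d' /\ forall a, A a -> d' a = d a.
Proof.
move=> fA; have /choice [f hf] : forall y, exists ab : K * K, [/\ A ab.1, A ab.2, ab.2 != 0 & y = ab.1 / ab.2].
  move=> y; have : frac A y by rewrite fA.
  by move=> [a [b [h1 h2 h3 h4]]]; exists (a, b).
pose d' y := (d (f y).1 - y * d (f y).2) / (f y).2.
have hd' y a b : A a -> A b -> b != 0 -> y = a / b -> d' y = (d a - y * d b) / b.
  move=> Aa Ab b0 e; have [Aa' Ab' b0' e'] := hf y; rewrite /d'.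
  move: (f y) Aa' Ab' b0' e' => [a' b'] /= Aa' Ab' b0' e'.
  have ea : a = y * b by rewrite e mulfVK.
  have ea' : a' = y * b' by rewrite e' mulfVK.
  have : a' * b = a * b' by rewrite ea ea'; ring.
  move/(congr1 d); rewrite !dM // => h.
  move: (d a) (d a') h => ua ua' h; apply/eqP; rewrite eqr_div //; apply/eqP.
  by rewrite !mulrBl -[ua' * b](addKr (a' * d b)) h ea ea'; ring.
have dA a : A a -> d' a = d a.
  by move=> Aa; rewrite (hd' a a 1) ?divr1 ?oner_eq0 ?d1 ?mulr0 ?subr0 //; exact: sr1.
exists d'; split=> //; split.
- by move=> c; rewrite dA; [case: hd|apply: CA; exists c].
- move=> y z; have [h1 h2 h3 h4] := hf y; have [k1 k2 k3 k4] := hf z.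
  move: (f y) (f z) h1 h2 h3 h4 k1 k2 k3 k4 => [a b] [a' b'] /= h1 h2 h3 h4 k1 k2 k3 k4.
  rewrite (hd' y a b) // (hd' z a' b') // (hd' _ (a * b' + a' * b) (b * b')) ?mulf_neq0 //.
  + rewrite dD ?dM //; try exact: srM.
    by rewrite h4 k4; field; rewrite h3 k3.
  + by apply: srD => //; exact: srM.
  + exact: srM.
  + by rewrite h4 k4; field; rewrite h3 k3.
- move=> y z; have [h1 h2 h3 h4] := hf y; have [k1 k2 k3 k4] := hf z.
  move: (f y) (f z) h1 h2 h3 h4 k1 k2 k3 k4 => [a b] [a' b'] /= h1 h2 h3 h4 k1 k2 k3 k4.
  rewrite (hd' y a b) // (hd' z a' b') // (hd' _ (a * a') (b * b')) ?mulf_neq0 //.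
  + rewrite !dM //; by rewrite h4 k4; field; rewrite h3 k3.
  + exact: srM.
  + exact: srM.
  + by rewrite h4 k4; field; rewrite h3 k3.
Qed.
End Extend.

Lemma extend_algs A d s : is_subring A -> C `<=` A -> pd A d -> (forall x, x \in s -> cl (frac A) x) ->
  exists d', pd (adjoin A [set` s]) d' /\ forall a, A a -> d' a = d a.
Proof.
move=> hA CA hd; elim: s => [|x s ih] hs; first by exists d; rewrite adjoin_nil.
have [|d' [hd' e]] := ih; first by move=> y ys; apply: hs; rewrite inE ys orbT.
have hB := adjoin_subring A [set` s]; have AB a : A a -> adjoin A [set` s] a by exact: mem_adjoinl.
have [||d'' [h1 h2]] := extend_alg hB _ hd' (x := x).
- by move=> c /CA /AB.
- by apply: (clS (fracS AB)); apply: hs; rewrite mem_head.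
by rewrite adjoin_cons; exists d''; split=> // a Aa; rewrite h2 ?e //; exact: AB.
Qed.

Lemma derivation_exists A d s : is_subring A -> C `<=` A -> pd A d ->
  (forall x, cl (frac A) x) -> frac (pol s) = setT ->
  exists d', derivation iota d' /\ forall a, A a -> d' a = d a.
Proof.
move=> hA CA hd hcl fs; have [d' [hd' e]] := extend_algs hA CA hd (fun x (_ : x \in s) => hcl x).
have hB := adjoin_subring A [set` s]; have AB a : A a -> adjoin A [set` s] a by exact: mem_adjoinl.
have [||d'' [h1 h2]] := extend_frac hB _ hd'.
- by move=> c /CA /AB.
- apply/seteqP; split=> // x _; have : frac (pol s) x by rewrite fs.
  apply: fracS; apply: pol_min => //; first by move=> c /CA /AB.
  by move=> y ys; exact: mem_adjoinr.
by exists d''; split=> // a Aa; rewrite h2 ?e //; exact: AB.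
Qed.

(** Triangular form of independence, fitted to prescribing a derivation one coordinate at a time. *)
Fixpoint tower s := if s is x :: s' then ~ cl (frac (pol s')) x /\ tower s' else True.

Lemma tower_pd s (u : nat -> K) : tower s ->
  exists d, pd (pol s) d /\ forall i, (i < size s)%N -> d s`_i = u i.
Proof.
elim: s u => [|x s ih] u /=.
  move=> _; exists (fun=> 0); split=> //; split=> // *; first by rewrite addr0.
  by rewrite mulr0 mul0r addr0.
move=> [nx /ih -/(_ (fun i => u i.+1)) [d [hd e]]].
have [d' [h1 h2 h3]] := extend_trans (pol_subring iota s) (@C_pol _ _ iota s) hd (u 0%N) nx.
rewrite pol_cons; exists d'; split=> // -[|i] hi //=; rewrite h2 ?e //.
by apply: mem_pol; exact: mem_nth.
Qed.

(* The last clause makes [x] a transcendence basis. *)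
Definition dual_basis n (x : 'I_n -> K) (d : 'I_n -> K -> K) :=
  [/\ forall i, derivation iota (d i), forall i j, d i (x j) = (i == j)%:R &
    forall phi e, pderiv phi e -> (forall i, e (x i) = 0) -> forall y, e y = 0].

Lemma tower_dual s s0 : tower s -> (forall x, cl (frac (pol s)) x) -> frac (pol s0) = setT ->
  exists d, dual_basis (fun i : 'I_(size s) => s`_i) d.
Proof.
move=> ts hs f0.
have /choice [d hd] : forall i : 'I_(size s), exists d, derivation iota d /\
    forall j : 'I_(size s), d s`_j = (i == j)%:R.
  move=> i; have [d [hd e]] := tower_pd (fun j => (val i == j)%:R) ts.
  have [d' [h1 h2]] := derivation_exists (pol_subring iota s) (@C_pol _ _ iota s) hd hs f0.
  by exists d'; split=> // j; rewrite h2 ?e //; apply: mem_pol; exact: mem_nth.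
exists d; split=> [i|i j|phi e he e0 y]; [by case: (hd i)|by case: (hd i)|].
apply: (pderiv_uniq he (pol_subring iota s)) => // a.
apply: (@pol_min _ _ iota s [set a | e a = 0]).
- apply/subringP; split=> /=; first exact: (pd1 he).
    by move=> b c eb ec; rewrite (pdD he) (pdN he) eb ec subrr.
  by move=> b c eb ec; rewrite (pdM he) eb ec mulr0 mul0r addr0.
- by move=> _ [c _ <-] /=; case: he.
- by move=> z /(nthP 0) [i hi <-]; exact: (e0 (Ordinal hi)).
Qed.

(** The formal partial derivatives are carried over by evaluation at [t], which is injective, and
    then extended to [K]. *)
Lemma mmap_dual n (t : 'I_n -> K) s0 : transcendence_basis iota t -> frac (pol s0) = setT ->
  exists d, dual_basis t d.
Proof.
move=> [tinj talg] f0; pose ev := mpoly.mmap iota t.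
pose A := range ev.
have hA : is_subring A.
  apply/subringP; split; first by exists (1 : mpoly.mpoly n R[i]) => //; rewrite /ev rmorph1.
    by move=> _ _ [p _ <-] [q _ <-]; exists (p - q) => //; rewrite /ev rmorphB.
  by move=> _ _ [p _ <-] [q _ <-]; exists (p * q) => //; rewrite /ev rmorphM.
have CA : C `<=` A.
  by move=> _ [c _ <-]; exists (mpoly.mpolyC n c) => //; rewrite /ev mpoly.mmapC.
have evt i : ev (mpoly.mpolyX R[i] (mpoly.mnm1 i)) = t i.
  by rewrite /ev mpoly.mmapX mpoly.mmap1U.
have tA : adjoin C (range t) `<=` A.
  apply: adjoin_min => // _ [i _ <-]; by rewrite -evt; exists (mpoly.mpolyX R[i] (mpoly.mnm1 i)).
have hcl x : cl (frac A) x.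
  have [f [f0' hf fx]] := talg x; apply: (@cl_root _ _ f) => //; first exact: frac_subfield.
  by move=> i; apply: sub_frac => //; apply: tA; exact: hf.
have /choice [g hg] : forall y, exists p : mpoly.mpoly n R[i], A y -> y = ev p.
  by move=> y; have [[p _ <-]|h] := pselect (A y); [exists p|exists 0].
have gev (p : mpoly.mpoly n R[i]) : g (ev p) = p.
  by apply: tinj; rewrite -[LHS]/(ev _) -hg //; exists p.
have /choice [d hd] : forall i : 'I_n, exists d, derivation iota d /\ forall p : mpoly.mpoly n R[i], d (ev p) = ev (mpoly.mderiv i p).
  move=> i; have [|d [h1 h2]] := @derivation_exists A (fun y => ev (mpoly.mderiv i (g y))) s0 hA CA _ hcl f0.
    split.
    - move=> c; have -> : iota c = ev (mpoly.mpolyC n c) by rewrite /ev mpoly.mmapC.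
      by rewrite gev mpoly.mderivC /ev rmorph0.
    - move=> _ _ [p _ <-] [q _ <-]; have -> : ev p + ev q = ev (p + q) by rewrite /ev rmorphD.
      by rewrite !gev mpoly.mderivD /ev rmorphD.
    - move=> _ _ [p _ <-] [q _ <-]; have -> : ev p * ev q = ev (p * q) by rewrite /ev rmorphM.
      by rewrite !gev mpoly.mderivM /ev rmorphD !rmorphM addrC.
  by exists d; split=> // p; rewrite h2 ?gev //; exists p.
exists d; split=> [i|i j|phi e he e0 y]; [by case: (hd i)| |].
  rewrite -evt; have [_ ->] := hd i; rewrite mpoly.mderivX /ev.
  rewrite mpoly.mmapZ mpoly.mmapX mpoly.mnmE eq_sym rmorph_nat.
  have [->|ne] := eqVneq i j; last by rewrite mul0r.
  rewrite mul1r; have -> : mpoly.mnm_sub (mpoly.mnm1 j) (mpoly.mnm1 j) = mpoly.mnm0.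
    by apply/mpoly.mnmP => l; rewrite mpoly.mnmBE subnn mpoly.mnm0E.
  by rewrite mpoly.mmap11.
apply: (pderiv_uniq he (adjoin_subring C (range t))); last first.
  have [f [f0' hf fx]] := talg y; apply: (@cl_root _ _ f) => //.
    exact/frac_subfield/adjoin_subring.
  by move=> i; apply: sub_frac; [exact: adjoin_subring|exact: hf].
move=> a; apply: (@adjoin_min _ C (range t) [set a | e a = 0]).
- apply/subringP; split=> /=; first exact: (pd1 he).
    by move=> b c eb ec; rewrite (pdD he) (pdN he) eb ec subrr.
  by move=> b c eb ec; rewrite (pdM he) eb ec mulr0 mul0r addr0.
- by move=> _ [c _ <-] /=; case: he.
- by move=> _ [i _ <-]; exact: e0.
Qed.

Section DualBasis.
Variables (n : nat) (x : 'I_n -> K) (d : 'I_n -> K -> K).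
Hypothesis hxd : dual_basis x d.

(** The difference of the two sides is a derivation along [phi] that kills every [x i]. *)
Lemma dual_expand phi e y : pderiv phi e -> e y = \sum_i e (x i) * phi (d i y).
Proof.
have [h1 h2 h3] := hxd => he.
pose e' y := e y - \sum_i e (x i) * phi (d i y).
suff : e' y = 0 by move/eqP; rewrite subr_eq0 => /eqP.
apply: (h3 phi); last first.
  move=> i; rewrite /e' (bigD1 i) //= h2 eqxx rmorph1 mulr1 big1 ?addr0 ?subrr //.
  by move=> j /negbTE ji; rewrite h2 ji rmorph0 mulr0.
have [k1 k2 k3] := he; split.
- by move=> c; rewrite /e' k1 big1 ?subr0 // => i _; have [-> _ _] := h1 i; rewrite rmorph0 mulr0.
- move=> a b; rewrite /e' k2 -addrACA -opprD -big_split /=; congr (_ - _).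
  by apply: eq_bigr => i _; have [_ -> _] := h1 i; rewrite rmorphD mulrDr.
- move=> a b; rewrite /e' k3 mulrBr mulrBl addrACA -opprD; congr (_ - _).
  rewrite mulr_sumr mulr_suml -big_split /=; apply: eq_bigr => i _.
  by have [_ _ ->] := h1 i; rewrite rmorphD !rmorphM; ring.
Qed.

Lemma dual_derivation e y : derivation iota e -> e y = \sum_i e (x i) * d i y.
Proof. by move=> /derivation_pderiv /dual_expand ->. Qed.
End DualBasis.

(** The two Jacobian matrices are inverse to each other. *)
Lemma dual_dim n m (x : 'I_n -> K) d (x' : 'I_m -> K) d' :
  dual_basis x d -> dual_basis x' d' -> n = m.
Proof.
move=> h h'; have [h1 h2 _] := h; have [h1' h2' _] := h'.
pose J := \matrix_(i, j) d i (x' j); pose J' := \matrix_(i, j) d' i (x j).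
have e1 : J *m J' = 1%:M.
  apply/matrixP => i j; rewrite !mxE -h2 (dual_derivation h' _ (h1 i)).
  by apply: eq_bigr => l _; rewrite !mxE.
have e2 : J' *m J = 1%:M.
  apply/matrixP => i j; rewrite !mxE -h2' (dual_derivation h _ (h1' i)).
  by apply: eq_bigr => l _; rewrite !mxE.
by apply/eqP; rewrite eqn_leq (mulmx1_min e1) (mulmx1_min e2).
Qed.

End Derivations.

(** * Derivations preserving a divisor and the order of a top form *)

Section OrderOfForms.
Context {R : realType} {K : fieldType} (iota : {rmorphism R[i] -> K}).
Implicit Types (A B L V P Q E F : set K) (x y z u : K) (s l : seq K) (p q : {poly K}).

Local Notation C := (range iota).
Local Notation pol s := (adjoin C [set` s]).

Lemma deriv_pol D E l : derivation iota D -> is_subring E -> C `<=` E ->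
  (forall x, x \in l -> E x /\ E (D x)) -> forall x, pol l x -> E x /\ E (D x).
Proof.
move=> /derivation_pderiv hD hE CE hl x hx; apply: (@pol_min _ _ iota l [set x | E x /\ E (D x)]) hx.
- apply/subringP; split=> /=.
  + by split; [exact: sr1|rewrite (pd1 hD); exact: sr0].
  + by move=> y z [? ?] [? ?]; rewrite (pdD hD) (pdN hD); split; exact: srB.
  + by move=> y z [? ?] [? ?]; rewrite (pdM hD); split; [exact: srM|apply: srD => //; exact: srM].
- by move=> c Cc /=; split; [exact: CE|have [h _ _] := hD; have [a _ <-] := Cc; rewrite h; exact: sr0].
- by move=> y /hl.
Qed.

Lemma pdiv D x y : derivation iota D -> y != 0 -> D (x / y) = (D x - x / y * D y) / y.
Proof.
move=> /derivation_pderiv hD y0; rewrite (pdM hD) (pdV hD) //=; by field.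
Qed.

Lemma ord1_neq0 E t : is_dvr E -> ord E t = 1 -> t != 0.
Proof.
move=> dE ot; apply/eqP => e; have := ot; rewrite e /ord; case: xgetP => // k _ [t' [u [t'0 _ [u0 _ _]]]].
by move/esym/eqP; rewrite mulf_eq0 (negbTE u0) expfz_eq0 (negbTE t'0) andbF.
Qed.

Lemma dcoord_trans E l t : is_dvr E -> C `<=` E -> dcoord iota E l t -> ~ cl (frac (pol l)) t.
Proof.
move=> dE CE [lE il ul [Et ot] _] ct; have hE : is_subring E by case: dE.
have lE' : frac (pol l) `<=` E.
  move=> _ [a [b [ha hb b0 ->]]]; apply: srM => //; last by case: (ul b hb b0).
  by apply: (pol_min hE CE _ ha) => y /lE.
have := subfield_valring (frac_subfield (pol_subring iota l)) (dvr_valring dE) lE' ct (ord1_neq0 dE ot).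
by move=> /(ord_unitP dE) [_]; rewrite ot.
Qed.

Lemma indep_tower l : indep iota l -> tower iota l.
Proof. by elim: l => // x l ih /indep_cons [h1 h2]; split => //; exact: ih. Qed.

(* A residual relation of minimal degree gives [f(x) = t x'] with [f'(x)] a unit, and
   differentiating it turns a bound on [D x'] into a better bound on [D x]. *)
Lemma derivation_preserves E l t D b : is_dvr E -> C `<=` E -> dcoord iota E l t -> derivation iota D ->
  (forall x, x \in t :: l -> E (D x)) -> b != 0 -> (forall x, E x -> E (b * D x)) ->
  forall x, E x -> E (D x).
Proof.
move=> dE CE hc hD hl b0 hb; have hE : is_subring E by case: dE.
have [lE il ul [Et ot] hcl] := hc; have t0 := ord1_neq0 dE ot.
have hDl x : pol l x -> E x /\ E (D x).
  by apply: (deriv_pol hD hE CE) => y yl; split; [exact: lE|apply: hl; rewrite inE yl orbT].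
have [c hc'] : exists c, forall x, E x -> E (t ^+ c * D x).
  exists `|ord E b|%N => x /hb h; have [->|d0] := eqVneq (D x) 0; first by rewrite mulr0; exact: sr0.
  apply/(ord_ge0 dE); first by rewrite mulf_neq0 ?expf_neq0.
  have /(ord_ge0 dE) : b * D x != 0 by rewrite mulf_neq0.
  move=> /iffLR /(_ h); rewrite !(ordM dE) ?expf_neq0 // (ordX dE) // ot natz => h'.
  by apply: le_trans h' _; rewrite lerD2r abszE ler_norm.
elim: c hc' => [|c ih] hc'; first by move=> x /hc'; rewrite expr0 mul1r.
apply: ih => x Ex.
have [f [hf fx ufx]] : exists f, [/\ pover (pol l) f, max_ideal E f.[x] & unit_in E f^`().[x]].
  (* If no nonzero polynomial took a value in the maximal ideal, the field generated by [pol l] and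
     [x] would lie in [E]; by exchange [t] is algebraic over it, hence would be a unit. *)
  have [f0 [hf0 f00 hfx0]] : exists f, [/\ pover (pol l) f, f != 0 & max_ideal E f.[x]].
    apply: contrapT => no.
    have Ef f : pover (pol l) f -> E f.[x].
      by move=> hf; apply: (sr_horner hE) => // i; case: (hDl _ (hf i)).
    have uf f : pover (pol l) f -> f != 0 -> unit_in E f.[x].
      by move=> hf f0; apply: contrapT => nu; apply: no; exists f; split=> //; split=> //; exact: Ef.
    have nx : ~ cl (frac (pol l)) x.
      move=> /(cl_frac_poly (pol_subring iota l)) [f [f0 hf fx]].
      by have [] := uf f hf f0; rewrite (rootP fx) eqxx.
    have kf := frac_subfield (pol_subring iota l).
    have : cl (frac (adjoin (frac (pol l)) [set x])) t.
      apply: exchange => //; rewrite frac_adjoin_frac //; last exact: pol_subring.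
      by rewrite -pol_cons; exact: hcl.
    have hx := adjoin_subring (pol l) [set x].
    rewrite frac_adjoin_frac //; last exact: pol_subring.
    move=> ct; have FE : frac (adjoin (pol l) [set x]) `<=` E.
      move=> _ [a [d [/(adjoin1P _ _ (pol_subring iota l)) [p hp ->]
        /(adjoin1P _ _ (pol_subring iota l)) [q hq ->] d0 ->]]].
      apply: srM => //; first exact: Ef.
      have [|_ _ //] := uf q hq; by apply: contraNneq d0 => ->; rewrite horner0.
    have /(ord_unitP dE) [_] := subfield_valring (frac_subfield hx) (dvr_valring dE) FE ct t0.
    by rewrite ot.
  have ex : exists n, `[< exists f : {poly K}, [/\ size f = n, pover (pol l) f, f != 0 & max_ideal E f.[x]] >].
    by exists (size f0); apply/asboolP; exists f0.
  case: (ex_minnP ex) => n /asboolP [f [sf hf f0' hfx]] hmin.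
  exists f; split=> //; apply: contrapT => nu.
  have hf'' : pover (pol l) f^`() := pover_deriv (pol_subring iota l) hf.
  have f'0 : f^`() != 0.
    apply: (deriv_neq0 iota); rewrite ltnNge; apply/negP => /size1_polyC e; move: hfx.
    have c0 : f`_0 != 0 by apply: contraNneq f0' => h; rewrite e h.
    by rewrite e hornerC => -[_]; apply; exact: ul.
  have : (n <= size f^`())%N.
    apply: hmin; apply/asboolP; exists f^`(); split=> //; split=> //.
    by apply: (sr_horner hE) => // i; case: (hDl _ (hf'' i)).
  by apply/negP; rewrite -ltnNge -sf lt_size_deriv.
have [x' Ex' ex'] : exists2 x', E x' & f.[x] = t * x'.
  have [e|fn] := eqVneq f.[x] 0; first by exists 0; [exact: sr0|rewrite mulr0].
  exists (f.[x] / t); last by rewrite mulrC mulfVK.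
  apply/(ord_ge0 dE); first by rewrite mulf_neq0 ?invr_eq0.
  by rewrite (ordM dE) ?invr_eq0 // (ordV dE) // ot subr_ge0; apply/(max_idealP dE).
have /derivation_pderiv hD' := hD.
have := congr1 D ex'; rewrite (pd_horner f x hD') (pdM hD') map_poly_id // => e.
have /(congr1 ( *%R (t ^+ c))) : f^`().[x] * D x = t * D x' + D t * x' - (Dp D f).[x].
  by rewrite -e addrC addKr.
move=> e'.
have {}e' : t ^+ c * D x = (t ^+ c.+1 * D x' + t ^+ c * (D t * x') - t ^+ c * (Dp D f).[x]) / f^`().[x].
  have [u0 _ _] := ufx; apply: (mulIf u0); rewrite mulfVK // -[LHS]mulrA [D x * _]mulrC e' exprSr.
  by ring.
have Etc : E (t ^+ c) by exact: srX.
rewrite e'; apply: (srM hE); last by case: ufx.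
apply: (srB hE); last apply: (srM hE) => //.
  by apply: (srD hE); [exact: hc'|do 2!apply: (srM hE) => //; apply: hl; rewrite mem_head].
apply: (sr_horner hE) => // i; rewrite coef_Dp ?(pd0 hD') //.
by case: (hDl _ (hf i)).
Qed.

(* Coordinates of a divisorial valuation: the derivations dual to [x] freely generate those
   which preserve [E]. *)
Definition ecoord E n (x : 'I_n -> K) (d : 'I_n -> K -> K) :=
  [/\ dual_basis iota x d, forall i, E (x i) & forall i y, E y -> E (d i y)].

(** A derivation loses only a bounded order at [E]. This weak form holds for rings essentially of
    finite type; [derivation_preserves] turns it into no loss at all. *)
Definition bounded_der E := forall D, derivation iota D -> exists2 b, b != 0 & forall x, E x -> E (b * D x).

Lemma dcoord_dual E l t s0 : is_dvr E -> C `<=` E -> dcoord iota E l t -> frac (pol s0) = setT ->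
  bounded_der E -> exists d : 'I_(size l).+1 -> K -> K, ecoord E (fun i => (t :: l)`_i) d.
Proof.
move=> dE CE hc f0 bd; have [lE il ul [Et ot] hcl] := hc; have hE : is_subring E by case: dE.
have [|d hd] := @tower_dual _ _ iota (t :: l) s0 _ hcl f0.
  by split; [exact: (dcoord_trans dE CE hc)|exact: indep_tower].
exists d; split=> //.
  by move=> i; have := mem_nth 0 (ltn_ord i : (i < size (t :: l))%N); rewrite inE => /orP[/eqP->|/lE].
move=> i; have [h1 h2 _] := hd; have [b b0 hb] := bd _ (h1 i).
apply: (derivation_preserves dE CE hc) b0 hb => //.
move=> x /(nthP 0) [j hj <-]; rewrite (h2 i (Ordinal hj)).
exact: (sr_nat hE).
Qed.

(** One denominator clears [D] on the finitely many generators, then on [A] by the Leibniz rule and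
    on its localization by the quotient rule. *)
Lemma loc_bounded_der A pr E s : is_subring A -> prime_ideal A pr -> E = localization A pr ->
  is_dvr E -> A = pol s -> bounded_der E.
Proof.
move=> hA hp eE dE eA D hD; have hE : is_subring E by case: dE.
have AE : A `<=` E by rewrite eE; exact: sub_loc.
have CE : C `<=` E by move=> c hc; apply: AE; rewrite eA; exact: C_pol.
have [|b [Eb b0 hb]] := @common_denom _ E [seq D x | x <- s] hE; first by move=> x _; rewrite (dvr_frac dE).
have /derivation_pderiv hD' := hD.
have hbA x : A x -> E (b * D x).
  suff : A `<=` [set x | E x /\ E (b * D x)] by move=> h /h [].
  rewrite eA; apply: pol_min.
  - apply/subringP; split=> /=.
    + by split; [exact: sr1|rewrite (pd1 hD') mulr0; exact: sr0].
    + by move=> y z [? ?] [? ?]; rewrite (pdD hD') (pdN hD') mulrBr; split; exact: srB.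
    + move=> y z [? ?] [? ?]; rewrite (pdM hD') /= mulrDr [b * (y * _)]mulrCA [b * (_ * z)]mulrA; split; first exact: srM.
      by apply: srD => //; exact: srM.
  - move=> c Cc /=; split; first exact: CE.
    by have [h _ _] := hD'; have [a _ <-] := Cc; rewrite h mulr0; exact: sr0.
  - move=> y ys /=; split; last by apply: hb; exact: map_f.
    by apply: AE; rewrite eA; exact: mem_pol.
exists b => // x; rewrite {1}eE => -[a [c [Aa Ac nc ->]]].
have [c0 Ec ci] : unit_in E c by rewrite eE; apply/(loc_unit hA hp).
rewrite (pdiv _ hD) // mulrA; apply: srM => //; rewrite mulrBr mulrCA.
by apply: srB => //; [exact: hbA|apply: srM => //; [apply: srM => //; exact: AE|exact: hbA]].
Qed.

Lemma prime_ecoord s X E : X = projective_over C s -> X setT -> normal X -> prime_divisor X E ->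
  exists l t, dcoord iota E l t /\
  exists d : 'I_(size l).+1 -> K -> K, ecoord E (fun i => (t :: l)`_i) d.
Proof.
move=> Xs XT Xn pE; have dE := prime_divisor_dvr Xs XT Xn pE; have [XE _] := pE.
have [l [t hc]] := prime_dcoord Xs XT Xn pE; exists l, t; split=> //.
have [_ CE _ _ _] := pt_facts Xs XE.
have [si [p [i1 i2 hp eE]]] := ptP Xs XE; have hA := chart_subring iota s si.
have fA := frac_chart Xs XT i1 i2; rewrite chart_pol in fA.
apply: (dcoord_dual dE CE hc fA).
by apply: (loc_bounded_der hA hp eE dE); exact: chart_pol.
Qed.

Lemma min_intP (S : set int) k : S k -> (forall j, S j -> k <= j) -> min_int S = k.
Proof.
move=> Sk hk; rewrite /min_int; case: xgetP => [k' _ [h1 h2]|/(_ k)]; last by case.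
by apply/eqP; rewrite eq_le h2 // hk.
Qed.

Section Form.
Variables (w : @top_form K) (s0 : seq K).
Hypotheses (hw : nonzero_top_form iota w) (f0 : frac (pol s0) = setT).

Local Notation n := (form_dim w).

Lemma ecoord_dim E m (x : 'I_m -> K) d : ecoord E x d -> m = n.
Proof.
by move=> [h _ _]; have [h' _] := hw; have [d' hd'] := mmap_dual h' f0; exact: (dual_dim h hd').
Qed.

Lemma form_evalM (D d : 'I_n -> K -> K) (x : 'I_n -> K) : dual_basis iota x d ->
  (forall i, derivation iota (D i)) ->
  form_eval D = \det (\matrix_(i, j) D i (x j)) * form_eval d.
Proof.
move=> hx hD; rewrite /form_eval mulrCA -det_mulmx; congr (_ * \det _).
by apply/matrixP => i j; rewrite !mxE (dual_derivation hx _ (hD i)); apply: eq_bigr => k _; rewrite !mxE.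
Qed.

Lemma form_eval_neq0 (d : 'I_n -> K -> K) (x : 'I_n -> K) : dual_basis iota x d -> form_eval d != 0.
Proof.
move=> hx; have [h' c0] := hw; have [d' hd'] := mmap_dual h' f0; have [k1 k2 _] := hd'.
have := form_evalM hx k1; rewrite {1}/form_eval.
have -> : \matrix_(i, j) d' i (form_vars j) = 1%:M by apply/matrixP => i j; rewrite !mxE k2.
by rewrite det1 mulr1 => e; apply: contra_neq c0 => h; rewrite e h mulr0.
Qed.

Section Ecoord.
Variables (E : set K) (x : 'I_n -> K) (d : 'I_n -> K -> K).
Hypotheses (dE : is_dvr E) (hx : ecoord E x d).

(** In terms of the dual derivations, [D] has a matrix with entries in [E], whose determinant is the
    quotient of the two values. *)
Lemma ord_form_le (D : 'I_n -> K -> K) : (forall i, derivation iota (D i)) ->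
  (forall i y, E y -> E (D i y)) -> form_eval D != 0 -> ord E (form_eval d) <= ord E (form_eval D).
Proof.
move=> hD hE D0; have [hd xE _] := hx; rewrite (form_evalM hd hD) in D0 *.
move: D0; rewrite mulf_eq0 negb_or => /andP[D0 d0].
rewrite [X in _ <= X](ordM dE) // lerDr; apply/(ord_ge0 dE D0); apply: det_over; first by case: dE.
by move=> i j; rewrite mxE; apply: hE.
Qed.

Lemma ord_formE : ord_form iota w E = ord E (form_eval d).
Proof.
have [hd xE hdE] := hx; have [k1 _ _] := hd.
apply: min_intP; first by exists d; split=> [i||//]; [split; [exact: k1|exact: hdE]|exact: form_eval_neq0 hd].
move=> j [D [hD D0 ->]]; apply: ord_form_le => // i; first by case: (hD i).
by move=> y; case: (hD i) => _; apply.
Qed.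
End Ecoord.

End Form.

End OrderOfForms.

(** * Limits of superadditive sequences *)

Section Fekete.
Context {R : realType}.

(** The limit is the supremum of the [u m / m], which is what the last two conclusions express; with
    them a limit is compared with single terms. *)
Lemma fekete (u : nat -> R) (a b : R) : (forall m n, u m + u n <= u (m + n)%N) ->
  (forall m, m%:R * a <= u m <= m%:R * b) ->
  exists L : R, [/\ (fun m => m%:R^-1 * u m) @ \oo --> L, forall m, u m <= m%:R * L &
    forall c, (forall m, u m <= m%:R * c) -> L <= c].
Proof.
move=> hu hab; pose S := [set x | exists2 m, (0 < m)%N & x = m%:R^-1 * u m].
have m0 m : (0 < m)%N -> 0 < m%:R :> R by rewrite ltr0n.
have ubS c : (forall m, u m <= m%:R * c) -> ubound S c.
  by move=> hc _ [m m_gt0 ->]; rewrite ler_pdivrMl ?m0.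
have hasS : has_sup S.
  split; first by exists (1%:R^-1 * u 1%N), 1%N.
  by exists b; apply: ubS => m; case/andP: (hab m).
have uS m : (0 < m)%N -> m%:R^-1 * u m <= sup S.
  by move=> h; apply: ub_le_sup; [case: hasS|exists m].
have u0 : u 0%N = 0 by have := hab 0%N; rewrite !mul0r -eq_le => /eqP.
exists (sup S); split; last first.
- by move=> c /ubS; apply: ge_sup; case: hasS.
- move=> m; case: (posnP m) => [->|h]; first by rewrite u0 mul0r.
  by rewrite -ler_pdivrMl ?m0 // uS.
apply/cvgrPdist_le => e e0; have e2 : 0 < e / 2 by rewrite divr_gt0.
have [_ [m m_gt0 ->] hm] := sup_adherent e2 hasS.
(* [k] bounds, uniformly in [n], the loss caused by the remainder of the division of [n] by [m]. *)
set L := sup S in hm uS *; pose k := `|L - e / 2 - a| * m%:R.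
have k0 : 0 <= k by rewrite mulr_ge0.
exists (Num.Def.archi_bound (k / (e / 2))).+1 => //= n hn.
have n_gt0 : (0 < n)%N by apply: leq_trans hn.
have hk : k <= n%:R * (e / 2).
  rewrite -ler_pdivrMr //; apply/ltW; apply: lt_le_trans (archi_boundP _) _.
    by rewrite divr_ge0 // ltW.
  by rewrite ler_nat; apply: leq_trans hn; exact: leqnSn.
have hq q : q%:R * u m <= u (q * m)%N.
  elim: q => [|q ih]; first by rewrite mul0r mul0n u0.
  by rewrite mulSn -addn1 natrD mulrDl mul1r addrC; apply: le_trans (hu _ _); rewrite lerD2l.
have hn' : u n >= (n %/ m)%:R * u m + (n %% m)%:R * a.
  have := hu (n %/ m * m)%N (n %% m)%N; rewrite -divn_eq; apply: le_trans; apply: lerD; first exact: hq.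
  by case/andP: (hab (n %% m)%N).
have un : n%:R * (L - e) <= u n.
  apply: le_trans hn'; move: hm; rewrite -(ltr_pM2l (m0 _ m_gt0)) mulrA divff ?mul1r ?gt_eqF ?m0 // => hm.
  have rm : (n %% m)%:R <= m%:R :> R by rewrite ler_nat ltnW // ltn_mod.
  have en : n%:R = (n %/ m)%:R * m%:R + (n %% m)%:R :> R by rewrite {1}(divn_eq n m) natrD natrM.
  have h1 : (n %/ m)%:R * (m%:R * (L - e / 2)) <= (n %/ m)%:R * u m.
    by apply: ler_wpM2l => //; exact: ltW.
  have h2 : (n %% m)%:R * (L - e / 2 - a) <= k.
    apply: le_trans (_ : (n %% m)%:R * `|L - e / 2 - a| <= _).
      by apply: ler_wpM2l => //; exact: ler_norm.
    by rewrite mulrC; apply: ler_wpM2l.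
  move: en h1 h2 hk; move: (n %/ m)%:R (n %% m)%:R => q r en h1 h2 hk.
  have : n%:R * (L - e / 2) = q * (m%:R * (L - e / 2)) + r * (L - e / 2) by rewrite en; ring.
  rewrite mulrBr; lra.
rewrite ler_norml; apply/andP; split.
  by rewrite lerBrDr addrC lerBlDr; apply: le_trans (uS _ n_gt0) _; rewrite lerDl ltW.
by rewrite lerBlDr -lerBlDl ler_pdivlMl ?m0.
Qed.

End Fekete.

(** * The nef envelope of the canonical divisor and the lower bound for log discrepancies *)

Section Envelope.
Context {R : realType} {K : fieldType} (iota : {rmorphism R[i] -> K}).
Implicit Types (A B L V P Q E F : set K) (x y z u g : K).

Local Notation C := (range iota).
Local Notation pol s := (adjoin C [set` s]).

Lemma min_int_ex (S : set int) k0 : (exists k, S k) -> (forall k, S k -> k0 <= k) ->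
  S (min_int S) /\ forall k, S k -> min_int S <= k.
Proof.
move=> [k1 Sk1] lb.
have ex : exists n : nat, `[< S (k0 + n%:Z) >].
  exists `|k1 - k0|%N; apply/asboolP; rewrite gez0_abs ?subr_ge0 ?lb //.
  by rewrite addrCA subrr addr0.
case: (ex_minnP ex) => n /asboolP Sn hmin.
have hn k : S k -> k0 + n%:Z <= k.
  move=> Sk; rewrite -lerBrDl -[k - k0]gez0_abs ?subr_ge0 ?lb // lez_nat; apply: hmin.
  by apply/asboolP; rewrite gez0_abs ?subr_ge0 ?lb // addrCA subrr addr0.
by rewrite (min_intP Sn hn).
Qed.

Variables (s : seq K) (X : set (set K)) (w : @top_form K).
Hypotheses (Xs : X = projective_over C s) (XT : X setT) (Xn : normal X)
  (hw : nonzero_top_form iota w).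

Local Notation n := (form_dim w).
Local Notation Kw := (Defs.canonical iota w : divisor).
Local Notation stalkK m := (stalk X (sheafO X (fun F => m%:R * Kw F))).

Definition has_ecoord E := exists (x : 'I_n -> K) d, ecoord iota E x d.

Lemma fin_gen : exists s0 : seq K, frac (pol s0) = setT.
Proof.
have [si i1 i2] := hasP (has_nz Xs XT); exists [seq sj / si | sj <- s].
by rewrite -chart_pol (frac_chart Xs XT).
Qed.

Lemma ecoord_has E m (x : 'I_m -> K) d : ecoord iota E x d -> has_ecoord E.
Proof.
have [s0 f0] := fin_gen; move=> h; have e := ecoord_dim hw f0 h.
by move: x d h; rewrite e => x d h; exists x, d.
Qed.

Lemma prime_has_ecoord F : prime_divisor X F -> has_ecoord F.
Proof. by move=> /(prime_ecoord Xs XT Xn) [l [t [_ [d /ecoord_has]]]]. Qed.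

Lemma pt_loc si F : si \in s -> si != 0 -> X F -> chart iota s si `<=` F ->
  exists2 q, prime_ideal (chart iota s si) q & F = localization (chart iota s si) q.
Proof.
move=> i1 i2 XF AF; have [hF CF _ hm _] := pt_facts Xs XF.
have hA := chart_subring iota s si; set A := chart iota s si in AF hA *.
pose q := [set x | A x /\ max_ideal F x].
have [_ [_ m1] m2 m3 m4] := hm.
have hq : prime_ideal A q.
  split.
  - by move=> x [].
  - by split; [split; [exact: (sr0 hA)|case: hm => _ []]|move=> [_ /m1]].
  - by move=> x y [Ax mx] [Ay my]; split; [exact: (srD hA)|exact: m2].
  - by move=> a x Aa [Ax mx]; split; [exact: (srM hA)|apply: m3 => //; exact: AF].
  - move=> a b Aa Ab [_ /m4 []]; [exact: AF|exact: AF| |]; by [left|right].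
exists q => //; have XQ := pt_mk Xs i1 i2 hq.
have uF a : A a -> ~ q a -> unit_in F a.
  by move=> Aa nq; apply: contrapT => nu; apply: nq; split=> //; split=> //; exact: AF.
apply: (center_uniq Xs hF (center_self XF)); split=> //; split.
  move=> _ [a [b [Aa Ab nb ->]]]; apply: (srM hF); first exact: AF.
  by case: (uF b Ab nb).
move=> x [a [b [Aa Ab nb ->]]] hu; have [b0 Fb Fbi] := uF b Ab nb.
have hQ := loc_subring hA hq.
have ub : unit_in (localization A q) b by apply/loc_unit.
have ua : unit_in F a.
  by rewrite -[a](mulfVK b0); apply: unit_inM => //; exact: uF.
apply: unit_inM => //; last by apply: unit_inV.
by apply/loc_unit => // -[_ [_]]; apply.
Qed.

Lemma chart_open si : si \in s -> si != 0 -> open_in X [set P | X P /\ chart iota s si `<=` P].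
Proof.
move=> i1 i2; split; first by move=> P [].
move=> P [XP AP]; exists [seq sj / si | sj <- s]; split.
  by move=> x xs; apply: AP; rewrite chart_pol; exact: mem_pol.
move=> Q XQ hQ; split=> //; have [hQs CQ _ _ _] := pt_facts Xs XQ.
by rewrite chart_pol; exact: pol_min.
Qed.

(* With [w = c dt_1 ... dt_n]: [a] clears the denominators of the derivations dual to [t] on a
   chart, and [a'] those of the [t_j]. *)
Lemma form_bounds si : si \in s -> si != 0 -> exists a a',
  [/\ chart iota s si a, chart iota s si a', a != 0, a' != 0 &
    (forall F, prime_divisor X F -> chart iota s si `<=` F ->
       ord_form iota w F <= ord F (form_coef w * a ^+ n)) /\
    (forall E, is_dvr E -> chart iota s si `<=` E -> has_ecoord E ->
       ord E (form_coef w / a' ^+ (2 * n)) <= ord_form iota w E)].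
Proof.
move=> i1 i2; have hA := chart_subring iota s si; have fA := frac_chart Xs XT i1 i2.
set A := chart iota s si in hA fA *; have [hb c0] := hw.
have [s0 f0] := fin_gen; have [d hd] := mmap_dual hb f0; have [d1 d2 _] := hd.
have [|a [Aa a0 ha]] := @common_denom _ A (allpairs (fun j x => d j x) (enum 'I_n) [seq sj / si | sj <- s]) hA.
  by move=> x _; rewrite fA.
have [|a' [Aa' a'0 ha']] := @common_denom _ A [seq form_vars (t := w) j | j <- enum 'I_n] hA.
  by move=> x _; rewrite fA.
have dA j x : A x -> A (a * d j x).
  have /derivation_pderiv hj := d1 j.
  suff : A `<=` [set x | A x /\ A (a * d j x)] by move=> h /h [].
  rewrite {1}/A chart_pol; apply: pol_min.
  - apply/subringP; split=> /=.
    + by split; [exact: (sr1 hA)|rewrite (pd1 hj) mulr0; exact: (sr0 hA)].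
    + by move=> y z [? ?] [? ?]; rewrite (pdD hj) (pdN hj) mulrBr; split; exact: (srB hA).
    + move=> y z [? ?] [? ?]; rewrite (pdM hj) /= mulrDr [a * (y * _)]mulrCA [a * (_ * z)]mulrA.
      by split; [exact: (srM hA)|apply: (srD hA); exact: (srM hA)].
  - move=> c Cc /=; split; first exact: C_chart.
    by have [h _ _] := hj; have [b _ <-] := Cc; rewrite h mulr0; exact: (sr0 hA).
  - move=> y /mapP [sj sjs ->] /=; split; first exact: mem_chart.
    apply: ha; apply/allpairsP; exists (j, sj / si); split=> //=; first by rewrite mem_enum.
    exact: map_f.
exists a, a'; split=> //; split.
- move=> F pF AF; have dF := prime_divisor_dvr Xs XT Xn pF; have hF : is_subring F by case: dF.
  have [x [e he]] := prime_has_ecoord pF; rewrite (ord_formE hw f0 dF he).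
  have ev : form_eval (w := w) (fun i x => a * d i x) = form_coef w * a ^+ n.
    rewrite /form_eval; congr (_ * _).
    have -> : \matrix_(i, j) (a * d i (form_vars (t := w) j)) = a%:M.
      by apply/matrixP => i j; rewrite !mxE d2 mulr_natr.
    by rewrite det_scalar.
  rewrite -ev; apply: (ord_form_le dF he).
  + move=> i; have [k1 k2 k3] := d1 i; split.
    * by move=> c; rewrite k1 mulr0.
    * by move=> y z; rewrite k2 mulrDr.
    * by move=> y z; rewrite k3; ring.
  + have [q hq eF] := pt_loc i1 i2 pF.1 AF.
    move=> i y; rewrite {1}eF => -[b [b' [Ab Ab' nb ->]]].
    have [b'0 _ Fbi] : unit_in F b' by rewrite eF; apply/loc_unit.
    rewrite (pdiv _ (d1 i)) // mulrA; apply: srM => //; rewrite mulrBr mulrCA.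
    have Fda z : A z -> F (a * d i z) by move=> Az; apply: (AF); exact: dA.
    apply: (srB hF); first exact: Fda.
    by apply: (srM hF); [apply: (srM hF) => //; exact: AF|exact: Fda].
  + by rewrite ev mulf_neq0 ?expf_neq0.
- move=> E dE AE [x [e he]]; rewrite (ord_formE hw f0 dE he).
  have [h1 h2 h3] := he; have [k1 _ _] := h1; have hE : is_subring E by case: dE.
  have ev0 := form_eval_neq0 hw f0 h1.
  (* [a'] clears [t_j] but not its derivatives: by the Leibniz rule [a' ^+ 2 * e_i(t_j)] is
     [a' * e_i(a' * t_j)] minus [a' * t_j * e_i(a')]. This is the source of the exponent [2 * n]. *)
  pose M := \matrix_(i, j) (a' ^+ 2 * e i (form_vars (t := w) j)).
  have eM : \det M = a' ^+ (2 * n) * \det (\matrix_(i, j) e i (form_vars (t := w) j)).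
    by rewrite exprM -detZ; congr (\det _); apply/matrixP => i j; rewrite !mxE.
  have EM : E (\det M).
    apply: det_over => // i j; rewrite mxE.
    have := ha' _ (map_f (fun j => form_vars (t := w) j) (_ : j \in enum 'I_n)); rewrite mem_enum => /(_ isT).
    move=> Ab; have /derivation_pderiv hi := k1 i.
    have := congr1 ( *%R a') (pdM hi a' (form_vars j)).
    rewrite /= mulrDr => /(canLR (addrK _)) h.
    have -> : a' ^+ 2 * e i (form_vars (t := w) j) = a' * e i (a' * form_vars (t := w) j) - a' * (e i a' * form_vars (t := w) j).
      by rewrite h; ring.
    apply: (srB hE); first by apply: (srM hE); [exact: AE|apply: h3; exact: AE].
    rewrite mulrCA; apply: (srM hE); last exact: AE.
    by apply: h3; exact: AE.
  have ef : form_eval (w := w) e = form_coef w / a' ^+ (2 * n) * \det M.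
    by rewrite eM /form_eval; field; rewrite expf_neq0.
  have M0 : \det M != 0 by apply: contraNneq ev0 => h; rewrite ef h mulr0.
  rewrite ef [X in _ <= X](ordM dE) //; last by rewrite mulf_neq0 ?invr_eq0 ?expf_neq0.
  by rewrite lerDl; apply/(ord_ge0 dE).
Qed.

Lemma stalk_ord m P g F : stalkK m P g -> g != 0 -> prime_divisor X F -> P `<=` F ->
  0 <= ord F g + ord_form iota w F *+ m.
Proof.
move=> [U [[UX hU] UP [->|h]]]; first by rewrite eqxx.
move=> g0 pF PF; have [l [lP hl]] := hU P UP.
have UF : U F by apply: hl; [case: pF|move=> x /lP /PF].
have := h F pF UF; rewrite /Defs.canonical mulr_natl -rmorphMn -rmorphD /= ler0z.
by [].
Qed.

Lemma stalk_mk m P g (U : set (set K)) : open_in X U -> U P ->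
  (forall F, prime_divisor X F -> U F -> 0 <= ord F g + ord_form iota w F *+ m) -> stalkK m P g.
Proof.
move=> oU UP h; exists U; split=> //; right=> F pF UF.
by rewrite /Defs.canonical mulr_natl -rmorphMn -rmorphD /= ler0z h.
Qed.

Lemma stalkM m m' P g g' : stalkK m P g -> stalkK m' P g' -> g != 0 -> g' != 0 ->
  stalkK (m + m')%N P (g * g').
Proof.
move=> [U [oU UP [->|h]]]; first by rewrite eqxx.
move=> [U' [oU' UP' [->|h']]]; first by rewrite eqxx.
move=> g0 g'0; apply: (@stalk_mk _ _ _ (U `&` U')) => //.
  split; first by move=> Q [/oU.1].
  move=> Q [UQ UQ']; have [l [lQ hl]] := oU.2 Q UQ; have [l' [lQ' hl']] := oU'.2 Q UQ'.
  exists (l ++ l'); split.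
    by move=> x; rewrite /= mem_cat => /orP[/lQ|/lQ'].
  move=> S XS hS; split; [apply: hl => // x xl|apply: hl' => // x xl]; apply: hS;
    by rewrite /= mem_cat xl ?orbT.
move=> F pF [UF UF']; have dF := prime_divisor_dvr Xs XT Xn pF.
have := h F pF UF; have := h' F pF UF'.
rewrite /Defs.canonical !mulr_natl -!rmorphMn -!rmorphD /= !ler0z (ordM dF) // mulrnDr => k1 k2.
by rewrite addrACA addr_ge0.
Qed.

Section Fixed.
Variables (E P : set K).
Hypotheses (dE : is_dvr E) (cP : Defs.center X E P).

(** If [d] bounds the canonical divisor on a chart, then [g * d ^+ m] is regular at the center by
    [hartogs]. *)
Lemma stalk_le si d m g : si \in s -> si != 0 -> chart iota s si `<=` P -> d != 0 ->
  (forall F, prime_divisor X F -> chart iota s si `<=` F -> ord_form iota w F <= ord F d) ->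
  stalkK m P g -> g != 0 -> - ord E g <= ord E d *+ m.
Proof.
move=> i1 i2 AP d0 hd sg g0; have [XP [PE _]] := cP.
have : P (g * d ^+ m).
  apply: (hartogs Xs XT Xn XP) => F pF PF; have dF := prime_divisor_dvr Xs XT Xn pF.
  apply/(ord_ge0 dF); first by rewrite mulf_neq0 ?expf_neq0.
  rewrite (ordM dF) ?expf_neq0 // (ordX dF) //; apply: le_trans (stalk_ord sg g0 pF PF) _.
  by rewrite lerD2l lerMn2r hd ?orbT // => x /AP /PF.
move=> /PE /(ord_ge0 dE); rewrite mulf_neq0 ?expf_neq0 // (ordM dE) ?expf_neq0 // (ordX dE) //.
by move=> /(_ isT); rewrite addrC -lerBlDr sub0r.
Qed.

(** Products of sections are sections, so the orders [z m] are superadditive; [form_bounds] gives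
    the linear bounds above and below that [fekete] asks for. *)
Lemma env_facts : exists z : nat -> int,
  (forall m, (exists g, [/\ stalkK m P g, g != 0 & z m = - ord E g]) /\
     (forall g, stalkK m P g -> g != 0 -> - ord E g <= z m)) /\
  [/\ (fun m : nat => m%:R^-1 * (z m)%:~R) @ \oo --> (Env X Kw E : R),
    forall m, (z m)%:~R <= m%:R * (Env X Kw E : R) &
    forall c : R, (forall m, (z m)%:~R <= m%:R * c) -> Env X Kw E <= c].
Proof.
have [XP [PE _]] := cP; have hE : is_subring E by case: dE.
have [hP CP _ _ [si hi]] := pt_facts Xs XP; have [i1 i2 iP] := hi.
have AP : chart iota s si `<=` P by apply: chart_min.
have [a [a' [Aa Aa' a0 a'0 [hup hlo]]]] := form_bounds i1 i2.
have c0 : form_coef w != 0 by case: hw.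
pose up := form_coef w * a ^+ n; pose lo := form_coef w / a' ^+ (2 * n).
have up0 : up != 0 by rewrite mulf_neq0 ?expf_neq0.
have lo0 : lo != 0 by rewrite mulf_neq0 ?invr_eq0 ?expf_neq0.
pose S m := [set k | exists P g, [/\ Defs.center X E P, stalkK m P g, g != 0 & k = ord E g]].
have SP m k : S m k <-> exists g, [/\ stalkK m P g, g != 0 & k = ord E g].
  split; last by move=> [g [? ? ?]]; exists P, g.
  by move=> [P' [g [cP' ? ? ?]]]; exists g; rewrite (center_uniq Xs hE cP cP').
have slo m : stalkK m P (lo ^+ m)^-1.
  apply: (stalk_mk (chart_open i1 i2)); first by split.
  move=> F pF [_ AF]; have dF := prime_divisor_dvr Xs XT Xn pF.
  rewrite (ordV dF) ?expf_neq0 // (ordX dF) // addrC subr_ge0 lerMn2r.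
  by rewrite hlo ?orbT //; exact: prime_has_ecoord.
have hS m : S m (min_int (S m)) /\ forall k, S m k -> min_int (S m) <= k.
  apply: (@min_int_ex _ (- (ord E up *+ m))).
    by exists (ord E (lo ^+ m)^-1); apply/SP; exists (lo ^+ m)^-1; rewrite invr_eq0 expf_neq0.
  by move=> k /SP [g [sg g0 ->]]; rewrite lerNl; exact: (stalk_le i1 i2 AP up0 hup).
pose z m := - min_int (S m); exists z.
have hz m : (exists g, [/\ stalkK m P g, g != 0 & z m = - ord E g]) /\
     (forall g, stalkK m P g -> g != 0 -> - ord E g <= z m).
  have [/SP [g [h1 h2 h3]] h4] := hS m; split; first by exists g; rewrite /z h3.
  by move=> g' h5 h6; rewrite lerN2; apply: h4; apply/SP; exists g'.
split=> //.
have [||L [h1 h2 h3]] := @fekete R (fun m => (z m)%:~R) (ord E lo)%:~R (ord E up)%:~R.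
- move=> m m'; rewrite -rmorphD /= ler_int.
  have [[g [sg g0 ->]] _] := hz m; have [[g' [sg' g'0 ->]] _] := hz m'.
  have [_ h] := hz (m + m')%N; have := h _ (stalkM sg sg' g0 g'0).
  by rewrite mulf_neq0 // (ordM dE) // opprD; apply.
- move=> m; rewrite !mulr_natl -!rmorphMn /= !ler_int; apply/andP; split.
    have [_ /(_ _ (slo m))] := hz m; rewrite invr_eq0 expf_neq0 // => /(_ isT).
    by rewrite (ordV dE) ?expf_neq0 // opprK (ordX dE).
  by have [[g [sg g0 ->]] _] := hz m; exact: (stalk_le i1 i2 AP up0 hup).
have eL : Env X Kw E = L.
  rewrite /Env; have -> : (fun m : nat => m%:R^-1 * Zdiv X (sheafO X (fun F => m%:R * Kw F)) E) =
      (fun m : nat => m%:R^-1 * (z m)%:~R) :> (nat -> R).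
    by apply: boolp.funext => m; rewrite /Zdiv /z rmorphN.
  exact: cvg_lim h1.
by rewrite eL; split.
Qed.

Lemma env_ge m g : stalkK m P g -> g != 0 -> - (ord E g)%:~R <= m%:R * Env X Kw E :> R.
Proof.
move=> sg g0; have [z [hz [_ h _]]] := env_facts; apply: le_trans (h m).
by rewrite -rmorphN ler_int; case: (hz m) => _; apply.
Qed.

Lemma env_le (b : R) : (forall m g, stalkK m P g -> g != 0 -> - (ord E g)%:~R <= m%:R * b) ->
  Env X Kw E <= b.
Proof.
move=> hb; have [z [hz [_ _ h]]] := env_facts; apply: h => m.
by have [[g [sg g0 ->]] _] := hz m; rewrite rmorphN; exact: hb.
Qed.
End Fixed.

(** Unlike [Aplus], it adds 1 along every divisor, exceptional or not; only in this form does it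
    behave well under ramification. *)
Definition logdisc E : R := (ord_form iota w E)%:~R + 1 - Env X Kw E.

(** Along a divisor of [X] itself the 1 is absent, but there the poles of sections of [m K_X] are
    bounded by [m K_X], so the envelope is at most [K_X]. *)
Lemma Aplus_ge0 E : is_dvr E -> C `<=` E -> 0 <= logdisc E -> 0 <= (Aplus iota X w E : R).
Proof.
move=> dE CE hB; rewrite /Aplus /exc_divisor; case: asboolP => // nexc.
have [P cP kP] : exists2 P, Defs.center X E P & krull_dim1 P by apply: contrapT.
have eP := dvr_center_eq Xs XT Xn dE cP kP; rewrite eP in cP kP.
rewrite addr0 subr_ge0; apply: (env_le dE cP) => m g sg g0.
have := stalk_ord sg g0 (conj cP.1 kP) (fun=> id).
by rewrite /Defs.canonical mulr_natl -rmorphMn -rmorphN ler_int addrC -lerBlDr sub0r.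
Qed.

(** Each chart gives a function with the desired bound. Made homogeneous, it is regular on the other
    charts too, so the product over all charts is one section that works everywhere. *)
Lemma logdisc_ge : exists N0 sg, [/\ sect iota s N0 sg, sg != 0 &
  forall E i, is_dvr E -> C `<=` E -> has_ecoord E -> idx s E i ->
   - (ord E (sg / i ^+ N0))%:~R <= logdisc E].
Proof.
have c0 : form_coef w != 0 by case: hw.
have /choice [f hf] : forall si, exists dN : K * nat, si \in s -> si != 0 ->
  [/\ chart iota s si dN.1, dN.1 != 0,
   forall sj, sj \in s -> sj != 0 -> chart iota s sj ((si / sj) ^+ dN.2 * dN.1)
   & forall E, is_dvr E -> C `<=` E -> has_ecoord E -> idx s E si -> - (ord E dN.1)%:~R <= logdisc E].
  move=> si; have [[i1 i2]|no] := pselect (si \in s /\ si != 0); last first.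
    by exists (0, 0%N) => i1 i2; case: no.
  have [a [a' [Aa Aa' a0 a'0 [hup hlo]]]] := form_bounds i1 i2.
  (* The order of the form is at least that of [form_coef w / a' ^+ (2 * n)] and the envelope at
     most that of [form_coef w * a ^+ n]; the difference is minus the order of [dl]. *)
  pose dl := a' ^+ (2 * n) * a ^+ n.
  have hA := chart_subring iota s si.
  have Adl : chart iota s si dl by apply: (srM hA); exact: (srX hA).
  have /choice [g hg] : forall sj, exists m0 : nat, sj \in s -> sj != 0 ->
      forall m, (m0 <= m)%N -> chart iota s sj ((si / sj) ^+ m * dl).
    move=> sj; have [[j1 j2]|no] := pselect (sj \in s /\ sj != 0); last by exists 0%N => j1 j2; case: no.
    by have [m0 h] := homogenize i1 j1 i2 j2 Adl; exists m0.
  exists (dl, \max_(sj <- s) g sj) => _ _ /=; split=> //.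
  - by rewrite mulf_neq0 ?expf_neq0.
  - by move=> sj j1 j2; apply: hg => //; exact: leq_bigmax_seq.
  - move=> E dE CE hE [_ _ iE]; have hEs : is_subring E by case: dE.
    have AE : chart iota s si `<=` E by exact: chart_min.
    have [P XP cP] := center_exists Xs XT (psi := idfun) (dvr_valring dE) (fun c hc => CE c hc).
    have cEP : Defs.center X E P by split.
    have [hP CP _ _ _] := pt_facts Xs XP.
    have hiP : idx s P si by apply: (idx_center Xs hEs cEP).
    have AP : chart iota s si `<=` P by apply: chart_min => // sk ks; case: hiP => _ _; apply.
    have up0 : form_coef w * a ^+ n != 0 by rewrite mulf_neq0 ?expf_neq0.
    have h1 : Env X Kw E <= (ord E (form_coef w * a ^+ n))%:~R :> R.
      apply: (env_le dE cEP) => m g0 sg g00; rewrite mulr_natl -rmorphMn -rmorphN ler_int.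
      exact: (stalk_le dE cEP i1 i2 AP up0 hup).
    have := hlo E dE AE hE; rewrite (ordM dE) ?invr_eq0 ?expf_neq0 // (ordV dE) ?expf_neq0 //.
    move: h1; rewrite (ordM dE) ?expf_neq0 // /logdisc /dl (ordM dE) ?expf_neq0 // => h1 h2.
    have : ((ord E (form_coef w) - ord E (a' ^+ (2 * n)))%:~R : R) <= (ord_form iota w E)%:~R by rewrite ler_int.
    move: h1; rewrite !rmorphD !rmorphN /=; lra.
pose nz := [seq j <- s | j != 0].
pose N0 := (\sum_(j <- nz) (f j).2)%N; pose sg := \prod_(j <- nz) (j ^+ (f j).2 * (f j).1).
have nzP j : j \in nz -> j \in s /\ j != 0 by rewrite mem_filter => /andP[].
have e i l : i != 0 -> \prod_(j <- l) (j ^+ (f j).2 * (f j).1) / i ^+ (\sum_(j <- l) (f j).2)%N =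
   \prod_(j <- l) ((j / i) ^+ (f j).2 * (f j).1).
  move=> i0; elim: l => [|j l ih]; first by rewrite !big_nil divr1.
  by rewrite !big_cons -ih exprD expr_div_n; field; rewrite !expf_neq0.
exists N0, sg; split.
- move=> V VV CV i hi; have [i1 i2 iV] := hi; have [hV _] := VV; rewrite /sg /N0 e //.
  have AV : chart iota s i `<=` V by exact: chart_min.
  rewrite big_seq; apply: (sr_prod hV) => j /nzP [j1 j2]; apply: AV.
  by have [_ _ h _] := hf j j1 j2; exact: h.
- rewrite /sg prodf_seq_neq0; apply/allP => j /nzP [j1 j2] /=.
  by have [_ h _ _] := hf j j1 j2; rewrite mulf_neq0 ?expf_neq0.
- move=> E i dE CE hE hi; have [i1 i2 iE] := hi; have hEs : is_subring E by case: dE.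
  have AE : chart iota s i `<=` E by exact: chart_min.
  have inz : i \in nz by rewrite mem_filter i2.
  have [_ d0 _ hd] := hf i i1 i2.
  rewrite /sg /N0 e //; apply: le_trans (hd E dE CE hE hi).
  rewrite lerN2 ler_int (big_rem i) //= divff // expr1n mul1r.
  have fe j : j \in nz -> E ((j / i) ^+ (f j).2 * (f j).1) /\ (j / i) ^+ (f j).2 * (f j).1 != 0.
    move=> /nzP [j1 j2]; have [_ h1 h _] := hf j j1 j2; split; first by apply: AE; exact: h.
    by rewrite !mulf_neq0 ?expf_neq0 // mulf_neq0 ?invr_eq0.
  have p0 : \prod_(j <- rem i nz) ((j / i) ^+ (f j).2 * (f j).1) != 0.
    by rewrite prodf_seq_neq0; apply/allP => j /mem_rem /fe [].
  rewrite (ordM dE) // lerDl; apply/(ord_ge0 dE) => //.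
  by rewrite big_seq; apply: (sr_prod hEs) => j /mem_rem /fe [].
Qed.

End Envelope.

(** * Images and preimages of rings under a field endomorphism *)

Section Transport.
Context {R : realType} {K : fieldType} (iota : {rmorphism R[i] -> K}).
Implicit Types (A B L V P Q E F : set K) (x y z u g : K) (s l : seq K).
Variable phi : {rmorphism K -> K}.

Local Notation C := (range iota).
Local Notation pol s := (adjoin C [set` s]).
Local Notation L := (range phi).

Lemma phi_subring A : is_subring A -> is_subring (phi @` A).
Proof.
move=> hA; apply/subringP; split; first by exists 1; [exact: sr1|rewrite rmorph1].
  by move=> _ _ [x Ax <-] [y Ay <-]; exists (x - y); [exact: srB|rewrite rmorphB].
by move=> _ _ [x Ax <-] [y Ay <-]; exists (x * y); [exact: srM|rewrite rmorphM].
Qed.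

Lemma preim_subring A : is_subring A -> is_subring (phi @^-1` A).
Proof.
move=> hA; apply/subringP; split=> /=; first by rewrite rmorph1; exact: sr1.
  by move=> x y Ax Ay /=; rewrite rmorphB; exact: srB.
by move=> x y Ax Ay /=; rewrite rmorphM; exact: srM.
Qed.

Lemma preim_valring V : valring V -> valring (phi @^-1` V).
Proof. by move=> [hV VV]; split; [exact: preim_subring|move=> x /=; rewrite fmorphV]. Qed.

Lemma phi_mem A x : (phi @` A) (phi x) <-> A x.
Proof. by split=> [[y Ay /fmorph_inj <-]|Ax] //; exists x. Qed.

Lemma range_subfield : is_subfield L.
Proof.
split; first by apply: phi_subring; apply/subringP; split.
by move=> _ [x _ <-]; exists x^-1 => //; rewrite fmorphV.
Qed.

Lemma phi_frac A : frac A = setT -> L `<=` frac (phi @` A).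
Proof.
move=> fA _ [x _ <-]; have : frac A x by rewrite fA.
move=> [a [b [Aa Ab b0 ->]]]; exists (phi a), (phi b); split; [by exists a|by exists b| |].
  by rewrite fmorph_eq0.
by rewrite fmorph_div.
Qed.

Lemma phi_poly A p : pover (phi @` A) p -> exists2 p', pover A p' & p = map_poly phi p'.
Proof.
move=> hp; have /choice [f hf] : forall i, exists a, A a /\ phi a = p`_i.
  by move=> i; have [a Aa e] := hp i; exists a.
have e : p = map_poly phi (\poly_(i < size p) f i).
  apply/polyP => i; rewrite coef_map coef_poly /=; case: ltnP => h; first by case: (hf i).
  by rewrite nth_default ?rmorph0.
exists (\poly_(i < size p) f i) => // i; rewrite coef_poly; case: ltnP => h; first by case: (hf i).
have [Af] := hf i; rewrite nth_default // => /eqP; rewrite fmorph_eq0 => /eqP <-.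
exact: Af.
Qed.

Lemma phi_clE A x : is_subring A -> cl (frac (phi @` A)) (phi x) -> cl (frac A) x.
Proof.
move=> hA /(cl_frac_poly (phi_subring hA)) [p [p0 /phi_poly [q hq eq] px]].
apply: (@cl_root _ _ q); first exact: frac_subfield.
- by apply: pover_sub hq; exact: sub_frac.
- by apply: contraNneq p0 => e; rewrite eq e rmorph0.
- by move: px; rewrite eq !rootE horner_map fmorph_eq0.
Qed.

Lemma phi_clI A x : cl A x -> cl (phi @` A) (phi x).
Proof.
move=> h V VV AV; apply: (h _ (preim_valring VV)) => y Ay /=; apply: AV; by exists y.
Qed.

Lemma phi_cic A : is_subring A -> noeth A -> cl A `<=` A -> cicin L (phi @` A).
Proof.
move=> hA nA cA _ _ [w Aw <-] w0 [y _ <-] h; exists y => //; apply: cA.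
apply: (noeth_cic hA nA (w := w)); first by rewrite -(fmorph_eq0 phi).
by move=> k; apply/phi_mem; rewrite rmorphM rmorphXn.
Qed.

Hypothesis phiC : forall c, phi (iota c) = iota c.

Lemma phi_adjoin A S : phi @` (adjoin A S) = adjoin (phi @` A) (phi @` S).
Proof.
apply/seteqP; split.
  move=> _ [x hx <-]; apply: (@adjoin_min _ A S (phi @^-1` (adjoin (phi @` A) (phi @` S))) _ _ _ _ hx).
  - exact/preim_subring/adjoin_subring.
  - by move=> a Aa /=; apply: mem_adjoinl; exists a.
  - by move=> a Sa /=; apply: mem_adjoinr; exists a.
apply: adjoin_min.
- exact/phi_subring/adjoin_subring.
- by move=> _ [a Aa <-]; exists a => //; exact: mem_adjoinl.
- by move=> _ [a Sa <-]; exists a => //; exact: mem_adjoinr.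
Qed.

Lemma phi_pol l : phi @` (pol l) = pol (map phi l).
Proof.
rewrite phi_adjoin; congr (adjoin _ _).
  by apply/seteqP; split=> [_ [_ [c _ <-] <-]|_ [c _ <-]]; [exists c|exists (iota c) => //; exists c].
apply/seteqP; split=> [_ [x xl <-]|y /mapP [x xl ->]]; [exact: map_f|by exists x].
Qed.

Lemma valring_prime V : valring V -> prime_ideal V (max_ideal V).
Proof.
move=> [hV VV]; split.
- by move=> x [].
- by split; [split; [exact: sr0|case; rewrite eqxx]|case=> _; apply; split; rewrite ?oner_eq0 ?invr1 //; exact: sr1].
- move=> x y [Vx ux] [Vy uy]; split; first exact: srD.
  have [->|x0] := eqVneq x 0; first by rewrite add0r.
  have [->|y0] := eqVneq y 0; first by rewrite addr0.
  have [h|h] := VV (x / y) => hu.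
    apply: uy; apply: (@unit_inMr _ V hV (x / y + 1) y) => //; first by apply: srD => //; exact: sr1.
    by rewrite mulrDl mulfVK // mul1r.
  rewrite invf_div in h.
  apply: ux; apply: (@unit_inMr _ V hV (1 + y / x) x) => //; first by apply: srD => //; exact: sr1.
  by rewrite mulrDl mulfVK // mul1r.
- by move=> a x Va [Vx ux]; split; [exact: srM|move=> hu; apply: ux; exact: (unit_inMr hV Va Vx hu)].
- move=> a b Va Vb [_ hu]; apply: contrapT => no; apply: hu; apply: (unit_inM hV).
    by apply: contrapT => ha; apply: no; left.
  by apply: contrapT => ha; apply: no; right.
Qed.

(** Otherwise a term of smallest value would be minus a sum of terms of larger value. *)
Lemma val_two V n (c : 'I_n -> K) : valring V -> \sum_i c i = 0 -> (exists i, c i != 0) ->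
  exists i j, [/\ i != j, c i != 0, c j != 0 & unit_in V (c i / c j)].
Proof.
move=> VV sc [i0 ci0]; have [hV _] := VV.
have [|_ [/mapP [j _ ->] j0 hj]] := valring_max (s := [seq c i | i <- enum 'I_n]) (idfun : {rmorphism K -> K}) VV.
  by apply/hasP; exists (c i0) => //; apply: map_f; rewrite mem_enum.
apply: contrapT => no.
have hm : prime_ideal V (max_ideal V) by exact: valring_prime.
have [_ [m0 m1] mD mM _] := hm.
have : max_ideal V (\sum_(i | i != j) - (c i / c j)).
  elim/big_ind: _; [exact: m0|exact: mD|].
  move=> i ij; rewrite -mulN1r; apply: mM; first exact/(srN hV)/(sr1 hV).
  have Vi : V (c i / c j) by apply: (hj (c i)); apply: map_f; rewrite mem_enum.
  by split=> // hu; apply: no; exists i, j; split=> //; case: hu => + _ _; rewrite mulf_eq0 negb_or => /andP[].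
rewrite sumrN -mulr_suml; move: sc; rewrite (bigD1 j) //= => /eqP; rewrite addrC addr_eq0 => /eqP ->.
by rewrite mulNr divff // opprK.
Qed.

End Transport.

(** * Valuation rings over a discrete valuation ring in a finite extension, and the Hurwitz
    formula *)

Section Extension.
Context {R : realType} {K : fieldType} (iota : {rmorphism R[i] -> K}).
Implicit Types (A B V P Q E : set K) (x y z u g : K) (s : seq K).
Variable phi : {rmorphism K -> K}.

Local Notation C := (range iota).
Local Notation pol s := (adjoin C [set` s]).
Local Notation L := (range phi).

(* A valuation ring over [A] is a localization of the integral closure of [A]: rewrite a
   relation for [x] as [y_s x = - z_s], cutting it at each degree. *)
Lemma prufer V A x p i0 : is_subring A -> valring V -> A `<=` V -> V x -> pover A p -> root p x ->
  unit_in V p`_i0 -> exists y z, [/\ cl A y, cl A z, unit_in V y & x = z / y].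
Proof.
move=> hA VV AV Vx hp px ui; have [hV _] := VV.
have [->|x0] := eqVneq x 0.
  exists 1, 0; rewrite mul0r; split=> //; [apply: sr1|apply: sr0|apply: unit_in1] => //; exact: cl_subring.
pose Y k := (drop_poly k p).[x].
have YS k : Y k = p`_k + Y k.+1 * x.
  have e : drop_poly k p = (p`_k)%:P + drop_poly k.+1 p * 'X.
    by apply/polyP => j; rewrite coefD coefMX coefC !coef_drop_poly; case: j => [|j] /=; rewrite ?addr0 // add0r addSnnS.
  by rewrite /Y e hornerD hornerM hornerX hornerC.
have VY k : V (Y k).
  apply: (sr_horner hV) => // i; rewrite coef_drop_poly; exact: AV.
have [k uk] : exists k, unit_in V (Y k).
  apply: contrapT => no; have [_ _ mD mM _] := valring_prime VV.
  have mY k : max_ideal V (Y k) by split=> // hu; apply: no; exists k.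
  have : max_ideal V (Y i0 + (- x) * Y i0.+1) by apply: mD => //; apply: mM => //; exact: srN.
  by rewrite YS mulNr [x * _]mulrC addrK => -[_].
have e : (take_poly k p).[x] + Y k * x ^+ k = 0.
  by rewrite -(hornerXn x k) /Y -hornerM -hornerD poly_take_drop (rootP px).
have tk j : (take_poly k p).[x] / x ^+ j = \sum_(i < k) p`_i * (x ^+ i / x ^+ j).
  rewrite (horner_coef_wide _ (size_take_poly k p)) mulr_suml; apply: eq_bigr => i _.
  by rewrite coef_take_poly ltn_ord mulrA.
have key j : (j <= k)%N -> (k <= j.+1)%N -> cl A (Y k * x ^+ (k - j)).
  move=> jk kj W WW AW; have [hW VW] := WW; have [Wx|Wx] := VW x.
    apply: (srM hW); last exact: (srX hW).
    by apply: (sr_horner hW) => // i; rewrite coef_drop_poly; exact: AW.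
  have -> : Y k * x ^+ (k - j) = - ((take_poly k p).[x] / x ^+ j).
    have /eqP := e; rewrite addrC addr_eq0 => /eqP h.
    have e2 : x ^+ k = x ^+ (k - j) * x ^+ j by rewrite -exprD subnK.
    by rewrite -mulNr -h e2 mulrA mulfK // expf_neq0.
  rewrite tk; apply: (srN hW); apply: (sr_sum hW) => i _; apply: (srM hW); first exact: AW.
  have ij : (i <= j)%N by rewrite -ltnS (leq_trans _ kj).
  by rewrite -{1}(subnKC ij) exprD invfM mulrA divff ?expf_neq0 // mul1r -exprVn; exact: (srX hW).
exists (Y k), (Y k * x); split=> //; last by case: uk => ? _ _; rewrite mulrC mulKf.
- by have := key k (leqnn k) (leqnSn k); rewrite subnn mulr1.
- case: k uk tk key {e} => [|k] uk tk key; last by have := key k (leqnSn k) (leqnn _); rewrite subSnn.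
  move=> W WW AW; have [hW VW] := WW; have -> : Y 0%N * x = 0; last exact: sr0.
  by rewrite /Y drop_poly0l (rootP px) mul0r.
Qed.

Hypotheses (phiC : forall c, phi (iota c) = iota c) (hK : forall x, cl L x).
Variables (s0 : seq K) (f0 : frac (pol s0) = setT).

Lemma range_basis : exists r (e : 'cV[K]_r), basis L e.
Proof.
have hL := range_subfield phi.
have [||b hb] := @fin_span _ L s0 hL; [by []| |exact: basis_exists hb].
apply/seteqP; split=> // x _; have : frac (pol s0) x by rewrite f0.
apply: fracS; apply: pol_min; first exact: adjoin_subring.
  by move=> c [a _ <-]; apply: mem_adjoinl; exists (iota a).
by move=> y ys; exact: mem_adjoinr.
Qed.

Section Over.
Variables (F V : set K).
Hypotheses (dF : is_dvr F) (CF : C `<=` F) (nF : noeth F) (VV : valring V)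
  (FV : forall x, F x -> V (phi x)) (VT : V <> setT).

Local Notation F' := (phi @` F).
Let hF : is_subring F. Proof. by case: dF. Qed.
Let hV : is_subring V. Proof. by case: VV. Qed.
Let hL := range_subfield phi.
Let hF' : is_subring F'. Proof. exact: phi_subring. Qed.
Let F'V : F' `<=` V. Proof. by move=> _ [x Fx <-]; exact: FV. Qed.
Let LF' : L `<=` frac F'. Proof. exact/phi_frac/dvr_frac. Qed.
Let F'L : F' `<=` L. Proof. by move=> _ [x Fx <-]; exists x. Qed.
Let cF' : cicin L F'. Proof. by apply: phi_cic => //; apply: valring_cl; exact: dvr_valring. Qed.
Let CV : C `<=` V. Proof. by move=> _ [c _ <-]; rewrite -phiC; apply: FV; apply: CF; exists c. Qed.
Let QF' : Qsub F'.
Proof. by apply: (C_Qsub (iota := iota)) => _ [c _ <-]; exists (iota c) => //; apply: CF; exists c. Qed.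
Lemma ext_unit x : unit_in F x -> unit_in V (phi x).
Proof. by move=> [x0 h1 h2]; split; rewrite ?fmorph_eq0 // -?fmorphV; exact: FV. Qed.

(** [F] is a maximal subring: if [V] met [phi K] in more than [phi F], it would contain [phi K], and
    then [K], which is algebraic over it. *)
Lemma ext_unitE x : unit_in V (phi x) -> unit_in F x.
Proof.
move=> hu; apply: contrapT => nu; apply: VT; have [px0 _ _] := hu.
have x0 : x != 0 by rewrite -(fmorph_eq0 phi).
have LV : L `<=` V.
  suff h : F `<` phi @^-1` V.
    have e : phi @^-1` V = setT.
      apply: (dvr_over dF (preim_subring phi hV)); case: h => // _ h e.
      by apply: h; rewrite e.
    by move=> _ [y _ <-]; have : (phi @^-1` V) y by rewrite e.
  split=> [y /FV //|h]; have Vx : (phi @^-1` V) x by case: hu.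
  have Vxi : (phi @^-1` V) x^-1 by rewrite /= fmorphV; case: hu.
  by apply: nu; split=> //; exact: h.
by apply/seteqP; split=> // y _; apply: (hK y).
Qed.

(** The characteristic polynomial of [x] is divided by its coefficient of smallest order. *)
Lemma val_denom x : exists (p : {poly K}) i0, [/\ pover F' p, root p x & unit_in V p`_i0].
Proof.
have [r [e he]] := range_basis; set p := char_poly (Mx L e x).
have pm : p \is monic by exact: char_poly_monic.
have px : root p x := char_poly_Mx_root he x.
have hp : pover L p.
  apply: (char_poly_integral hL he) => //; first by case: hL.
  - by rewrite frac_id.
  - by apply: (C_Qsub (iota := iota)) => _ [c _ <-]; exists (iota c).
have [q hq eq] : exists2 q, pover setT q & p = map_poly phi q by apply: phi_poly => i; exact: hp.
have [|c [cq c0 hc]] := valring_max (s := q) (idfun : {rmorphism K -> K}) (dvr_valring dF).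
  apply/hasP; exists 1; rewrite ?oner_eq0 //; have := monicP pm; rewrite eq lead_coef_map => /eqP.
  rewrite fmorph_eq1 => /eqP <-; rewrite lead_coefE.
  apply: mem_nth; suff : (0 < size q)%N by case: (size q).
  rewrite lt0n size_poly_eq0.
  by apply: contraTneq pm => h; rewrite eq h rmorph0 monicE lead_coef0 eq_sym oner_eq0.
have [j sj ej] := nthP 0 cq.
exists ((phi c)^-1 *: p), j; split.
- move=> i; rewrite coefZ eq coef_map -fmorphV -rmorphM mulrC; apply/phi_mem.
  have [h|h] := ltnP i (size q); first by apply: (hc q`_i); exact: mem_nth.
  by rewrite nth_default // mul0r; exact: sr0.
- by rewrite rootE hornerZ (rootP px) mulr0.
- by rewrite coefZ eq coef_map ej mulVf ?fmorph_eq0 //; exact: unit_in1.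
Qed.

Lemma ext_int x : V x -> exists y z, [/\ cl F' y, cl F' z, unit_in V y & x = z / y].
Proof. by move=> Vx; have [p [i0 [hp px ui]]] := val_denom x; exact: (prufer hF' VV F'V Vx hp px ui). Qed.

Section Uniformizer.
Variables (t : K) (Ft : F t) (ot : ord F t = 1).
Let t0 : t != 0. Proof. exact: (ord1_neq0 dF ot). Qed.
Let pt0 : phi t != 0. Proof. by rewrite fmorph_eq0. Qed.

Lemma phi_tX (m : int) : unit_in V (phi t ^ m) <-> m = 0.
Proof.
split=> [|->]; last exact: unit_in1.
rewrite -rmorphXz ?unitfE // => /ext_unitE /(ord_unitP dF) [_].
by rewrite (ordXz dF) // ot mul1r.
Qed.

Lemma phi_form a : a != 0 -> exists u, unit_in V u /\ phi a = u * phi t ^ (ord F a).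
Proof.
move=> a0; exists (phi (a / t ^ (ord F a))); split.
  apply: ext_unit; apply/(ord_unitP dF).
  have h : t ^ (ord F a) != 0 by rewrite expfz_neq0.
  by rewrite mulf_neq0 ?invr_eq0 // (ordM dF) ?invr_eq0 // (ordV dF) // (ordXz dF) // ot mul1r subrr.
by rewrite -(rmorphXz phi) ?unitfE // -rmorphM mulfVK // expfz_neq0.
Qed.

(** In the characteristic equation two terms have the same value, so some power [x ^+ (i - j)] has
    the value of an element of [phi K]; as [0 < i - j <= r], this exponent divides [r!]. *)
Lemma val_power : exists2 N : nat, (0 < N)%N &
  forall x, x != 0 -> exists m : int, unit_in V (x ^+ N * phi t ^ m).
Proof.
have [r [e he]] := range_basis; exists r`!; first exact: fact_gt0.
move=> x x0; set p := char_poly (Mx L e x).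
have sp : size p = r.+1 by exact: size_char_poly.
have px : root p x := char_poly_Mx_root he x.
have hp : pover L p.
  apply: (char_poly_integral hL he) => //; first by case: hL.
  - by rewrite frac_id.
  - by apply: (C_Qsub (iota := iota)) => _ [c _ <-]; exists (iota c).
have [||i [j [ij ci cj hu]]] := @val_two _ V r.+1 (fun i => p`_i * x ^+ i) VV.
- by have := rootP px; rewrite horner_coef sp.
- exists ord_max; rewrite mulf_neq0 ?expf_neq0 //=.
  by have := char_poly_monic (Mx L e x); rewrite monicE lead_coefE -/p sp => /eqP ->; rewrite oner_eq0.
wlog ltij : i j ij ci cj hu / (j < i)%N.
  move=> h; have := ij; rewrite -val_eqE neq_ltn => /orP[hlt|]; last exact: h.
  apply: (h j i) => //; first by rewrite eq_sym.
  by have := unit_inV hu; rewrite invf_div.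
have [a _ ea] := hp i; have [b _ eb] := hp j.
have pi0 : p`_i != 0 by move: ci; rewrite mulf_eq0 negb_or => /andP[].
have pj0 : p`_j != 0 by move: cj; rewrite mulf_eq0 negb_or => /andP[].
have a0 : a / b != 0 by rewrite -(fmorph_eq0 phi) fmorph_div ea eb mulf_neq0 ?invr_eq0.
have [u [hu' eu]] := phi_form a0.
have h : unit_in V (x ^+ (i - j) * phi t ^ (ord F (a / b))).
  rewrite (_ : _ * _ = u^-1 * (p`_i * x ^+ i / (p`_j * x ^+ j))).
    by apply: unit_inM => //; exact: unit_inV.
  have e1 : phi (a / b) = p`_i / p`_j by rewrite fmorph_div ea eb.
  have u0 : u != 0 by case: hu'.
  have e2 : x ^+ i = x ^+ (i - j) * x ^+ j by rewrite -exprD subnK // ltnW.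
  apply: (mulfI u0); rewrite mulrCA -eu e1 e2; by field; rewrite ?pj0 ?u0 ?expf_neq0.
have dv : (i - j %| r`!)%N.
  by apply: dvdn_fact; rewrite subn_gt0 ltij leq_subLR (leq_trans _ (leq_addl _ _)) // -ltnS.
exists (ord F (a / b) * (r`! %/ (i - j))%N%:Z).
have := unit_inX hV (r`! %/ (i - j)) h; rewrite exprMn -exprM mulnC divnK //.
by rewrite exprnP -exprz_exp.
Qed.

(** By [val_power] the value group lies between that of [phi t] and its [N]-th part. [val x m] says
    that [x] has [m / N] times the value of [phi t]; an element with the least positive [m] is a
    uniformizer. *)
Lemma ext_dvr : is_dvr V.
Proof.
have [N N0 hN] := val_power.
pose val x (m : int) := unit_in V (x ^+ N / phi t ^ m).
have pz m : phi t ^ m != 0 by rewrite expfz_neq0.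
have valM x y m m' : val x m -> val y m' -> val (x * y) (m + m').
  move=> h h'; rewrite /val exprMn expfzDr // (_ : _ / _ = (x ^+ N / phi t ^ m) * (y ^+ N / phi t ^ m')).
    exact: unit_inM.
  by field; rewrite !pz.
have valV x m : val x m -> val x^-1 (- m).
  move=> h; rewrite /val exprVn invr_expz opprK.
  by have := unit_inV h; rewrite invf_div mulrC.
have valX x m q : val x m -> val (x ^ q) (m * q).
  have valn (n : nat) : val x m -> val (x ^+ n) (m *+ n).
    elim: n => [|n ih] h; first by rewrite /val mulr0n expr1n expr0z divr1; exact: unit_in1.
    by rewrite exprS mulrS; apply: valM => //; exact: ih.
  have eq (n : nat) : m * n%:Z = m *+ n by rewrite -[n%:Z]natz mulr_natr.
  case: q => q h; first by rewrite eq; exact: valn.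
  by rewrite NegzE mulrN -exprnN eq; apply: valV; exact: valn.
have val_ex x : x != 0 -> exists m, val x m.
  by move=> /hN [m h]; exists (- m); rewrite /val invr_expz opprK.
have valt : val (phi t) N%:Z by rewrite /val exprnP divff //; exact: unit_in1.
have VX x : V (x ^+ N) -> V x.
  move=> h; have [//|hi] := VV.2 x; have [->|x0] := eqVneq x 0; first exact: sr0.
  have -> : x = x ^+ N * x^-1 ^+ N.-1.
    by rewrite -{1}(prednK N0) exprSr mulrAC -exprMn divff // expr1n mul1r.
  by apply: srM => //; exact: srX.
have val0 x : x != 0 -> val x 0 -> unit_in V x.
  move=> x0; rewrite /val expr0z divr1 => -[_ h1 h2]; split=> //; apply: VX => //.
  by rewrite exprVn.
have ex : exists n : nat, `[< exists2 x, x != 0 & val x n.+1%:Z >].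
  by exists N.-1; apply/asboolP; exists (phi t); rewrite ?prednK.
case: (ex_minnP ex) => n /asboolP [tau tau0 htau] hmin.
split=> //; exists tau.
have nu : ~ unit_in V tau.
  move=> hu; have := unit_inX hV N hu; move: htau; rewrite /val => h h'.
  have := unit_inM hV (unit_inV h) h'; rewrite invf_div mulfVK ?expf_neq0 //.
  by move/phi_tX.
have Vtau : V tau.
  apply: VX; rewrite -[tau ^+ N](mulfVK (pz n.+1%:Z)); apply: srM => //; first by case: htau.
  by rewrite -exprnP; apply: srX => //; exact: FV.
split=> //; first by move=> h; apply: nu.
move=> x x0; have [m hm] := val_ex x x0.
pose q := (m %/ n.+1%:Z)%Z; pose rr := (m %% n.+1%:Z)%Z.
have hr : val (x / tau ^ q) rr.
  have -> : rr = m + - (n.+1%:Z * q) by rewrite [m in RHS](divz_eq m n.+1%:Z) -/q -/rr mulrC addrAC subrr add0r.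
  by apply: valM => //; apply: valV; exact: valX.
have xt0 : x / tau ^ q != 0 by rewrite mulf_neq0 ?invr_eq0 ?expfz_neq0.
exists q, (x / tau ^ q); split; last by rewrite mulfVK // expfz_neq0.
apply: val0 => //; suff -> : 0 = rr by [].
have r0 : 0 <= rr by rewrite modz_ge0.
have rn : rr < n.+1%:Z by rewrite ltz_pmod.
move: r0 rn hr; case: rr => // -[|k] // _ kn hr.
rewrite ltz_nat ltnS in kn.
have /(hmin k) : `[< exists2 x1 : K, x1 != 0 & val x1 k.+1%:Z >] by apply/asboolP; exists (x / tau ^ q).
by rewrite leqNgt kn.
Qed.

Lemma ext_ramif : exists2 k : nat, (0 < k)%N & forall y, y != 0 -> ord V (phi y) = ord F y *+ k.
Proof.
have dV := ext_dvr; exists `|ord V (phi t)|%N.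
  rewrite absz_gt0; apply/eqP => h; have /ext_unitE /(ord_unitP dF) [_] : unit_in V (phi t) by apply/(ord_unitP dV).
  by rewrite ot.
move=> y y0; have [u [hu ->]] := phi_form y0; have [_ ou] := (ord_unitP dV u).1 hu.
have u0 : u != 0 by case: hu.
rewrite (ordM dV) ?expfz_neq0 // ou add0r (ordXz dV) //.
have : 0 <= ord V (phi t) by apply/(ord_ge0 dV pt0); exact: FV.
by case: (ord V (phi t)) => // k _; rewrite -mulr_natl natz.
Qed.

End Uniformizer.

Section Coordinates.
Variables (l : seq K) (t : K) (tau : K).
Hypotheses (hc : dcoord iota F l t) (Vtau : V tau) (otau : ord V tau = 1).

Let Ft : F t. Proof. by case: hc => _ _ _ [? _] _. Qed.
Let ot : ord F t = 1. Proof. by case: hc => _ _ _ [_ ?] _. Qed.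
Let dV : is_dvr V. Proof. exact: (ext_dvr Ft ot). Qed.

Lemma rem_map_phi y : y \in l -> rem (phi y) (map phi l) = map phi (rem y l).
Proof.
elim: l => //= x l' ih; rewrite inE (inj_eq (fmorph_inj phi)) eq_sym.
by case: eqP => //= _ /ih ->.
Qed.

(** [phi] preserves independence and the units; [tau] is not algebraic over the [phi l] and is
    exchanged for [phi t]. *)
Lemma ext_dcoord : dcoord iota V (map phi l) tau.
Proof.
have [lF il ul _ hcl] := hc.
have ul' g : pol (map phi l) g -> g != 0 -> unit_in V g.
  rewrite -(phi_pol phiC) => -[y hy <-]; rewrite fmorph_eq0 => y0.
  by apply: ext_unit; exact: ul.
split=> //.
- by move=> _ /mapP [y yl ->]; apply: FV; exact: lF.
- move=> _ /mapP [y yl ->]; rewrite rem_map_phi // -(phi_pol phiC) => /phi_clE h.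
  by apply: (il y yl); apply: h; exact: pol_subring.
pose L0 := frac (pol (map phi l)); have hp := pol_subring iota (map phi l).
have hL0 : is_subfield L0 by exact: frac_subfield.
have L0V : L0 `<=` V.
  move=> _ [a [b [ha hb b0 ->]]]; apply: srM => //; last by case: (ul' b hb b0).
  by apply: (pol_min hV CV _ ha) => _ /mapP [y yl ->]; apply: FV; exact: lF.
have ntau : ~ cl L0 tau.
  move=> ct; have /(ord_unitP dV) [_] := subfield_valring hL0 VV L0V ct (ord1_neq0 dV otau).
  by rewrite otau.
have all1 x : cl (frac (pol (phi t :: map phi l))) x.
  apply: (cl_min _ (hK x)) => _ [y _ <-].
  apply: clS (phi_clI (phi := phi) (hcl y)) => _ [_ [a [b [ha hb b0 ->]]] <-].
  exists (phi a), (phi b); rewrite fmorph_eq0 fmorph_div; split=> //;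
    by rewrite -[_ :: _]/(map phi (t :: l)) -(phi_pol phiC); apply/phi_mem.
have ht : cl (frac (pol (tau :: map phi l))) (phi t).
  rewrite pol_cons -frac_adjoin_frac //; apply: exchange => //.
  by rewrite frac_adjoin_frac // -pol_cons; exact: all1.
have hF2 := frac_subfield (pol_subring iota (tau :: map phi l)).
move=> x; have [h1 h2] := cl_subfield hF2; apply: cl_min (all1 x); apply: frac_min => //.
rewrite (pol_cons iota (phi t)); apply: adjoin_min => //; last by move=> _ /= ->.
move=> a ha; apply: sub_cl; apply: sub_frac; first exact: pol_subring.
by rewrite pol_cons; exact: mem_adjoinl.
Qed.

(** The coordinates of [x] follow from the traces of the [x * e_j] by inverting the matrix of the
    trace form. For integral [x], these traces have bounded denominators. *)
Lemma coord_denom r (e : 'cV[K]_r) : basis L e -> exists dl, [/\ F' dl, dl != 0 &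
  forall x, cl F' x -> forall i, F' (dl * coord L e x 0 i)].
Proof.
move=> he; have hL1 : is_subring L by case: hL.
have hS := cl_subring F'.
pose T := \matrix_(i, j) \tr (Mx L e (e i 0 * e j 0)).
have [h1 h2] := he.
have Mxsum x j : Mx L e (x * e j 0) = \sum_i coord L e x 0 i *: Mx L e (e i 0 * e j 0).
  have [hx ex] := coordP he x.
  rewrite -(Mx_lin hL he _ (fun i => e i 0 * e j 0)) //; congr (Mx L e _).
  by rewrite {1}ex mxE mulr_suml; apply: eq_bigr => i _; rewrite mulrA.
have trE x j : \tr (Mx L e (x * e j 0)) = (coord L e x *m T) 0 j.
  by rewrite Mxsum raddf_sum [RHS]mxE; apply: eq_bigr => i _; rewrite /= mxtraceZ [T _ _]mxE.
have LT i j : L (T i j).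
  by rewrite mxE; apply: (sr_sum hL1) => k _; exact: Mx_over.
have Tu : T \in unitmx.
  rewrite -row_free_unit -kermx_eq0; apply/eqP/row_matrixP => i; rewrite row0.
  have kT : row i (kermx T) *m T = 0 by rewrite -row_mul mulmx_ker row0.
  move: (row i _) kT => v kT.
  have hv0 (v' : 'rV[K]_r) : (forall i, L (v' 0 i)) -> v' *m T = 0 -> v' = 0.
    move=> hv vT; apply: (h2) => //; apply: (trace_nondeg hL he (natn0 iota)) => j.
    have ec : coord L e ((v' *m e) 0 0) = v'.
      have [k1 k2] := coordP he ((v' *m e) 0 0).
      apply/eqP; rewrite -subr_eq0; apply/eqP; apply: (h2).
        by move=> k; rewrite mxE [X in _ + X]mxE; apply: srB.
      by rewrite mulmxBl mxE -k2 [X in _ + X]mxE subrr.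
    by rewrite trE ec vT mxE.
  (* The trace form is known to be nondegenerate over [L]; a kernel vector over [K] is split along
     the basis into kernel vectors over [L]. *)
  pose c i := coord L e (v 0 i).
  have vE : v = \sum_k (e k 0) *: (\row_i c i 0 k).
    apply/rowP => j; rewrite summxE; have [_ {1}->] := coordP he (v 0 j).
    by rewrite mxE; apply: eq_bigr => k _; rewrite !mxE mulrC.
  rewrite vE big1 // => k _; rewrite (hv0 (\row_i c i 0 k)) ?scaler0 //.
    by move=> j; rewrite mxE; exact: (coordP he _).1.
  apply/rowP => j; rewrite mxE [RHS]mxE.
  have := congr1 (fun M : 'rV[K]_r => M 0 j) kT; rewrite vE mulmx_suml summxE [RHS]mxE.
  under eq_bigr do rewrite -scalemxAl mxE.
  move=> h; pose a := \row_k' ((\row_i c i 0 k') *m T) 0 j.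
  have : a = 0.
    apply: (h2); last by rewrite mxE -[RHS]h; apply: eq_bigr => k' _; rewrite mxE mulrC.
    move=> k'; rewrite !mxE; apply: (sr_sum hL1) => m _; rewrite mxE; apply: srM => //.
    exact: (coordP he _).1.
  by move/rowP => /(_ k); rewrite !mxE.
have LTi i j : L (invmx T i j).
  rewrite /invmx Tu mxE mxE; apply: srM => //.
    by apply: hL.2; apply: det_over.
  rewrite /cofactor; apply: srM => //; first exact: sr_sign.
  by apply: det_over => // i' j'; rewrite 2!mxE; exact: LT.
have [|w1 [Fw1 w10 hw1]] := @common_denom _ F' [seq invmx T ij.1 ij.2 | ij <- enum [set: 'I_r * 'I_r]] hF'.
  by move=> _ /mapP [ij _ ->]; apply: LF'; exact: LTi.
have /choice [f hf] : forall j : 'I_r, exists a, [/\ F' a, a != 0 & cl F' (a * e j 0)].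
  move=> j; apply: cl_frac_denom => //; exact: clS LF' _ (hK _).
pose w2 := \prod_j f j.
have Fw2 : F' w2 by apply: (sr_prod hF') => j _; case: (hf j).
have w20 : w2 != 0 by apply/prodf_neq0 => j _; case: (hf j).
have hw2 j : cl F' (w2 * e j 0).
  rewrite /w2 (bigD1 j) //= mulrAC; apply: (srM hS); first by case: (hf j).
  by apply: (sr_prod hS) => k _; apply: sub_cl; case: (hf k).
exists (w1 * w2); split; [exact: (srM hF')|exact: mulf_neq0|].
move=> x Sx i.
have -> : coord L e x = (coord L e x *m T) *m invmx T by rewrite mulmxK.
rewrite mxE mulr_sumr; apply: (sr_sum hF') => j _.
rewrite -trE (_ : _ * _ = w2 * \tr (Mx L e (x * e j 0)) * (w1 * invmx T j i)); last by ring.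
apply: (srM hF'); last first.
  by apply: hw1; apply/mapP; exists (j, i); rewrite // mem_enum inE.
have -> : w2 * \tr (Mx L e (x * e j 0)) = \tr (Mx L e (w2 * e j 0 * x)).
  have Lw2 : L w2 by exact: F'L.
  by rewrite -mulrA [e j 0 * x]mulrC (MxM hL he w2) (MxL hL he Lw2) mul_scalar_mx mxtraceZ.
by apply: (trace_integral hL he) => //; exact: (srM hS).
Qed.

(** An integral element has coordinates in the basis with bounded denominators, on which [D] is
    controlled by its values at the finitely many [phi (x i)]; and [ext_int] makes [V] a
    localization of the integral elements. *)
Lemma ext_bounded m (x : 'I_m -> K) d : ecoord iota F x d -> bounded_der iota V.
Proof.
move=> [hx xF dF1] D hD; have hD' := (derivation_pderiv iota D).1 hD.
have [r [e he]] := range_basis; have [dl [Fdl dl0 hdl]] := coord_denom he.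
have hS := cl_subring F'; have fS z : frac (cl F') z.
  have [a [Fa a0 Sa]] := cl_frac_denom hF' (clS LF' (hK z)).
  exists (a * z), a; split=> //; first exact: sub_cl.
  by rewrite mulrC mulKf.
have [|b1 [_ b10 hb1]] := @common_denom _ (cl F') [seq D (phi (x i)) | i <- enum 'I_m] hS.
  by move=> z _; exact: fS.
have [|b2 [Sb2 b20 hb2]] := @common_denom _ (cl F') ([seq D (e i 0) | i <- enum 'I_r] ++ [seq e i 0 | i <- enum 'I_r]) hS.
  by move=> z _; exact: fS.
have hphi : pderiv iota phi (D \o phi).
  have [k1 k2 k3] := hD'; split=> /= [c|y z|y z]; first by rewrite phiC.
    by rewrite rmorphD k2.
  by rewrite rmorphM k3.
have DF y : F y -> cl F' (b1 * D (phi y)).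
  move=> Fy; have /= -> := dual_expand hx y hphi; rewrite mulr_sumr; apply: (sr_sum hS) => i _; rewrite mulrA.
  apply: (srM hS); first by apply: hb1; apply: map_f; rewrite mem_enum.
  by apply: sub_cl; apply/phi_mem; exact: dF1.
have [|b3 [Sb3 b30 hb3]] := @common_denom _ (cl F') [:: b1] hS; first by move=> z _; exact: fS.
have Sb31 : cl F' (b3 * b1) by apply: hb3; rewrite mem_head.
(* [b1] clears [D] on [phi F], [b2] the basis and its derivatives, [dl] the coordinates. *)
pose b := b3 * b1 * b2 * dl; exists b; first by rewrite !mulf_neq0.
have DS z : cl F' z -> cl F' (b * D z).
  move=> Sz; have [y0 Fy0 ey0] := Fdl.
  have e1 : dl * D z = D (dl * z) - D dl * z by rewrite (pdM hD') /= addrK.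
  rewrite /b -mulrA e1 mulrBr; apply: (srB hS); last first.
    have -> : b3 * b1 * b2 * (D dl * z) = b3 * b2 * (b1 * D dl) * z by ring.
    by apply: (srM hS) => //; apply: (srM hS); [exact: (srM hS)|rewrite -ey0; exact: DF].
  have [_ ez] := coordP he z.
  rewrite {1}ez mxE mulr_sumr (pd_sum hD') mulr_sumr; apply: (sr_sum hS) => i _.
  rewrite mulrA; have [y Fy <-] := hdl z Sz i; rewrite (pdM hD') /= mulrDr; apply: (srD hS).
    have -> : b3 * b1 * b2 * (phi y * D (e i 0)) = b3 * b1 * phi y * (b2 * D (e i 0)) by ring.
    apply: (srM hS); first by apply: (srM hS) => //; apply: sub_cl; exists y.
    by apply: hb2; rewrite mem_cat map_f ?mem_enum.
  have -> : b3 * b1 * b2 * (D (phi y) * e i 0) = b3 * (b1 * D (phi y)) * (b2 * e i 0) by ring.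
  apply: (srM hS); first by apply: (srM hS) => //; exact: DF.
  by apply: hb2; rewrite mem_cat; apply/orP; right; apply/mapP; exists i; rewrite ?mem_enum.
have SV z : cl F' z -> V z by move=> h; exact: h.
move=> z /ext_int [a [c [Sa Sc ua ->]]]; have [a0 _ Vai] := ua.
rewrite (pdiv _ hD) // mulrA; apply: srM => //; rewrite mulrBr mulrCA.
have VD y : cl F' y -> V (b * D y) by move=> Sy; apply: (SV); exact: DS.
apply: (srB hV); first exact: VD.
by apply: (srM hV); [apply: (srM hV) => //; exact: SV|exact: VD].
Qed.

(* The valuation of the pulled back form: [phi t = v tau^k] contributes [k - 1]. *)
Lemma ext_form (d : 'I_(size l).+1 -> K -> K) (w : @top_form K) u k :
  ecoord iota F (fun i => (t :: l)`_i) d -> nonzero_top_form iota w ->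
  (0 < k)%N -> (forall y, y != 0 -> ord V (phi y) = ord F y *+ k) ->
  (forall D : 'I_(form_dim w) -> K -> K, (forall i, derivation iota (D i)) ->
     phi (form_coef w) * \det (\matrix_(i, j) D i (phi (form_vars (t := w) j))) = u * form_eval D) ->
  [/\ u != 0, ord V u + ord_form iota w V = ord_form iota w F *+ k + k.-1%:Z &
    exists (y : 'I_(form_dim w) -> K) e, ecoord iota V y e].
Proof.
move=> hx hw k0 hk hu; have t0 : t != 0 := ord1_neq0 dF ot; have tau0 := ord1_neq0 dV otau.
have := dcoord_dual dV CV ext_dcoord f0 (ext_bounded hx); rewrite size_map => -[e he].
have en := ecoord_dim hw f0 he; case: w hw hu en => n tv c hw hu /= en; subst n.
set w := TopForm tv c in hw hu *.
have [h1 h2 h3] := he; have [k1 k2 _] := h1; have [x1 x2 x3] := hx.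
pose N := \matrix_(i, j < (size l).+1) e i (phi (t :: l)`_j).
have eN i (j : 'I_(size l)) : N i (lift ord0 j) = (i == lift ord0 j)%:R.
  rewrite mxE -k2; congr (e i _).
  by rewrite lift0 /= (nth_map 0).
(* The [phi l] are among the coordinates at [V], so all columns but the first are unit vectors, and
   only the derivative of [phi t] along [tau] remains. *)
have dN : \det N = e ord0 (phi t).
  rewrite (expand_det_row N ord0) big_ord_recl big1 ?addr0; last first.
    by move=> j _; rewrite eN (negbTE (neq_lift _ _)) mul0r.
  rewrite mxE /= /cofactor expr0 mul1r (_ : row' _ _ = 1%:M) ?det1 ?mulr1 //.
  by apply/matrixP => i j; rewrite mxE [LHS]mxE eN [RHS]mxE; congr (_%:R).
have E1 : phi c * \det (\matrix_(i, j) e i (phi (tv j))) = \det N * phi (form_eval (w := w) d).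
  rewrite /form_eval rmorphM mulrCA -det_map_mx -det_mulmx; congr (_ * \det _).
  apply/matrixP => i j; rewrite !mxE.
  have hi : pderiv iota phi (e i \o phi).
    have [a1 a2 a3] := k1 i; split=> /= [b|y z|y z]; first by rewrite phiC.
      by rewrite rmorphD a2.
    by rewrite rmorphM a3.
  have /= -> := dual_expand x1 (tv j) hi; apply: eq_bigr => a _.
  by rewrite !mxE.
have e0V y : V y -> V (e ord0 y) by apply: h3.
have /derivation_pderiv he0 := k1 ord0.
have ept : ord V (phi t) = k%:Z by rewrite hk // ot natz.
pose v := phi t / tau ^+ k.
have pt0 : phi t != 0 by rewrite fmorph_eq0.
have uv : unit_in V v.
  apply/(ord_unitP dV); have v0 : v != 0 by rewrite mulf_neq0 ?invr_eq0 ?expf_neq0.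
  by rewrite (ordM dV) ?invr_eq0 ?expf_neq0 // (ordV dV) ?expf_neq0 // (ordX dV) // otau ept natz subrr.
have etau : e ord0 tau = 1 by have := k2 ord0 ord0; rewrite eqxx.
have edN : \det N = tau ^+ k.-1 * (v *+ k + e ord0 v * tau).
  have -> : \det N = e ord0 (v * tau ^+ k) by rewrite dN /v mulfVK // expf_neq0.
  rewrite (pdM he0) (pdX he0) /= etau mulr1.
  by rewrite -{3}(prednK k0) exprS -[v *+ k]mulr_natr -[_ *+ k]mulr_natr; ring.
(* Tameness: in characteristic zero [v *+ k] is a unit, and the other term is in the maximal ideal.
   So the different has order exactly [k - 1]. *)
have u2 : unit_in V (v *+ k + e ord0 v * tau).
  have [_ _ mD mM _] := valring_prime VV; have [v0 Vv _] := uv.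
  have Vs : V (v *+ k) by apply: srMn.
  have me : max_ideal V (e ord0 v * tau).
    apply: mM; first exact: e0V.
    by apply/(max_idealP dV tau0); rewrite otau.
  apply: contrapT => nu; have : max_ideal V (v *+ k).
    rewrite -(addrK (e ord0 v * tau) (v *+ k)); apply: mD; first by split=> //; apply: srD => //; case: me.
    by rewrite -mulN1r; apply: mM => //; exact/(srN hV)/(sr1 hV).
  case=> _; apply; rewrite -mulr_natr; apply: unit_inM => //.
  apply: (C_unit (iota := iota)) => //; first by apply: (sr_nat (C_subring iota)).
  by case: k k0 {hk ept v uv etau edN v0 Vv Vs me nu} => // k _; exact: (natn0 iota).
have [u20 ou2] := (ord_unitP dV _).1 u2.
have f1 := form_eval_neq0 hw f0 x1; have f2 := form_eval_neq0 hw f0 h1.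
have N0 : \det N != 0 by rewrite edN mulf_neq0 ?expf_neq0.
have oN : ord V (\det N) = k.-1%:Z.
  by rewrite edN (ordM dV) ?expf_neq0 // ou2 addr0 (ordX dV) // otau natz.
have E2 := hu e k1; rewrite /= E1 in E2.
have u0 : u != 0.
  apply: contra_eq_neq E2 => ->; rewrite mul0r mulf_neq0 // fmorph_eq0.
  exact: f1.
split=> //; last by exists (fun i => (tau :: map phi l)`_i), e.
rewrite (ord_formE hw f0 dV he) (ord_formE hw f0 dF hx) -hk //.
have := congr1 (ord V) E2; rewrite [in RHS](ordM dV) // [in LHS](ordM dV) ?fmorph_eq0 // oN => <-.
by rewrite addrC.
Qed.

End Coordinates.
End Over.
End Extension.

(** * Polarized endomorphisms: finiteness, going down, and log discrepancies under pull back *)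

Section Endomorphism.
Context {R : realType} {K : fieldType} (iota : {rmorphism R[i] -> K}).
Implicit Types (A B V P Q E F : set K) (x y z u g : K) (phi psi : {rmorphism K -> K}).

Local Notation C := (range iota).
Local Notation pol s := (adjoin C [set` s]).
Local Notation L phi := (range phi).

(* The pull back of the hyperplane class of the coordinates [s] is [q] times this class, [G]
   being the rational function which realizes the linear equivalence. *)
Definition polar (s : seq K) phi G (q : nat) := G != 0 /\ forall V, valring V -> C `<=` V ->
  forall i l, idx s V i -> idx s (phi @^-1` V) l -> unit_in V (G * i ^+ q / phi l).

Lemma coef_char_polyZ n (M : 'M[K]_n) c i : c != 0 -> (i <= n)%N ->
  (char_poly (c *: M))`_i = c ^+ (n - i) * (char_poly M)`_i.
Proof.
move=> c0 ni; pose f : {rmorphism {poly K} -> {poly K}} := comp_poly (c *: 'X).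
have e1 : map_mx f (char_poly_mx (c *: M)) = c%:P *: char_poly_mx M.
  apply/matrixP => a b; rewrite !mxE /f rmorphB /= comp_polyC rmorphMn /= comp_polyX.
  by rewrite mulrBr -polyCM mulrnAr mul_polyC.
have e2 : f (char_poly (c *: M)) = c ^+ n *: char_poly M.
  by rewrite /char_poly -(det_map_mx f) e1 detZ -rmorphXn /= mul_polyC.
have e3 (p : {poly K}) : (f p)`_i = c ^+ i * p`_i.
  rewrite /f /= comp_polyE; under eq_bigr do rewrite exprZn scalerA mulrC.
  rewrite -(poly_def _ (fun j => c ^+ j * p`_j)) coef_poly; case: ltnP => // h.
  by rewrite nth_default // mulr0.
apply: (mulfI (expf_neq0 i c0)); rewrite -e3 e2 coefZ mulrA -exprD.
by rewrite subnKC.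
Qed.

Variables (s : seq K) (X : set (set K)).
Hypotheses (Xs : X = projective_over C s) (XT : X setT) (Xn : normal X).

Section Polar.
Variables (phi : {rmorphism K -> K}) (G : K) (q : nat).
Hypotheses (phiC : forall c, phi (iota c) = iota c) (hG : polar s phi G q) (q0 : (0 < q)%N).

Lemma polar_idx V : valring V -> C `<=` V -> exists i, idx s V i.
Proof.
move=> VV CV; have [i [? ? h]] := valring_max (idfun : {rmorphism K -> K}) VV (has_nz Xs XT).
by exists i.
Qed.

(** At any valuation ring over [phi A], with [m] a coordinate of least value, the expression is a
    product of ratios of coordinates with [m] and of the unit [G * m ^+ q / phi l]. *)
Lemma polar_int A l i j : C `<=` A -> idx s A l -> i \in s -> j \in s ->
  cl (phi @` A) (G * j * i ^+ q.-1 / phi l).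
Proof.
move=> CA hl hi hj V VV AV; have [hV _] := VV.
have CV : C `<=` V by move=> _ [c _ <-]; rewrite -phiC; apply: AV; exists (iota c) => //; apply: CA; exists c.
have [m hm] := polar_idx VV CV; have [m1 m0 mV] := hm.
have hl' : idx s (phi @^-1` V) l by apply: idxS hl => x Ax; apply: AV; exists x.
have [_ l0 _] := hl.
have [_ Vu _] := hG.2 V VV CV m l hm hl'.
have -> : G * j * i ^+ q.-1 / phi l = (j / m) * (i / m) ^+ q.-1 * (G * m ^+ q / phi l).
  have -> : m ^+ q = m * m ^+ q.-1 by rewrite -exprS prednK.
  rewrite expr_div_n; field.
  by rewrite ?fmorph_eq0 ?l0 ?m0 ?expf_neq0.
by apply: (srM hV) => //; apply: (srM hV); [exact: mV|apply: (srX hV); exact: mV].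
Qed.

Lemma polar_unit A l i F : C `<=` A -> idx s A l -> valring F -> phi @` A `<=` F -> idx s F i ->
  unit_in F (G * i * i ^+ q.-1 / phi l).
Proof.
move=> CA hl FF AF hi; have -> : G * i * i ^+ q.-1 = G * i ^+ q by rewrite -mulrA -exprS prednK.
apply: hG.2 => //.
  by move=> _ [c _ <-]; rewrite -phiC; apply: AF; exists (iota c) => //; apply: CA; exists c.
by apply: idxS hl => x Ax; apply: AF; exists x.
Qed.

(** The generators [j / i] of [K] are quotients of two elements of the form of [polar_int]: the
    endomorphism is generically finite. *)
Lemma polar_alg x : cl (L phi) x.
Proof.
have [i i1 i2] := hasP (has_nz Xs XT).
have hT : idx s setT i by split.
have hL := cl_subfield (range_subfield phi); have [hL1 hL2] := hL.
have CL : C `<=` cl (L phi) by move=> _ [c _ <-]; apply: sub_cl; exists (iota c).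
have key j : j \in s -> cl (L phi) (j / i).
  move=> js; have h1 := polar_int (fun _ _ => I) hT i1 js.
  have h2 := polar_int (fun _ _ => I) hT i1 i1.
  rewrite (_ : j / i = (G * j * i ^+ q.-1 / phi i) * (G * i * i ^+ q.-1 / phi i)^-1).
    by apply: (srM hL1) => //; exact: hL2.
  by field; have [G0 _] := hG; rewrite ?fmorph_eq0 ?i2 ?G0 ?expf_neq0.
have : frac (chart iota s i) x by rewrite (frac_chart Xs XT).
by apply: (frac_min hL); apply: chart_min.
Qed.

(** Finiteness of the endomorphism near [F]: every function on the chart of [F] becomes integral
    over [phi F'] after multiplication by a power of [ep], which is a unit at [F]. *)
Lemma polar_local F F' x : valring F -> X F -> X F' -> phi @` F' `<=` F -> F x ->
  exists y z, [/\ cl (phi @` F') y, cl (phi @` F') z, unit_in F z & x = y / z].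
Proof.
move=> FF XF XF' FF' Fx; have [hF CF _ _ [i hi]] := pt_facts Xs XF; have [i1 i2 iF] := hi.
have [hF' CF' _ _ [l hl]] := pt_facts Xs XF'.
have hS := cl_subring (phi @` F').
pose ep := G * i * i ^+ q.-1 / phi l.
have Sep : cl (phi @` F') ep by exact: polar_int.
have uep : unit_in F ep by exact: (polar_unit CF' hl FF FF' hi).
have [ep0 _ _] := uep.
have clear a : chart iota s i a -> exists k, cl (phi @` F') (ep ^+ k * a).
  apply: (@chart_min _ _ iota s i [set a | exists k, cl (phi @` F') (ep ^+ k * a)]).
  - apply/subringP; split=> /=.
    + by exists 0%N; rewrite expr0 mul1r; exact: sr1.
    + move=> y z [k hy] [k' hz]; exists (k + k')%N; rewrite mulrBr; apply: (srB hS).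
        by rewrite addnC exprD -mulrA; apply: (srM hS) => //; exact: (srX hS).
      by rewrite exprD -mulrA; apply: (srM hS) => //; exact: (srX hS).
    + move=> y z [k hy] [k' hz]; exists (k + k')%N.
      by rewrite exprD mulrACA; exact: (srM hS).
  - move=> _ [c _ <-]; exists 0%N; rewrite expr0 mul1r; apply: sub_cl.
    by exists (iota c) => //; apply: CF'; exists c.
  - move=> j js /=; exists 1%N; rewrite expr1.
    rewrite (_ : ep * (j / i) = G * j * i ^+ q.-1 / phi l); first exact: polar_int.
    by rewrite /ep; field; have [_ l0 _] := hl; rewrite ?fmorph_eq0 ?l0 ?i2.
have AF : chart iota s i `<=` F by exact: chart_min.
have [p hp eF] := pt_loc Xs i1 i2 XF AF.
move: Fx; rewrite {1}eF => -[a [b [Aa Ab nb ->]]].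
have [k hk] := clear a Aa; have [k' hk'] := clear b Ab.
have ub : unit_in F b by rewrite eF; apply/loc_unit => //; exact: chart_subring.
exists (ep ^+ (k + k') * a), (ep ^+ (k + k') * b); split.
- by rewrite addnC exprD -mulrA; apply: (srM hS) => //; exact: (srX hS).
- by rewrite exprD -mulrA; apply: (srM hS) => //; exact: (srX hS).
- by apply: unit_inM => //; exact: unit_inX.
- by case: ub => b0 _ _; field; rewrite ?b0 ?expf_neq0.
Qed.

(* Going down: if [a] is not in the intermediate prime [p], then [phi a ^ k y' = phi y x] with
   [y] in [p], so that the characteristic polynomial of the unit [y'] is a power of the variable
   modulo [p]. *)
Lemma polar_prime F F' : prime_divisor X F -> X F' -> maps_to phi F F' -> prime_divisor X F'.
Proof.
move=> pF XF' [m1 m2]; have dF := prime_divisor_dvr Xs XT Xn pF; have [XF _] := pF.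
have FF := dvr_valring dF; have [hF CF _ _ _] := pt_facts Xs XF.
have [hF' CF' nF' hmF' _] := pt_facts Xs XF'.
have sub : phi @` F' `<=` F by move=> _ [x hx <-]; exact: m1.
have [_ _ mD mM _] := valring_prime FF.
split=> //; split.
  apply: contrapT => no; apply: (dvr_neqT dF).
  have F'T : F' = setT.
    apply/seteqP; split=> // x _; have : frac F' x by rewrite (frac_pt Xs XT XF').
    move=> [a [b [Fa Fb b0 ->]]]; apply: (srM hF') => //.
    suff : unit_in F' b by case.
    by apply: contrapT => nb; apply: no; exists b.
  apply/seteqP; split=> // x _; apply: (polar_alg x FF) => _ [y _ <-].
  by apply: m1; rewrite F'T.
move=> p hp; apply: contrapT => no.
have [pF' [p0 p1] pD pM pP] := hp.
have pmax : p `<=` max_ideal F'.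
  move=> x px; split; first exact: pF'.
  by move=> [x0 _ xi]; apply: p1; rewrite -(mulVf x0); exact: pM.
have [a [Fa na] npa] : exists2 a, max_ideal F' a & ~ p a.
  apply: contrapT => no'; apply: no; right; apply/seteqP; split=> // x hx.
  by apply: contrapT => npx; apply: no'; exists x.
have [y py y0] : exists2 y, p y & y != 0.
  apply: contrapT => no'; apply: no; left; apply/seteqP; split=> [x px|_ ->] //=.
  by apply: contrapT => /eqP x0; apply: no'; exists x.
have a0 : a != 0 by apply: contra_notN npa => /eqP ->.
have pa0 : phi a != 0 by rewrite fmorph_eq0.
have py0 : phi y != 0 by rewrite fmorph_eq0.
have oa : 0 < ord F (phi a).
  by apply/(max_idealP dF pa0); split; [exact: m1|move=> h; apply: na; exact: m2].
have oy : 0 <= ord F (phi y) by apply/(ord_ge0 dF py0)/m1/pF'.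
pose k := `|ord F (phi y)|%N.
have : F (phi a ^+ k / phi y).
  apply/(ord_ge0 dF); first by rewrite mulf_neq0 ?invr_eq0 ?expf_neq0.
  rewrite (ordM dF) ?invr_eq0 ?expf_neq0 // (ordV dF) // (ordX dF) // subr_ge0.
  rewrite -[X in X <= _](gez0_abs oy) -/k -[X in X <= _]natz lerMn2r.
  by rewrite -gtz0_ge1 oa orbT.
move=> /(polar_local FF XF XF' sub) [x [y' [Sx Sy' uy' e]]].
have [s0 f0] := fin_gen Xs XT.
have [r [ee he]] := range_basis phiC polar_alg f0.
have hL := range_subfield phi; have [hL1 _] := hL.
have A1 := phi_subring phi hF'.
have A2 : L phi `<=` frac (phi @` F') by exact: (@phi_frac _ phi F' (frac_pt Xs XT XF')).
have A3 : phi @` F' `<=` L phi by move=> _ [z _ <-]; exists z.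
have A4 : cicin (L phi) (phi @` F').
  by exact: (@phi_cic _ phi F' hF' nF' (pt_cl Xs Xn XF')).
have A5 : Qsub (phi @` F').
  by apply: (C_Qsub (iota := iota)) => _ [c _ <-]; exists (iota c) => //; apply: CF'; exists c.
have hx := char_poly_integral hL he A1 A2 A3 A4 A5 Sx.
have hy := char_poly_integral hL he A1 A2 A3 A4 A5 Sy'.
have [y'0 Fy' _] := uy'.
have e2 : (phi a ^+ k) *: Mx (L phi) ee y' = phi y *: Mx (L phi) ee x.
  have La : L phi (phi a ^+ k) by rewrite -rmorphXn; exists (a ^+ k).
  have Ly : L phi (phi y) by exists y.
  have : phi a ^+ k * y' = phi y * x.
    by move: e => /(congr1 (fun z => z * y' * phi y)); rewrite mulfVK // mulrAC mulfVK // => ->; rewrite mulrC.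
  move/(congr1 (Mx (L phi) ee)); rewrite !(MxM hL he).
  by rewrite (MxL hL he La) (MxL hL he Ly) !mul_scalar_mx.
have key i : (i < r)%N -> (phi @` p) (char_poly (Mx (L phi) ee y'))`_i.
  move=> ir; have := congr1 (fun M => (char_poly M)`_i) e2.
  rewrite (coef_char_polyZ _ (expf_neq0 k pa0) (ltnW ir)) (coef_char_polyZ _ py0 (ltnW ir)).
  have [b Fb <-] := hy i; have [c Fc <-] := hx i.
  rewrite -!rmorphXn -!rmorphM => /fmorph_inj h; exists b => //.
  have : p (a ^+ k ^+ (r - i) * b).
    rewrite h -(prednK (_ : 0 < r - i)%N) ?subn_gt0 // exprSr -mulrA mulrC -mulrA.
    by rewrite mulrC; apply: pM => //; apply: (srM hF') => //; apply: (srX hF'); exact: pF'.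
  have nX n : ~ p (a ^+ n).
    elim: n => [|n ih]; first by rewrite expr0.
    by rewrite exprS => /pP [] //; exact: (srX hF').
  rewrite -exprM => /pP [] //; first exact: (srX hF').
  by move/nX.
have : max_ideal F (y' ^+ r).
  have := char_poly_Mx_root he y'; rewrite rootE horner_coef size_char_poly big_ord_recr /=.
  have := char_poly_monic (Mx (L phi) ee y'); rewrite monicE lead_coefE size_char_poly => /eqP -> .
  rewrite mul1r addrC addr_eq0 => /eqP ->; rewrite -sumrN.
  elim/big_ind: _; [by case: (valring_prime FF) => _ []|exact: mD|move=> i _].
  rewrite -mulrN mulrC; apply: mM; first by apply: (srN hF); exact: (srX hF).
  have [b pb <-] := key i (ltn_ord i); split; first exact/m1/pF'.
  by move=> hu; have [Fb] := pmax b pb; apply; exact: m2.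
by case=> _; apply; exact: unit_inX.
Qed.

End Polar.

Section LogDiscrepancy.
Variables (w : @top_form K) (phi : {rmorphism K -> K}) (G : K) (q : nat).
Hypotheses (hw : nonzero_top_form iota w) (hphi : surjective_endomorphism iota X phi)
  (hG : polar s phi G q) (q0 : (0 < q)%N).

Let phiC c : phi (iota c) = iota c. Proof. by case: hphi => + _ _. Qed.

(** Top forms make up a line over [K], so the pull back of [w] is [u] times [w]; the equation is
    stated after evaluation on derivations. *)
Lemma form_pull : exists u, forall D : 'I_(form_dim w) -> K -> K, (forall i, derivation iota (D i)) ->
  phi (form_coef w) * \det (\matrix_(i, j) D i (phi (form_vars (t := w) j))) = u * form_eval D.
Proof.
have [hb c0] := hw; have [s0 f0] := fin_gen Xs XT; have [d hd] := mmap_dual hb f0.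
exists (phi (form_coef w) / form_coef w * \det (\matrix_(i, j) d i (phi (form_vars (t := w) j)))) => D hD.
have -> : \matrix_(i, j) D i (phi (form_vars (t := w) j)) =
   (\matrix_(i, j) D i (form_vars (t := w) j)) *m (\matrix_(i, j) d i (phi (form_vars (t := w) j))).
  apply/matrixP => i j; rewrite !mxE (dual_derivation hd _ (hD i)).
  by apply: eq_bigr => k _; rewrite !mxE.
by rewrite det_mulmx /form_eval; field.
Qed.

Lemma ext_all Y E V u : birational_model iota X Y -> prime_divisor Y E -> valring V ->
  (forall x, E x -> V (phi x)) -> V <> setT ->
  (forall D : 'I_(form_dim w) -> K -> K, (forall i, derivation iota (D i)) ->
     phi (form_coef w) * \det (\matrix_(i, j) D i (phi (form_vars (t := w) j))) = u * form_eval D) ->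
  [/\ is_dvr V, u != 0, has_ecoord iota w V, maps_to phi V E &
   exists2 k : nat, (0 < k)%N & (forall y, y != 0 -> ord V (phi y) = ord E y *+ k) /\
     ord V u + ord_form iota w V = ord_form iota w E *+ k + k.-1%:Z].
Proof.
move=> [[YT [sY Ys]] Yn _] pE VV EV VT hu; have dE := prime_divisor_dvr Ys YT Yn pE.
have [XE _] := pE; have [hE CE nE _ _] := pt_facts Ys XE.
have [l [t [hc [d hx]]]] := prime_ecoord Ys YT Yn pE.
have [s0 f0] := fin_gen Xs XT; have [_ _ _ [Et ot] _] := hc.
have hK := polar_alg phiC hG q0.
have dV := ext_dvr phiC hK f0 dE VV EV VT Et ot.
have [k k0 hk] := ext_ramif phiC hK f0 dE VV EV VT Et ot.
have [tau [tau0 Vtau otau]] := ord_unif dV.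
have [u0 h1 h2] := ext_form phiC hK f0 dE CE nE VV EV VT hc Vtau otau hx hw k0 hk hu.
split=> //; last by exists k.
by split=> // x Ex; exact: (ext_unitE hK dE VV EV VT).
Qed.

Lemma model_refl : birational_model iota X X.
Proof. by split; [split=> //; exists s|by []|move=> Q XQ; exists Q; exact: center_self]. Qed.

(* Sections of multiples of the canonical divisor pull back along [phi], up to powers of [u]. *)
Lemma stalk_pull P P' u m g : X P -> X P' -> maps_to phi P P' -> g != 0 ->
  (forall D : 'I_(form_dim w) -> K -> K, (forall i, derivation iota (D i)) ->
     phi (form_coef w) * \det (\matrix_(i, j) D i (phi (form_vars (t := w) j))) = u * form_eval D) ->
  stalk X (sheafO X (fun F => m%:R * (Defs.canonical iota w : divisor) F)) P' g ->
  stalk X (sheafO X (fun F => m%:R * (Defs.canonical iota w : divisor) F)) P (phi g * u ^+ m).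
Proof.
move=> XP XP' [m1 m2] g0 hu [U' [[U'X hU'] U'P' [g00|hg]]]; first by rewrite g00 eqxx in g0.
have [l [q' [l1 l2 hq' eP']]] := ptP Xs XP'; have hA := chart_subring iota s l.
have [hP CP _ _ _] := pt_facts Xs XP.
have AP' : chart iota s l `<=` P' by rewrite eP'; exact: sub_loc.
have [s1 [s1P' hs1]] := hU' P' U'P'.
have [|b [Ab nb hb]] := loc_denom (l := s1) hA hq'; first by move=> x xs; rewrite -eP'; exact: s1P'.
have b0 := prime_nz hq' nb.
have ub : unit_in P' b by rewrite eP'; apply/loc_unit.
pose lst := (phi b)^-1 :: [seq phi (j / l) | j <- s].
pose U := [set Q | X Q /\ [set` lst] `<=` Q].
have oU : open_in X U.
  split; first by move=> Q [].
  by move=> Q [XQ hQ]; exists lst; split.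
have UP : U P.
  split=> // x; rewrite /= inE => /orP[/eqP ->|/mapP [j js ->]].
    by rewrite -fmorphV; apply: m1; case: ub.
  by apply: m1; apply: AP'; exact: mem_chart.
apply: (stalk_mk oU UP) => F pF [XF hF].
have dF := prime_divisor_dvr Xs XT Xn pF; have FF := dvr_valring dF; have [hFs _] := FF.
have [F' [XF' mF]] : exists F', X F' /\ maps_to phi F F' by case: hphi => _ + _; apply.
have pF' := polar_prime phiC hG q0 pF XF' mF.
have [n1 n2] := mF; have [hF's _ _ _ [m' hm']] := pt_facts Xs XF'; have [m'1 m'0 m'F] := hm'.
have uml : unit_in F' (l / m').
  apply: n2; first exact: m'F.
  have ml0 : phi (l / m') != 0 by rewrite fmorph_eq0 mulf_neq0 ?invr_eq0.
  split=> //; first by apply: n1; exact: m'F.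
  by rewrite -fmorphV invf_div; apply: hF; rewrite /= inE; apply/orP; right; apply/mapP; exists m'.
have AF' : chart iota s l `<=` F'.
  have [_ CF' _ _ _] := pt_facts Xs XF'.
  apply: chart_min => // j js; rewrite (_ : j / l = j / m' * (l / m')^-1).
    by apply: (srM hF's); [exact: m'F|case: uml].
  by field; rewrite m'0 l2.
have ub' : unit_in F' b.
  apply: n2; first exact: AF'.
  split; rewrite ?fmorph_eq0 //; first by apply: n1; exact: AF'.
  by apply: hF; rewrite /= mem_head.
have U'F' : U' F'.
  apply: hs1 => // x xs; rewrite -[x](mulKf b0); apply: (srM hF's); first by case: ub'.
  by apply: AF'; exact: hb.
have h0 := hg F' pF' U'F'.
have {}h0 : 0 <= ord F' g + ord_form iota w F' *+ m.
  by move: h0; rewrite /Defs.canonical mulr_natl -rmorphMn -rmorphD /= ler0z.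
have [_ u0 _ _ [k k0 [hk e]]] := ext_all model_refl pF' FF n1 (dvr_neqT dF) hu.
rewrite (ordM dF) ?fmorph_eq0 ?expf_neq0 // hk // (ordX dF) // -addrA -mulrnDl e.
rewrite mulrnDl -mulrnA mulnC mulrnA addrA -mulrnDl addr_ge0 // mulrn_wge0 //.
Qed.

(** Pulling back sections gives [k * Env(E) <= Env(V) + ord_V u]. The Hurwitz formula gives
    [ord_V u + ord_V w = k * ord_E w + k - 1], whose [k - 1] turns the 1 of [logdisc] at [V] into
    [k] times the 1 at [E]. *)
Lemma logdisc_ext Y E V : birational_model iota X Y -> prime_divisor Y E -> valring V ->
  (forall x, E x -> V (phi x)) -> V <> setT ->
  [/\ is_dvr V, C `<=` V, has_ecoord iota w V &
   exists2 k : nat, (0 < k)%N & (forall y, y != 0 -> ord V (phi y) = ord E y *+ k) /\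
     logdisc iota X w V <= k%:R * logdisc iota X w E].
Proof.
move=> hY pE VV EV VT; have [u hu] := form_pull.
have [dV u0 eV [mV mV2] [k k0 [hk e]]] := ext_all hY pE VV EV VT hu.
have [[YT [sY Ys]] Yn YX] := hY; have dE := prime_divisor_dvr Ys YT Yn pE.
have [YE _] := pE; have [_ CE _ _ _] := pt_facts Ys YE.
have CV : C `<=` V by move=> _ [c _ <-]; rewrite -phiC; apply: EV; apply: CE; exists c.
split=> //; exists k => //; split=> //.
have [P' cP'] := YX E YE; have [XP' [P'E P'E2]] := cP'.
have [P XP mP] := center_exists Xs XT (psi := idfun) VV (fun c hc => CV c hc).
have [PV PV2] := mP.
have cP : Defs.center X V P by split.
have [Q [XQ mQ]] : exists Q, X Q /\ maps_to phi P Q by case: hphi => _ + _; apply.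
have hV : is_subring V by case: VV.
(* Both points are the image of [V] on [X], through the center of [V] and through [E]. *)
have eQ : Q = P'.
  apply: (pt_uniq Xs (psi := phi) hV XQ XP').
    split=> [x /mQ.1 /PV //|x Qx hx]; apply: mQ.2 => //; apply: PV2 => //; exact: mQ.1.
  split=> [x /P'E /mV //|x Px hx]; apply: P'E2 => //; apply: mV2 => //; exact: P'E.
rewrite eQ in mQ.
have kR : 0 < k%:R :> R by rewrite ltr0n.
have hEnv : k%:R * Env X (Defs.canonical iota w : divisor) E <= Env X (Defs.canonical iota w : divisor) V + (ord V u)%:~R :> R.
  rewrite -ler_pdivlMl //; apply: (env_le Xs XT Xn hw dE cP') => m g sg g0.
  have := stalk_pull XP XP' mQ g0 hu sg; move=> /(env_ge Xs XT Xn hw dV cP).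
  rewrite mulf_neq0 ?fmorph_eq0 ?expf_neq0 // => /(_ isT).
  rewrite (ordM dV) ?fmorph_eq0 ?expf_neq0 // hk // (ordX dV) // rmorphD !rmorphMn /= => h.
  rewrite mulrCA ler_pdivlMl // mulrDr.
  by move: h; move: (m%:R * Env _ _ _) => a h; rewrite !mulr_natl mulNrn -lerBlDr -opprD.
rewrite /logdisc mulrBr mulrDr mulr1.
have : (ord V u)%:~R + (ord_form iota w V)%:~R = k%:R * (ord_form iota w E)%:~R + k.-1%:R :> R.
  rewrite -rmorphD e rmorphD rmorphMn /= mulr_natl; congr (_ + _).
have : k%:R = k.-1%:R + 1 :> R by rewrite -{1}(prednK k0) -addn1 natrD.
move: hEnv; move: (Env _ _ _) (Env _ _ _) => b a; move: (k%:R * a) => ka.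
move: (k%:R * _) => ko; move: (ord V u)%:~R (ord_form _ _ V)%:~R k.-1%:R k%:R => d e1 f g; lra.
Qed.

End LogDiscrepancy.

End Endomorphism.

(** * Iterates, norms of sections, and nonnegativity of the log discrepancy *)

Section MainEstimate.
Context {R : realType} {K : fieldType} (iota : {rmorphism R[i] -> K}).
Implicit Types (A B V P Q E F : set K) (x y z u g : K) (phi psi : {rmorphism K -> K}) (s : seq K).

Local Notation C := (range iota).

(** The final comparison: [a] is the order of the norm, [b] that of the coordinate [l], [m] the
    degree [N0]. Cancelling [r] leaves [Q <= p * m * (c + d)]. *)
Lemma vanishing_count (r p m c d Q : nat) (a b : int) : (0 < r)%N -> (p * m * (c + d) < Q)%N ->
  - b <= d%:Z -> a <= (c * (m * r))%N%:Z -> 0 <= (a + - b *+ m *+ r) *+ p + - 1 *+ Q *+ r -> False.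
Proof.
have mz (x : int) (n : nat) : x *+ n = x * n%:Z by rewrite -mulr_natr natz.
rewrite !mz => r0 hQ hb ha h.
have h4 : a + - b * m%:Z * r%:Z <= ((c + d) * (m * r))%N%:Z.
  rewrite mulnDl PoszD; apply: lerD => //; rewrite -mulrA -PoszM [X in _ <= X]PoszM.
  by apply: ler_wpM2r.
have h5 : (Q * r)%N%:Z <= ((c + d) * (m * r))%N%:Z * p%:Z.
  by apply: le_trans (ler_wpM2r _ h4) => //; rewrite -subr_ge0 PoszM -mulNr -mulN1r.
have : (Q * r <= (p * m * (c + d)) * r)%N.
  rewrite -lez_nat; apply: le_trans h5 _; rewrite -PoszM lez_nat.
  by rewrite [X in (_ <= X)%N](_ : _ = (c + d) * (m * r) * p)%N //; ring.
by rewrite leq_pmul2r // leqNgt hQ.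
Qed.

Lemma very_ample_unit s P V h i : is_subring V -> P `<=` V -> (forall x, x \in s -> P (h * x)) ->
  (exists2 x, x \in s & unit_in P (h * x)) -> idx s V i -> unit_in V (h * i).
Proof.
move=> hV PV hs [x xs [hx0 _ hxi]] [i1 i0 iV].
have [h0 x0] : h != 0 /\ x != 0 by apply/andP; rewrite -negb_or -mulf_eq0.
split; [exact: mulf_neq0|exact/PV/hs|].
rewrite (_ : (h * i)^-1 = (h * x)^-1 * (x / i)); last by field; rewrite h0 x0 i0.
by apply: srM => //; [exact: PV|exact: iV].
Qed.

(** At the center [P] of a valuation ring where [i] has least value, [h P ^+ m * i] is a unit, so
    local equations can be traded for coordinates. These belong to [m] times the polarization, which
    is why [G] is [g ^+ m]. *)
Lemma polarized_polar X phi : X setT -> surjective_endomorphism iota X phi -> polarized iota X phi ->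
  exists s G q, [/\ X = projective_over C s, (0 < q)%N & polar iota s phi G q].
Proof.
move=> XT [phiC him _] [h [q [_ [m m0 [s [Xs hs]]] q0 [g g0 hg]]]].
exists s, (g ^+ m), q; split=> //; split; first exact: expf_neq0.
move=> V VV CV i l hi hl; have [hV _] := VV.
have [P XP [PV _]] := center_exists Xs XT (psi := idfun) VV (fun c hc => CV c hc).
pose Q := xget setT [set Q | X Q /\ maps_to phi P Q].
have [XQ [mQ _]] : X Q /\ maps_to phi P Q.
  by rewrite /Q; case: xgetP => [Q' _ //|no]; have [Q' hQ'] := him P XP; case: (no Q' hQ').
have [h0 Vh Vhi] := hg P XP; rewrite /pullback -/Q /cmul in h0 Vh Vhi.
have u1 : unit_in V (g * phi (h Q) / h P ^+ q) by split=> //; exact: PV.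
have [hs1 hs2] := hs P XP; have u2 := very_ample_unit hV PV hs1 hs2 hi.
have [hs3 hs4] := hs Q XQ.
have u3 : unit_in (phi @^-1` V) (cmul m h Q * l).
  by apply: (very_ample_unit (preim_subring phi hV) _ hs3 hs4 hl) => x /mQ /PV.
have {}u3 : unit_in V (phi (h Q) ^+ m * phi l).
  by have [a1 a2 a3] := u3; rewrite -rmorphXn -rmorphM; split; rewrite ?fmorph_eq0 // -fmorphV.
rewrite /cmul in u2.
have [] := (u1, u2, u3) => -[[n1 _ _] [n2 _ _]] [n3 _ _].
have hP0 : h P != 0.
  by apply: contraNneq n2 => ->; rewrite expr0n -[m]prednK // mul0r.
have hQ0 : phi (h Q) != 0.
  by apply: contraNneq n3 => ->; rewrite expr0n -[m]prednK // mul0r.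
have l0 : phi l != 0 by apply: contraNneq n3 => ->; rewrite mulr0.
rewrite (_ : g ^+ m * i ^+ q / phi l =
  (g * phi (h Q) / h P ^+ q) ^+ m * (h P ^+ m * i) ^+ q / (phi (h Q) ^+ m * phi l)).
  apply: unit_inM => //; last exact: unit_inV.
  by apply: unit_inM => //; exact: unit_inX.
rewrite !expr_div_n !exprMn -!exprM [(m * q)%N]mulnC; field.
by rewrite ?hQ0 ?l0 ?expf_neq0.
Qed.

Lemma surjective_comp X phi psi : surjective_endomorphism iota X phi ->
  surjective_endomorphism iota X psi -> surjective_endomorphism iota X (phi \o psi).
Proof.
move=> [h1 h2 h3] [k1 k2 k3]; split.
- by move=> c /=; rewrite k1 h1.
- move=> P XP; have [Q [XQ mQ]] := h2 P XP; have [S [XS mS]] := k2 Q XQ.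
  by exists S; split=> //; exact: maps_to_comp mQ mS.
- move=> S XS; have [Q [XQ mQ]] := k3 S XS; have [P [XP mP]] := h3 Q XQ.
  by exists P; split=> //; exact: maps_to_comp mP mQ.
Qed.

Section Fixed.
Variables (s : seq K) (X : set (set K)).
Hypotheses (Xs : X = projective_over C s) (XT : X setT) (Xn : normal X).

Lemma polar_comp phi psi G G' q q' : (forall c, phi (iota c) = iota c) ->
  polar iota s phi G q -> polar iota s psi G' q' ->
  polar iota s (phi \o psi) (G ^+ q' * phi G') (q * q').
Proof.
move=> phiC [G0 h] [G'0 h']; split; first by rewrite mulf_neq0 ?expf_neq0 ?fmorph_eq0.
move=> V VV CV i l hi hl; have [hV _] := VV.
have VV' := preim_valring phi VV.
have CV' : C `<=` phi @^-1` V by move=> _ [c _ <-] /=; rewrite phiC; apply: CV; exists c.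
have [m hm] := polar_idx Xs XT VV' CV'.
have [u0 u1 u2] := h' _ VV' CV' m l hm hl.
have {u0 u1 u2} hu : unit_in V (phi (G' * m ^+ q' / psi l)).
  by split; [rewrite fmorph_eq0|exact: u1|rewrite -fmorphV; exact: u2].
have hu' := h V VV CV i m hi hm.
have [_ m0 _] := hm; have [_ l0 _] := hl.
rewrite (_ : _ / _ = (G * i ^+ q / phi m) ^+ q' * phi (G' * m ^+ q' / psi l)).
  by apply: unit_inM => //; exact: unit_inX.
rewrite /= fmorph_div rmorphM rmorphXn expr_div_n exprMn -exprM; field.
by rewrite ?expf_neq0 ?fmorph_eq0 ?m0 ?l0.
Qed.

Lemma polar_iter phi G q k : surjective_endomorphism iota X phi -> polar iota s phi G q ->
  exists psi G', surjective_endomorphism iota X psi /\ polar iota s psi G' (q ^ k)%N.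
Proof.
move=> hphi hG; have [phiC _ _] := hphi; elim: k => [|k [psi [G' [h1 h2]]]]; last first.
  exists (phi \o psi), (G ^+ (q ^ k)%N * phi G'); split; first exact: surjective_comp.
  by rewrite expnS; exact: polar_comp.
exists idfun, 1; split.
  by split=> // P XP; exists P; split=> //; exact: (center_self XP).2.
split; rewrite ?oner_eq0 // => V [hV _] _ i l hi hl; rewrite expn0 expr1 mul1r.
exact: (idx_unit hV hi hl).
Qed.

Lemma norm_local phi r (e : 'cV[K]_r) A y : is_subring A -> noeth A -> cl A `<=` A -> frac A = setT ->
  basis (range phi) e -> cl (phi @` A) y -> (phi @` A) (normL (range phi) e y).
Proof.
move=> hA nA cA fA he; apply: (normL_integral (range_subfield phi) he).
- exact: phi_subring.
- exact: phi_frac.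
- by move=> _ [x _ <-]; exists x.
- exact: phi_cic.
Qed.

(** Divided by the image of [l ^+ M], the argument of the norm is [(x / i ^+ M) ^+ q * (G * i ^+ q /
    phi l) ^+ M], integral over [phi P]. The power [q] on [x] is what keeps the degree of the norm
    at [M * r]. *)
Lemma norm_sect phi G q r (e : 'cV[K]_r) M x nu : (forall c, phi (iota c) = iota c) ->
  polar iota s phi G q -> basis (range phi) e -> sect iota s M x ->
  normL (range phi) e (x ^+ q * G ^+ M) = phi nu -> sect iota s (M * r) nu.
Proof.
move=> phiC hG he hx enu V VV CV l hl; have [hV _] := VV.
have [P XP [PV PV2]] := center_exists Xs XT (psi := idfun) VV (fun c hc => CV c hc).
have hlP : idx s P l by apply: (idx_center Xs hV _ hl).
have [hP CP nP _ _] := pt_facts Xs XP; have [_ l0 _] := hl.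
apply: PV; apply/(phi_mem phi).
have hL := range_subfield phi.
have Ll : range phi (phi (l^-1 ^+ M)) by exists (l^-1 ^+ M).
rewrite (_ : phi _ = normL (range phi) e (x ^+ q * G ^+ M * phi (l^-1 ^+ M))); last first.
  by rewrite (normLM hL he) enu (normLa hL he Ll) -rmorphXn -exprM exprVn -rmorphM.
apply: norm_local => //; [exact: pt_cl Xs Xn _ XP|exact: frac_pt Xs XT _ XP|].
move=> W WW PW; have [hW _] := WW.
have CW : C `<=` W by move=> _ [c _ <-]; rewrite -phiC; apply: PW; exists (iota c) => //; apply: CP; exists c.
have [i hi] := polar_idx Xs XT WW CW; have [_ i0 _] := hi.
have hlW : idx s (phi @^-1` W) l by apply: idxS hlP => z Pz; apply: PW; exists z.
have [_ Wu _] := hG.2 W WW CW i l hi hlW.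
rewrite (_ : _ * _ = (x / i ^+ M) ^+ q * (G * i ^+ q / phi l) ^+ M).
  by apply: (srM hW); apply: (srX hW) => //; exact: hx.
rewrite rmorphXn fmorphV !expr_div_n exprMn -!exprM [(M * q)%N]mulnC exprVn; field.
by rewrite ?expf_neq0 ?fmorph_eq0.
Qed.

Variables (w : @top_form K) (phi : {rmorphism K -> K}) (G : K) (q : nat).
Hypotheses (hw : nonzero_top_form iota w) (hphi : surjective_endomorphism iota X phi)
  (hG : polar iota s phi G q) (q1 : (1 < q)%N).

Lemma logdisc_ge0 E : prime_divisor_over iota X E -> 0 <= logdisc iota X w E.
Proof.
move=> [Y hY pE]; have [[YT [sY Ys]] Yn YX] := hY.
have dE := prime_divisor_dvr Ys YT Yn pE; have [YE _] := pE.
have [hE CE nE _ _] := pt_facts Ys YE.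
rewrite leNgt; apply/negP => neg; set a := - logdisc iota X w E.
have a0 : 0 < a by rewrite oppr_gt0.
have [N0 [sg [hsg sg0 hB]]] := logdisc_ge Xs XT Xn hw.
(* If [V] has ramification index [k], the section vanishes along it to order at least [k * a]; its
   [p2]-th power vanishes at least to order [k], that is, like [psi t]. *)
pose p2 := Num.Def.archi_bound a^-1.
have hp2 : 1 <= p2%:R * a.
  by rewrite -ler_pdivrMr // div1r ltW // archi_boundP // invr_ge0 ltW.
have [l hl] := polar_idx Xs XT (dvr_valring dE) CE; have [_ l0 _] := hl.
have [c hc] := prime_linear_bound Ys YT Yn pE (has_nz Xs XT).
have [t [t0 Et ot]] := ord_unif dE.
(* The final inequality will be [Q <= bnd]; since [bnd < q ^ bnd], iterating [bnd] times contradicts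
   it. *)
pose bnd := (p2 * N0 * (c + `|ord E l|))%N.
have [psi [G' [hpsi hG']]] := polar_iter bnd hphi hG.
set Q := (q ^ bnd)%N in hG'.
have Q0 : (0 < Q)%N by rewrite expn_gt0 (ltn_trans _ q1).
have [psiC _ _] := hpsi.
have [s0 f0] := fin_gen Xs XT.
have hK := polar_alg Xs XT psiC hG' Q0.
have [r [e he]] := range_basis psiC hK f0.
have hL := range_subfield psi.
pose gam := sg ^+ Q * G' ^+ N0; pose N := normL (range psi) e.
have gam0 : gam != 0 by rewrite mulf_neq0 ?expf_neq0 //; case: hG'.
have [nu _ enu] : range psi (N gam) by exact: normL_in.
have nu0 : nu != 0 by rewrite -(fmorph_eq0 psi) enu normL_neq0.
have snu := norm_sect psiC hG' he hsg (esym enu).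
(* Integrality of [y] over [psi E] records the vanishing of [sg] along all valuations over [E] at
   once; its norm then transfers this to [nu] along [E]. *)
pose y := (gam * psi (l^-1 ^+ N0)) ^+ p2 * psi (t^-1 ^+ Q).
have Sy : cl (psi @` E) y.
  move=> V VV EV; have [->//|VT] := pselect (V = setT).
  have EV' x : E x -> V (psi x) by move=> Ex; apply: EV; exists x.
  have [dV CV eV [k k0 [hk hB']]] := logdisc_ext Xs XT Xn hw hpsi hG' Q0 hY pE VV EV' VT.
  have [hV _] := VV; have [i hi] := polar_idx Xs XT VV CV; have [_ i0 _] := hi.
  have hlV : idx s (psi @^-1` V) l by apply: idxS hl => x Ex; exact: EV'.
  have [_ Vu _] := hG'.2 V VV CV i l hi hlV.
  have d0 : sg / i ^+ N0 != 0 by rewrite mulf_neq0 ?invr_eq0 ?expf_neq0.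
  have Vd : V ((sg / i ^+ N0) ^+ p2 / psi t).
    apply/(ord_ge0 dV); first by rewrite mulf_neq0 ?invr_eq0 ?fmorph_eq0 ?expf_neq0.
    rewrite (ordM dV) ?invr_eq0 ?fmorph_eq0 ?expf_neq0 // (ordV dV) ?fmorph_eq0 // (ordX dV) //.
    rewrite hk // ot subr_ge0 natz -(ler_int R) rmorphMn /= -mulr_natl.
    have h1 := hB V i dV CV eV hi.
    have h2 : k%:R * a <= (ord V (sg / i ^+ N0))%:~R.
      by rewrite /a mulrN lerNl; exact: le_trans h1 hB'.
    have h3 : p2%:R * (k%:R * a) <= p2%:R * (ord V (sg / i ^+ N0))%:~R by apply: ler_wpM2l.
    by apply: le_trans h3; rewrite mulrCA -[X in X <= _]mulr1; apply: ler_wpM2l.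
  have -> : y = ((sg / i ^+ N0) ^+ p2 / psi t) ^+ Q * (G' * i ^+ Q / psi l) ^+ N0 ^+ p2.
    have : psi t != 0 by rewrite fmorph_eq0.
    have : psi l != 0 by rewrite fmorph_eq0.
    rewrite /y /gam !rmorphXn !fmorphV; move: (psi l) (psi t) => pl pt pl0 pt0.
    rewrite !(exprMn, exprVn, =^~ exprM) [(p2 * Q)%N]mulnC [(N0 * (Q * p2))%N]mulnCA.
    move: (expf_neq0 (Q * (N0 * p2)) i0) (expf_neq0 (N0 * p2) pl0) (expf_neq0 Q pt0).
    move: (i ^+ _) (pl ^+ _) (pt ^+ _) (sg ^+ _) (G' ^+ _) => a1 a2 a3 a4 a5 b1 b2 b3.
    by field; rewrite b1 b2 b3.
  by apply: (srM hV); [exact: (srX hV)|apply: (srX hV); exact: (srX hV)].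
have cE : cl E `<=` E by apply: valring_cl; exact: dvr_valring.
have := norm_local hE nE cE (dvr_frac dE) he Sy.
have Ll : range psi (psi (l^-1 ^+ N0)) by exists (l^-1 ^+ N0).
have Lt : range psi (psi (t^-1 ^+ Q)) by exists (t^-1 ^+ Q).
rewrite (normLM hL he) (normLX hL he) (normLM hL he) (normLa hL he Ll) (normLa hL he Lt).
rewrite -/(N gam) -enu -!rmorphXn -!rmorphM -!rmorphXn -rmorphM => /phi_mem.
have r0 : (0 < r)%N := basis_gt0 he.
have li0 : l^-1 ^+ N0 ^+ r != 0 by rewrite !expf_neq0 ?invr_eq0.
have ti0 : t^-1 ^+ Q ^+ r != 0 by rewrite !expf_neq0 ?invr_eq0.
have y0 : (nu * l^-1 ^+ N0 ^+ r) ^+ p2 * t^-1 ^+ Q ^+ r != 0 by rewrite mulf_neq0 // expf_neq0 // mulf_neq0.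
move/(ord_ge0 dE y0); rewrite (ordM dE) ?expf_neq0 ?mulf_neq0 ?invr_eq0 // (ordX dE) ?mulf_neq0 // (ordM dE) //.
rewrite !(ordX dE) ?expf_neq0 ?invr_eq0 // !(ordV dE) // ot.
have := hc _ _ snu nu0.
have : - ord E l <= `|ord E l|%N%:Z by rewrite abszE lerNl; exact: lerNnormlW.
have Qb : (bnd < Q)%N by exact: ltn_expl.
move: r0 Qb; rewrite /bnd; move: (ord E nu) (ord E l) `|ord E l|%N => o1 o2 o3.
exact: vanishing_count.
Qed.

End Fixed.
End MainEstimate.

(** * Finite dimension of the space of sections, and the case [q = 1] *)

Section FiniteDimension.
Context {R : realType} {K : fieldType} (iota : {rmorphism R[i] -> K}).
Implicit Types (A B V P Q E F : set K) (x y z u g l : K) (s : seq K).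

Local Notation C := (range iota).
Local Notation pol s := (adjoin C [set` s]).

Section Monomials.
Variable z : seq K.
Hypothesis hi : indep iota z.

Definition mon (al : K -> nat) : K := \prod_(l <- z) l ^+ al l.

(** The span as the intersection of all subspaces containing the monomials, so that [mspanW] is its
    induction principle. *)
Definition mspan (Pr : (K -> nat) -> Prop) : set K := [set x | forall S : set K, S 0 ->
  (forall y y', S y -> S y' -> S (y + y')) -> (forall c y, C c -> S y -> S (c * y)) ->
  (forall al, Pr al -> S (mon al)) -> S x].

Lemma mspanW Pr (S : set K) : S 0 -> (forall y y', S y -> S y' -> S (y + y')) ->
  (forall c y, C c -> S y -> S (c * y)) -> (forall al, Pr al -> S (mon al)) -> mspan Pr `<=` S.
Proof. by move=> h1 h2 h3 h4 x; apply. Qed.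

Lemma mspan_mod Pr : [/\ mspan Pr 0, forall y y', mspan Pr y -> mspan Pr y' -> mspan Pr (y + y'),
  forall c y, C c -> mspan Pr y -> mspan Pr (c * y) & forall al, Pr al -> mspan Pr (mon al)].
Proof.
split=> [S //|y y' hy hy' S h1 h2 h3 h4|c y hc hy S h1 h2 h3 h4|al ha S h1 h2 h3 h4].
- by apply: (h2); [exact: hy|exact: hy'].
- by apply: (h3) => //; exact: hy.
- exact: h4.
Qed.

Lemma pol_mspan : pol z `<=` mspan (fun=> True).
Proof.
have [m0 mD mC mM] := mspan_mod (fun=> True).
have hC1 := C_subring iota.
have mon0 : mon (fun=> 0%N) = 1 by rewrite /mon big1_seq.
apply: pol_min.
- apply/subringP; split.
  + by rewrite -mon0; exact: mM.
  + move=> x y hx hy; apply: (mD) => //; rewrite -mulN1r; apply: (mC) => //.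
    by apply: (srN hC1); exact: sr1.
  + move=> x y hx; move: y; apply: mspanW.
    * by rewrite /= mulr0.
    * by move=> y y' h h'; rewrite /= mulrDr; exact: mD.
    * by move=> c y hc h; rewrite /= mulrCA; exact: mC.
    * move=> be _ /=; move: x hx; apply: mspanW.
      - by rewrite /= mul0r.
      - by move=> y y' h h'; rewrite /= mulrDl; exact: mD.
      - by move=> c y hc h; rewrite /= -mulrA; exact: mC.
      - move=> al _ /=; have -> : mon al * mon be = mon (fun l => al l + be l)%N.
          by rewrite /mon -big_split; apply: eq_bigr => l _; rewrite exprD.
        exact: mM.
- by move=> c hc; rewrite -[c]mulr1 -mon0; apply: (mC) => //; exact: mM.
- move=> x xz; have -> : x = mon (fun l => (l == x)).
    rewrite /mon (big_rem x) //= eqxx expr1 big1_seq ?mulr1 // => l /andP[_ lr].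
    have := indep_uniq hi => /mem_rem_uniq e; have : l \in [predD1 z & x] by rewrite -e.
    by rewrite inE /= => /andP[/negbTE -> _].
  exact: mM.
Qed.

(** The polynomial is cut at degree [D] in [l]; a nonzero upper part would give [x / l ^+ D]
    positive degree in [l]. *)
Lemma mspan_drop Pr l D x : l \in z -> mspan Pr x -> polW iota z l (x / l ^+ D) ->
  mspan (fun al => Pr al /\ (al l <= D)%N) x.
Proof.
move=> lz hx; have hR := pol_subring iota (rem l z); set Rr := pol (rem l z) in hR *.
have hk := frac_subfield hR; have nl := hi lz.
have [m0 mD mC mM] := mspan_mod (fun al => Pr al /\ (al l <= D)%N).
have CR : C `<=` Rr by exact: C_pol.
have [p [q [h1 hp hq sp e]]] : exists p q : {poly K}, [/\ mspan (fun al => Pr al /\ (al l <= D)%N) p.[l],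
    pover Rr p, pover Rr q, (size p <= D.+1)%N & x = (p + q * 'X^(D.+1)).[l]].
  move: x hx; apply: mspanW.
  - by exists 0, 0; rewrite mul0r addr0 horner0 size_poly0; split=> //; exact: pover0.
  - move=> y y' [p [q [h1 h2 h3 h4 ->]]] [p' [q' [h1' h2' h3' h4' ->]]].
    exists (p + p'), (q + q'); split; [by rewrite hornerD; exact: mD|exact: poverD|exact: poverD| |].
    + by rewrite (leq_trans (size_polyD _ _)) // geq_max h4.
    + by rewrite -hornerD; congr (_.[l]); ring.
  - move=> c y hc [p [q [h1 h2 h3 h4 ->]]]; exists (c%:P * p), (c%:P * q).
    have hc' : pover Rr c%:P by apply: poverC => //; exact: CR.
    split; [by rewrite hornerM hornerC; exact: mC|exact: poverM|exact: poverM| |].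
    + by rewrite mul_polyC (leq_trans (size_scale_leq _ _)).
    + by rewrite -[c in LHS](hornerC c l) -hornerM; congr (_.[l]); ring.
  - move=> al ha /=; pose c := \prod_(l' <- rem l z) l' ^+ al l'.
    have ec : mon al = c * l ^+ al l by rewrite /mon (big_rem l) //= mulrC.
    have Rc : Rr c.
      by rewrite /c big_seq; apply: (sr_prod hR) => l' h; apply: (srX hR); exact: mem_pol.
    have hc : pover Rr c%:P by exact: poverC.
    have [h|h] := leqP (al l) D.
      exists (c%:P * 'X^(al l)), 0; rewrite mul0r addr0 hornerM hornerC hornerXn -ec; split=> //.
      * exact: mM.
      * by apply: poverM => //; exact: poverXn.
      * exact: pover0.
      * by rewrite mul_polyC (leq_trans (size_scale_leq _ _)) // size_polyXn.
    exists 0, (c%:P * 'X^(al l - D.+1)); rewrite horner0 size_poly0; split=> //; [exact: pover0| |].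
      by apply: poverM => //; exact: poverXn.
    by rewrite add0r -mulrA -exprD subnK // hornerM hornerC hornerXn ec.
move=> [P [Q [hP hQ Q0 sPQ ePQ]]].
have subk : Rr `<=` frac Rr by exact: sub_frac.
have [hk1 _] := hk.
have l0 : l != 0 := trans_neq0 hk nl.
have hF : pover (frac Rr) (p + q * 'X^(D.+1)).
  by apply: poverD => //; [|apply: poverM => //; [|exact: poverXn]]; apply: pover_sub subk _.
have eq : (p + q * 'X^(D.+1)) * Q = P * 'X^D.
  apply: (trans_eq hk nl); [exact: poverM|by apply: poverM => //; exact: poverXn|].
  rewrite !hornerM hornerXn -e; have q0 := trans_horner_neq0 hk nl hQ Q0.
  move: ePQ => /(congr1 (fun y => y * Q.[l] * l ^+ D)); rewrite mulfVK // => <-.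
  by field; rewrite ?expf_neq0.
suff q0 : q = 0 by rewrite e q0 mul0r addr0.
apply/eqP; apply: contraT => q0; have sq : (0 < size q)%N by rewrite size_poly_gt0.
have sz : size (p + q * 'X^(D.+1)) = (D.+1 + size q)%N.
  have sqX : size (q * 'X^(D.+1)) = (D.+1 + size q)%N by rewrite size_mulXn.
  by rewrite addrC size_polyDl sqX // (leq_ltn_trans sp) // -[X in (X < _)%N]addn0 ltn_add2l.
have n0 : p + q * 'X^(D.+1) != 0 by rewrite -size_poly_gt0 sz addn_gt0.
have := congr1 (fun r : {poly K} => size r) eq; rewrite /= size_mul // sz.
have P0 : P != 0 by apply: contra_eq_neq eq => ->; rewrite mul0r mulf_neq0.
rewrite size_mulXn //; move: sPQ sq; move: (size (polyseq q)) (size (polyseq P)) (size (polyseq Q)) => a b c.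
lia.
Qed.

Lemma mspan_all (D : K -> nat) x : pol z x -> (forall l, l \in z -> polW iota z l (x / l ^+ D l)) ->
  mspan (fun al => forall l, l \in z -> (al l <= D l)%N) x.
Proof.
move=> hx hD; suff H (s : seq K) : {subset s <= z} -> mspan (fun al => forall l, l \in s -> (al l <= D l)%N) x by exact: H.
elim: s => [|l s ih] hs.
  have [m0 mD mC mM] := mspan_mod (fun al => forall l, l \in [::] -> (al l <= D l)%N).
  by apply: mspanW (pol_mspan hx) => // al _; exact: mM.
have lz : l \in z by apply: hs; exact: mem_head.
have h := mspan_drop lz (ih _) (hD l lz).
have [m0 mD mC mM] := mspan_mod (fun al => forall l', l' \in l :: s -> (al l' <= D l')%N).
apply: mspanW (h _) => //; last by move=> y ys; apply: hs; rewrite inE ys orbT.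
by move=> al [h1 h2]; apply: (mM) => l'; rewrite inE => /orP[/eqP ->|/h1].
Qed.

Lemma mspan_fin (D : K -> nat) : exists M : seq K, mspan (fun al => forall l, l \in z -> (al l <= D l)%N) `<=` ispan C M.
Proof.
pose Dm := \max_(l <- z) D l.
pose mf (f : {ffun 'I_(size z) -> 'I_Dm.+1}) : K := \prod_(i < size z) z`_i ^+ f i.
exists [seq mf f | f <- enum {: {ffun 'I_(size z) -> 'I_Dm.+1}}].
have hC := C_subring iota.
have [h0 hD hM] := ispan_closed [seq mf f | f <- enum {: {ffun 'I_(size z) -> 'I_Dm.+1}}] hC.
apply: mspanW => // al hal; have -> : mon al = mf [ffun i : 'I_(size z) => inord (al z`_i)].
  rewrite /mon (big_nth 0) big_mkord; apply: eq_bigr => i _; rewrite ffunE inordK //.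
  have iz : z`_i \in z by exact: mem_nth.
  by rewrite ltnS (leq_trans (hal _ iz)) // /Dm (big_rem (z`_i)) //= leq_maxl.
by apply: mem_ispan => //; apply: map_f; rewrite mem_enum.
Qed.

End Monomials.

(* Pairing with a basis through the trace embeds the sections in a finite power of the space of
   polynomials of bounded degree in each of the Noether coordinates. *)
Lemma sect_dependent sg s0 : has (fun i => i != 0) sg -> frac (pol s0) = setT ->
  exists N, forall x : 'I_N.+1 -> K, (forall i, sect iota sg 1 (x i)) ->
    exists2 c : 'I_N.+1 -> R[i], (exists i, c i != 0) & \sum_i iota (c i) * x i = 0.
Proof.
move=> nz f0; have [z [z1 z2 hz]] := noether_normalization iota s0.
have hZ := pol_subring iota z; have hC := C_subring iota.
have sz : pol s0 `<=` cl (pol z).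
  apply: pol_min; [exact: cl_subring|by move=> x /(@C_pol _ _ iota z); exact: sub_cl|].
  by move=> x /z2; rewrite inE.
have [r [e he]] := pol_frac_basis f0 sz; have hL := frac_subfield hZ.
have subL : pol z `<=` frac (pol z) by exact: sub_frac.
pose lst := [seq i * e j 0 | i <- sg, j <- enum 'I_r].
have [|d [Sd d0 hd]] := @common_denom _ (cl (pol z)) lst (cl_subring _).
  move=> x _; have [a [Aa a0 h]] := cl_frac_denom hZ (cl_setT f0 sz x).
  by exists (a * x), a; split=> //; [exact: sub_cl|rewrite mulrC mulKf].
have /choice [D hD] : forall l, exists c : nat, l \in z -> forall x, x \in lst -> cl (polW iota z l) (d * x / l ^+ c).
  move=> l; have [lz|nl] := boolP (l \in z); last by exists 0%N.
  have [|c hc] := @cl_polW_bounds _ _ iota z l hz lz [seq d * x | x <- lst].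
    by move=> _ /mapP [x xl ->]; exact: hd.
  by exists c => _ x xl; apply: hc; exact: map_f.
have [M hM] := mspan_fin z D.
have key x j : sect iota sg 1 x -> ispan C M (\tr (Mx (frac (pol z)) e (d * x * e j 0))).
  move=> hx; apply: hM; apply: mspan_all => //.
    apply: (trace_integral hL he hZ) => //; [exact: pol_cic|by apply: (C_Qsub (iota := iota)); exact: C_pol|].
    move=> V VV ZV; have [hV _] := VV; have CV : C `<=` V by move=> c /(@C_pol _ _ iota z) /ZV.
    have [i [i1 i0 iV]] := valring_max (idfun : {rmorphism K -> K}) VV nz.
    rewrite (_ : d * x * e j 0 = d * (i * e j 0) * (x / i ^+ 1)); last by rewrite expr1; field.
    apply: (srM hV); last exact: (hx V VV CV).
    by apply: (hd _ _ V VV ZV); apply/allpairsP; exists (i, j); rewrite mem_enum.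
  move=> l lz; have [hW CW LW WL cW] := polW_facts hz lz.
  have l0 := x_neq0 hz lz.
  have Ll : frac (pol z) (l ^+ D l)^-1.
    by apply: hL.2; apply: srX; [case: hL|apply: subL; exact: mem_pol].
  rewrite (_ : _ / _ = \tr (Mx (frac (pol z)) e ((l ^+ D l)^-1 * (d * x * e j 0)))); last first.
    by rewrite (MxM hL he (l ^+ D l)^-1) (MxL hL he Ll) mul_scalar_mx mxtraceZ mulrC.
  apply: (trace_integral hL he hW) => //; first by apply: (C_Qsub (iota := iota)).
  move=> V VV WV; have [hV _] := VV; have CV : C `<=` V by move=> c /CW /WV.
  have [i [i1 i0 iV]] := valring_max (idfun : {rmorphism K -> K}) VV nz.
  rewrite (_ : (l ^+ D l)^-1 * (d * x * e j 0) = d * (i * e j 0) / l ^+ D l * (x / i ^+ 1)); last first.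
    by rewrite expr1; field; rewrite i0 expf_neq0.
  apply: (srM hV); last exact: (hx V VV CV).
  by apply: (hD l lz _ _ V VV WV); apply/allpairsP; exists (i, j); rewrite mem_enum.
pose m := size M; exists (r * m)%N => x hx.
have /choice [a ha] : forall ij : 'I_(r * m).+1 * 'I_r, exists a : 'I_m -> R[i],
    \tr (Mx (frac (pol z)) e (d * x ij.1 * e ij.2 0)) = \sum_k iota (a k) * M`_k.
  move=> [i j] /=; have [b [hb ->]] := ispanP hC (key (x i) j (hx i)).
  have /choice [a ea] : forall k, exists a, iota a = b 0 k by move=> k; have [a _ ea] := hb k; exists a.
  by exists a; apply: eq_bigr => k _; rewrite ea.
pose A := \matrix_i mxvec (\matrix_(j, k) a (i, j) k) : 'M[R[i]]_((r * m).+1, r * m).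
have [v v0 vA] : exists2 v : 'rV[R[i]]_((r * m).+1), v != 0 & v *m A = 0.
  have : kermx A != 0 by rewrite kermx_eq0 /row_free neq_ltn (leq_ltn_trans (rank_leq_col A)).
  move/rowV0Pn => [v vk v0]; exists v => //; exact/sub_kermxP.
have hv j k : \sum_i v 0 i * a (i, j) k = 0.
  have e1 : vec_mx (v *m A) j k = 0 by rewrite vA linear0 mxE.
  rewrite -[RHS]e1 mulmx_sum_row linear_sum summxE; apply: eq_bigr => i _.
  by rewrite linearZ /= rowK mxvecK !mxE.
exists (fun i => v 0 i).
  apply: contrapT => no; move/eqP: v0; apply; apply/rowP => i; rewrite mxE; apply/eqP.
  by apply: contrapT => /negP h; apply: no; exists i.
have hin c : C c -> frac (pol z) c by move=> hc; apply: subL; exact: C_pol.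
suff : d * \sum_i iota (v 0 i) * x i = 0 by move/eqP; rewrite mulf_eq0 (negbTE d0) => /eqP.
apply: (trace_nondeg hL he (natn0 iota)) => j.
have -> : d * (\sum_i iota (v 0 i) * x i) * e j 0 = \sum_i iota (v 0 i) * (d * x i * e j 0).
  by rewrite mulr_sumr mulr_suml; apply: eq_bigr => i _; ring.
rewrite (Mx_lin hL he _ (fun i => d * x i * e j 0)); last by move=> i; apply: hin; exists (v 0 i).
rewrite raddf_sum /=.
under eq_bigr => i _ do rewrite mxtraceZ (ha (i, j)) mulr_sumr.
rewrite exchange_big big1 // => k _; under eq_bigr => i _ do rewrite mulrA -rmorphM.
by rewrite -mulr_suml -rmorph_sum hv rmorph0 mul0r.
Qed.

Section DegreeOne.
Variables (s : seq K) (X : set (set K)) (phi : {rmorphism K -> K}) (G : K).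
Hypotheses (Xs : X = projective_over C s) (XT : X setT) (Xn : normal X)
  (hphi : surjective_endomorphism iota X phi) (hG : polar iota s phi G 1).

Let G0 : G != 0. Proof. by case: hG. Qed.
Let phiC c : phi (iota c) = iota c. Proof. by case: hphi => + _ _. Qed.

Lemma sect_pull y : sect iota s 1 y -> sect iota s 1 (phi y / G).
Proof.
move=> hy V VV CV i hi; have [hV _] := VV; have VV' := preim_valring phi VV.
have CV' : C `<=` phi @^-1` V by move=> _ [c _ <-] /=; rewrite phiC; apply: CV; exists c.
have [l hl] := polar_idx Xs XT VV' CV'; have [_ l0 _] := hl; have [_ i0 _] := hi.
have [_ _ Vu] := hG.2 V VV CV i l hi hl.
have Vy : V (phi (y / l ^+ 1)) := hy _ VV' CV' l hl.
rewrite (_ : _ / _ = phi (y / l ^+ 1) * (G * i ^+ 1 / phi l)^-1); first exact: (srM hV).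
by rewrite !expr1 fmorph_div; field; rewrite ?i0 ?G0 ?fmorph_eq0 ?l0.
Qed.

(** [T] is an injective linear map on a finite-dimensional space of sections, so the iterates of [j]
    satisfy a linear relation. Cancelling [T] until the first coefficient is nonzero expresses [j]
    as the image of a section. *)
Lemma sect_surj j : j \in s -> exists2 y, sect iota s 1 y & G * j = phi y.
Proof.
move=> js; pose T y := phi y / G.
have TD x y : T (x + y) = T x + T y by rewrite /T rmorphD mulrDl.
have TZ c y : T (iota c * y) = iota c * T y by rewrite /T rmorphM phiC mulrA.
have T0 y : T y = 0 -> y = 0.
  by move/eqP; rewrite mulf_eq0 invr_eq0 (negbTE G0) orbF fmorph_eq0 => /eqP.
have Tsum n (F : nat -> K) : T (\sum_(k < n) F k) = \sum_(k < n) T (F k).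
  by elim: n => [|n ih]; rewrite ?big_ord0 ?big_ord_recr /= ?TD ?ih // /T rmorph0 mul0r.
have sD M x y : sect iota s M x -> sect iota s M y -> sect iota s M (x + y).
  by move=> h h' V VV CV i hi; have [hV _] := VV; rewrite mulrDl; apply: (srD hV); [exact: h|exact: h'].
have sZ M c x : sect iota s M x -> sect iota s M (iota c * x).
  by move=> h V VV CV i hi; have [hV _] := VV; rewrite -mulrA; apply: (srM hV); [apply: CV; exists c|exact: h].
have sj : sect iota s 1 j by move=> V VV CV i [_ _ iV]; rewrite expr1; exact: iV.
have sT k : sect iota s 1 (iter k T j) by elim: k => //= k; exact: sect_pull.
have s0' : sect iota s 1 0 by move=> V [hV _] CV i hi; rewrite mul0r; exact: (sr0 hV).
have rel n (c : nat -> R[i]) : (exists2 k, (k < n)%N & c k != 0) ->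
    \sum_(k < n) iota (c k) * iter k T j = 0 -> exists2 y, sect iota s 1 y & j = T y.
  elim: n c => [|n ih] c; first by case.
  move=> [k kn ck]; rewrite big_ord_recl /=.
  have -> : \sum_(i < n) iota (c (bump 0 i)) * iter (bump 0 i) T j =
      T (\sum_(i < n) iota (c i.+1) * iter i T j).
    by rewrite (Tsum n (fun i => iota (c i.+1) * iter i T j)); apply: eq_bigr => i _; rewrite TZ.
  have [c0|c0] := eqVneq (c 0%N) 0.
    rewrite c0 rmorph0 mul0r add0r => /T0; apply: (ih (fun k => c k.+1)).
    by case: k kn ck => [|k] kn ck; [rewrite c0 eqxx in ck|exists k].
  set y := \sum_(i < n) _ => e.
  exists (iota (- (c 0%N)^-1) * y).
    by apply: (sZ); rewrite /y; elim/big_ind: _; [exact: s0'|exact: sD|move=> i _; apply: sZ; exact: sT].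
  have i0 : iota (c 0%N) != 0 by rewrite fmorph_eq0.
  apply: (mulfI i0); rewrite TZ rmorphN fmorphV mulNr mulrN mulVKf //.
  by move/eqP: e; rewrite addr_eq0 => /eqP.
have [s1 f1] := fin_gen Xs XT; have [N hN] := sect_dependent (has_nz Xs XT) f1.
have [|c [i ci] ec] := hN (fun k => iter k T j); first by move=> i; exact: sT.
have [||y hy ->] := rel N.+1 (fun k => c (inord k)).
- by exists i => //; rewrite inord_val.
- by rewrite -[RHS]ec; apply: eq_bigr => k _; rewrite inord_val.
by exists y; rewrite // /T mulrC mulfVK.
Qed.

(** Since each [G * j] is [phi] of a section, the whole chart ring of [P] lies in [phi Q]; the
    elements inverted in [P] come from units of [Q]. *)
Lemma polar1_local P Q y : X P -> X Q -> maps_to phi P Q -> P (phi y) -> Q y.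
Proof.
move=> XP XQ [m1 m2] Py; have [hP CP _ _ _] := pt_facts Xs XP.
have [hQ CQ _ _ [l hl]] := pt_facts Xs XQ; have [l1 l0 lQ] := hl.
have [i [p [i1 i2 hp eP]]] := ptP Xs XP.
have AP : chart iota s i `<=` P by rewrite eP; apply: sub_loc => //; exact: chart_subring.
have iP j : j \in s -> P (j / i) by move=> js; apply: AP; exact: mem_chart.
have [yi hyi eyi] := sect_surj i1.
have Qy j : sect iota s 1 j -> Q (j / l).
  move=> hj; apply: (pt_cl Xs Xn XQ) => V VV QV; rewrite -[l]expr1.
  by apply: hj => //; [move=> c /CQ /QV|exact: idxS hl].
have yi0 : yi != 0 by rewrite -(fmorph_eq0 phi) -eyi mulf_neq0.
have uQ : unit_in Q (yi / l).
  apply: m2; first exact: Qy.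
  split; first by rewrite fmorph_eq0 mulf_neq0 ?invr_eq0.
    exact/m1/Qy.
  apply: (pt_cl Xs Xn XP) => V VV PV; rewrite fmorph_div -eyi -(expr1 i).
  have [] // := hG.2 V VV _ i l; first by move=> c /CP /PV.
    by split=> // j js; apply: PV; exact: iP.
  by apply: idxS hl => x Qx; apply: PV; exact: m1.
have AQ : chart iota s i `<=` phi @` Q.
  apply: chart_min; first exact: phi_subring.
    by move=> _ [c _ <-]; exists (iota c) => //; apply: CQ; exists c.
  move=> j js; have [yj hyj eyj] := sect_surj js.
  exists (yj / l * (yi / l)^-1); first by apply: (srM hQ); [exact: Qy|case: uQ].
  rewrite rmorphM fmorphV !fmorph_div -eyi -eyj; field.
  by rewrite G0 i2 fmorph_eq0 l0.
move: Py; rewrite {1}eP => -[a [b [Aa Ab nb e]]].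
have ub : unit_in P b by rewrite eP; apply/loc_unit => //; exact: chart_subring.
have [a' Qa' ea] := AQ a Aa; have [b' Qb' eb] := AQ b Ab.
have ub' : unit_in Q b' by apply: m2 => //; rewrite eb.
have -> : y = a' / b' by apply: (fmorph_inj phi); rewrite fmorph_div ea eb.
by apply: (srM hQ) => //; case: ub'.
Qed.

Lemma polar1_automorphism : automorphism iota X phi.
Proof.
have surj x : exists y, phi y = x.
  have [i i1 i2] := hasP (has_nz Xs XT); have [hL1 hL2] := range_subfield phi.
  have [yi _ eyi] := sect_surj i1.
  have : frac (chart iota s i) x by rewrite (frac_chart Xs XT).
  suff : frac (chart iota s i) `<=` range phi by move=> h /h [y _ <-]; exists y.
  apply: frac_min => //; apply: chart_min => //; first by move=> _ [c _ <-]; exists (iota c).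
  move=> j js; have [yj _ eyj] := sect_surj js; exists (yj / yi) => //.
  by rewrite fmorph_div -eyi -eyj; field; rewrite ?G0 ?i2.
have [psi0 hpsi0] := choice surj.
have add : zmod_morphism psi0.
  by move=> x y; apply: (fmorph_inj phi); rewrite rmorphB !hpsi0.
have mul : monoid_morphism psi0.
  by split=> [|x y]; apply: (fmorph_inj phi); rewrite ?rmorph1 ?rmorphM !hpsi0.
pose psi : {rmorphism K -> K} := HB.pack psi0 (GRing.isZmodMorphism.Build K K psi0 add)
  (GRing.isMonoidMorphism.Build K K psi0 mul).
have phiK : cancel psi phi by move=> x; exact: hpsi0.
have psiK : cancel phi psi by move=> x; apply: (fmorph_inj phi); exact: hpsi0.
split=> //; exists psi; split=> //.
have inv P Q : X P -> X Q -> maps_to phi P Q -> maps_to psi Q P.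
  move=> XP XQ m; split=> x Px; first by apply: (polar1_local XP XQ m); rewrite phiK.
  by move=> hu; rewrite -[x]phiK; exact: maps_to_unit m hu.
have [_ h2 h3] := hphi; split.
- by move=> c; rewrite -(phiC c) psiK.
- by move=> P XP; have [Q [XQ m]] := h3 P XP; exists Q; split=> //; exact: inv.
- by move=> Q XQ; have [P [XP m]] := h2 Q XQ; exists P; split=> //; exact: inv.
Qed.

End DegreeOne.
End FiniteDimension.

(** * Smallness of log canonical models *)

Section LogCanonicalModel.
Context {R : realType} {K : fieldType} (iota : {rmorphism R[i] -> K}).
Implicit Types (A B V P Q E F : set K) (x y z u g l : K) (s : seq K) (Y : set (set K)).

Local Notation C := (range iota).
Local Notation pol s := (adjoin C [set` s]).

Lemma prime_contract A F p : is_subring A -> A `<=` F -> prime_ideal F p -> prime_ideal A (p `&` A).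
Proof.
move=> hA AF [p1 [p2 p3] p4 p5 p6]; split.
- by move=> x [].
- by split=> [|[]//]; split=> //; exact: sr0.
- by move=> x y [px Ax] [py Ay]; split; [exact: p4|exact: srD].
- by move=> a x Aa [px Ax]; split; [apply: p5 => //; exact: AF|exact: srM].
- by move=> a b Aa Ab [/p6 [|||]]; [exact: AF|exact: AF|left|right].
Qed.

Lemma loc_between E B B' q : valring E -> is_subring B -> B' `<=` B -> B `<=` E -> is_subring B' ->
  prime_ideal B' q -> E = localization B' q ->
  prime_ideal B (max_ideal E `&` B) /\ E = localization B (max_ideal E `&` B).
Proof.
move=> VE hB B'B BE hB' hq eE; have [hE _] := VE.
split; first exact/prime_contract/valring_prime.
apply/seteqP; split=> x.
  rewrite {1}eE => -[a [b [Ba Bb nb ->]]]; exists a, b; split=> //; try exact: B'B.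
  by move=> [[_ nu] _]; apply: nu; rewrite eE; apply/loc_unit.
move=> [a [b [Ba Bb nb ->]]]; have [_ _ Ebi] : unit_in E b.
  by apply: contrapT => nu; apply: nb; split=> //; split=> //; exact: BE.
by apply: (srM hE) => //; exact: BE.
Qed.

Lemma loc_sub A B p : is_subring A -> is_subring B -> A `<=` B -> prime_ideal B p ->
  (forall y, B y -> exists c, [/\ A c, ~ p c & A (c * y)]) ->
  prime_ideal A (p `&` A) /\ localization B p = localization A (p `&` A).
Proof.
move=> hA hB AB hp hc; split; first exact: (prime_contract hA AB).
apply/seteqP; split=> x.
  move=> [y [z [By Bz nz ->]]]; have [c [Ac nc Acy]] := hc y By; have [d [Ad nd Adz]] := hc z Bz.
  exists (d * (c * y)), (c * (d * z)); split; [exact: srM|exact: srM| |].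
    by move=> [h _]; move: h; apply: (primeNM hp) => //; [exact: AB|apply: (srM hB) => //; exact: AB|apply: (primeNM hp) => //; exact: AB].
  have c0 := prime_nz hp nc; have d0 := prime_nz hp nd; have z0 := prime_nz hp nz.
  by field; rewrite c0 d0 z0.
by move=> [a [b [Aa Ab nb ->]]]; exists a, b; split=> //; [exact: AB|exact: AB|move=> pb; apply: nb].
Qed.

Lemma adjoin_clear A a y : is_subring A -> A a -> a != 0 -> adjoin A [set a^-1] y ->
  exists k, A (a ^+ k * y).
Proof.
move=> hA Aa a0 /(adjoin1P _ _ hA) [p hp ->]; exists (size p).
rewrite horner_coef mulr_sumr; apply: (sr_sum hA) => i _; rewrite mulrCA exprVn.
apply: (srM hA) => //; rewrite mulrC exprVB //; first exact: (srX hA).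
exact: ltnW.
Qed.

Section Base.
Variables (s : seq K) (X : set (set K)).
Hypotheses (Xs : X = projective_over C s) (XT : X setT) (Xn : normal X).

(** The affine set of relative ampleness is shrunk to a principal open subset of a chart, whose ring
    is noetherian because it is finitely generated. [A] lies in all localizations of [A2], hence in
    [A2]. *)
Lemma shrink_affine P A : is_subring A -> open_in X (affine A) -> affine A P ->
  exists A2, [/\ is_subring A2, noeth A2, A `<=` A2, A2 `<=` P &
    exists lst : seq K, [set` lst] `<=` P /\
      forall Q, X Q -> [set` lst] `<=` Q -> A2 `<=` Q /\ affine A Q].
Proof.
move=> hA [AX hU] AP; have XP := AX P AP; have [lst [lP hl]] := hU P AP.
have [i [p0 [i1 i2 hp0 eP]]] := ptP Xs XP; set A0 := chart iota s i in hp0 eP.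
have hA0 : is_subring A0 := chart_subring iota s i.
have [|a [Aa na ha]] := loc_denom (l := lst) hA0 hp0; first by move=> x /lP; rewrite -eP.
have a0 := prime_nz hp0 na.
have ua : unit_in P a by rewrite eP; apply/loc_unit.
have A0P : A0 `<=` P by rewrite eP; exact: sub_loc.
pose A2 := adjoin A0 [set a^-1]; have h2 : is_subring A2 by exact: adjoin_subring.
have A02 : A0 `<=` A2 by move=> x; exact: mem_adjoinl.
have n2 : noeth A2.
  rewrite /A2 -(adjoin_nil hA0) -adjoin_cons; apply: noeth_adjoin => //; exact: chart_noeth.
have ua2 : unit_in A2 a by split=> //; [exact: A02|exact: mem_adjoinr].
have l2 x : x \in lst -> A2 x.
  by move=> /ha h; rewrite -[x](mulKf a0); apply: (srM h2); [case: ua2|exact: A02].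
exists A2; split=> //.
- move=> x Ax; apply: loc_all => // p hp.
  have [|hq eq] := loc_sub hA0 h2 A02 hp.
    move=> y /(adjoin_clear hA0 Aa a0) [k hk]; exists (a ^+ k); split=> //; first exact: (srX hA0).
    move=> pk; have [_ [_ p1] _ pM _] := hp; apply: p1.
    rewrite -(mulVf (expf_neq0 k a0)) -exprVn; apply: pM => //.
    by apply: (srX h2); case: ua2.
  have XQ : X (localization A2 p) by rewrite eq; exact: (pt_mk Xs).
  have [q' hq' ->] : affine A (localization A2 p).
    by apply: hl => // y /l2; exact: sub_loc.
  exact: sub_loc.
- apply: adjoin_min => //; last by move=> _ ->; case: ua.
  by have [h _ _ _ _] := pt_facts Xs XP.
exists (a^-1 :: [seq j / i | j <- s] ++ lst); split.
  move=> x; rewrite /= inE mem_cat => /or3P[/eqP ->|/mapP [j js ->]|/lP //]; first by case: ua.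
  by apply: A0P; exact: mem_chart.
move=> Q XQ hQ; have [hQs CQ _ _ _] := pt_facts Xs XQ; split.
  apply: adjoin_min => //; last by move=> _ ->; apply: hQ; rewrite /= mem_head.
  apply: chart_min => // j js; apply: hQ; rewrite /= inE mem_cat; apply/orP; right; apply/orP; left.
  by apply/mapP; exists j.
by apply: hl => // x xl; apply: hQ; rewrite /= inE mem_cat xl !orbT.
Qed.

(** Two varieties with a common local ring agree near it: once [a] is inverted, the chart of [Y] is
    contained in that of [X]. *)
Lemma inter_open Y sY P : Y = projective_over C sY -> X P -> Y P ->
  exists lst : seq K, [set` lst] `<=` P /\ forall Q, Y Q -> [set` lst] `<=` Q -> X Q.
Proof.
move=> Ys XP YP; have [hP CP _ _ _] := pt_facts Xs XP.
have [i [p [i1 i2 hp eP]]] := ptP Xs XP; have [j [q [j1 j2 hq eP']]] := ptP Ys YP.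
have hA := chart_subring iota s i; have hB := chart_subring iota sY j.
have AP : chart iota s i `<=` P by rewrite eP; exact: sub_loc.
have BP : chart iota sY j `<=` P by rewrite eP'; exact: sub_loc.
have [|a [Aa na ha]] := loc_denom (l := [seq k / j | k <- sY]) hA hp.
  by move=> _ /mapP [k ks ->]; rewrite -eP; apply: BP; exact: mem_chart.
have a0 := prime_nz hp na.
exists (a^-1 :: [seq k / i | k <- s] ++ [seq k / j | k <- sY]); split.
  move=> x; rewrite /= inE mem_cat => /or3P[/eqP ->|/mapP [k ks ->]|/mapP [k ks ->]].
  - by have [] : unit_in P a by rewrite eP; apply/loc_unit.
  - by apply: AP; exact: mem_chart.
  - by apply: BP; exact: mem_chart.
move=> Q YQ hQ; have [hQs CQ _ hm _] := pt_facts Ys YQ.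
have AQ : chart iota s i `<=` Q.
  apply: chart_min => // k ks; apply: hQ; rewrite /= inE mem_cat; apply/orP; right; apply/orP; left.
  by apply/mapP; exists k.
have BQ : chart iota sY j `<=` Q.
  apply: chart_min => // k ks; apply: hQ; rewrite /= inE mem_cat; apply/orP; right; apply/orP; right.
  by apply/mapP; exists k.
have Qai : Q a^-1 by apply: hQ; rewrite /= mem_head.
have uaQ : unit_in Q a by split=> //; exact: AQ.
have hq3 := prime_contract hA AQ hm; set q3 := _ `&` _ in hq3.
suff -> : Q = localization (chart iota s i) q3 by exact: (pt_mk Xs).
have uQ x : chart iota s i x -> unit_in Q x -> unit_in (localization (chart iota s i) q3) x.
  by move=> Ax hu; apply/loc_unit => // -[[_]].
have hL := loc_subring hA hq3.
have Ba : chart iota sY j `<=` adjoin (chart iota s i) [set a^-1].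
  apply: chart_min; first exact: adjoin_subring.
    by move=> c /(@C_chart _ _ iota s i); exact: mem_adjoinl.
  move=> k ks; rewrite -[k / j](mulKf a0); apply: (srM (adjoin_subring _ _)).
    exact: mem_adjoinr.
  by apply: mem_adjoinl; apply: ha; exact: map_f.
have [q2 hq2 eQ] := pt_loc Ys j1 j2 YQ BQ.
apply/seteqP; split=> x.
  rewrite {1}eQ => -[y [z [By Bz nz ->]]].
  have [k hk] := adjoin_clear hA Aa a0 (Ba y By); have [k' hk'] := adjoin_clear hA Aa a0 (Ba z Bz).
  have uz : unit_in Q z by rewrite eQ; apply/loc_unit.
  have [] := uQ _ hk' (unit_inM hQs (unit_inX hQs k' uaQ) uz) => n0 _ n2.
  have [_ _ n3] := unit_inX hL k (uQ _ Aa uaQ).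
  have z0 : z != 0 by case: uz.
  rewrite (_ : y / z = (a ^+ k * y) * (a ^+ k)^-1 * a ^+ k' * (a ^+ k' * z)^-1); last first.
    by field; rewrite z0 !expf_neq0.
  apply: (srM hL) => //; apply: (srM hL); last by apply: sub_loc => //; exact: (srX hA).
  by apply: (srM hL) => //; exact: sub_loc.
move=> [b [c [Ab Ac nc ->]]]; apply: (srM hQs); first exact: AQ.
have [] // : unit_in Q c.
by apply: contrapT => nu; apply: nc; split=> //; split=> //; exact: AQ.
Qed.

Lemma homogenize_over A2 sg i j x : is_subring A2 -> i \in sg -> i != 0 -> j != 0 ->
  adjoin A2 [set` [seq k / i | k <- sg]] x ->
  exists M, adjoin A2 [set` [seq k / j | k <- sg]] ((i / j) ^+ M * x).
Proof.
move=> h2 isg i0 j0; set Bj := adjoin A2 [set` [seq k / j | k <- sg]].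
have hB : is_subring Bj by exact: adjoin_subring.
have Bi : Bj (i / j) by apply: mem_adjoinr; exact: map_f.
have up M M' y : (M <= M')%N -> Bj ((i / j) ^+ M * y) -> Bj ((i / j) ^+ M' * y).
  by move=> /subnK <- h; rewrite exprD -mulrA; apply: (srM hB) => //; exact: (srX hB).
apply: (@adjoin_min _ A2 _ [set x | exists M, Bj ((i / j) ^+ M * x)]).
- apply/subringP; split=> /=.
  + by exists 0%N; rewrite expr0 mul1r; exact: sr1.
  + move=> y z [M hM] [M' hM']; exists (maxn M M'); rewrite mulrBr.
    by apply: (srB hB); [apply: up hM; exact: leq_maxl|apply: up hM'; exact: leq_maxr].
  + by move=> y z [M hM] [M' hM']; exists (M + M')%N; rewrite exprD mulrACA; exact: (srM hB).
- by move=> a Aa; exists 0%N; rewrite expr0 mul1r; exact: mem_adjoinl.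
- move=> _ /mapP [k ks ->]; exists 1%N; rewrite expr1 (_ : i / j * (k / i) = k / j).
    by apply: mem_adjoinr; exact: map_f.
  by field; rewrite i0 j0.
Qed.

Section Model.
Variables (w : @top_form K) (Y : set (set K)).
Hypotheses (hw : nonzero_top_form iota w) (hY : birational_model iota X Y)
  (hlc : valuative_lc iota X w).

(** The center of [F] on [Y] contains its image on [X], which is the center of [F] on [X], that is,
    [F] itself. *)
Lemma model_prime F : prime_divisor X F -> Y F.
Proof.
move=> pF; have [[YT [sY Ys]] Yn YX] := hY; have dF := prime_divisor_dvr Xs XT Xn pF.
have [XF _] := pF; have [hF CF _ _ _] := pt_facts Xs XF.
have [Q YQ [QF QF2]] := center_exists Ys YT (psi := idfun) (dvr_valring dF) (fun c hc => CF c hc).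
have [P [XP [PQ PQ2]]] := YX Q YQ.
have eP : F = P.
  apply: (center_uniq Xs hF (center_self XF)); split=> //; split; first by move=> x /PQ /QF.
  by move=> x Px hu; apply: PQ2 => //; apply: QF2 => //; exact: PQ.
have -> : F = Q by apply/seteqP; split; [rewrite eP|exact: QF].
by [].
Qed.

(** [b] multiplies the ideal [p] of [E] into [t * B]. At another divisor [F] some [y] in [p] is
    invertible, and [b / t] is [b * (y / t)] divided by [y]. *)
Lemma simple_pole B p E : is_subring B -> noeth B -> prime_ideal B p -> E = localization B p -> is_dvr E ->
  exists b t, [/\ B b, B t, b != 0, t != 0 & ord E (b / t) = -1 /\
    forall F q, is_dvr F -> prime_ideal B q -> F = localization B q -> F <> E -> F (b / t)].
Proof.
move=> hB nB hp eE dE; have [t [b [[Bt t0 ot] [Bb nb hb]]]] := local_uniformizer hB nB hp eE dE.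
have b0 := prime_nz hp nb; exists b, t; split=> //; split.
  have /(ord_unitP dE) [_ ob] : unit_in E b by rewrite eE; apply/loc_unit.
  by rewrite (ordM dE) ?invr_eq0 // (ordV dE) // ot ob.
move=> F q dF hq eF nFE; have [hF _] := dF.
have [y py nqy] : exists2 y, p y & ~ q y.
  apply: contrapT => no; apply: (dvr_neqT dE); apply: (dvr_over dF); [by case: dE| |by move=> e; apply: nFE].
  rewrite eF eE => _ [x [z [Bx Bz nz ->]]]; exists x, z; split=> // pz.
  by apply: no; exists z => // _; exact: nz.
have [y0 _ Fyi] : unit_in F y by rewrite eF; apply/loc_unit => //; case: hp => + _ _ _ _; apply.
rewrite (_ : b / t = b * (y / t) * y^-1); last by field; rewrite t0 y0.
by apply: (srM hF) => //; rewrite eF; apply: sub_loc => //; exact: hb.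
Qed.

(** For each [F] some power of [z] removes the pole up to a denominator that is a unit at [F]. The
    ideals [J r] of these denominators increase with [r], so by noetherianity a single [r0] serves
    all [F]. *)
Lemma pole_bound B b t z : is_subring B -> noeth B -> B b -> B t -> b != 0 -> t != 0 -> B z -> exists r0 : nat,
  forall F q r, is_dvr F -> prime_ideal B q -> F = localization B q -> (r0 <= r)%N ->
    (unit_in F z -> F (b / t)) -> F (b / t * z ^+ r).
Proof.
move=> hB nB Bb Bt b0 t0 Bz.
pose J r := [set c | B c /\ B (c * (b / t * z ^+ r))].
have Jup r r' c : (r <= r')%N -> J r c -> J r' c.
  by move=> /subnKC <- [Bc h]; split=> //; rewrite exprD !mulrA in h *; apply: (srM hB) => //; exact: (srX hB).
have [|r|r0 hr0] := nB J.
- move=> r; split.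
  + by move=> c [].
  + by split; rewrite ?mul0r; exact: sr0.
  + by move=> c c' [h1 h2] [h3 h4]; split; rewrite ?mulrDl; exact: (srD hB).
  + by move=> a c Ba [h1 h2]; split; first exact: (srM hB); rewrite -[a * c * _]mulrA; exact: (srM hB).
- by move=> c; exact: Jup.
exists r0 => F q r dF hq eF hr hz; have [hF _] := dF.
have BF : B `<=` F by rewrite eF; exact: sub_loc.
suff h : F (b / t * z ^+ r0).
  rewrite -(subnKC hr) exprD mulrA; apply: (srM hF) => //.
  by apply: (srX hF); exact: BF.
have [uz|nuz] := pselect (unit_in F z).
  by apply: (srM hF); [exact: hz|apply: (srX hF); case: uz].
have [z0|z0] := eqVneq z 0.
  have [d hd] : exists d, J r0 d /\ unit_in F d.
    exists 1; split; last exact: unit_in1.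
    apply: (hr0 r0.+1); split; first exact: sr1.
    by rewrite z0 expr0n mulr0 mulr0; exact: sr0.
  have [[_ h] [d0 _ Fdi]] := hd; rewrite -[b / t * _](mulKf d0); apply: (srM hF) => //.
  exact: BF.
have oz : 0 < ord F z by apply/(max_idealP dF z0); split=> //; exact: BF.
have bt0 : b / t != 0 by rewrite mulf_neq0 ?invr_eq0.
pose N := `|ord F (b / t)|%N.
have : F (b / t * z ^+ N).
  apply/(ord_ge0 dF); first by rewrite mulf_neq0 ?expf_neq0.
  rewrite (ordM dF) ?expf_neq0 // (ordX dF) //.
  have h1 : - ord F (b / t) <= N%:Z by rewrite abszE lerNl; exact: lerNnormlW.
  have h2 : N%:Z <= ord F z *+ N by rewrite -[X in X <= _]natz lerMn2r -gtz0_ge1 oz orbT.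
  by rewrite -lerBlDl sub0r; exact: le_trans h2.
rewrite {1}eF => -[a [d [Ba Bd nd e]]].
have ud : unit_in F d by rewrite eF; apply/loc_unit.
have [d0 _ Fdi] := ud.
have : J r0 d by apply: (hr0 N); split=> //; rewrite e mulrC mulfVK.
move=> [_ h]; rewrite -[b / t * _](mulKf d0); apply: (srM hF) => //; exact: BF.
Qed.

Lemma lc_not_exceptional m h E : cartier_multiple Y (log_divisor iota w (exc_divisor X) : divisor) m h ->
  rel_ample Y X h -> prime_divisor Y E -> ~ exceptional X E.
Proof.
move=> [m0 hcart hK] hr pE exc; have [[YT [sY Ys]] Yn YX] := hY.
have dE := prime_divisor_dvr Ys YT Yn pE; have [YE kE] := pE.
have [P cP] := YX E YE; have [XP [PE PE2]] := cP.
have [A [hA oA AP [m1 m10 [sg [Ysg hsg]]]]] := hr P XP.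
have [A2 [h2 n2 AA2 A2P [lst [lP hl]]]] := shrink_affine hA oA AP.
pose B j := adjoin A2 [set` [seq k / j | k <- sg]].
have hB j : is_subring (B j) by exact: adjoin_subring.
have nB j : noeth (B j) by exact: noeth_adjoin.
have chart_pt F : is_dvr F -> Y F -> A2 `<=` F -> (exists P', Defs.center (affine A) F P') ->
    [/\ (forall x, x \in sg -> F (h F ^+ m1 * x)), (exists2 x, x \in sg & unit_in F (h F ^+ m1 * x)) &
     exists j q, [/\ j != 0, idx sg F j, prime_ideal (B j) q & F = localization (B j) q]].
  move=> dF YF A2F cF; have YAF : [set Q | Y Q /\ exists P', Defs.center (affine A) Q P'] F by split.
  have [k1 k2] := hsg F YAF; split=> //.
  move: YAF; rewrite Ysg => -[j [js j0] [q hq eF]]; have hB' := adjoin_subring A [set sj / j | sj in [set` sg]].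
  have [hF _] := dF.
  have B'F x : adjoin A [set sj / j | sj in [set` sg]] x -> F x by rewrite eF; exact: sub_loc.
  have jF k : k \in sg -> F (k / j) by move=> ks; apply: B'F; apply: mem_adjoinr; exists k.
  have B'B : adjoin A [set sj / j | sj in [set` sg]] `<=` B j.
    apply: adjoin_min => //; first by move=> x /AA2; exact: mem_adjoinl.
    by move=> _ [k ks <-]; apply: mem_adjoinr; exact: map_f.
  have BF : B j `<=` F by apply: adjoin_min => // _ /mapP [k ks ->]; exact: jF.
  have [hp eF'] := loc_between (dvr_valring dF) (hB j) B'B BF hB' hq eF.
  by exists j, (max_ideal F `&` B j); split.
have A2E : A2 `<=` E by move=> x /A2P /PE.
have cE : exists P', Defs.center (affine A) E P' by exists P; split.
have [hE1 hE2 [i [p [i0 iE hp eE]]]] := chart_pt E dE YE A2E cE; have [isg _ _] := iE.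
have [b [t [Bb Bt b0 t0 [ou hu]]]] := simple_pole (hB i) (nB i) hp eE dE.
pose u := b / t; have u0 : u != 0 by rewrite mulf_neq0 ?invr_eq0.
(* [u] is controlled on the chart of [i] only; a power of [i / j] removes the poles it may have on
   the chart of [j] outside that of [i]. *)
have /choice [rr hrr] : forall j, exists r0 : nat, j \in sg -> j != 0 -> forall F q r, is_dvr F ->
    prime_ideal (B j) q -> F = localization (B j) q -> F <> E -> (r0 <= r)%N -> F (u * (i / j) ^+ r).
  move=> j; have [[js j0]|no] := pselect (j \in sg /\ j != 0); last by exists 0%N => j1 j2; case: no.
  have [M hM] := homogenize_over h2 isg i0 j0 Bb; have [M' hM'] := homogenize_over h2 isg i0 j0 Bt.
  have Bij : B j (i / j) by apply: mem_adjoinr; exact: map_f.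
  have ij0 : i / j != 0 by rewrite mulf_neq0 ?invr_eq0.
  pose b1 := (i / j) ^+ (M' + M) * b; pose t1 := (i / j) ^+ (M + M') * t.
  have Bb1 : B j b1 by rewrite /b1 exprD -mulrA; apply: (srM (hB j)) => //; exact: (srX (hB j)).
  have Bt1 : B j t1 by rewrite /t1 exprD -mulrA; apply: (srM (hB j)) => //; exact: (srX (hB j)).
  have b10 : b1 != 0 by rewrite mulf_neq0 ?expf_neq0.
  have t10 : t1 != 0 by rewrite mulf_neq0 ?expf_neq0.
  have eu : b1 / t1 = u by rewrite /b1 /t1 /u addnC; field; rewrite t0 expf_neq0.
  have [r0 hr0] := pole_bound (hB j) (nB j) Bb1 Bt1 b10 t10 Bij.
  exists r0 => _ _ F q r dF hq eF nFE hr'; have := hr0 F q r dF hq eF hr'; rewrite eu; apply => uij.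
  have [hF _] := dF; have BF : B j `<=` F by rewrite eF; exact: sub_loc.
  have BiF : B i `<=` F.
    apply: adjoin_min => //; first by move=> x A2x; apply: BF; exact: mem_adjoinl.
    move=> _ /mapP [k ks ->]; rewrite (_ : k / i = k / j * (i / j)^-1); last by field; rewrite i0 j0.
    by apply: (srM hF); [apply: BF; apply: mem_adjoinr; exact: map_f|case: uij].
  have uji : unit_in F (j / i) by rewrite -invf_div; exact: unit_inV.
  have Bji : B i (j / i) by apply: mem_adjoinr; exact: map_f.
  have hq' := prime_contract (hB i) BiF (valring_prime (dvr_valring dF)).
  apply: (hu F (max_ideal F `&` B i)) => //; apply/seteqP; split=> x; last first.
    move=> [a [d [Ba Bd nd ->]]]; apply: (srM hF); first exact: BiF.
    have [] // : unit_in F d.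
    by apply: contrapT => nu; apply: nd; split=> //; split=> //; exact: BiF.
  rewrite {1}eF => -[a [d [Ba Bd nd ->]]].
  have [N hN] := homogenize_over h2 js j0 i0 Ba; have [N' hN'] := homogenize_over h2 js j0 i0 Bd.
  have ud : unit_in F d by rewrite eF; apply/loc_unit.
  have [d0 _ _] := ud.
  exists ((j / i) ^+ (N' + N) * a), ((j / i) ^+ (N + N') * d); split.
  - by rewrite exprD -mulrA; apply: (srM (hB i)) => //; exact: (srX (hB i)).
  - by rewrite exprD -mulrA; apply: (srM (hB i)) => //; exact: (srX (hB i)).
  - by move=> [[_ nu] _]; apply: nu; apply: unit_inM => //; exact: unit_inX.
  - by rewrite addnC; field; rewrite d0 ?expf_neq0 // mulf_neq0 ?invr_eq0.
(* The coordinate [i] is a section of [m1] times the divisor of [h], which is [m] times the log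
   canonical divisor; hence [n]. The factor [u] adds a simple pole along [E]. *)
pose r := (\max_(j <- sg) rr j)%N; pose n := (r * (m1 * m))%N.
pose g := u * i ^+ r; have g0 : g != 0 by rewrite mulf_neq0 ?expf_neq0.
pose o F := ord_form iota w F.
have ordH F c : prime_divisor Y F -> (exc_divisor X : divisor) F = c%:~R :> R -> ord F (h F) = m%:Z * (o F + c).
  move=> pF ec; apply: (intr_inj (R := R)); have [_ _] := And3 I I (hK F pF) => ->.
  by rewrite /log_divisor /Defs.canonical ec rmorphM rmorphD.
have ordi F j c : is_dvr F -> prime_divisor Y F -> (exc_divisor X : divisor) F = c%:~R :> R ->
    j != 0 -> idx sg F j -> (forall x, x \in sg -> F (h F ^+ m1 * x)) ->
    (exists2 x, x \in sg & unit_in F (h F ^+ m1 * x)) -> ord F j = - ((o F + c) *+ (m1 * m)).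
  move=> dF pF ec j0 hj k1 k2; have [hF _] := dF.
  have := very_ample_unit hF (fun x => id) k1 k2 hj; move=> /(ord_unitP dF) [hj0 oj].
  have h0 : h F ^+ m1 != 0 by apply: contraNneq hj0 => ->; rewrite mul0r.
  have hF0 : h F != 0 by apply: contraNneq h0 => ->; rewrite expr0n -[m1]prednK.
  move: oj; rewrite (ordM dF) // (ordX dF) // (ordH F c pF ec) => /eqP; rewrite addrC addr_eq0 => /eqP ->.
  by rewrite mulnC mulrnA -[_ *+ m]mulr_natl natz.
have excE : (exc_divisor X : divisor) E = 1%:~R :> R by rewrite /exc_divisor; case: asboolP.
have oi := ordi E i 1 dE pE excE i0 iE hE1 hE2.
have sg' : stalk X (sheafO X (fun F => n%:R * (Defs.canonical iota w : divisor) F)) P g.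
  pose U := [set Q | X Q /\ [set` lst] `<=` Q].
  have oU : open_in X U by split; [move=> Q []|move=> Q [XQ hQ]; exists lst; split].
  apply: (stalk_mk oU) => // F pF [XF lF].
  have dF := prime_divisor_dvr Xs XT Xn pF; have [hF _] := dF; have [_ kF] := pF.
  have [A2F AF] := hl F XF lF; have YF := model_prime pF.
  have nex : ~ exceptional X F by move=> ex; apply: ex; exists F => //; exact: center_self.
  have nFE : F <> E by move=> e; apply: nex; rewrite e.
  have cF : exists P', Defs.center (affine A) F P' by exists F; exact: center_self.
  have [k1 k2 [j [q [j0 jF hq eF]]]] := chart_pt F dF YF A2F cF; have [js _ _] := jF.
  have excF : (exc_divisor X : divisor) F = 0%:~R :> R by rewrite /exc_divisor; case: asboolP.
  have oj := ordi F j 0 dF (conj YF kF) excF j0 jF k1 k2.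
  have Fu : F (u * (i / j) ^+ r).
    by apply: (hrr j js j0 F q) => //; rewrite /r (big_rem j) //= leq_maxl.
  have j0r : j ^+ r != 0 by rewrite expf_neq0.
  have eg : g = u * (i / j) ^+ r * j ^+ r by rewrite expr_div_n mulrA mulfVK.
  have ui0 : u * (i / j) ^+ r != 0 by apply: contraNneq g0 => e; rewrite eg e mul0r.
  have oFu : 0 <= ord F (u * (i / j) ^+ r) by apply/(ord_ge0 dF).
  rewrite eg (ordM dF ui0 j0r) (ordX dF) // oj addr0 mulNrn -mulrnA [(m1 * m * r)%N]mulnC -/n -/(o F).
  by rewrite subrK.
have lcE : 0 <= (Aplus iota X w E : R) by apply: hlc; exists Y.
have := env_ge Xs XT Xn hw dE cP sg' g0.
(* The pole along [E] exceeds by one the order [n * (o E + 1)] that [Aplus] allows. *)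
have -> : ord E g = -1 - (o E + 1) *+ n.
  by rewrite (ordM dE) ?expf_neq0 // (ordX dE) // ou oi mulNrn -mulrnA mulnC.
move: lcE; rewrite /Aplus excE subr_ge0 => h3.
rewrite leNgt => /negP; apply; apply: le_lt_trans (_ : n%:R * (Defs.canonical iota w E + 1%:~R) < _).
  exact: ler_wpM2l.
rewrite -rmorphN opprB opprK rmorphD rmorphMn rmorphD /= -/(o E) mulr_natl.
by rewrite /Defs.canonical ltrDl ltr01.
Qed.

End Model.
End Base.
End LogCanonicalModel.

Theorem theorem5p2 (R : realType) (K : fieldType)
    (iota : {rmorphism R[i] -> K}) (X : set (set K))
    (Xproj : projective_variety iota X) (Xnormal : normal X)
    (Xendo : exists phi : {rmorphism K -> K},
       [/\ surjective_endomorphism iota X phi, polarized iota X phi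
         & ~ automorphism iota X phi])
    (w : @top_form K) (w_neq0 : nonzero_top_form iota w) :
  valuative_lc iota X w /\
  (forall Y : set (set K), log_canonical_model iota X w Y ->
     small_model X Y /\ iso_in_codim1 X Y).
Proof.
have [XT _] := Xproj; have [phi [hphi hpol nauto]] := Xendo.
have [s [G [q [Xs q0 hG]]]] := polarized_polar XT hphi hpol.
have q1 : (1 < q)%N.
  move: q0 hG; case: q => [|[|q]] // _ hG; case: nauto.
  exact: polar1_automorphism Xs XT Xnormal hphi hG.
have hlc : valuative_lc iota X w.
  move=> E hE; have [Y [[YT [sY Ys]] Yn _] pE] := hE.
  have [_ CE _ _ _] := pt_facts Ys pE.1.
  apply: (Aplus_ge0 Xs XT Xnormal w_neq0 (prime_divisor_dvr Ys YT Yn pE) CE).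
  exact: (logdisc_ge0 Xs XT Xnormal w_neq0 hphi hG q1 hE).
split=> // Y [hY [m [h [hcm hra]]] _]; have [[YT [sY Ys]] Yn YX] := hY.
have small E : prime_divisor Y E -> ~ exceptional X E.
  exact: (lc_not_exceptional Xs XT Xnormal w_neq0 hY hlc hcm hra).
(* Both varieties being sets of local rings of the same field, the open set of isomorphism is their
   intersection. *)
split=> //; exists (X `&` Y); split.
- split=> [P [] //|P [XP YP]]; have [l [lP hl]] := inter_open Xs Ys XP YP.
  by exists l; split=> // Q YQ lQ; split=> //; exact: hl.
- split=> [P [] //|P [XP YP]]; have [l [lP hl]] := inter_open Ys Xs YP XP.
  by exists l; split=> // Q XQ lQ; split=> //; exact: hl.
- move=> E pE; have [YE _] := pE; split=> //.
  have [P cP kP] : exists2 P, Defs.center X E P & krull_dim1 P by apply: contrapT; exact: small.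
  by rewrite -(dvr_center_eq Xs XT Xnormal (prime_divisor_dvr Ys YT Yn pE) cP kP); case: cP.
- by move=> E pE; have [XE _] := pE; split=> //; exact: (model_prime Xs XT Xnormal hY pE).
Qed.
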